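(* For each equation $\mathcal L$: $u_t=A(t,x)u_{xx}+B(t,x)u_x+C(t,x)u$ with analytic $A,B,C$, $A\ne0$, the maximal point symmetry groups (resp. the maximal Lie invariance algebras) of the equation $\mathcal L$ and of the system ${\rm DE}_1(\mathcal L)$ are isomorphic. A Lie symmetry operator $Q=\tau\partial_t+\xi\partial_x+(\zeta^1u+\zeta^0)\partial_u$ of $\mathcal L$ induces the Lie symmetry operator $Q_1=\tau\partial_t+\xi\partial_x+\theta^1\partial_{g^1}+\theta^2\partial_{g^2}+\theta^3\partial_{g^3}$ of ${\rm DE}_1(\mathcal L)$, where $$\theta^1=(\xi_x-\tau_t)g^1+\xi_t,\qquad \theta^2=-\tau_tg^2+\zeta^1_xg^1+\zeta^1_t,\qquad \theta^3=(\zeta^1-\tau_t)g^3-\zeta^0g^2+\zeta^0_xg^1+\zeta^0_t.$$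
   Context: All considerations are local. ${\rm DE}_1(\mathcal L)$ is the system for $g^i=g^i(t,x)$, $i=1,2,3$ (the determining equations for reduction operators $\partial_t+g^1\partial_x+(g^2u+g^3)\partial_u$ of $\mathcal L$): $$g^1_t-Ag^1_{xx}-Bg^1_x+\Bigl(2g^1_x-\tfrac{A_x}{A}g^1-\tfrac{A_t}{A}\Bigr)(g^1+B)+B_xg^1+2Ag^2_x+B_t=0,$$ $$g^2_t-Ag^2_{xx}-Bg^2_x+\Bigl(2g^1_x-\tfrac{A_x}{A}g^1-\tfrac{A_t}{A}\Bigr)(g^2-C)-C_xg^1-C_t=0,$$ $$g^3_t-Ag^3_{xx}-Bg^3_x+\Bigl(2g^1_x-\tfrac{A_x}{A}g^1-\tfrac{A_t}{A}\Bigr)g^3-Cg^3=0.$$ Every Lie symmetry operator of $\mathcal L$ has the form $Q=\tau\partial_t+\xi\partial_x+(\zeta^1u+\zeta^0)\partial_u$ with $\tau=\tau(t)$, $\xi=\xi(t,x)$, $\zeta^1=\zeta^1(t,x)$ and $\zeta^0=\zeta^0(t,x)$. *)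

(* Defs.v *)
From mathcomp Require Import all_boot all_order all_algebra.
From mathcomp Require Import all_classical all_reals all_analysis.
Import Order.TTheory GRing.Theory Num.Theory.
Import numFieldNormedType.Exports.

Set Implicit Arguments.
Unset Strict Implicit.
Unset Printing Implicit Defensive.

Local Open Scope classical_set_scope.
Local Open Scope ring_scope.

(* Indices of t and x in the vector (t, x) of independent variables. *)
Definition it : 'I_2 := ord0.
Definition ix : 'I_2 := ord_max.

Definition row2 {R : realType} (a b : R) : 'rV[R]_2 := \row_i [:: a; b]`_i.
Definition row3 {R : realType} (a b c : R) : 'rV[R]_3 :=
  \row_i [:: a; b; c]`_i.

Definition pd {R : realType} {n : nat} {W : normedModType R} (i : 'I_n)
    (f : 'rV[R]_n -> W) : 'rV[R]_n -> W :=
  fun z => 'D_(delta_mx 0 i) f z.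

Fixpoint iter_pd {R : realType} {n : nat} {W : normedModType R}
    (s : seq 'I_n) (f : 'rV[R]_n -> W) : 'rV[R]_n -> W :=
  if s is i :: s' then pd i (iter_pd s' f) else f.

(* C^oo near p: on one neighbourhood of p, the iterated partial derivatives of
   all orders are Frechet differentiable. *)
Definition smooth_at {R : realType} {n : nat} {W : normedModType R}
    (p : 'rV[R]_n) (f : 'rV[R]_n -> W) : Prop :=
  \forall z \near p, forall s : seq 'I_n, differentiable (iter_pd s f) z.

Definition taylor_term {R : realType} (f : 'rV[R]_2 -> R) (w0 w : 'rV[R]_2)
    (i j : nat) : R :=
  iter_pd (nseq i it ++ nseq j ix) f w0 / (i`! * j`!)%:R
  * (w 0 it - w0 0 it) ^+ i * (w 0 ix - w0 0 ix) ^+ j.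

(* Real analyticity on Omega: f is C^oo and, near every point w0 of Omega, it is
   the sum of its absolutely convergent Taylor series at w0. *)
Definition analytic_on {R : realType} (Omega : set 'rV[R]_2)
    (f : 'rV[R]_2 -> R) : Prop :=
  forall w0, Omega w0 -> smooth_at w0 f /\
    \forall w \near w0,
      summable [set: nat * nat]
        (fun ij => (taylor_term f w0 w ij.1 ij.2)%:E) /\
      (fun N : nat => \sum_(i < N) \sum_(j < N) taylor_term f w0 w i j)
        @ \oo --> f w.

(* A point of the second-order jet space: jt1 i is the vector of the derivatives
   u^a_i and jt2 i j the vector of the u^a_ij. *)
Record jet (R : realType) (m : nat) := Jet {
  jt_base : 'rV[R]_2;
  jt0 : 'rV[R]_m;
  jt1 : 'I_2 -> 'rV[R]_m;
  jt2 : 'I_2 -> 'I_2 -> 'rV[R]_m }.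

Definition j2 {R : realType} {m : nat} (u : 'rV[R]_2 -> 'rV[R]_m)
    (w : 'rV[R]_2) : jet R m :=
  Jet w (u w) (fun i => pd i u w) (fun i j => pd j (pd i u) w).

Definition jet_line {R : realType} {m : nat} (J V : jet R m) (s : R) :
    jet R m :=
  Jet (jt_base J + s *: jt_base V) (jt0 J + s *: jt0 V)
    (fun i => jt1 J i + s *: jt1 V i)
    (fun i j => jt2 J i j + s *: jt2 V i j).

(* A system of k equations E l = 0, l < k, considered for the values of the
   independent variables lying in an open set Omega given separately. *)
Definition system (R : realType) (m k : nat) := 'I_k -> jet R m -> R.

Definition satisfies {R : realType} {m k : nat} (E : system R m k)
    (J : jet R m) : Prop := forall l, E l J = 0.

(* A point of the space of independent and dependent variables is
   z = row_mx (t, x) (u^1, ..., u^m) : 'rV_(2 + m). *)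
Definition base {R : realType} {m : nat} (z : 'rV[R]_(2 + m)) : 'rV[R]_2 :=
  lsubmx z.
Definition dep {R : realType} {m : nat} (z : 'rV[R]_(2 + m)) : 'rV[R]_m :=
  rsubmx z.

(* Maps and vector fields on that space are total functions, used only through
   their germs. *)
Definition germ_eq {R : realType} {m : nat} (p : 'rV[R]_(2 + m))
    (f g : 'rV[R]_(2 + m) -> 'rV[R]_(2 + m)) : Prop :=
  \forall z \near p, f z = g z.

(* The second prolongation of f maps the jet j2 u w to the jet of v at the image
   point.  Writing F w' = f (w', u w') for the image of the graph of u: it is
   the graph of a function near F w, since base \o F is a local diffeomorphism,
   and that function has at base (F w) the same second-order jet as v, since the
   graph of v has contact of order 2 with the image. *)
Definition prolongs_to {R : realType} {m : nat}
    (f : 'rV[R]_(2 + m) -> 'rV[R]_(2 + m))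
    (u v : 'rV[R]_2 -> 'rV[R]_m) (w : 'rV[R]_2) : Prop :=
  let F := fun w' => f (row_mx w' (u w')) in
  \det ('J (base \o F) w) != 0 /\ j2 (dep \o F) w = j2 (v \o (base \o F)) w.

(* The prolongation of f to the second-order jets over z preserves the
   submanifold E = 0.  Since u is an arbitrary function, and not a solution,
   j2 u (base z) ranges over all jets over z. *)
Definition preserves_at {R : realType} {m k : nat} (E : system R m k)
    (f : 'rV[R]_(2 + m) -> 'rV[R]_(2 + m)) (z : 'rV[R]_(2 + m)) : Prop :=
  forall u v : 'rV[R]_2 -> 'rV[R]_m,
    smooth_at (base z) u -> smooth_at (base (f z)) v ->
    u (base z) = dep z -> prolongs_to f u v (base z) ->
    (satisfies E (j2 u (base z)) <-> satisfies E (j2 v (base (f z)))).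

(* The germ of f at p is a point symmetry of E: a germ of a local
   diffeomorphism (with source p and target f p) preserving E.  These germs
   form the maximal point symmetry (pseudo)group of E. *)
Definition point_symmetry {R : realType} {m k : nat} (Omega : set 'rV[R]_2)
    (E : system R m k) (p : 'rV[R]_(2 + m))
    (f : 'rV[R]_(2 + m) -> 'rV[R]_(2 + m)) : Prop :=
  [/\ Omega (base p), Omega (base (f p)), smooth_at p f, \det ('J f p) != 0
    & \forall z \near p, preserves_at E f z].

(* An isomorphism of the point symmetry pseudogroups of two systems with the
   same independent variables, possibly with different numbers of unknown
   functions.  The two pseudogroups act on different spaces, so germs at p are
   matched with germs at q for each pair (p, q) over the same (t, x): their
   targets lie again over the same point, the matching is bijective and
   multiplicative, and it depends on (p, q) coherently, that is, it comes from
   local maps and not merely from separate germs. *)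
Record pseudogroup_iso (R : realType) (m k m' k' : nat)
    (Omega : set 'rV[R]_2) (E : system R m k) (E' : system R m' k')
    (I : 'rV[R]_(2 + m) -> 'rV[R]_(2 + m') ->
         ('rV[R]_(2 + m) -> 'rV[R]_(2 + m)) ->
         ('rV[R]_(2 + m') -> 'rV[R]_(2 + m'))) : Prop := PseudogroupIso {
  pgi_sym : forall p q f, base p = base q ->
    point_symmetry Omega E p f -> point_symmetry Omega E' q (I p q f);
  pgi_base : forall p q f, base p = base q ->
    point_symmetry Omega E p f -> base (I p q f q) = base (f p);
  pgi_inj : forall p q f f', base p = base q ->
    point_symmetry Omega E p f -> point_symmetry Omega E p f' ->
    (germ_eq p f f' <-> germ_eq q (I p q f) (I p q f'));
  pgi_surj : forall p q h, base p = base q ->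
    point_symmetry Omega E' q h ->
    exists2 f, point_symmetry Omega E p f & germ_eq q (I p q f) h;
  pgi_comp : forall p q f f', base p = base q ->
    point_symmetry Omega E p f -> point_symmetry Omega E (f p) f' ->
    germ_eq q (I p q (f' \o f)) (I (f p) (I p q f q) f' \o I p q f);
  pgi_local : forall p q f, base p = base q ->
    point_symmetry Omega E p f ->
    \forall p' \near p & q' \near q, base p' = base q' ->
      germ_eq q' (I p' q' f) (I p q f) }.

Definition point_symmetry_groups_isomorphic {R : realType} {m k m' k' : nat}
    (Omega : set 'rV[R]_2) (E : system R m k) (E' : system R m' k') : Prop :=
  exists I, pseudogroup_iso Omega E E' I.

(* The coefficients xi^k (k < 2) and eta of the vector field
   Q = xi^k d_(x_k) + eta^a d_(u^a), restricted to the graph of u.  The partial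
   derivatives of such a restriction are total derivatives. *)
Definition xi_on {R : realType} {m : nat}
    (Q : 'rV[R]_(2 + m) -> 'rV[R]_(2 + m)) (u : 'rV[R]_2 -> 'rV[R]_m)
    (k : 'I_2) : 'rV[R]_2 -> R :=
  fun w => base (Q (row_mx w (u w))) 0 k.
Definition eta_on {R : realType} {m : nat}
    (Q : 'rV[R]_(2 + m) -> 'rV[R]_(2 + m)) (u : 'rV[R]_2 -> 'rV[R]_m) :
    'rV[R]_2 -> 'rV[R]_m :=
  fun w => dep (Q (row_mx w (u w))).

(* eta_i = D_i eta - (D_i xi^k) u_k and
   eta_ij = D_j eta_i - (D_j xi^k) u_ik. *)
Definition prol1 {R : realType} {m : nat}
    (Q : 'rV[R]_(2 + m) -> 'rV[R]_(2 + m)) (u : 'rV[R]_2 -> 'rV[R]_m)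
    (i : 'I_2) : 'rV[R]_2 -> 'rV[R]_m :=
  fun w => pd i (eta_on Q u) w - \sum_(k < 2) pd i (xi_on Q u k) w *: pd k u w.
Definition prol2 {R : realType} {m : nat}
    (Q : 'rV[R]_(2 + m) -> 'rV[R]_(2 + m)) (u : 'rV[R]_2 -> 'rV[R]_m)
    (i j : 'I_2) : 'rV[R]_2 -> 'rV[R]_m :=
  fun w => pd j (prol1 Q u i) w
    - \sum_(k < 2) pd j (xi_on Q u k) w *: pd k (pd i u) w.

(* The value at j2 u w of the second prolongation of Q, as a tangent vector. *)
Definition prolongation {R : realType} {m : nat}
    (Q : 'rV[R]_(2 + m) -> 'rV[R]_(2 + m)) (u : 'rV[R]_2 -> 'rV[R]_m)
    (w : 'rV[R]_2) : jet R m :=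
  Jet (\row_k xi_on Q u k w) (eta_on Q u w)
    (fun i => prol1 Q u i w) (fun i j => prol2 Q u i j w).

(* Infinitesimal invariance over z: pr Q (E) vanishes wherever E does. *)
Definition inf_invariant_at {R : realType} {m k : nat} (E : system R m k)
    (Q : 'rV[R]_(2 + m) -> 'rV[R]_(2 + m)) (z : 'rV[R]_(2 + m)) : Prop :=
  forall u : 'rV[R]_2 -> 'rV[R]_m,
    smooth_at (base z) u -> u (base z) = dep z ->
    satisfies E (j2 u (base z)) ->
    forall l, derive1 (fun s : R => E l (jet_line (j2 u (base z))
                                          (prolongation Q u (base z)) s)) 0 = 0.

(* The germ of Q at p belongs to the maximal Lie invariance algebra of E. *)
Definition lie_symmetry {R : realType} {m k : nat} (Omega : set 'rV[R]_2)
    (E : system R m k) (p : 'rV[R]_(2 + m))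
    (Q : 'rV[R]_(2 + m) -> 'rV[R]_(2 + m)) : Prop :=
  [/\ Omega (base p), smooth_at p Q & \forall z \near p, inf_invariant_at E Q z].

Definition lie_bracket {R : realType} {m : nat}
    (Q P : 'rV[R]_(2 + m) -> 'rV[R]_(2 + m)) :
    'rV[R]_(2 + m) -> 'rV[R]_(2 + m) :=
  fun z => 'D_(Q z) P z - 'D_(P z) Q z.

(* J induces an isomorphism from the Lie algebra of the germs at p in S onto the
   Lie algebra of the germs at q in S'. *)
Record lie_algebra_iso (R : realType) (m m' : nat)
    (p : 'rV[R]_(2 + m)) (S : set ('rV[R]_(2 + m) -> 'rV[R]_(2 + m)))
    (q : 'rV[R]_(2 + m')) (S' : set ('rV[R]_(2 + m') -> 'rV[R]_(2 + m')))
    (J : ('rV[R]_(2 + m) -> 'rV[R]_(2 + m)) ->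
         ('rV[R]_(2 + m') -> 'rV[R]_(2 + m'))) : Prop := LieAlgebraIso {
  lai_sym : forall Q, S Q -> S' (J Q);
  lai_inj : forall Q P, S Q -> S P -> (germ_eq p Q P <-> germ_eq q (J Q) (J P));
  lai_surj : forall P, S' P -> exists2 Q, S Q & germ_eq q (J Q) P;
  lai_linear : forall (a : R) Q P, S Q -> S P ->
    germ_eq q (J (fun z => a *: Q z + P z)) (fun z => a *: J Q z + J P z);
  lai_bracket : forall Q P, S Q -> S P ->
    germ_eq q (J (lie_bracket Q P)) (lie_bracket (J Q) (J P)) }.

Definition eqL {R : realType} (A B C : 'rV[R]_2 -> R) : system R 1 1 :=
  fun _ J =>
    let w := jt_base J in
    jt1 J it 0 0
    - (A w * jt2 J ix ix 0 0 + B w * jt1 J ix 0 0 + C w * jt0 J 0 0).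

Definition DE1 {R : realType} (A B C : 'rV[R]_2 -> R) : system R 3 3 :=
  fun l J =>
    let w := jt_base J in
    let a1 : 'I_3 := @Ordinal 3 0 isT in
    let a2 : 'I_3 := @Ordinal 3 1 isT in
    let a3 : 'I_3 := @Ordinal 3 2 isT in
    let g a := jt0 J 0 a in
    let g_t a := jt1 J it 0 a in
    let g_x a := jt1 J ix 0 a in
    let g_xx a := jt2 J ix ix 0 a in
    let K := 2 * g_x a1 - pd ix A w / A w * g a1 - pd it A w / A w in
    [:: g_t a1 - A w * g_xx a1 - B w * g_x a1 + K * (g a1 + B w)
          + pd ix B w * g a1 + 2 * A w * g_x a2 + pd it B w;
        g_t a2 - A w * g_xx a2 - B w * g_x a2 + K * (g a2 - C w)
          - pd ix C w * g a1 - pd it C w;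
        g_t a3 - A w * g_xx a3 - B w * g_x a3 + K * g a3 - C w * g a3]`_l.

Definition opQ {R : realType} (tau : R -> R) (xi zeta1 zeta0 : 'rV[R]_2 -> R) :
    'rV[R]_(2 + 1) -> 'rV[R]_(2 + 1) :=
  fun z =>
    let w := base z in
    let u := dep z 0 0 in
    row_mx (row2 (tau (w 0 it)) (xi w)) (const_mx (zeta1 w * u + zeta0 w)).

Definition opQ1 {R : realType} (tau : R -> R) (xi zeta1 zeta0 : 'rV[R]_2 -> R) :
    'rV[R]_(2 + 3) -> 'rV[R]_(2 + 3) :=
  fun z =>
    let w := base z in
    let g1 := dep z 0 (@Ordinal 3 0 isT) in
    let g2 := dep z 0 (@Ordinal 3 1 isT) in
    let g3 := dep z 0 (@Ordinal 3 2 isT) in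
    let tau_t := derive1 tau (w 0 it) in
    row_mx (row2 (tau (w 0 it)) (xi w))
      (row3 ((pd ix xi w - tau_t) * g1 + pd it xi w)
            (- tau_t * g2 + pd ix zeta1 w * g1 + pd it zeta1 w)
            ((zeta1 w - tau_t) * g3 - zeta0 w * g2
               + pd ix zeta0 w * g1 + pd it zeta0 w)).

(* Main.v *)
(* Both systems have the form
   u^l_t = A u^l_xx - sum_c H1_lc(t, x, u) u^c_x - H0_l(t, x, u).
   For such a system, varying u_tt, u_tx, u_xx and u_x in the invariance
   condition forces a point symmetry to be t' = T(t), x' = X(t, x),
   u' = M(t, x) u + N(t, x), and leaves a condition on A together with residues
   that are polynomial in u and in u_x.
   For DE_1 the coefficients of these residues express M and N through T, X,
   U1 = T_t M_33 and U0 = - T_t M_32, and the remaining ones say precisely that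
   (T, X, U1 u + U0) is a symmetry of L.  Conversely, for a symmetry
   (T, X, U1 u + U0) of L the push-forward of the operators
   d_t + g1 d_x + (g2 u + g3) d_u, normalized to have coefficient 1 at d_t, has
   vanishing residues: this follows from the conditions on (T, X, U1, U0) and
   their first derivatives.  Equality of the data (T, X, U1, U0) is therefore the
   required isomorphism, and the Lie algebras are matched by the linearization of
   the same computation. *)
Require Import Defs.
From HB Require Import structures.
From mathcomp Require Import all_boot all_order all_algebra.
From mathcomp Require Import all_classical all_reals all_analysis.
From mathcomp Require Import ring lra.
Import Order.TTheory GRing.Theory Num.Theory.
Import numFieldNormedType.Exports.
Local Open Scope classical_set_scope.
Local Open Scope ring_scope.
Set Implicit Arguments.
Unset Strict Implicit.
Unset Printing Implicit Defensive.

(** * Smooth functions *)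

(** Two reductions carry the computation. Quadratic polynomials realize every second-order jet with
    symmetric mixed part, so invariance becomes algebra over jets; for finite symmetries a jet is
    usable only if the image of its graph is again a graph, so every variation has to keep the total
    Jacobian of (T, X) nonzero. Moreover, a germ at [p] sees only a piece of one fibre, yet it is
    matched with germs at every [q] over the same (t, x). The residues have degree at most 2 along
    the fibre, so they vanish on all of it and leave conditions on (t, x) alone.

    The induced map comes from a push-forward. Under (T, X, v = U1 u + U0) the operator d_t + g1 d_x
    + (g2 u + g3) d_u gets the coefficients T_t, X_t + g1 X_x and U1_t u + U0_t + g1 (U1_x u + U0_x)
    + U1 (g2 u + g3). Dividing by T_t and substituting u = (v - U0) / U1 gives [indM] and [indN];
    their linearization at the identity is [indlieM] and [indlieN]. *)

Section SmoothFunctions.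
Context {R : realType}.

Lemma near_openE (T : topologicalType) (p : T) (P : T -> Prop) :
  (\forall z \near p, P z) = exists2 U, open_nbhs p U & U `<=` P.
Proof. by rewrite -[LHS]/(nbhs p P) nbhsE. Qed.

Lemma near_all (T : topologicalType) (I : finType) (p : T) (P : I -> T -> Prop) :
  (forall i, \forall z \near p, P i z) -> \forall z \near p, forall i, P i z.
Proof. by move=> H; apply: (@filter_forall T I P (nbhs p)). Qed.

Lemma near_eq_differentiable (V W : normedModType R) (f g : V -> W) (x : V) :
  (\forall z \near x, f z = g z) -> differentiable f x -> differentiable g x.
Proof.
move=> fg /diff_locallyP [cf df].
have eqx := nbhs_singleton fg.
have fg0 : \forall h \near (0 : V), f (h + x) = g (h + x).
  by move: fg; rewrite (near_shift 0 x) /=; apply: filterS => h /=; rewrite subr0.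
have dg : g \o shift x = cst (g x) + 'd f x +o_ (0 : V) id.
  apply/eqaddoP => e e0; move/eqaddoP: df => /(_ e e0).
  by apply: filterS2 fg0 => h; rewrite /= -eqx !fctE /= => ->.
have dE : 'd g x = 'd f x :> (V -> W) by exact: diff_unique.
by apply/diff_locallyP; rewrite dE.
Unshelve. all: by end_near. Qed.

Lemma differentiable_row n (V : normedModType R) (F : V -> 'rV[R]_n) (x : V) :
  (forall a, differentiable (fun z => F z 0 a) x) -> differentiable F x.
Proof.
move=> dF; have -> : F = \sum_(a < n) (fun z => F z 0 a *: delta_mx 0 a).
  apply/funext => z; rewrite {1}(row_sum_delta (F z)).
  by rewrite fct_sumE.
by apply: differentiable_sum => a; apply: differentiableZl.
Qed.

Definition smooth_on n (U : set 'rV[R]_n) (f : 'rV[R]_n -> R) : Prop :=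
  forall s z, U z -> differentiable (iter_pd s f) z.

(* Closing the smooth functions under the algebraic operations and composition
   gives a class stable under partial derivatives, so that membership in it
   already yields smoothness. *)
Inductive smooth_gen : forall n, set 'rV[R]_n -> ('rV[R]_n -> R) -> Prop :=
| gen_smooth n (U : set 'rV[R]_n) f : smooth_on U f -> smooth_gen U f
| gen_add n (U : set 'rV[R]_n) f g :
    smooth_gen U f -> smooth_gen U g -> smooth_gen U (fun z => f z + g z)
| gen_mul n (U : set 'rV[R]_n) f g :
    smooth_gen U f -> smooth_gen U g -> smooth_gen U (fun z => f z * g z)
| gen_inv n (U : set 'rV[R]_n) f :
    (forall z, U z -> f z != 0) -> smooth_gen U f ->
    smooth_gen U (fun z => (f z)^-1)
| gen_comp n k (U : set 'rV[R]_n) (V : set 'rV[R]_k) f (g : 'rV[R]_n -> 'rV[R]_k) :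
    smooth_on V f -> (forall z, U z -> V (g z)) ->
    (forall a, smooth_gen U (fun z => g z 0 a)) ->
    smooth_gen U (fun z => f (g z)).

Lemma smooth_on_pd n (U : set 'rV[R]_n) f i : smooth_on U f -> smooth_on U (pd i f).
Proof.
move=> sf s z Uz; have := sf (rcons s i) z Uz.
suff -> : iter_pd (rcons s i) f = iter_pd s (pd i f) by [].
by elim: s {z Uz} => //= j s ->.
Qed.

Lemma smooth_on_cst n (U : set 'rV[R]_n) (c : R) : smooth_on U (fun=> c).
Proof.
suff H (s : seq 'I_n) : exists c', iter_pd s (fun _ : 'rV[R]_n => c) = fun=> c'.
  by move=> s z _; have [c' ->] := H s; exact: differentiable_cst.
elim: s c => [|i s IHs] c /=; first by exists c.
by have [c' ->] := IHs c; exists 0; apply/funext => z; exact: derive_cst.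
Qed.

Lemma pd_comp n k (f : 'rV[R]_k -> R) (g : 'rV[R]_n -> 'rV[R]_k) z (i : 'I_n) :
  differentiable f (g z) -> (forall a, differentiable (fun z => g z 0 a) z) ->
  pd i (fun z => f (g z)) z
  = \sum_(a < k) pd a f (g z) * pd i (fun z => g z 0 a) z.
Proof.
move=> df dg; have dg' : differentiable g z by exact: differentiable_row.
rewrite {1}/pd deriveE; last exact: differentiable_comp.
rewrite (diff_comp dg' df) /= -(deriveE _ dg') derive_mx; last exact: diff_derivable.
set v := (X in 'd f (g z) X).
rewrite (row_sum_delta v) linear_sum; apply: eq_bigr => a _.
by rewrite linearZ /= -(deriveE _ df) mxE mulrC.
Qed.

Lemma smooth_gen_sum n (U : set 'rV[R]_n) k (F : 'I_k -> 'rV[R]_n -> R) :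
  (forall a, smooth_gen U (F a)) -> smooth_gen U (fun z => \sum_a F a z).
Proof.
elim: k F => [|k IHk] F sF.
  rewrite (_ : (fun _ => _) = fun=> 0); first exact/gen_smooth/smooth_on_cst.
  by apply/funext => z; rewrite big_ord0.
rewrite (_ : (fun _ => _) = fun z => F ord0 z + \sum_(a < k) F (lift ord0 a) z).
  by apply: gen_add => //; exact: IHk.
by apply/funext => z; rewrite big_ord_recl.
Qed.

(** Each differentiation rule returns an expression built from the same constructors. The derivative
    is only claimed to agree with a generated function on [U], since nothing is controlled
    outside. *)
Lemma smooth_gen_pd n (U : set 'rV[R]_n) f : smooth_gen U f ->
  (forall z, U z -> differentiable f z) /\
  (forall i, exists2 g, smooth_gen U g & forall z, U z -> pd i f z = g z).
Proof.
elim=> {n U f} [n U f sf|n U f g sf [df pf] sg [dg pg]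
  |n U f g sf [df pf] sg [dg pg]|n U f f0 sf [df pf]|n k U V f g sf gV sg IHg].
- split=> [z Uz|i]; first exact: (sf [::]).
  by exists (pd i f) => //; exact/gen_smooth/smooth_on_pd.
- split=> [z Uz|i]; first exact: differentiableD (df _ Uz) (dg _ Uz).
  have [f' sf' f'E] := pf i; have [g' sg' g'E] := pg i.
  exists (fun z => f' z + g' z); first exact: gen_add.
  move=> z Uz; rewrite -f'E // -g'E //.
  by apply: deriveD; apply: diff_derivable; [exact: df|exact: dg].
- split=> [z Uz|i]; first exact: differentiableM (df _ Uz) (dg _ Uz).
  have [f' sf' f'E] := pf i; have [g' sg' g'E] := pg i.
  exists (fun z => f z * g' z + g z * f' z).
    by apply: gen_add; exact: gen_mul.
  move=> z Uz; rewrite -f'E // -g'E //.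
  by apply: deriveM; apply: diff_derivable; [exact: df|exact: dg].
- split=> [z Uz|i]; first exact: differentiableV (df _ Uz) (f0 _ Uz).
  have [f' sf' f'E] := pf i.
  exists (fun z => - 1 * (((f z)^-1 * (f z)^-1) * f' z)).
    apply: gen_mul; first exact/gen_smooth/smooth_on_cst.
    by apply: gen_mul => //; apply: gen_mul; exact: gen_inv.
  move=> z Uz; rewrite -f'E // {1}/pd deriveV; last exact/diff_derivable/df.
    by rewrite mulN1r -exprVn expr2 scaleNr.
  exact: f0.
- have dg a z : U z -> differentiable (fun z => g z 0 a) z by move: (IHg a).1; apply.
  split=> [z Uz|i].
    apply: (@differentiable_comp _ _ _ _ g f).
      by apply: differentiable_row => a; exact: dg.
    exact: (sf [::]) (gV _ Uz).
  have [h hP] := choice (fun a => (exists2P _ _).1 ((IHg a).2 i)).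
  exists (fun z => \sum_a pd a f (g z) * h a z).
    apply: smooth_gen_sum => a; apply: gen_mul; last exact: (hP a).1.
    by apply: (@gen_comp _ _ _ V (pd a f)) => //; exact: smooth_on_pd.
  move=> z Uz; rewrite pd_comp; last by move=> a; exact: dg.
    by apply: eq_bigr => a _; rewrite (hP a).2.
  exact: (sf [::]) (gV _ Uz).
Qed.

(** Induction on the list of indices: openness of [U] upgrades agreement on [U] to equality of
    germs, which is what passing to one more derivative requires. *)
Lemma smooth_gen_on n (U : set 'rV[R]_n) f :
  open U -> smooth_gen U f -> smooth_on U f.
Proof.
move=> oU sf s.
have nearU z : U z -> \forall y \near z, U y by move=> Uz; exact: open_nbhs_nbhs.
suff [g sg gE] : exists2 g, smooth_gen U g & forall z, U z -> iter_pd s f z = g z.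
  move=> z Uz; apply: near_eq_differentiable ((smooth_gen_pd sg).1 z Uz).
  by apply: filterS (nearU z Uz) => y Uy; rewrite gE.
elim: s => [|i s [g sg gE]]; first by exists f.
have [h sh hE] := (smooth_gen_pd sg).2 i; exists h => // z Uz.
rewrite -hE //=; apply: near_eq_derive.
by apply: filterS (nearU z Uz) => y Uy; rewrite gE.
Qed.

Lemma smooth_atP n (p : 'rV[R]_n) (f : 'rV[R]_n -> R) :
  smooth_at p f <-> exists U : set 'rV[R]_n, [/\ open U, U p & smooth_on U f].
Proof.
split; last first.
  move=> [U [oU Up sU]].
  by apply: filterS (open_nbhs_nbhs (conj oU Up)) => z Uz s; exact: sU.
move=> sf; have : nbhs p [set z | forall s, differentiable (iter_pd s f) z] := sf.
rewrite nbhsE => -[U [oU Up] sU]; exists U; split=> // s z Uz.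
exact: sU.
Qed.

Lemma smooth_atP2 n (p : 'rV[R]_n) (f g : 'rV[R]_n -> R) :
  smooth_at p f -> smooth_at p g -> exists U : set 'rV[R]_n,
    [/\ open U, U p, smooth_on U f & smooth_on U g].
Proof.
move=> /smooth_atP[U [oU Up sU]] /smooth_atP[V [oV Vp sV]].
exists (U `&` V); split=> //; first exact: openI.
  by move=> s z [Uz _]; exact: sU.
by move=> s z [_ Vz]; exact: sV.
Qed.

Lemma smooth_gen_at n (U : set 'rV[R]_n) p f :
  open U -> U p -> smooth_gen U f -> smooth_at p f.
Proof. by move=> oU Up sf; apply/smooth_atP; exists U; split=> //; exact: smooth_gen_on. Qed.

Section Closure.
Context {n : nat} (p : 'rV[R]_n).
Implicit Types f g : 'rV[R]_n -> R.

Lemma smooth_cst (c : R) : smooth_at p (fun=> c).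
Proof. by apply/smooth_atP; exists setT; split=> //; [exact: openT|exact: smooth_on_cst]. Qed.

Lemma smoothD f g : smooth_at p f -> smooth_at p g -> smooth_at p (fun z => f z + g z).
Proof.
move=> sf sg; have [U [oU Up {}sf {}sg]] := smooth_atP2 sf sg.
by apply: (smooth_gen_at oU Up); apply: gen_add; exact: gen_smooth.
Qed.

Lemma smoothM f g : smooth_at p f -> smooth_at p g -> smooth_at p (fun z => f z * g z).
Proof.
move=> sf sg; have [U [oU Up {}sf {}sg]] := smooth_atP2 sf sg.
by apply: (smooth_gen_at oU Up); apply: gen_mul; exact: gen_smooth.
Qed.

Lemma smoothN f : smooth_at p f -> smooth_at p (fun z => - f z).
Proof.
move=> sf; rewrite (_ : (fun _ => _) = fun z => -1 * f z).
  by apply: smoothM => //; exact: smooth_cst.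
by apply/funext => z; rewrite mulN1r.
Qed.

Lemma smoothB f g : smooth_at p f -> smooth_at p g -> smooth_at p (fun z => f z - g z).
Proof. by move=> sf sg; apply: smoothD => //; exact: smoothN. Qed.

Lemma smooth_sum k (F : 'I_k -> 'rV[R]_n -> R) :
  (forall a, smooth_at p (F a)) -> smooth_at p (fun z => \sum_a F a z).
Proof.
elim: k F => [|k IHk] F sF.
  rewrite (_ : (fun _ => _) = fun=> 0); first exact: smooth_cst.
  by apply/funext => z; rewrite big_ord0.
rewrite (_ : (fun _ => _) = fun z => F ord0 z + \sum_(a < k) F (lift ord0 a) z).
  by apply: smoothD => //; exact: IHk.
by apply/funext => z; rewrite big_ord_recl.
Qed.

Lemma smooth_diff f : smooth_at p f -> differentiable f p.
Proof. by move=> /nbhs_singleton /(_ [::]). Qed.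

Lemma smooth_near f : smooth_at p f -> \forall z \near p, smooth_at z f.
Proof. exact: near_join. Qed.

Lemma smooth_continuous f : smooth_at p f -> {for p, continuous f}.
Proof. by move=> /smooth_diff/differentiable_continuous. Qed.

Lemma smoothV f : f p != 0 -> smooth_at p f -> smooth_at p (fun z => (f z)^-1).
Proof.
move=> f0 sf.
have nz : \forall z \near p, f z != 0.
  exact: (smooth_continuous sf) (open_nbhs_nbhs (conj (@open_neq _ 0) f0)).
have : \forall z \near p, f z != 0 /\ forall s, differentiable (iter_pd s f) z.
  by apply: filterS2 nz sf.
rewrite near_openE => -[U [oU Up] sU].
apply: (smooth_gen_at oU Up); apply: gen_inv; first by move=> z /sU[].
by apply: gen_smooth => s z /sU[].
Qed.

Lemma smooth_eq f g : (\forall z \near p, f z = g z) -> smooth_at p f -> smooth_at p g.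
Proof.
move=> fg sf; have : \forall z \near p, f z = g z /\ forall s, differentiable (iter_pd s f) z.
  by apply: filterS2 fg sf.
rewrite near_openE => -[U [oU Up] sU].
apply/smooth_atP; exists U; split=> // s z Uz.
have nearU y : U y -> \forall z \near y, U z by move=> Uy; exact: open_nbhs_nbhs.
have E : forall y, U y -> iter_pd s f y = iter_pd s g y.
  elim: s => [|i s IHs] y Uy /=; first exact: (sU y Uy).1.
  by apply: near_eq_derive; apply: filterS (nearU y Uy) => x /IHs.
apply: near_eq_differentiable ((sU z Uz).2 s).
by apply: filterS (nearU z Uz) => x /E.
Qed.

End Closure.

Lemma smooth_coord n (p : 'rV[R]_n) i : smooth_at p (fun z : 'rV[R]_n => z 0 i).
Proof.
apply/smooth_atP; exists setT; split=> //; first exact: openT.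
suff H (s : seq 'I_n) : s != [::] ->
    exists c, iter_pd s (fun z : 'rV[R]_n => z 0 i) = fun=> c.
  move=> [|j s] z _; first exact: differentiable_coord.
  by have [//|c ->] := H (j :: s); exact: differentiable_cst.
elim: s => // j [|k s] IHs _.
  exists ((j == i)%:R); apply/funext => z; rewrite /= /pd.
  have di : derivable (id : 'rV[R]_n -> 'rV[R]_n) z (delta_mx 0 j) by exact: derivable_id.
  have := derive_mx di.
  by rewrite derive_id => /matrixP/(_ 0 i); rewrite !mxE eqxx /= eq_sym => ->.
by have [//|c /= ->] := IHs; exists 0; apply/funext => z; exact: derive_cst.
Qed.

Lemma smooth_comp n k (p : 'rV[R]_n) (f : 'rV[R]_k -> R) (g : 'rV[R]_n -> 'rV[R]_k) :
  smooth_at (g p) f -> (forall a, smooth_at p (fun z => g z 0 a)) ->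
  smooth_at p (fun z => f (g z)).
Proof.
move=> /smooth_atP[V [oV Vp sf]] sg.
have cg : {for p, continuous g}.
  apply: differentiable_continuous; apply: differentiable_row => a.
  exact: smooth_diff.
have : \forall z \near p, V (g z) /\ forall a s, differentiable (iter_pd s (fun z => g z 0 a)) z.
  have nV : \forall z \near p, V (g z) := cg _ (open_nbhs_nbhs (conj oV Vp)).
  have ns : \forall z \near p, forall a s, differentiable (iter_pd s (fun z => g z 0 a)) z.
    exact: near_all.
  by apply: filterS2 nV ns.
rewrite near_openE => -[U [oU Up] sU].
apply: (smooth_gen_at oU Up); apply: (gen_comp sf); first by move=> z /sU[].
by move=> a; apply: gen_smooth => s z /sU[_]; exact.
Qed.

End SmoothFunctions.

(** * Partial derivatives *)

(** A locked copy of [pd] for scalar functions, so that rewriting with the derivative rules never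
    unfolds it to a limit. *)
HB.lock Definition dif {R : realType} {n : nat} (i : 'I_n) (f : 'rV[R]_n -> R) :
  'rV[R]_n -> R := fun z => 'D_(delta_mx 0 i) f z.

Section PartialDerivatives.
Context {R : realType}.

Lemma difE n (i : 'I_n) (f : 'rV[R]_n -> R) : dif i f = pd i f.
Proof. by rewrite dif.unlock. Qed.

Lemma dif_near n (i : 'I_n) (f g : 'rV[R]_n -> R) (p : 'rV[R]_n) :
  (\forall z \near p, f z = g z) -> dif i f p = dif i g p.
Proof. by move=> fg; rewrite !difE; exact: near_eq_derive. Qed.

Lemma near_dif n (i : 'I_n) (f g : 'rV[R]_n -> R) (p : 'rV[R]_n) :
  (\forall z \near p, f z = g z) -> \forall z \near p, dif i f z = dif i g z.
Proof. by move=> /near_join; apply: filterS => z; exact: dif_near. Qed.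

Lemma smooth_dif n (i : 'I_n) (f : 'rV[R]_n -> R) (p : 'rV[R]_n) :
  smooth_at p f -> smooth_at p (dif i f).
Proof.
move=> /smooth_atP[U [oU Up sU]]; apply/smooth_atP; exists U; split=> //.
by rewrite difE; exact: smooth_on_pd.
Qed.

Section Rules.
Context {n : nat} (i : 'I_n) (p : 'rV[R]_n).
Implicit Types f g : 'rV[R]_n -> R.

Lemma dif_cst (c : R) : dif i (fun=> c) p = 0.
Proof. by rewrite difE; exact: derive_cst. Qed.

Lemma difD f g : smooth_at p f -> smooth_at p g ->
  dif i (fun z => f z + g z) p = dif i f p + dif i g p.
Proof.
move=> /smooth_diff df /smooth_diff dg; rewrite !difE.
by apply: deriveD; exact: diff_derivable.
Qed.

Lemma difM f g : smooth_at p f -> smooth_at p g ->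
  dif i (fun z => f z * g z) p = dif i f p * g p + f p * dif i g p.
Proof.
move=> /smooth_diff df /smooth_diff dg; rewrite !difE addrC (mulrC (pd i f p)).
by apply: deriveM; exact: diff_derivable.
Qed.

Lemma difN f : smooth_at p f -> dif i (fun z => - f z) p = - dif i f p.
Proof. by move=> /smooth_diff df; rewrite !difE; apply: deriveN; exact: diff_derivable. Qed.

Lemma difB f g : smooth_at p f -> smooth_at p g ->
  dif i (fun z => f z - g z) p = dif i f p - dif i g p.
Proof. by move=> sf sg; rewrite difD ?difN //; exact: smoothN. Qed.

Lemma difV f : f p != 0 -> smooth_at p f ->
  dif i (fun z => (f z)^-1) p = - dif i f p / f p ^+ 2.
Proof.
move=> f0 /smooth_diff df; rewrite !difE {1}/pd deriveV //; last exact: diff_derivable.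
by rewrite mulNr scaleNr mulrC.
Qed.

Lemma dif_sum k (F : 'I_k -> 'rV[R]_n -> R) : (forall a, smooth_at p (F a)) ->
  dif i (fun z => \sum_a F a z) p = \sum_a dif i (F a) p.
Proof.
elim: k F => [|k IHk] F sF.
  rewrite big_ord0 (_ : (fun _ => _) = fun=> 0) ?dif_cst //.
  by apply/funext => z; rewrite big_ord0.
rewrite (_ : (fun _ => _) = fun z => F ord0 z + \sum_(a < k) F (lift ord0 a) z).
  by rewrite difD ?big_ord_recl ?IHk //; exact: smooth_sum.
by apply/funext => z; rewrite big_ord_recl.
Qed.

Lemma dif_coord k : dif i (fun z => z 0 k) p = (i == k)%:R.
Proof.
rewrite difE /pd; have di : derivable (id : 'rV[R]_n -> 'rV[R]_n) p (delta_mx 0 i).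
  exact: derivable_id.
have := derive_mx di.
by rewrite derive_id => /matrixP/(_ 0 k); rewrite !mxE eqxx /= eq_sym => ->.
Qed.

Lemma dif_comp k (f : 'rV[R]_k -> R) (g : 'rV[R]_n -> 'rV[R]_k) :
  smooth_at (g p) f -> (forall a, smooth_at p (fun z => g z 0 a)) ->
  dif i (fun z => f (g z)) p = \sum_(a < k) dif a f (g p) * dif i (fun z => g z 0 a) p.
Proof.
move=> sf sg; rewrite !difE pd_comp; last by move=> a; exact: smooth_diff.
  by apply: eq_bigr => a _; rewrite !difE.
exact: smooth_diff.
Qed.

End Rules.

Lemma is_derive_line n (f : 'rV[R]_n -> R) q v (c : R) :
  differentiable f (q + c *: v) ->
  is_derive c 1 (fun s => f (q + s *: v)) ('D_v f (q + c *: v)).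
Proof.
move=> df; have dl : is_diff c (fun s : R => q + s *: v) ( *:%R^~ v).
  by apply: is_diff_eq; apply/funext => s /=; rewrite add0r.
have dfl : differentiable (f \o (fun s : R => q + s *: v)) c.
  by apply: differentiable_comp => //; exact: ex_diff.
apply: DeriveDef; first exact: diff_derivable.
rewrite -[LHS]/('D_1 (f \o (fun s : R => q + s *: v)) c) deriveE //.
have dl' : differentiable (fun s : R => q + s *: v) c by exact: ex_diff.
by rewrite (diff_comp dl' df) /= diff_val scale1r deriveE.
Qed.

Lemma line_mvt (k dk : R -> R) (h : R) : 0 < h ->
  (forall s, 0 <= s <= h -> is_derive s 1 k (dk s)) ->
  exists2 c, 0 <= c <= h & k h - k 0 = dk c * h.
Proof.
move=> h0 dkP; have [s||c] := @MVT R k dk 0 h h0.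
- by rewrite in_itv /= => /andP[/ltW s0 /ltW sh]; apply: dkP; rewrite s0.
- apply: continuous_in_subspaceT => s.
  rewrite inE /= in_itv /= => /dkP [/derivable1_diffP ds _].
  exact: differentiable_continuous.
- rewrite in_itv /= => /andP[/ltW c0 /ltW ch]; rewrite subr0 => E.
  by exists c; rewrite ?c0.
Qed.

Lemma ball_line n (p : 'rV[R]_n) (r a b : R) (i j : 'I_n) :
  0 < r -> 0 <= a <= r / 3%:R -> 0 <= b <= r / 3%:R ->
  ball p r (p + a *: delta_mx 0 i + b *: delta_mx 0 j).
Proof.
move=> r0 /andP[a0 ar] /andP[b0 br].
rewrite -ball_normE /= -addrA opprD addrA subrr sub0r normrN.
have nd k : `|delta_mx 0 k : 'rV[R]_n| <= 1.
  rewrite /Num.Def.normr /= mx_normrE; apply: bigmax_le => // -[x y] _.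
  by rewrite mxE; case: (_ && _); rewrite ?normr1 ?normr0.
apply: (@le_lt_trans _ _ (a + b)); last by lra.
apply: (le_trans (ler_normD _ _)); rewrite !normrZ !ger0_norm //.
by apply: lerD; rewrite -[leRHS]mulr1 ler_wpM2l.
Qed.

(** The mean value theorem is applied first in direction [i] to a difference in direction [j], then
    in direction [j]. The step r / 3 keeps the whole parallelogram in the ball, since the two
    displacements add up to at most 2 r / 3. *)
Lemma dif2_mvt n (f : 'rV[R]_n -> R) (p : 'rV[R]_n) i j (r : R) : 0 < r ->
  (forall z, ball p r z -> smooth_at z f) ->
  let h := r / 3%:R in let v k : 'rV[R]_n := delta_mx 0 k in
  exists2 z, ball p r z & dif j (dif i f) z * h * h =
    f (p + h *: v i + h *: v j) - f (p + h *: v i) - f (p + h *: v j) + f p.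
Proof.
move=> r0 sf h v; have h0 : 0 < h by rewrite divr_gt0.
have sf1 s t : 0 <= s <= h -> 0 <= t <= h -> smooth_at (p + s *: v i + t *: v j) f.
  by move=> sh th; apply: sf; exact: ball_line.
have hh : 0 <= h <= h by rewrite lexx ltW.
have h00 : 0 <= (0 : R) <= h by rewrite lexx ltW.
have D0 s : 0 <= s <= h -> smooth_at (p + s *: v i) f.
  by move=> sh; have := sf1 s 0 sh h00; rewrite scale0r addr0.
have [s sh|c ch Ec] := @line_mvt
    (fun s => f (p + h *: v j + s *: v i) - f (p + s *: v i))
    (fun s => dif i f (p + h *: v j + s *: v i) - dif i f (p + s *: v i)) h h0.
  apply: is_deriveB; rewrite difE; apply: is_derive_line; apply: smooth_diff.
    by rewrite addrAC; exact: sf1.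
  exact: D0.
have [t th|d dh Ed] := @line_mvt (fun t => dif i f (p + c *: v i + t *: v j))
    (fun t => dif j (dif i f) (p + c *: v i + t *: v j)) h h0.
  by rewrite (difE j); apply: is_derive_line;
     apply: smooth_diff; apply: smooth_dif; exact: sf1.
exists (p + c *: v i + d *: v j); first exact: ball_line.
move: Ec; rewrite scale0r !addr0 (addrAC p (h *: v j) (h *: v i)).
rewrite (addrAC p (h *: v j) (c *: v i)) -Ed scale0r addr0 => <-; ring.
Qed.

(** Schwarz's theorem: the second difference is symmetric in the two directions, so by [dif2_mvt]
    the two mixed derivatives take a common value at two points close to [p]; their continuity at
    [p] does the rest. *)
Lemma dif_swap n (f : 'rV[R]_n -> R) (p : 'rV[R]_n) i j :
  smooth_at p f -> dif j (dif i f) p = dif i (dif j f) p.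
Proof.
move=> sf; apply/eqP; rewrite -subr_eq0 -normr_eq0; apply/eqP/le_anti.
rewrite normr_ge0 andbT; apply/ler_addgt0Pr => e e0; rewrite add0r.
have ca k l : \forall z \near p, `|dif k (dif l f) p - dif k (dif l f) z| < e / 2.
  have c : {for p, continuous (dif k (dif l f))}.
    by apply: smooth_continuous; do 2!apply: smooth_dif.
  by move/cvgrPdist_lt: c; apply; rewrite divr_gt0.
have : \forall z \near p, [/\ smooth_at z f,
    `|dif j (dif i f) p - dif j (dif i f) z| < e / 2
    & `|dif i (dif j f) p - dif i (dif j f) z| < e / 2].
  by near=> z; split; near: z; [exact: smooth_near|exact: ca|exact: ca].
move=> /nbhs_ballP[r /= r0 rP].
have sr z : ball p r z -> smooth_at z f by move=> /rP[].
have [z1 /rP[_ + _] E1] := dif2_mvt i j r0 sr.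
have [z2 /rP[_ _ +] E2] := dif2_mvt j i r0 sr.
have h0 : r / 3%:R != 0 by rewrite lt0r_neq0 // divr_gt0.
have -> : dif i (dif j f) z2 = dif j (dif i f) z1.
  apply: (mulIf h0); apply: (mulIf h0); rewrite E1 E2 addrAC.
  by rewrite (addrAC p (r / 3%:R *: _)); ring.
set a := dif j _ p; set b := dif i _ p; set c := dif j _ z1 => Ha Hb.
rewrite (_ : a - b = (a - c) - (b - c)); last by ring.
by apply: (le_trans (ler_normB _ _)); lra.
Unshelve. all: by end_near. Qed.

End PartialDerivatives.

(** * Row-valued functions, restriction to graphs, and behaviour along the fibres over (t, x) *)

Section GraphsAndFibers.
Context {R : realType}.

Lemma iter_pd_coord n m (U : set 'rV[R]_n) (F : 'rV[R]_n -> 'rV[R]_m) s :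
  open U -> (forall s z, U z -> differentiable (iter_pd s F) z) ->
  forall z a, U z -> iter_pd s F z 0 a = iter_pd s (fun z => F z 0 a) z.
Proof.
move=> oU dF; elim: s => //= i s IHs z a Uz.
rewrite /pd derive_mx; last exact/diff_derivable/dF.
rewrite mxE; apply: near_eq_derive.
by apply: filterS (open_nbhs_nbhs (conj oU Uz)) => y Uy; rewrite IHs.
Qed.

(** Differentiability of a row reduces to its entries, but the entries of a derivative are the
    derivatives of the entries only where the row is already known to be differentiable. Both facts
    are therefore carried through one induction. *)
Lemma smooth_rowP n m (p : 'rV[R]_n) (F : 'rV[R]_n -> 'rV[R]_m) :
  smooth_at p F <-> forall a, smooth_at p (fun z => F z 0 a).
Proof.
split=> [sF a|sF].
  have : \forall z \near p, forall s, differentiable (iter_pd s F) z by exact: sF.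
  rewrite near_openE => -[U [oU Up] sU]; apply/smooth_atP; exists U; split=> // s z Uz.
  have dc : differentiable (fun z => iter_pd s F z 0 a) z.
    apply: (@differentiable_comp _ _ _ _ (iter_pd s F) (fun M : 'rV[R]_m => M 0 a)).
      exact: sU.
    exact: differentiable_coord.
  apply: near_eq_differentiable dc.
  apply: filterS (open_nbhs_nbhs (conj oU Uz)) => y Uy.
  exact: (iter_pd_coord s oU (fun s z Uz => sU z Uz s)).
have : \forall z \near p, forall a s, differentiable (iter_pd s (fun z => F z 0 a)) z.
  exact: near_all.
rewrite near_openE => -[U [oU Up] sU].
suff H s : forall z, U z -> differentiable (iter_pd s F) z /\
    forall a, iter_pd s F z 0 a = iter_pd s (fun z => F z 0 a) z.
  by apply: filterS (open_nbhs_nbhs (conj oU Up)) => z Uz s; exact: (H s z Uz).1.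
elim: s => [|i s IHs] z Uz /=.
  by split=> //; apply: differentiable_row => a; exact: (sU z Uz a [::]).
have E y : U y -> forall a, pd i (iter_pd s F) y 0 a
    = pd i (iter_pd s (fun z => F z 0 a)) y.
  move=> Uy a; rewrite /pd derive_mx; last exact/diff_derivable/(IHs y Uy).1.
  rewrite mxE; apply: near_eq_derive.
  by apply: filterS (open_nbhs_nbhs (conj oU Uy)) => x Ux; rewrite (IHs x Ux).2.
split; last exact: E.
apply: differentiable_row => a.
apply: near_eq_differentiable (sU z Uz a (i :: s)).
by apply: filterS (open_nbhs_nbhs (conj oU Uz)) => y Uy; rewrite E.
Qed.

Lemma pd_coord n m (i : 'I_n) (F : 'rV[R]_n -> 'rV[R]_m) p a :
  smooth_at p F -> pd i F p 0 a = dif i (fun z => F z 0 a) p.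
Proof.
move=> sF; rewrite difE /pd derive_mx ?mxE //.
apply/diff_derivable/differentiable_row => b.
by apply: smooth_diff; move/smooth_rowP: sF; apply.
Qed.

Lemma smooth_near_row n m (F : 'rV[R]_n -> 'rV[R]_m) p :
  smooth_at p F -> \forall z \near p, smooth_at z F.
Proof. exact: near_join. Qed.

Lemma smooth_pd n m (i : 'I_n) (F : 'rV[R]_n -> 'rV[R]_m) p :
  smooth_at p F -> smooth_at p (pd i F).
Proof.
move=> sF; apply/smooth_rowP => a.
apply: (@smooth_eq _ _ _ (dif i (fun z => F z 0 a))).
  by apply: filterS (smooth_near_row sF) => z /pd_coord ->.
by apply: smooth_dif; move/smooth_rowP: sF.
Qed.

Lemma pd2_coord n m (i j : 'I_n) (F : 'rV[R]_n -> 'rV[R]_m) p a :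
  smooth_at p F -> pd j (pd i F) p 0 a = dif j (dif i (fun z => F z 0 a)) p.
Proof.
move=> sF; rewrite pd_coord; last exact: smooth_pd.
by apply: dif_near; apply: filterS (smooth_near_row sF) => z /pd_coord ->.
Qed.

Lemma near_comp n k (g : 'rV[R]_n -> 'rV[R]_k) p (P : 'rV[R]_k -> Prop) :
  (forall a, smooth_at p (fun z => g z 0 a)) ->
  (\forall y \near g p, P y) -> \forall z \near p, P (g z).
Proof.
move=> sg nP; have cg : {for p, continuous g}; last exact: cg _ nP.
by apply: differentiable_continuous; apply: differentiable_row => a; exact: smooth_diff.
Qed.

Lemma jacobianE n m (F : 'rV[R]_n -> 'rV[R]_m) p i a :
  smooth_at p F -> ('J F p) i a = dif i (fun z => F z 0 a) p.
Proof.
move=> sF; rewrite -pd_coord // /jacobian mxE /= /pd deriveE //.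
apply/differentiable_row => b.
by apply: smooth_diff; move/smooth_rowP: sF; apply.
Qed.

Lemma derive_dif n (h : 'rV[R]_n -> R) p v :
  differentiable h p -> 'D_v h p = \sum_k v 0 k * dif k h p.
Proof.
move=> dh; rewrite deriveE // {1}(row_sum_delta v) linear_sum; apply: eq_bigr => k _.
by rewrite linearZ /= -(deriveE _ dh) difE.
Qed.

Section Fibers.
Context {m : nat}.
Notation Z := 'rV[R]_(2 + m).

Definition tx (i : 'I_2) : 'I_(2 + m) := lshift m i.
Definition dv (b : 'I_m) : 'I_(2 + m) := rshift 2 b.

Lemma baseE (z : Z) k : base z 0 k = z 0 (tx k). Proof. by rewrite mxE. Qed.
Lemma depE (z : Z) b : dep z 0 b = z 0 (dv b). Proof. by rewrite mxE. Qed.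

Lemma base_row (w : 'rV[R]_2) (u : 'rV[R]_m) : base (row_mx w u) = w.
Proof. exact: row_mxKl. Qed.
Lemma dep_row (w : 'rV[R]_2) (u : 'rV[R]_m) : dep (row_mx w u) = u.
Proof. exact: row_mxKr. Qed.
Lemma row_base_dep (z : Z) : row_mx (base z) (dep z) = z.
Proof. exact: hsubmxK. Qed.

Lemma near_base (p : Z) (P : 'rV[R]_2 -> Prop) :
  (\forall w \near base p, P w) -> \forall z \near p, P (base z).
Proof.
apply: (@near_comp _ _ base) => a.
rewrite (_ : (fun _ => _) = fun z : Z => z 0 (tx a)).
  exact: smooth_coord.
by apply/funext => z; rewrite baseE.
Qed.

Lemma near_section (w0 : 'rV[R]_2) (u : 'rV[R]_m) (P : Z -> Prop) :
  (\forall z \near row_mx w0 u, P z) -> \forall w \near w0, P (row_mx w u).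
Proof.
apply: (@near_comp _ _ (fun w => row_mx w u)) => a.
rewrite -(splitK a); case: (fintype.split a) => k /=.
  rewrite (_ : (fun _ => _) = fun z : 'rV_2 => z 0 k); first exact: smooth_coord.
  by apply/funext => z; rewrite row_mxEl.
rewrite (_ : (fun _ => _) = fun z : 'rV_2 => u 0 k); first exact: smooth_cst.
by apply/funext => z; rewrite row_mxEr.
Qed.

Lemma smooth_graph (u : 'rV[R]_2 -> 'rV[R]_m) w a : smooth_at w u ->
  smooth_at w (fun w => row_mx w (u w) 0 a).
Proof.
move=> /smooth_rowP su; rewrite -(splitK a); case: (fintype.split a) => k /=.
  rewrite (_ : (fun _ => _) = fun z : 'rV_2 => z 0 k); first exact: smooth_coord.
  by apply/funext => z; rewrite row_mxEl.
rewrite (_ : (fun _ => _) = fun z : 'rV_2 => u z 0 k) //.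
by apply/funext => z; rewrite row_mxEr.
Qed.

Lemma smooth_on_graph (h : Z -> R) (u : 'rV[R]_2 -> 'rV[R]_m) w :
  smooth_at w u -> smooth_at (row_mx w (u w)) h ->
  smooth_at w (fun w => h (row_mx w (u w))).
Proof.
move=> su sh; apply: (@smooth_comp _ _ _ _ h (fun w => row_mx w (u w))) => // a.
exact: smooth_graph.
Qed.

Lemma dif_graph (h : Z -> R) (u : 'rV[R]_2 -> 'rV[R]_m) w i :
  smooth_at w u -> smooth_at (row_mx w (u w)) h ->
  dif i (fun w => h (row_mx w (u w))) w = dif (tx i) h (row_mx w (u w))
  + \sum_b dif (dv b) h (row_mx w (u w)) * dif i (fun w => u w 0 b) w.
Proof.
move=> su sh; rewrite (@dif_comp _ _ _ _ _ h (fun w => row_mx w (u w))) //; last first.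
  by move=> a; exact: smooth_graph.
rewrite big_split_ord /=; congr (_ + _).
  rewrite (bigD1 i) //= big1 ?addr0 => [|k ki].
    rewrite (_ : (fun _ => _) = fun z : 'rV_2 => z 0 i).
      by rewrite dif_coord eqxx mulr1.
    by apply/funext => z; rewrite row_mxEl.
  rewrite (_ : (fun _ => _) = fun z : 'rV_2 => z 0 k).
    by rewrite dif_coord eq_sym (negbTE ki) mulr0.
  by apply/funext => z; rewrite row_mxEl.
apply: eq_bigr => b _; congr (_ * dif _ _ _); apply/funext => z.
by rewrite row_mxEr.
Qed.

(** The first-order formula holds at all points near [w] and is differentiated once more. The last
    sum is grouped so that second derivatives of [u] appear only with the factor
    [dif (dv b) h z]. *)
Lemma dif2_graph (h : Z -> R) (u : 'rV[R]_2 -> 'rV[R]_m) w i j :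
  smooth_at w u -> smooth_at (row_mx w (u w)) h ->
  let z := row_mx w (u w) in let u_ k b := dif k (fun w => u w 0 b) w in
  dif j (dif i (fun w => h (row_mx w (u w)))) w =
  dif (tx j) (dif (tx i) h) z + \sum_b dif (dv b) (dif (tx i) h) z * u_ j b
  + \sum_b ((dif (tx j) (dif (dv b) h) z
             + \sum_c dif (dv c) (dif (dv b) h) z * u_ j c) * u_ i b
            + dif (dv b) h z * dif j (dif i (fun w => u w 0 b)) w).
Proof.
move=> su sh z u_; have sub b : smooth_at w (fun w => u w 0 b) by move/smooth_rowP: su.
have nE : \forall w' \near w, dif i (fun w => h (row_mx w (u w))) w'
   = dif (tx i) h (row_mx w' (u w'))
     + \sum_b dif (dv b) h (row_mx w' (u w')) * dif i (fun w => u w 0 b) w'.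
  near=> w'; apply: dif_graph; first by near: w'; exact: smooth_near_row.
  near: w'; apply: (@near_comp _ _ (fun w => row_mx w (u w)) w (fun z => smooth_at z h)).
    by move=> a; exact: smooth_graph.
  exact: smooth_near.
have s1 k : smooth_at w (fun w => dif k h (row_mx w (u w))).
  by apply: smooth_on_graph => //; exact: smooth_dif.
have s2 b : smooth_at w (fun w => dif (dv b) h (row_mx w (u w)) * dif i (fun w => u w 0 b) w).
  by apply: smoothM => //; exact: smooth_dif.
rewrite (dif_near _ nE) difD //; last exact: smooth_sum.
rewrite dif_graph //; last exact: smooth_dif.
congr (_ + _); rewrite dif_sum //; apply: eq_bigr => b _.
rewrite difM //; last exact: smooth_dif.
by rewrite dif_graph //; exact: smooth_dif.
Unshelve. all: by end_near. Qed.

(** Balls are taken entrywise, so moving the fibre coordinates towards those of [p] while keeping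
    the base point of [z] does not leave them. *)
Lemma near_ball_fiber (p : Z) (r : R) z (s : R) : ball p r z -> 0 <= s <= 1 ->
  ball p r (row_mx (base z) (dep p) + s *: row_mx 0 (dep z - dep p)).
Proof.
move=> [r0 pz] /andP[s0 s1]; split=> // i j; have := pz i j; rewrite !ord1 -(splitK j).
case: (fintype.split j) => k /=.
  by rewrite scale_row_mx add_row_mx row_mxEl scaler0 addr0 baseE.
rewrite scale_row_mx add_row_mx row_mxEr !mxE /ball /= => pzr.
set a := p 0 _ in pzr *; set b := z 0 _ in pzr *.
rewrite (_ : a - _ = s * (a - b)); last by ring.
by rewrite normrM ger0_norm // (le_lt_trans _ pzr) // ler_piMl.
Qed.

(** Mean value theorem on the vertical segment that ends at [z]: its direction has no base
    component, so the derivative along it is a combination of the vanishing fibre derivatives. *)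
Lemma fiber_const (h : Z -> R) (p : Z) : smooth_at p h ->
  (\forall z \near p, forall b, dif (dv b) h z = 0) ->
  \forall z \near p, h z = h (row_mx (base z) (dep p)).
Proof.
move=> sh dh; have : \forall z \near p, smooth_at z h /\ forall b, dif (dv b) h z = 0.
  by near=> z; split; near: z => //; exact: smooth_near.
move=> /nbhs_ballP[r /= r0 rP]; apply/nbhs_ballP; exists r => //= z pz.
set q := row_mx _ _; set v : Z := row_mx 0 (dep z - dep p).
have [s sh1|c ch] := @line_mvt R (fun s => h (q + s *: v)) (fun s => 'D_v h (q + s *: v)) 1 ltr01.
  apply: is_derive_line; apply: smooth_diff.
  by have [] := rP _ (near_ball_fiber pz sh1).
have [sc dc] := rP _ (near_ball_fiber pz ch).
rewrite derive_dif; last exact: smooth_diff.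
rewrite big_split_ord /= !big1 => [|b _|k _]; last 2 first.
- by rewrite -/(dv b) dc mulr0.
- by rewrite /v row_mxEl mxE mul0r.
rewrite addr0 mul0r scale0r addr0 scale1r => /eqP; rewrite subr_eq0 => /eqP <-.
congr h; rewrite /q /v add_row_mx addr0 addrC subrK.
by rewrite row_base_dep.
Unshelve. all: by end_near. Qed.

(** [fiber_const] is used twice: for the slopes, which therefore depend on the base point only, and
    for what remains of [h] after the linear part is subtracted. Both are read off on the section
    with fibre value [dep p]. *)
Lemma fiber_affine (h : Z -> R) (p : Z) : smooth_at p h ->
  (\forall z \near p, forall b c, dif (dv c) (dif (dv b) h) z = 0) ->
  let M b w := dif (dv b) h (row_mx w (dep p)) in
  let N w := h (row_mx w (dep p)) - \sum_b M b w * dep p 0 b in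
  \forall z \near p, h z = \sum_b M b (base z) * dep z 0 b + N (base z).
Proof.
move=> sh ddh M N.
have Mc : \forall z \near p, forall b, dif (dv b) h z = M b (base z).
  apply: near_all => b; apply: fiber_const; first exact: smooth_dif.
  by apply: filterS ddh => z; exact.
have sM b : smooth_at p (fun z => M b (base z)).
  apply: smooth_eq (smooth_dif (dv b) sh).
  by apply: filterS Mc => z ->.
have sz c : smooth_at p (fun z : Z => z 0 c) by exact: smooth_coord.
have sk : smooth_at p (fun z => h z - \sum_b M b (base z) * dep z 0 b).
  apply: smoothB => //; apply: smooth_sum => b; apply: smoothM => //.
  by under eq_fun do rewrite depE.
have : \forall z \near p, h z - \sum_b M b (base z) * dep z 0 b =
   h (row_mx (base z) (dep p)) - \sum_b M b (base (row_mx (base z) (dep p))) *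
     dep (row_mx (base z) (dep p)) 0 b.
  apply: (@fiber_const (fun z => h z - \sum_b M b (base z) * dep z 0 b)) => //.
  have : \forall z \near p, [/\ smooth_at z h,
      forall b, smooth_at z (fun z => M b (base z)),
      forall b c, dif (dv c) (dif (dv b) h) z = 0
      & \forall y \near z, forall b, dif (dv b) h y = M b (base y)].
    have n1 := smooth_near sh; have n2 := near_all (fun b => smooth_near (sM b)).
    have n3 := near_join Mc.
    by near=> z; split; near: z.
  apply: filterS => z [szh szz ddz nMz] c.
  have MM b : dif (dv c) (fun z0 => M b (base z0)) z = 0.
    by rewrite -(ddz b c); apply: dif_near; apply: filterS nMz => y ->.
  have sz' b : smooth_at z (fun z : Z => dep z 0 b).
    by under eq_fun do rewrite depE; exact: smooth_coord.
  rewrite difB //; last by apply: smooth_sum => b; exact: smoothM.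
  rewrite dif_sum; last by move=> b; exact: smoothM.
  rewrite (nbhs_singleton nMz) (bigD1 c) //= big1 => [|b bc].
    rewrite difM // MM; under [X in _ * dif _ X _]eq_fun do rewrite depE.
    by rewrite dif_coord eqxx mul0r add0r addr0 mulr1 subrr.
  rewrite difM // MM; under [X in _ * dif _ X _]eq_fun do rewrite depE.
  by rewrite dif_coord /dv eq_rshift eq_sym (negbTE bc) mul0r mulr0 addr0.
apply: filterS => z E; rewrite -[LHS](subrK (\sum_b M b (base z) * dep z 0 b)) E addrC.
by rewrite base_row dep_row.
Unshelve. all: by end_near. Qed.

End Fibers.
End GraphsAndFibers.

(** * Second-order jets *)

Section Jets.
Context {R : realType}.

Lemma ord2P (P : 'I_2 -> Prop) : P it -> P ix -> forall i, P i.
Proof.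
move=> Pt Px i; have [->//|->//] : i = it \/ i = ix.
by case: i => -[|[|//]] Hi; [left|right]; exact: val_inj.
Qed.

Lemma sum2E (F : 'I_2 -> R) : \sum_k F k = F it + F ix.
Proof.
rewrite big_ord_recl big_ord_recl big_ord0 addr0; congr (_ + F _).
exact: val_inj.
Qed.

Lemma det2E (M : 'M[R]_2) : \det M = M it it * M ix ix - M it ix * M ix it.
Proof.
rewrite (expand_det_row _ it) sum2E /cofactor !det_mx11 !mxE /=.
have -> : lift it (0 : 'I_1) = ix by exact: val_inj.
have -> : lift ix (0 : 'I_1) = it by exact: val_inj.
by rewrite expr0 mul1r expr1 mulN1r mulrN.
Qed.

(** The inverse of a 2 by 2 matrix by cofactors, with the indices placed so that it solves sum_k c_k
    D_ki = g_i for c. *)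
Definition inv2 (D : 'I_2 -> 'I_2 -> R) (k i : 'I_2) : R :=
  (if k == it then if i == it then D ix ix else - D ix it
   else if i == it then - D it ix else D it it) / (D it it * D ix ix - D ix it * D it ix).

Lemma inv2_solve (D : 'I_2 -> 'I_2 -> R) (g : 'I_2 -> R) i :
  D it it * D ix ix - D ix it * D it ix != 0 ->
  \sum_k (\sum_i' inv2 D k i' * g i') * D k i = g i.
Proof. by move=> d0; rewrite /inv2 !sum2E; move: i; apply: ord2P; rewrite /=; field. Qed.

Lemma dif2_comp n k (f : 'rV[R]_k -> R) (g : 'rV[R]_n -> 'rV[R]_k) p i j :
  smooth_at (g p) f -> (forall a, smooth_at p (fun z => g z 0 a)) ->
  dif j (dif i (fun z => f (g z))) p =
  \sum_a ((\sum_b dif b (dif a f) (g p) * dif j (fun z => g z 0 b) p)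
            * dif i (fun z => g z 0 a) p
          + dif a f (g p) * dif j (dif i (fun z => g z 0 a)) p).
Proof.
move=> sf sg; have nE : \forall z \near p, dif i (fun z => f (g z)) z
    = \sum_a dif a f (g z) * dif i (fun z => g z 0 a) z.
  have n1 : \forall z \near p, smooth_at (g z) f.
    by apply: (@near_comp _ _ _ g p (fun y => smooth_at y f)) => //; exact: smooth_near.
  have n2 := near_all (fun a => smooth_near (sg a)).
  by apply: filterS2 n1 n2 => z sfz sgz; exact: dif_comp.
have s1 a : smooth_at p (fun z => dif a f (g z)).
  by apply: smooth_comp => //; exact: smooth_dif.
have s2 a : smooth_at p (dif i (fun z => g z 0 a)) by exact: smooth_dif.
rewrite (dif_near _ nE) dif_sum; last by move=> a; exact: smoothM.
apply: eq_bigr => a _; rewrite difM // dif_comp //; exact: smooth_dif.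
Qed.

(** A Taylor polynomial with prescribed second-order jet at [w0]. Of the mixed coefficients only
    [s it ix] enters, so it realizes [s] when [s] is symmetric. *)
Definition quad (w0 : 'rV[R]_2) (c : R) (a : 'I_2 -> R) (s : 'I_2 -> 'I_2 -> R)
    (w : 'rV[R]_2) : R :=
  let dt := w 0 it - w0 0 it in let dx := w 0 ix - w0 0 ix in
  c + (a it * dt + a ix * dx)
  + ((s it it / 2) * (dt * dt) + s it ix * (dt * dx) + (s ix ix / 2) * (dx * dx)).

Ltac smooth_tac := repeat first
  [ assumption
  | apply: smooth_coord | apply: smooth_cst | apply: smooth_dif
  | apply: smoothD | apply: smoothN | apply: smoothM | apply: smooth_sum => ? ].

Lemma smooth_quad w0 c a s p : smooth_at p (quad w0 c a s).
Proof. by rewrite /quad /=; smooth_tac. Qed.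

Lemma quad0 w0 c a s : quad w0 c a s w0 = c.
Proof. by rewrite /quad /= !subrr; ring. Qed.

Lemma dif_quad w0 c a s i : dif i (quad w0 c a s) = fun w =>
  let dt := w 0 it - w0 0 it in let dx := w 0 ix - w0 0 ix in
  let et := (i == it)%:R in let ex := (i == ix)%:R in
  a it * et + a ix * ex + (s it it * dt * et + s it ix * (et * dx + dt * ex) + s ix ix * dx * ex).
Proof.
apply/funext => p; rewrite {1}/quad /=.
have sx k : smooth_at p (fun w : 'rV[R]_2 => w 0 k - w0 0 k) by smooth_tac.
have dx k : dif i (fun w : 'rV[R]_2 => w 0 k - w0 0 k) p = (i == k)%:R.
  by rewrite difD ?dif_coord ?dif_cst ?addr0 //; smooth_tac.
by rewrite !(dx, difD, difM, dif_cst); try (smooth_tac; exact: sx); field.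
Qed.

Lemma dif2_quad w0 c a s i j p : s it ix = s ix it ->
  dif j (dif i (quad w0 c a s)) p = s i j.
Proof.
move=> sC; rewrite dif_quad /=.
have sx k : smooth_at p (fun w : 'rV[R]_2 => w 0 k - w0 0 k) by smooth_tac.
have dx k : dif j (fun w : 'rV[R]_2 => w 0 k - w0 0 k) p = (j == k)%:R.
  by rewrite difD ?dif_coord ?dif_cst ?addr0 //; smooth_tac.
rewrite !(dx, difD, difM, dif_cst); try (smooth_tac; exact: sx).
by move: i j {dx}; do 2!apply: ord2P; rewrite /= ?sC; ring.
Qed.

Section PreservationOnJets.
Context {m : nat}.
Notation Z := 'rV[R]_(2 + m).

Definition qrow (w0 : 'rV[R]_2) (c : 'rV[R]_m) (a : 'I_2 -> 'I_m -> R)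
    (s : 'I_2 -> 'I_2 -> 'I_m -> R) (w : 'rV[R]_2) : 'rV[R]_m :=
  \row_l quad w0 (c 0 l) (a^~ l) (fun i j => s i j l) w.

Lemma qrowE w0 c a s l :
  (fun w => qrow w0 c a s w 0 l) = quad w0 (c 0 l) (a^~ l) (fun i j => s i j l).
Proof. by apply/funext => w; rewrite mxE. Qed.

Lemma smooth_qrow w0 c a s p : smooth_at p (qrow w0 c a s).
Proof. by apply/smooth_rowP => l; rewrite qrowE; exact: smooth_quad. Qed.

Lemma qrow0 w0 c a s : qrow w0 c a s w0 = c.
Proof. by apply/rowP => l; rewrite mxE quad0. Qed.

Lemma dif_qrow w0 c a s l i : dif i (fun w => qrow w0 c a s w 0 l) w0 = a i l.
Proof.
rewrite qrowE dif_quad !subrr.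
by move: i; apply: ord2P; rewrite /=; ring.
Qed.

Lemma dif2_qrow w0 c a s l i j : s it ix =1 s ix it ->
  dif j (dif i (fun w => qrow w0 c a s w 0 l)) w0 = s i j l.
Proof. by move=> sC; rewrite qrowE dif2_quad. Qed.

(* Total derivatives of h along a graph with first derivatives a, the part of
   the second total derivative free of second derivatives being td2. *)
Definition td (h : Z -> R) z (a : 'I_2 -> 'I_m -> R) i : R :=
  dif (tx i) h z + \sum_b dif (dv b) h z * a i b.
Definition td2 (h : Z -> R) z (a : 'I_2 -> 'I_m -> R) i j : R :=
  dif (tx j) (dif (tx i) h) z + \sum_b dif (dv b) (dif (tx i) h) z * a j b
  + \sum_b (dif (tx j) (dif (dv b) h) z
            + \sum_c dif (dv c) (dif (dv b) h) z * a j c) * a i b.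

Lemma td2_sym h z a i j : smooth_at z h -> td2 h z a i j = td2 h z a j i.
Proof.
move=> sh; rewrite /td2 (dif_swap (tx i) (tx j) sh) -!addrA; congr (_ + _).
under [X in X + _]eq_bigr do rewrite (dif_swap _ _ sh).
under [X in _ = X + _]eq_bigr do rewrite (dif_swap _ _ sh).
under [X in _ + X]eq_bigr do rewrite mulrDl.
under [X in _ = _ + X]eq_bigr do rewrite mulrDl.
rewrite !big_split /= addrCA; congr (_ + (_ + _)).
under eq_bigr do rewrite mulr_suml; rewrite exchange_big /=.
apply: eq_bigr => b _; rewrite mulr_suml; apply: eq_bigr => c _.
by rewrite (dif_swap _ _ sh) mulrAC.
Qed.

Definition evol (A : 'rV[R]_2 -> R) (H0 : 'I_m -> 'rV[R]_2 -> 'rV[R]_m -> R)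
    (H1 : 'I_m -> 'I_m -> 'rV[R]_2 -> 'rV[R]_m -> R) : system R m m :=
  fun l J => jt1 J it 0 l - A (jt_base J) * jt2 J ix ix 0 l
    + H0 l (jt_base J) (jt0 J)
    + \sum_c H1 l c (jt_base J) (jt0 J) * jt1 J ix 0 c.

(* r is the second-order part and c the first-order part of the jet to which
   the prolongation of f maps the jet (a, s) over z. *)
Definition jet_image (f : Z -> Z) z a s (c : 'I_2 -> 'I_m -> R)
    (r : 'I_2 -> 'I_2 -> 'I_m -> R) : Prop :=
  let D k := td (fun z => f z 0 k) z a in
  let D2 k i j := td2 (fun z => f z 0 k) z a i j
    + \sum_b dif (dv b) (fun z => f z 0 k) z * s i j b in
  [/\ D (tx it) it * D (tx ix) ix - D (tx ix) it * D (tx it) ix != 0,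
      forall i l, D (dv l) i = \sum_k c k l * D (tx k) i
    & forall i j l, D2 (dv l) i j = \sum_k ((\sum_k' r k k' l * D (tx k') j)
         * D (tx k) i + c k l * D2 (tx k) i j)].

Definition evol_jet (A : 'rV[R]_2 -> R) (H0 : 'I_m -> 'rV[R]_2 -> 'rV[R]_m -> R)
    (H1 : 'I_m -> 'I_m -> 'rV[R]_2 -> 'rV[R]_m -> R) (z : Z)
    (a : 'I_2 -> 'I_m -> R) (s : 'I_2 -> 'I_2 -> 'I_m -> R) l : R :=
  a it l - A (base z) * s ix ix l + H0 l (base z) (dep z)
  + \sum_c H1 l c (base z) (dep z) * a ix c.

Lemma j2_coordP (F G : 'rV[R]_2 -> 'rV[R]_m) w : smooth_at w F -> smooth_at w G ->
  j2 F w = j2 G w <->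
  [/\ F w = G w,
      forall i l, dif i (fun w => F w 0 l) w = dif i (fun w => G w 0 l) w
    & forall i j l, dif j (dif i (fun w => F w 0 l)) w
                    = dif j (dif i (fun w => G w 0 l)) w].
Proof.
move=> sF sG; split=> [E|[E0 E1 E2]].
  split; [exact: (congr1 (@jt0 R m) E)|move=> i l|move=> i j l].
    rewrite -(pd_coord i l sF) -(pd_coord i l sG).
    exact: (congr1 (fun J => jt1 J i 0 l) E).
  rewrite -(pd2_coord i j l sF) -(pd2_coord i j l sG).
  exact: (congr1 (fun J => jt2 J i j 0 l) E).
have JetE a b b' (c c' : 'I_2 -> 'rV[R]_m) d d' :
  b = b' -> c = c' -> d = d' -> Jet a b c d = Jet a b' c' d' by move=> -> -> ->.
apply: JetE; [exact: E0|apply/funext => i; apply/rowP => l|].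
  exact: (etrans (pd_coord i l sF) (etrans (E1 i l) (esym (pd_coord i l sG)))).
apply/funext => i; apply/funext => j; apply/rowP => l.
exact: (etrans (pd2_coord i j l sF) (etrans (E2 i j l) (esym (pd2_coord i j l sG)))).
Qed.

Lemma evol_j2 A H0 H1 (u : 'rV[R]_2 -> 'rV[R]_m) w l : smooth_at w u ->
  evol A H0 H1 l (j2 u w) = evol_jet A H0 H1 (row_mx w (u w))
    (fun i l => dif i (fun w => u w 0 l) w)
    (fun i j l => dif j (dif i (fun w => u w 0 l)) w) l.
Proof.
move=> su; rewrite /evol_jet base_row dep_row -(pd_coord it l su) -(pd2_coord ix ix l su).
by under [X in _ = _ + X]eq_bigr do rewrite -(pd_coord ix _ su).
Qed.

Lemma satisfies_evol A H0 H1 (u : 'rV[R]_2 -> 'rV[R]_m) w z a s : smooth_at w u ->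
  row_mx w (u w) = z -> (forall i l, dif i (fun w => u w 0 l) w = a i l) ->
  (forall i j l, dif j (dif i (fun w => u w 0 l)) w = s i j l) ->
  satisfies (evol A H0 H1) (j2 u w) <-> forall l, evol_jet A H0 H1 z a s l = 0.
Proof.
move=> su <- aE sE; have E l : evol A H0 H1 l (j2 u w)
    = evol_jet A H0 H1 (row_mx w (u w)) a s l.
  rewrite (evol_j2 A H0 H1 l su) /evol_jet aE sE; congr (_ + _).
  by apply: eq_bigr => c _; rewrite aE.
by split=> H l; [exact: (etrans (esym (E l)) (H l))|exact: (etrans (E l) (H l))].
Qed.

(** Contact of order 2 is the chain rule written out to second order, so the prolongation depends on
    [u] and [v] only through their jets. *)
Lemma prolongs_toP (f : Z -> Z) u v w : smooth_at w u ->
  smooth_at (row_mx w (u w)) f -> smooth_at (base (f (row_mx w (u w)))) v ->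
  prolongs_to f u v w <-> v (base (f (row_mx w (u w)))) = dep (f (row_mx w (u w))) /\
  jet_image f (row_mx w (u w)) (fun i l => dif i (fun w => u w 0 l) w)
    (fun i j l => dif j (dif i (fun w => u w 0 l)) w)
    (fun k l => dif k (fun y => v y 0 l) (base (f (row_mx w (u w)))))
    (fun k k' l => dif k' (dif k (fun y => v y 0 l)) (base (f (row_mx w (u w))))).
Proof.
move=> su sf sv; set z := row_mx w (u w) in sf sv *; set y := base (f z) in sv *.
pose F w' := f (row_mx w' (u w')).
have sfc k : smooth_at z (fun z => f z 0 k) by move/smooth_rowP: sf.
have sF k : smooth_at w (fun w => F w 0 k) by exact: (smooth_on_graph su (sfc k)).
have DE k i : td (fun z => f z 0 k) z (fun i l => dif i (fun w => u w 0 l) w) i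
    = dif i (fun w => F w 0 k) w.
  by rewrite (dif_graph i su (sfc k)).
have D2E k i j : td2 (fun z => f z 0 k) z (fun i l => dif i (fun w => u w 0 l) w) i j
    + \sum_b dif (dv b) (fun z => f z 0 k) z * dif j (dif i (fun w => u w 0 b)) w
    = dif j (dif i (fun w => F w 0 k)) w.
  by rewrite (dif2_graph i j su (sfc k)) /td2 big_split /= addrA.
have bE k : (fun w => (base \o F) w 0 k) = fun w => F w 0 (tx k).
  by apply/funext => w'; rewrite /= baseE.
have gE k : (fun w => (dep \o F) w 0 k) = fun w => F w 0 (dv k).
  by apply/funext => w'; rewrite /= depE.
have sb : smooth_at w (base \o F) by apply/smooth_rowP => k; rewrite bE.
have sg : smooth_at w (dep \o F) by apply/smooth_rowP => k; rewrite gE.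
have svc l : smooth_at y (fun y => v y 0 l) by move/smooth_rowP: sv.
have sbc k : smooth_at w (fun w => (base \o F) w 0 k) by rewrite bE.
have svb : smooth_at w (v \o (base \o F)).
  apply/smooth_rowP => l.
  exact: (@smooth_comp _ _ _ _ (fun y => v y 0 l) (base \o F)).
have vE l i : dif i (fun w => (v \o (base \o F)) w 0 l) w
    = \sum_k dif k (fun y => v y 0 l) y * dif i (fun w => F w 0 (tx k)) w.
  rewrite (@dif_comp _ _ _ _ _ (fun y => v y 0 l) (base \o F)) //.
  by apply: eq_bigr => k _; rewrite bE.
have v2E l i j : dif j (dif i (fun w => (v \o (base \o F)) w 0 l)) w
    = \sum_k ((\sum_k' dif k' (dif k (fun y => v y 0 l)) y
                * dif j (fun w => F w 0 (tx k')) w) * dif i (fun w => F w 0 (tx k)) w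
       + dif k (fun y => v y 0 l) y * dif j (dif i (fun w => F w 0 (tx k))) w).
  rewrite (@dif2_comp _ _ (fun y => v y 0 l) (base \o F)) //.
  apply: eq_bigr => k _; rewrite bE; congr (_ * _ + _).
  by apply: eq_bigr => k' _; rewrite bE.
have det : \det ('J (base \o F) w) =
   dif it (fun w => F w 0 (tx it)) w * dif ix (fun w => F w 0 (tx ix)) w
   - dif it (fun w => F w 0 (tx ix)) w * dif ix (fun w => F w 0 (tx it)) w.
  by rewrite det2E !(jacobianE _ _ sb) !bE.
rewrite /prolongs_to -/F det /jet_image !DE; split.
  move=> [d0 Ej]; split; first exact: (esym (congr1 (@jt0 R m) Ej)).
  split; [exact: d0|move=> i l|move=> i j l].
    have := (j2_coordP sg svb).1 Ej; case=> _ /(_ i l) + _.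
    by rewrite gE vE DE => ->; apply: eq_bigr => k _; rewrite DE.
  have := (j2_coordP sg svb).1 Ej; case=> _ _ /(_ i j l).
  rewrite gE v2E D2E => ->; apply: eq_bigr => k _.
  rewrite DE D2E; congr (_ * _ + _).
  by apply: eq_bigr => k' _; rewrite DE.
move=> [E0 [d0 E1 E2]]; split; first exact: d0.
apply/(j2_coordP sg svb); split; first exact: (esym E0).
  move=> i l; rewrite gE vE -DE E1.
  by apply: eq_bigr => k _; rewrite DE.
move=> i j l; rewrite gE v2E -D2E E2; apply: eq_bigr => k _.
rewrite DE D2E; congr (_ * _ + _).
by apply: eq_bigr => k' _; rewrite DE.
Qed.

(** Every symmetric jet is the jet of some [qrow], which removes the functions [u] and [v]. The
    symmetry conditions on [s] and [r] are the equality of mixed derivatives. *)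
Lemma preserves_jetsP A H0 H1 (f : Z -> Z) z : smooth_at z f ->
  preserves_at (evol A H0 H1) f z <->
  forall a s c r, s it ix =1 s ix it -> r it ix =1 r ix it -> jet_image f z a s c r ->
    ((forall l, evol_jet A H0 H1 z a s l = 0) <->
     (forall l, evol_jet A H0 H1 (f z) c r l = 0)).
Proof.
move=> sf; split=> [pf a s c r sC rC im|pf u v su sv uz].
  pose u := qrow (base z) (dep z) a s; pose v := qrow (base (f z)) (dep (f z)) c r.
  have uz : u (base z) = dep z by exact: qrow0.
  have zE : row_mx (base z) (u (base z)) = z by rewrite uz row_base_dep.
  have vz : v (base (f z)) = dep (f z) by exact: qrow0.
  have fzE : row_mx (base (f z)) (v (base (f z))) = f z by rewrite vz row_base_dep.
  have aE i l : dif i (fun w => u w 0 l) (base z) = a i l by rewrite dif_qrow.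
  have sE i j l : dif j (dif i (fun w => u w 0 l)) (base z) = s i j l by rewrite dif2_qrow.
  have cE i l : dif i (fun w => v w 0 l) (base (f z)) = c i l by rewrite dif_qrow.
  have rE i j l : dif j (dif i (fun w => v w 0 l)) (base (f z)) = r i j l.
    by rewrite dif2_qrow.
  have su : smooth_at (base z) u by exact: smooth_qrow.
  have sv : smooth_at (base (f z)) v by exact: smooth_qrow.
  apply: iff_trans (iff_sym (satisfies_evol A H0 H1 su zE aE sE)) _.
  apply: iff_trans (satisfies_evol A H0 H1 sv fzE cE rE).
  apply: (pf u v su sv uz); apply/(prolongs_toP su); rewrite zE //.
  split; first exact: vz.
  have -> : (fun i l => dif i (fun w => u w 0 l) (base z)) = a.
    by apply/funext => i; apply/funext => l.
  have -> : (fun i j l => dif j (dif i (fun w => u w 0 l)) (base z)) = s.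
    by do 3!apply/funext => ?.
  have -> : (fun i l => dif i (fun w => v w 0 l) (base (f z))) = c.
    by apply/funext => i; apply/funext => l.
  have -> : (fun i j l => dif j (dif i (fun w => v w 0 l)) (base (f z))) = r.
    by do 3!apply/funext => ?.
  exact: im.
have zE : row_mx (base z) (u (base z)) = z by rewrite uz row_base_dep.
have sfz : smooth_at (row_mx (base z) (u (base z))) f by rewrite zE.
have svz : smooth_at (base (f (row_mx (base z) (u (base z))))) v by rewrite zE.
move=> /(prolongs_toP su sfz svz); rewrite zE => -[vz im].
have fzE : row_mx (base (f z)) (v (base (f z))) = f z by rewrite vz row_base_dep.
apply: iff_trans (satisfies_evol A H0 H1 su zE (fun _ _ => erefl) (fun _ _ _ => erefl)) _.
apply: iff_trans (iff_sym (satisfies_evol A H0 H1 sv fzE (fun _ _ => erefl) (fun _ _ _ => erefl))).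
have suC : (fun l => dif ix (dif it (fun w => u w 0 l)) (base z))
    =1 (fun l => dif it (dif ix (fun w => u w 0 l)) (base z)).
  by move=> l; apply: dif_swap; move/smooth_rowP: su; apply.
have svC : (fun l => dif ix (dif it (fun w => v w 0 l)) (base (f z)))
    =1 (fun l => dif it (dif ix (fun w => v w 0 l)) (base (f z))).
  by move=> l; apply: dif_swap; move/smooth_rowP: sv; apply.
exact: (pf _ _ _ _ suC svC im).
Qed.

(** With [P] the inverse of the total Jacobian, [c] is [P] applied to the total derivatives of the
    dependent components, and [r] is [P] applied on both indices to the second total derivatives
    from which the contribution of [c] has been subtracted. That difference is symmetric, hence so
    is [r]. *)
Lemma jet_image_exists (f : Z -> Z) z a s : smooth_at z f -> s it ix =1 s ix it ->
  let D k := td (fun z => f z 0 k) z a in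
  D (tx it) it * D (tx ix) ix - D (tx ix) it * D (tx it) ix != 0 ->
  exists c r, r it ix =1 r ix it /\ jet_image f z a s c r.
Proof.
move=> sf sC D d0.
pose D2 k i j := td2 (fun z => f z 0 k) z a i j
    + \sum_b dif (dv b) (fun z => f z 0 k) z * s i j b.
have D2C k : D2 k it ix = D2 k ix it.
  rewrite /D2 td2_sym; last by move/smooth_rowP: sf.
  by congr (_ + _); apply: eq_bigr => b _; rewrite sC.
pose P := inv2 (fun k => D (tx k)).
pose c k l := \sum_i P k i * D (dv l) i.
pose Q l i j := D2 (dv l) i j - \sum_n c n l * D2 (tx n) i j.
pose r k k' l := \sum_i P k i * \sum_j P k' j * Q l i j.
exists c, r; split.
  have QC l : Q l it ix = Q l ix it by rewrite /Q !sum2E !D2C.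
  by move=> l; rewrite /r !sum2E !QC; ring.
split; first exact: d0.
  by move=> i l; exact: (esym (inv2_solve (D (dv l)) i d0)).
move=> i j l; rewrite -[LHS]/(D2 (dv l) i j) -[RHS]/(\sum_k
  ((\sum_k' r k k' l * D (tx k') j) * D (tx k) i + c k l * D2 (tx k) i j)).
rewrite big_split /=.
suff -> : \sum_k (\sum_k' r k k' l * D (tx k') j) * D (tx k) i = Q l i j by rewrite subrK.
have := @inv2_solve (fun k => D (tx k)) (fun i => Q l i j) i d0 => {1}<-; apply: eq_bigr => k _.
congr (_ * _); rewrite /r -/P.
under eq_bigr do rewrite mulr_suml.
rewrite exchange_big /=; apply: eq_bigr => i' _.
under eq_bigr do rewrite -mulrA; rewrite -mulr_sumr; congr (_ * _).
exact: (@inv2_solve (fun k => D (tx k)) (Q l i') j d0).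
Qed.

End PreservationOnJets.
End Jets.

(** * Point symmetries of evolution systems *)

Section PointSymmetryEquations.
Context {R : realType} {m : nat}.
Notation Z := 'rV[R]_(2 + m).

Lemma sum_delta n (F : 'I_n -> R) b0 : \sum_b F b * (b == b0)%:R = F b0.
Proof.
rewrite (bigD1 b0) //= eqxx mulr1 big1 ?addr0 // => b /negbTE ->.
by rewrite mulr0.
Qed.

Lemma sum_split (F : 'I_(2 + m) -> R) :
  \sum_k F k = F (tx it) + F (tx ix) + \sum_b F (dv b).
Proof. by rewrite big_split_ord /= sum2E. Qed.

Lemma idxP (P : 'I_(2 + m) -> Prop) :
  P (tx it) -> P (tx ix) -> (forall b, P (dv b)) -> forall k, P k.
Proof.
move=> Pt Px Pd k; rewrite -(splitK k); case: (fintype.split k) => j /=; last exact: Pd.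
by move: j; exact: ord2P.
Qed.

Lemma sum_deltaM n (F : 'I_n -> R) e b0 : \sum_b F b * (e * (b == b0)%:R) = e * F b0.
Proof. by rewrite -(sum_delta F b0) mulr_sumr; apply: eq_bigr => b _; rewrite mulrCA. Qed.

Lemma sum_deltaD n (F g : 'I_n -> R) e b0 :
  \sum_b F b * (g b + e * (b == b0)%:R) = \sum_b F b * g b + e * F b0.
Proof. by rewrite -sum_deltaM -big_split /=; apply: eq_bigr => b _; rewrite mulrDr. Qed.

(** Comparison of coefficients by evaluation: plus and minus a basis vector separate odd from even
    degree, and the sum of two basis vectors gives the off-diagonal entries by polarization, which
    needs the symmetry of [d]. *)
Lemma quadratic_eq0 (Ah r0 : R) (r1 : 'I_m -> R) (d : 'I_m -> 'I_m -> R) :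
  Ah != 0 -> (forall b c, d b c = d c b) ->
  (forall p, r0 + \sum_c r1 c * p c = Ah * \sum_b (\sum_c d b c * p c) * p b) ->
  [/\ r0 = 0, forall c, r1 c = 0 & forall b c, d b c = 0].
Proof.
move=> Ah0 dC key; have z0 : r0 = 0.
  have := key (fun=> 0); rewrite big1 => [|c _]; last by rewrite mulr0.
  by rewrite big1 => [|c _]; rewrite mulr0 // addr0.
pose q e b e' b' (c : 'I_m) : R := e * (c == b)%:R + e' * (c == b')%:R.
have key2 e b e' b' : e * r1 b + e' * r1 b' = Ah *
   (e ^+ 2 * d b b + e ^+ 1 * e' * (d b b' + d b' b) + e' ^+ 2 * d b' b').
  have := key (q e b e' b'); rewrite z0 add0r /q.
  under eq_bigr do rewrite mulrDr.
  rewrite big_split /= !sum_deltaM => ->; congr (_ * _).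
  under eq_bigr => b1 _ do under eq_bigr do rewrite mulrDr.
  under eq_bigr => b1 _ do rewrite big_split /= !sum_deltaM mulrDr.
  rewrite big_split /= !(sum_deltaM (fun b1 => _ + _)); ring.
have d0 b : d b b = 0.
  apply: (mulfI Ah0); rewrite mulr0; have := key2 1 b 0 b; have := key2 (-1) b 0 b.
  by rewrite expr0n /=; lra.
have r10 b : r1 b = 0 by have := key2 1 b 0 b; rewrite d0 expr0n /=; lra.
split=> // b c; apply: (mulfI Ah0); rewrite mulr0.
by have := key2 1 b 1 c; rewrite !r10 !d0 (dC c b); lra.
Qed.

Definition jet1 (at_ ax : 'I_m -> R) (i : 'I_2) : 'I_m -> R := if i == it then at_ else ax.
Definition jet2 (stt stx sxx : 'I_m -> R) (i j : 'I_2) : 'I_m -> R :=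
  if i == it then if j == it then stt else stx else if j == it then stx else sxx.

Variables (f : Z -> Z) (z : Z).
Notation "'d_[ k ] l" := (dif k (fun z : Z => f z 0 l) z)
  (at level 10, k at level 200, l at level 9).
Notation "'d2_[ k , k' ] l" := (dif k' (dif k (fun z : Z => f z 0 l)) z)
  (at level 10, k at level 200, k' at level 200, l at level 9).
Notation "'D[ a , i ] l" := (td (fun z : Z => f z 0 l) z a i)
  (at level 10, a at level 200, i at level 200, l at level 9).
Notation T := (@tx m it).
Notation X := (@tx m ix).

Hypothesis sf : smooth_at z f.
Hypothesis Jf : \det ('J f z) != 0.

Lemma jac_ker_col (c : 'I_(2 + m) -> R) :
  (forall k, \sum_l 'd_[k] l * c l = 0) -> forall l, c l = 0.
Proof.
move=> H; have JU : 'J f z \in unitmx by rewrite unitmxE unitfE.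
have E : 'J f z *m (\col_l c l) = 0.
  apply/colP => k; rewrite !mxE -[RHS](H k); apply: eq_bigr => l _.
  by rewrite jacobianE // mxE.
by move=> l; have /colP/(_ l) := mulKmx JU (\col_l c l); rewrite E mulmx0 !mxE.
Qed.

Lemma jac_ker_row (c : 'I_(2 + m) -> R) :
  (forall l, \sum_k c k * 'd_[k] l = 0) -> forall k, c k = 0.
Proof.
move=> H; have JU : 'J f z \in unitmx by rewrite unitmxE unitfE.
have E : (\row_k c k) *m 'J f z = 0.
  apply/rowP => l; rewrite !mxE -[RHS](H l); apply: eq_bigr => k _.
  by rewrite jacobianE // mxE.
by move=> l; have /rowP/(_ l) := mulmxK JU (\row_k c k); rewrite E mul0mx !mxE.
Qed.

Definition graph_det a := 'D[a, it] T * 'D[a, ix] X - 'D[a, it] X * 'D[a, ix] T.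

Lemma td_jet1t h at_ ax : td h z (jet1 at_ ax) it
  = dif (tx it) h z + \sum_b dif (dv b) h z * at_ b.
Proof. by []. Qed.
Lemma td_jet1x h at_ ax : td h z (jet1 at_ ax) ix
  = dif (tx ix) h z + \sum_b dif (dv b) h z * ax b.
Proof. by []. Qed.

(** If every first-order jet were degenerate, evaluating at zero and at unit jets would kill all 2
    by 2 minors of the columns of T and X in the Jacobian of [f], contradicting its
    invertibility. *)
Lemma graph_det_exists : exists a, graph_det a != 0.
Proof.
apply/not_existsP => H.
have {}H a : graph_det a = 0 by have /negP := H a; rewrite negbK => /eqP.
have s0 h : \sum_b dif (dv b) h z * (0 : R) = 0 by under eq_bigr do rewrite mulr0; rewrite big1.
pose e b : 'I_m -> R := fun b' => (b' == b)%:R.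
have m1 : 'd_[tx it] T * 'd_[tx ix] X - 'd_[tx it] X * 'd_[tx ix] T = 0.
  by have := H (jet1 (fun=> 0) (fun=> 0)); rewrite /graph_det !td_jet1t !td_jet1x !s0 !addr0.
have m2 b : 'd_[tx it] T * 'd_[dv b] X - 'd_[tx it] X * 'd_[dv b] T = 0.
  have := H (jet1 (fun=> 0) (e b)).
  rewrite /graph_det !td_jet1t !td_jet1x !s0 !sum_delta !addr0; move: m1; lra.
have m3 b : 'd_[dv b] T * 'd_[tx ix] X - 'd_[dv b] X * 'd_[tx ix] T = 0.
  have := H (jet1 (e b) (fun=> 0)).
  rewrite /graph_det !td_jet1t !td_jet1x !s0 !sum_delta !addr0; move: m1; lra.
have m4 b c : 'd_[dv b] T * 'd_[dv c] X - 'd_[dv b] X * 'd_[dv c] T = 0.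
  have := H (jet1 (e b) (e c)).
  rewrite /graph_det !td_jet1t !td_jet1x !sum_delta; move: m1 (m2 c) (m3 b); lra.
have M k k' : 'd_[k] T * 'd_[k'] X - 'd_[k] X * 'd_[k'] T = 0.
  move: k k'; apply: idxP; [apply: idxP|apply: idxP|move=> b; apply: idxP] => //.
  - by ring.
  - by move: m1; lra.
  - by ring.
  - by move=> c; move: (m3 c); lra.
  - by move: (m2 b); lra.
have [k Tk] : exists k, 'd_[k] T != 0.
  apply/not_existsP => H0; suff E : ((T == T)%:R : R) = 0 by move/eqP: E; rewrite eqxx oner_eq0.
  apply: (@jac_ker_col (fun l => (l == T)%:R)) => k.
  rewrite (@sum_delta _ (fun l => 'd_[k] l)).
  by have /negP := H0 k; rewrite negbK => /eqP.
(* A row [k] in which the T-column is nonzero supplies the coefficients of a linear relation between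
   the columns of T and X. *)
suff : (X == X)%:R * 'd_[k] T - (X == T)%:R * 'd_[k] X = 0.
  by rewrite eqxx mul1r /= mul0r subr0 => /eqP; rewrite (negbTE Tk).
apply: (@jac_ker_col (fun l => (l == X)%:R * 'd_[k] T - (l == T)%:R * 'd_[k] X)) => k'.
have := M k' k; rewrite (eq_bigr (fun l => 'd_[k] T * ('d_[k'] l * (l == X)%:R)
   - 'd_[k] X * ('d_[k'] l * (l == T)%:R))); last by move=> l _; ring.
by rewrite sumrB -!mulr_sumr !(@sum_delta _ (fun l => 'd_[k'] l)); lra.
Qed.

(** The coefficient with which the second derivative [s i j b] enters the second-order relation for
    the component [l] of the image. *)
Definition shear (c : 'I_2 -> 'I_m -> R) l b : R :=
  'd_[dv b] (dv l) - \sum_k c k l * 'd_[dv b] (tx k).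

(** Otherwise the column of the component [l] in the Jacobian would be the combination of the T- and
    X-columns with coefficients [c]: along the fibre this is the vanishing of [shear], and along the
    base it follows by subtracting the fibre part from the first-order relation. *)
Lemma shear_neq0 a c : (forall i l, 'D[a, i] (dv l) = \sum_k c k l * 'D[a, i] (tx k)) ->
  forall l, exists b, shear c l b != 0.
Proof.
move=> ac l; apply/not_existsP => H.
have {}H b : 'd_[dv b] (dv l) = \sum_k c k l * 'd_[dv b] (tx k).
  by have /negP := H b; rewrite negbK subr_eq0 => /eqP.
have Hx i : 'd_[tx i] (dv l) = \sum_k c k l * 'd_[tx i] (tx k).
  have := ac i l; rewrite /td; under eq_bigr do rewrite H mulr_suml.
  rewrite exchange_big /= !sum2E !mulrDr !mulr_sumr => E.
  apply: (addIr (\sum_b c it l * 'd_[dv b] (tx it) * a i b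
                 + \sum_b c ix l * 'd_[dv b] (tx ix) * a i b)).
  rewrite E; under [X in _ = _ + (X + _)]eq_bigr do rewrite -mulrA.
  by under [X in _ = _ + (_ + X)]eq_bigr do rewrite -mulrA; ring.
pose e k : R := (k == dv l)%:R - (k == tx it)%:R * c it l - (k == tx ix)%:R * c ix l.
suff E : e (dv l) = 0 by move/eqP: E; rewrite /e eqxx /= !mul0r !subr0 oner_eq0.
apply: (@jac_ker_col e) => k.
transitivity ('d_[k] (dv l) - c it l * 'd_[k] (tx it) - c ix l * 'd_[k] (tx ix)).
  rewrite (eq_bigr (fun j => 'd_[k] j * (j == dv l)%:R - c it l * ('d_[k] j * (j == tx it)%:R)
    - c ix l * ('d_[k] j * (j == tx ix)%:R))); last by move=> j _; rewrite /e; ring.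
  by rewrite !sumrB -!mulr_sumr !(@sum_delta _ (fun j => 'd_[k] j)).
by move: k; apply: idxP => [||b]; rewrite ?Hx ?H !sum2E; ring.
Qed.

(** Cramer's rule. It matters that [c] depends on [a] only, so varying [s] at fixed [a] changes only
    the second-order part of the image. *)
Lemma jet_image_unique a s c r s' c' r' :
  jet_image f z a s c r -> jet_image f z a s' c' r' -> forall k l, c' k l = c k l.
Proof.
move=> [d0 E _] [_ E' _] k l; have := E it l; have := E ix l; have := E' it l; have := E' ix l.
rewrite !sum2E => -> -> Ex Et; apply/eqP; rewrite -subr_eq0; apply/eqP.
move: k; apply: ord2P; apply: (mulIf d0); rewrite mul0r.
  transitivity ('D[a, ix] X * (c' it l * 'D[a, it] T + c' ix l * 'D[a, it] X)
    - 'D[a, it] X * (c' it l * 'D[a, ix] T + c' ix l * 'D[a, ix] X)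
    - 'D[a, ix] X * (c it l * 'D[a, it] T + c ix l * 'D[a, it] X)
    + 'D[a, it] X * (c it l * 'D[a, ix] T + c ix l * 'D[a, ix] X)); first by ring.
  by rewrite Ex Et; ring.
transitivity ('D[a, it] T * (c' it l * 'D[a, ix] T + c' ix l * 'D[a, ix] X)
    - 'D[a, ix] T * (c' it l * 'D[a, it] T + c' ix l * 'D[a, it] X)
    - 'D[a, it] T * (c it l * 'D[a, ix] T + c ix l * 'D[a, ix] X)
    + 'D[a, ix] T * (c it l * 'D[a, it] T + c ix l * 'D[a, it] X)); first by ring.
by rewrite Ex Et; ring.
Qed.

Variables (A : 'rV[R]_2 -> R) (H0 : 'I_m -> 'rV[R]_2 -> 'rV[R]_m -> R)
  (H1 : 'I_m -> 'I_m -> 'rV[R]_2 -> 'rV[R]_m -> R).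
Hypothesis Az : A (base z) != 0.
Hypothesis Afz : A (base (f z)) != 0.
Variable l0 : 'I_m.

Section Projectability.
Hypothesis pf : preserves_at (evol A H0 H1) f z.

(* Only the leading term of the equation sees u_tt, through the coefficient
   (D_x T)^2 of the transformed u_xx. *)
Lemma td_time_x a : graph_det a != 0 -> 'D[a, ix] T = 0.
Proof.
(* The value of u_xx forced by the equation once u_t and u_x are given; u_tt then remains free. *)
move=> d0; pose s0 l := (a it l + H0 l (base z) (dep z)
   + \sum_c H1 l c (base z) (dep z) * a ix c) / A (base z).
have jC (x : 'I_m -> R) : jet2 x (fun=> 0) s0 it ix =1 jet2 x (fun=> 0) s0 ix it by [].
have E0 x l : evol_jet A H0 H1 z a (jet2 x (fun=> 0) s0) l = 0.
  by rewrite /evol_jet -[jet2 _ _ _ _ _ _]/(s0 l) /s0; field.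
have [c [r [rC im]]] := jet_image_exists sf (jC (fun=> 0)) d0.
have [_ imc imr] := im; have [b0 Wb] := shear_neq0 imc l0.
have [c' [r' [r'C im']]] := jet_image_exists sf (jC (fun b => (b == b0)%:R)) d0.
have [_ _ imr'] := im'; have cE := jet_image_unique im im'.
have Er := ((preserves_jetsP A H0 H1 sf).1 pf _ _ _ _ (jC _) rC im).1 (E0 _) l0.
have Er' := ((preserves_jetsP A H0 H1 sf).1 pf _ _ _ _ (jC _) r'C im').1 (E0 _) l0.
have rxx : r' ix ix l0 = r ix ix l0.
  apply: (mulfI Afz); move: Er Er'; rewrite /evol_jet cE.
  rewrite [X in _ -> _ + X = 0 -> _](_ : _ = \sum_c0 H1 l0 c0 (base (f z)) (dep (f z)) * c ix c0).
    by lra.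
  by apply: eq_bigr => ? _; rewrite cE.
have s00 h : \sum_b dif (dv b) h z * (0 : R) = 0 by under eq_bigr do rewrite mulr0; rewrite big1.
have tt := imr it it l0; have tt' := imr' it it l0.
have xt := imr ix it l0; have xt' := imr' ix it l0.
have xx := imr ix ix l0; have xx' := imr' ix ix l0.
move: tt tt' xt xt' xx xx'; rewrite !sum2E !cE /jet2 /= !sum_delta !s00 !addr0 rxx -rC -r'C.
move: Wb; rewrite /shear sum2E /graph_det in d0 *.
set p := td _ _ _ it in d0 *; set y := td _ _ _ ix in d0 *.
set x := td _ _ _ it in d0 *; set q := td _ _ _ ix in d0 *.
move=> Wb tt tt' xt xt' xx xx'; apply/eqP; apply/negPn/negP => q0.
(* If [q] is nonzero, the xx and xt relations, whose left sides are the same for both jets, force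
   both increments to vanish. The tt relation then equates [shear] at [b0] to zero. *)
set u := r' it it l0 - r it it l0; set v := r' it ix l0 - r it ix l0.
have e1 : q * (u * q + 2 * v * y) = 0 by rewrite /u /v; move: xx xx'; lra.
have e2 : u * p * q + v * (p * y + q * x) = 0 by rewrite /u /v; move: xt xt'; lra.
have /eqP := e1; rewrite mulf_eq0 (negbTE q0) /= => /eqP e3.
have v0 : v = 0 by apply: (mulIf d0); rewrite mul0r; move: (congr1 (fun t => p * t) e3) e2; lra.
have u0 : u = 0 by apply: (mulIf q0); move: e3; rewrite v0; lra.
move/eqP: Wb; apply; move: (congr1 (fun t => t * (p * p)) u0) (congr1 (fun t => t * (p * x)) v0) tt tt'.
by rewrite /u /v; lra.
Qed.

(** [td_time_x] speaks only of nondegenerate jets. Changing u_x by [e] in the direction [b] changes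
    [graph_det] affinely in [e], so it stays nonzero for [e = 1] or for [e = -1], and the two values
    of D_x T are compared. *)
Lemma time_projectable : 'd_[X] T = 0 /\ forall b, 'd_[dv b] T = 0.
Proof.
have [a d0] := graph_det_exists; have q0 := td_time_x d0.
suff Tb b : 'd_[dv b] T = 0.
  split=> //; move: q0; rewrite /td; under eq_bigr do rewrite Tb mul0r.
  by rewrite big1 ?addr0.
pose a' e := jet1 (a it) (fun b' => a ix b' + (b' == b)%:R * e).
have a't e l : 'D[a' e, it] l = 'D[a, it] l by [].
have a'x e l : 'D[a' e, ix] l = 'D[a, ix] l + e * 'd_[dv b] l.
  rewrite /a' td_jet1x /td -addrA; congr (_ + _).
  rewrite -(sum_delta (fun b => dif (dv b) (fun z => f z 0 l) z) b) mulr_sumr -big_split /=.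
  by apply: eq_bigr => b' _; ring.
suff [e e0 de] : exists2 e, e != 0 & graph_det (a' e) != 0.
  have := td_time_x de; rewrite a'x q0 add0r => /eqP.
  by rewrite mulf_eq0 (negbTE e0) /= => /eqP.
have dE e : graph_det (a' e) = graph_det a
    + e * ('D[a, it] T * 'd_[dv b] X - 'D[a, it] X * 'd_[dv b] T).
  by rewrite /graph_det !a't !a'x; ring.
have [d1|] := eqVneq (graph_det (a' 1)) 0; last by exists 1; rewrite ?oner_eq0.
exists (-1); first by rewrite oppr_eq0 oner_eq0.
have -> : graph_det (a' (-1)) = 2 * graph_det a - graph_det (a' 1) by rewrite !dE; ring.
by rewrite d1 subr0 mulf_neq0 // pnatr_eq0.
Qed.

Hypothesis Tflat : forall k, k != T -> \forall z' \near z, dif k (fun z => f z 0 T) z' = 0.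

Lemma dif_T k : k != T -> 'd_[k] T = 0.
Proof. by move=> /Tflat/nbhs_singleton. Qed.

Lemma dif2_T k k' : k != T -> 'd2_[k, k'] T = 0.
Proof. by move=> /Tflat/dif_near->; rewrite dif_cst. Qed.

Lemma td_Tt a : 'D[a, it] T = 'd_[T] T.
Proof.
by rewrite /td; under eq_bigr do rewrite dif_T // mul0r; rewrite big1 ?addr0.
Qed.

Lemma td_Tx a : 'D[a, ix] T = 0.
Proof.
rewrite /td; under eq_bigr do rewrite dif_T // mul0r.
by rewrite dif_T // big1 ?addr0.
Qed.

Lemma td2_Txx a s : td2 (fun z => f z 0 T) z a ix ix
  + \sum_b 'd_[dv b] T * s b = 0.
Proof.
rewrite /td2 dif2_T // big1 => [|b _]; last by rewrite dif2_T // mul0r.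
rewrite big1 => [|b _]; last first.
  by rewrite dif2_T // big1 ?addr0 ?mul0r // => c _; rewrite dif2_T // mul0r.
by rewrite big1 ?addr0 // => b _; rewrite dif_T // mul0r.
Qed.

Lemma graph_detE a : graph_det a = 'd_[T] T * 'D[a, ix] X.
Proof. by rewrite /graph_det td_Tt td_Tx mulr0 subr0. Qed.

Lemma Tt_neq0 : 'd_[T] T != 0.
Proof. by have [a] := graph_det_exists; rewrite graph_detE mulf_eq0 negb_or => /andP[]. Qed.

(* Vary u_xx, keeping the equation satisfied by varying u_t along with it. *)
Lemma td_space_x ax : 'D[jet1 (fun=> 0) ax, ix] X != 0 ->
  A (base z) * 'D[jet1 (fun=> 0) ax, ix] X ^+ 2 = A (base (f z)) * 'd_[T] T.
Proof.
move=> Y0; pose h b := - H0 b (base z) (dep z) - \sum_c H1 b c (base z) (dep z) * ax c.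
pose a e b0 := jet1 (fun b => h b + A (base z) * e * (b == b0)%:R) ax.
pose s e b0 := jet2 (fun=> 0) (fun=> 0) (fun b : 'I_m => e * (b == b0)%:R).
have sC e b0 : s e b0 it ix =1 s e b0 ix it by [].
have d0 e b0 : graph_det (a e b0) != 0 by rewrite graph_detE mulf_neq0 // Tt_neq0.
have E0 e b0 l : evol_jet A H0 H1 z (a e b0) (s e b0) l = 0.
  by rewrite /evol_jet /a /s /jet1 /jet2 /= /h; ring.
have [c [r [rC im]]] := jet_image_exists sf (sC 0 l0) (d0 0 l0).
have [_ imc imr] := im; have [b0 Wb] := shear_neq0 imc l0.
have [c' [r' [r'C im']]] := jet_image_exists sf (sC 1 b0) (d0 1 b0).
have [_ imc' imr'] := im'.
have Er := ((preserves_jetsP A H0 H1 sf).1 pf _ _ _ _ (sC _ _) rC im).1 (E0 _ _) l0.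
have Er' := ((preserves_jetsP A H0 H1 sf).1 pf _ _ _ _ (sC _ _) r'C im').1 (E0 _ _) l0.
have aX e e' b b' k : 'D[a e b, ix] k = 'D[a e' b', ix] k by [].
have YE e b : 'D[a e b, ix] X = 'D[jet1 (fun=> 0) ax, ix] X by [].
have cx l : c' ix l = c ix l.
  apply: (mulIf Y0); have := imc ix l; have := imc' ix l.
  by rewrite (aX 1 0 b0 l0) !sum2E !td_Tx !YE; lra.
have at_ e b k : 'D[a e b, it] k = 'D[jet1 h ax, it] k + A (base z) * e * 'd_[dv b] k.
  by rewrite /a !td_jet1t sum_deltaD addrA.
have WE : shear c l0 b0 = 'd_[dv b0] (dv l0) - c ix l0 * 'd_[dv b0] X.
  by rewrite /shear sum2E (@dif_T (dv b0)) //; ring.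
(* The increments of the image jet satisfy three relations: [ct] from the t-derivative, [rx] from
   the xx-derivative and [cr] from the transformed equation. Eliminating the increments and dividing
   by the nonzero [shear] leaves the claim. *)
have ct : 'd_[T] T * (c' it l0 - c it l0) = A (base z) * shear c l0 b0.
  have := imc it l0; have := imc' it l0; rewrite !sum2E !td_Tt !at_ cx WE.
  by lra.
have rx : 'D[jet1 (fun=> 0) ax, ix] X ^+ 2 * (r' ix ix l0 - r ix ix l0) = shear c l0 b0.
  have a2 k : td2 (fun z => f z 0 k) z (a 1 b0) ix ix = td2 (fun z => f z 0 k) z (a 0 l0) ix ix by [].
  have := imr ix ix l0; have := imr' ix ix l0; rewrite !sum2E !td_Tx !td2_Txx !YE cx WE a2.
  by rewrite /s /jet2 /= !sum_deltaM; lra.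
have cr : c' it l0 - c it l0 = A (base (f z)) * (r' ix ix l0 - r ix ix l0).
  move: Er Er'; rewrite /evol_jet.
  rewrite [X in _ -> _ + X = 0 -> _](_ : _ = \sum_c0 H1 l0 c0 (base (f z)) (dep (f z)) * c ix c0).
    by lra.
  by apply: eq_bigr => ? _; rewrite cx.
apply: (mulIf Wb); rewrite -{2}rx mulrAC -ct cr; ring.
Qed.

(** If X depended on u_b, a suitable u_x would give D_x X any prescribed nonzero value e, whereas
    [td_space_x] fixes A e^2; e = 1 and e = 2 contradict each other. *)
Lemma space_projectable : [/\ 'd_[T] T != 0, 'd_[X] X != 0, forall b, 'd_[dv b] X = 0
  & A (base z) * 'd_[X] X ^+ 2 = A (base (f z)) * 'd_[T] T].
Proof.
have DE b e : 'D[jet1 (fun=> 0) (fun b' => e * (b' == b)%:R), ix] X = 'd_[X] X + e * 'd_[dv b] X.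
  by rewrite td_jet1x sum_deltaM.
have Xb b : 'd_[dv b] X = 0.
  apply/eqP/negPn/negP => Xb0.
  have E e : e != 0 -> A (base z) * e ^+ 2 = A (base (f z)) * 'd_[T] T.
    move=> e0; have := @td_space_x (fun b' => ((e - 'd_[X] X) / 'd_[dv b] X) * (b' == b)%:R).
    by rewrite DE divfK // addrC subrK; apply.
  have := E 1 (oner_neq0 _); rewrite -(E 2) ?pnatr_eq0 // => /(mulfI Az).
  by move/eqP; rewrite expr1n eq_sym -subr_eq0 => /eqP; lra.
have Xx a : 'D[a, ix] X = 'd_[X] X.
  by rewrite /td; under eq_bigr do rewrite Xb mul0r; rewrite big1 ?addr0.
have X0 : 'd_[X] X != 0.
  have [a] := graph_det_exists; rewrite graph_detE Xx.
  by rewrite mulf_eq0 negb_or => /andP[].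
split=> //; first exact: Tt_neq0.
by have := @td_space_x (fun=> 0); rewrite Xx; apply.
Qed.

End Projectability.

(** [res0] and [res1] are the parts of degree 0 and 1 in u_x of what T_t times the transformed
    equation differs from a linear combination of the original equations. *)
Definition res0 l : R :=
  'd_[T] (dv l) - \sum_b 'd_[dv b] (dv l) * H0 b (base z) (dep z)
  - 'd_[X] (dv l) / 'd_[X] X * ('d_[T] X - A (base z) * 'd2_[X, X] X)
  - A (base z) * 'd2_[X, X] (dv l)
  + 'd_[T] T * (H0 l (base (f z)) (dep (f z))
      + \sum_d H1 l d (base (f z)) (dep (f z)) * ('d_[X] (dv d) / 'd_[X] X)).

Definition res1 l c : R :=
  - \sum_b 'd_[dv b] (dv l) * H1 b c (base z) (dep z)
  - 'd_[dv c] (dv l) / 'd_[X] X * ('d_[T] X - A (base z) * 'd2_[X, X] X)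
  - 2 * A (base z) * 'd2_[X, dv c] (dv l)
  + 'd_[T] T * \sum_d H1 l d (base (f z)) (dep (f z)) * ('d_[dv c] (dv d) / 'd_[X] X).

Section TransformedEquation.
Hypothesis Tflat : forall k, k != T -> \forall z' \near z, dif k (fun z => f z 0 T) z' = 0.
Hypothesis Xflat : forall b, \forall z' \near z, dif (dv b) (fun z => f z 0 X) z' = 0.
Hypothesis X0 : 'd_[X] X != 0.
Hypothesis AX : A (base z) * 'd_[X] X ^+ 2 = A (base (f z)) * 'd_[T] T.

Lemma dif_Xb b : 'd_[dv b] X = 0.
Proof. exact: nbhs_singleton (Xflat b). Qed.

Lemma td_X a i : 'D[a, i] X = 'd_[tx i] X.
Proof.
by rewrite /td; under eq_bigr do rewrite dif_Xb mul0r; rewrite big1 ?addr0.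
Qed.

Lemma td2_Xxx a s : td2 (fun z => f z 0 X) z a ix ix
  + \sum_b 'd_[dv b] X * s b = 'd2_[X, X] X.
Proof.
have d2 b k : 'd2_[dv b, k] X = 0 by rewrite (dif_near _ (Xflat b)) dif_cst.
have sX : smooth_at z (fun z => f z 0 X) by move/smooth_rowP: sf.
rewrite /td2 big1 => [|b _]; last by rewrite (dif_swap _ _ sX) d2 mul0r.
rewrite big1 => [|b _]; last by rewrite d2 big1 ?addr0 ?mul0r // => c _; rewrite d2 mul0r.
by rewrite big1 ?addr0 // => b _; rewrite dif_Xb mul0r.
Qed.

(** The jet relations are solved for c_x, T_t c_t and T_t A' r_xx, where A' is the value of [A] at
    the image point. The hypothesis [AX] converts T_t A' into A X_x^2, which is exactly what cancels
    the X_x^2 in front of r_xx. *)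
Lemma evol_transform a s c r l : jet_image f z a s c r ->
  'd_[T] T * evol_jet A H0 H1 (f z) c r l =
  \sum_b 'd_[dv b] (dv l) * evol_jet A H0 H1 z a s b + res0 l
  + \sum_c res1 l c * a ix c
  - A (base z) * \sum_b (\sum_c 'd2_[dv b, dv c] (dv l) * a ix c) * a ix b.
Proof.
move=> [_ imc imr]; have sl : smooth_at z (fun z => f z 0 (dv l)) by move/smooth_rowP: sf.
have cX d : c ix d = ('d_[X] (dv d) + \sum_b 'd_[dv b] (dv d) * a ix b) / 'd_[X] X.
  apply: (mulIf X0); rewrite divfK //; have := imc ix d.
  by rewrite sum2E (td_Tx Tflat) td_X mulr0 add0r => <-.
have cT : 'd_[T] T * c it l
    = 'd_[T] (dv l) + \sum_b 'd_[dv b] (dv l) * a it b - c ix l * 'd_[T] X.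
  by have := imc it l; rewrite sum2E (td_Tt Tflat) td_X {1}/td; lra.
have rX : 'd_[T] T * (A (base (f z)) * r ix ix l) = A (base z) *
    ('d2_[X, X] (dv l) + 2 * \sum_b 'd2_[X, dv b] (dv l) * a ix b
     + \sum_b (\sum_c 'd2_[dv b, dv c] (dv l) * a ix c) * a ix b
     + \sum_b 'd_[dv b] (dv l) * s ix ix b - c ix l * 'd2_[X, X] X).
  rewrite mulrA (mulrC ('d_[T] T)) -AX -mulrA; congr (_ * _).
  have := imr ix ix l; rewrite !sum2E (td_Tx Tflat) (td2_Txx Tflat) td_X td2_Xxx.
  rewrite {1}/td2; under [X in _ + _ + X + _ = _ -> _]eq_bigr do rewrite mulrDl (dif_swap _ _ sl).
  by rewrite big_split /=; lra.
have H1X : \sum_d H1 l d (base (f z)) (dep (f z)) * c ix d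
   = \sum_d H1 l d (base (f z)) (dep (f z)) * ('d_[X] (dv d) / 'd_[X] X)
   + \sum_c (\sum_d H1 l d (base (f z)) (dep (f z)) * ('d_[dv c] (dv d) / 'd_[X] X)) * a ix c.
  under eq_bigr do rewrite cX mulrDl mulrDr; rewrite big_split /=; congr (_ + _).
  under eq_bigr do rewrite mulrA mulr_sumr mulr_suml.
  rewrite exchange_big /=; apply: eq_bigr => b _; rewrite mulr_suml.
  by apply: eq_bigr => d _; ring.
have S1 : \sum_b 'd_[dv b] (dv l) * evol_jet A H0 H1 z a s b =
   \sum_b 'd_[dv b] (dv l) * a it b - A (base z) * \sum_b 'd_[dv b] (dv l) * s ix ix b
   + \sum_b 'd_[dv b] (dv l) * H0 b (base z) (dep z)
   + \sum_c (\sum_b 'd_[dv b] (dv l) * H1 b c (base z) (dep z)) * a ix c.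
  rewrite /evol_jet; under eq_bigr do rewrite !mulrDr mulrN.
  rewrite !big_split /= sumrN; congr (_ - _ + _ + _).
    by rewrite mulr_sumr; apply: eq_bigr => b _; ring.
  under eq_bigr do rewrite mulr_sumr; rewrite exchange_big /=; apply: eq_bigr => b _.
  by rewrite mulr_suml; apply: eq_bigr => d _; ring.
have S2 : \sum_c res1 l c * a ix c =
  - \sum_c (\sum_b 'd_[dv b] (dv l) * H1 b c (base z) (dep z)) * a ix c
  - (\sum_b 'd_[dv b] (dv l) * a ix b) / 'd_[X] X * ('d_[T] X - A (base z) * 'd2_[X, X] X)
  - 2 * A (base z) * \sum_b 'd2_[X, dv b] (dv l) * a ix b
  + 'd_[T] T * \sum_c (\sum_d H1 l d (base (f z)) (dep (f z))
                        * ('d_[dv c] (dv d) / 'd_[X] X)) * a ix c.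
  rewrite /res1; under eq_bigr do rewrite !mulrDl !mulNr.
  rewrite !big_split /= !sumrN; congr (- _ - _ - _ + _).
  - by rewrite !mulr_suml; apply: eq_bigr => b _; ring.
  - by rewrite mulr_sumr; apply: eq_bigr => b _; ring.
  - by rewrite mulr_sumr; apply: eq_bigr => b _; ring.
rewrite {1}/evol_jet H1X !mulrDr mulrN cT rX S1 S2 cX /res0.
by field.
Qed.

(** For every value of u_x, zero second derivatives together with the u_t dictated by the equation
    give a jet of the system. The residual expression thus vanishes identically as a quadratic
    polynomial in u_x. *)
Lemma evol_residues : preserves_at (evol A H0 H1) f z ->
  [/\ forall l, res0 l = 0, forall l c, res1 l c = 0
    & forall l b c, 'd2_[dv b, dv c] (dv l) = 0].
Proof.
move=> pf; have key p l : res0 l + \sum_c res1 l c * p c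
   = A (base z) * \sum_b (\sum_c 'd2_[dv b, dv c] (dv l) * p c) * p b.
  pose a := jet1 (fun b => - H0 b (base z) (dep z) - \sum_c H1 b c (base z) (dep z) * p c) p.
  pose s : 'I_2 -> 'I_2 -> 'I_m -> R := jet2 (fun=> 0) (fun=> 0) (fun=> 0).
  have sC : s it ix =1 s ix it by [].
  have E0 b : evol_jet A H0 H1 z a s b = 0 by rewrite /evol_jet /a /s /jet1 /jet2 /=; ring.
  have [c [r [rC im]]] : exists c r, r it ix =1 r ix it /\ jet_image f z a s c r.
    apply: (jet_image_exists sf) => //.
    by rewrite -/(graph_det a) (graph_detE Tflat) td_X mulf_neq0 // (Tt_neq0 Tflat).
  have Er := ((preserves_jetsP A H0 H1 sf).1 pf _ _ _ _ sC rC im).1 E0.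
  have := evol_transform l im; rewrite Er mulr0 big1 => [|b _]; last by rewrite E0 mulr0.
  by rewrite /a /=; lra.
have H l : [/\ res0 l = 0, forall c, res1 l c = 0 & forall b c, 'd2_[dv b, dv c] (dv l) = 0].
  apply: (quadratic_eq0 Az) => // b c; apply: dif_swap.
  by move: (dv l); apply/smooth_rowP.
by split=> l; have [] := H l.
Qed.

(** With zero residues the new equations are linear combinations of the old ones, the matrix being
    the fibre block of the Jacobian. One direction is immediate; the other needs the invertibility
    of that block. *)
Lemma residues_preserve : (forall l, res0 l = 0) -> (forall l c, res1 l c = 0) ->
  (forall l b c, 'd2_[dv b, dv c] (dv l) = 0) -> preserves_at (evol A H0 H1) f z.
Proof.
move=> z0 z1 z2; apply/(preserves_jetsP A H0 H1 sf) => a s c r sC rC im.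
have key l : 'd_[T] T * evol_jet A H0 H1 (f z) c r l =
    \sum_b 'd_[dv b] (dv l) * evol_jet A H0 H1 z a s b.
  rewrite (evol_transform l im) z0 addr0.
  rewrite [X in _ + X - _]big1 => [|b _]; last by rewrite z1 mul0r.
  rewrite [X in _ - _ * X]big1 ?mulr0 ?addr0 ?subr0 // => b _.
  by rewrite big1 ?mul0r // => b' _; rewrite z2 mul0r.
split=> [E l|E].
  apply: (mulfI (Tt_neq0 Tflat)); rewrite mulr0 key big1 // => b _.
  by rewrite E mulr0.
(* The values of the equations, padded by zeros in the t and x places, form a left kernel vector of
   the full Jacobian, because T and X do not depend on the fibre. *)
pose e (k : 'I_(2 + m)) := \sum_b (k == dv b)%:R * evol_jet A H0 H1 z a s b.
have eb b : e (dv b) = evol_jet A H0 H1 z a s b.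
  rewrite /e -[RHS](sum_delta (evol_jet A H0 H1 z a s)); apply: eq_bigr => b' _.
  by rewrite mulrC /dv eq_rshift eq_sym.
have et i : e (tx i) = 0.
  by rewrite /e big1 // => b _; rewrite /tx /dv eq_lrshift mul0r.
move=> l; rewrite -eb; apply: (@jac_ker_row e) => k.
rewrite sum_split !et !mul0r !add0r; move: k; apply: idxP => [||b].
- by rewrite big1 // => b _; rewrite (dif_T Tflat) // mulr0.
- by rewrite big1 // => b _; rewrite dif_Xb mulr0.
transitivity ('d_[T] T * evol_jet A H0 H1 (f z) c r b); last by rewrite E mulr0.
by rewrite key; apply: eq_bigr => b' _; rewrite eb mulrC.
Qed.

End TransformedEquation.
End PointSymmetryEquations.

(** * Maps that are affine along the fibres *)

Section AffineMaps.
Context {R : realType} {m : nat}.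
Notation Z := 'rV[R]_(2 + m).
Implicit Types (T X : 'rV[R]_2 -> R) (M : 'I_m -> 'I_m -> 'rV[R]_2 -> R)
  (N : 'I_m -> 'rV[R]_2 -> R).

Definition affmap T X M N (z : Z) : Z :=
  row_mx (row2 (T (base z)) (X (base z)))
    (\row_l (\sum_b M l b (base z) * dep z 0 b + N l (base z))).

Lemma row2_it (a b : R) : row2 a b 0 it = a. Proof. by rewrite mxE. Qed.
Lemma row2_ix (a b : R) : row2 a b 0 ix = b. Proof. by rewrite mxE. Qed.

Lemma base_affmap T X M N z : base (affmap T X M N z) = row2 (T (base z)) (X (base z)).
Proof. exact: base_row. Qed.

Lemma affmapT T X M N z : affmap T X M N z 0 (tx it) = T (base z).
Proof. by rewrite row_mxEl row2_it. Qed.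
Lemma affmapX T X M N z : affmap T X M N z 0 (tx ix) = X (base z).
Proof. by rewrite row_mxEl row2_ix. Qed.
Lemma affmapD T X M N z l :
  affmap T X M N z 0 (dv l) = \sum_b M l b (base z) * dep z 0 b + N l (base z).
Proof. by rewrite row_mxEr mxE. Qed.

Lemma smooth_base (z : Z) a : smooth_at z (fun z : Z => base z 0 a).
Proof. by under eq_fun do rewrite baseE; exact: smooth_coord. Qed.
Lemma smooth_dep (z : Z) b : smooth_at z (fun z : Z => dep z 0 b).
Proof. by under eq_fun do rewrite depE; exact: smooth_coord. Qed.

Lemma smooth_over_base (h : 'rV[R]_2 -> R) (z : Z) :
  smooth_at (base z) h -> smooth_at z (fun z => h (base z)).
Proof. by move=> sh; apply: smooth_comp => // a; exact: smooth_base. Qed.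

Lemma dif_base (h : 'rV[R]_2 -> R) (z : Z) i :
  smooth_at (base z) h -> dif (tx i) (fun z => h (base z)) z = dif i h (base z).
Proof.
move=> sh; rewrite dif_comp //; last by move=> a; exact: smooth_base.
rewrite -[RHS](sum_delta (fun a => dif a h (base z))); apply: eq_bigr => a _.
by under [X in _ * dif _ X _]eq_fun do rewrite baseE; rewrite dif_coord /tx eq_lshift eq_sym.
Qed.

Lemma dif_base_dv (h : 'rV[R]_2 -> R) (z : Z) b :
  smooth_at (base z) h -> dif (dv b) (fun z => h (base z)) z = 0.
Proof.
move=> sh; rewrite dif_comp //; last by move=> a; exact: smooth_base.
rewrite big1 // => a _.
by under [X in _ * dif _ X _]eq_fun do rewrite baseE;
  rewrite dif_coord /tx /dv eq_rlshift mulr0.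
Qed.

Lemma dif_dep_tx (z : Z) i b : dif (tx i) (fun z : Z => dep z 0 b) z = 0.
Proof. by under eq_fun do rewrite depE; rewrite dif_coord /tx /dv eq_lrshift. Qed.
Lemma dif_dep_dv (z : Z) c b : dif (dv c) (fun z : Z => dep z 0 b) z = (b == c)%:R.
Proof. by under eq_fun do rewrite depE; rewrite dif_coord /dv eq_rshift eq_sym. Qed.

Definition affine (M : 'I_m -> 'rV[R]_2 -> R) (N : 'rV[R]_2 -> R) (z : Z) : R :=
  \sum_b M b (base z) * dep z 0 b + N (base z).

Section AffineFunctions.
Variables (M : 'I_m -> 'rV[R]_2 -> R) (N : 'rV[R]_2 -> R) (z : Z).
Hypothesis sM : forall b, smooth_at (base z) (M b).
Hypothesis sN : smooth_at (base z) N.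

Let sMb b : smooth_at z (fun z => M b (base z)). Proof. exact: smooth_over_base. Qed.
Let sMu b : smooth_at z (fun z => M b (base z) * dep z 0 b).
Proof. by apply: smoothM => //; exact: smooth_dep. Qed.

Lemma smooth_affine : smooth_at z (affine M N).
Proof. by apply: smoothD; [exact: smooth_sum|exact: smooth_over_base]. Qed.

Lemma dif_affine_tx i :
  dif (tx i) (affine M N) z = affine (fun b => dif i (M b)) (dif i N) z.
Proof.
rewrite /affine difD; [|exact: smooth_sum|exact: smooth_over_base].
rewrite dif_base // dif_sum //; congr (_ + _); apply: eq_bigr => b _.
by rewrite difM ?dif_base ?dif_dep_tx ?mulr0 ?addr0 //; exact: smooth_dep.
Qed.

Lemma dif_affine_dv c : dif (dv c) (affine M N) z = M c (base z).
Proof.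
rewrite /affine difD; [|exact: smooth_sum|exact: smooth_over_base].
rewrite dif_base_dv // addr0 dif_sum // -(sum_delta (fun b => M b (base z)) c).
apply: eq_bigr => b _.
by rewrite difM ?dif_base_dv ?dif_dep_dv ?mul0r ?add0r //; exact: smooth_dep.
Qed.

End AffineFunctions.

Section AffineFunctions2.
Variables (M : 'I_m -> 'rV[R]_2 -> R) (N : 'rV[R]_2 -> R) (z : Z).
Hypothesis sM : forall b, smooth_at (base z) (M b).
Hypothesis sN : smooth_at (base z) N.

Lemma near_smooth_base : \forall y \near z,
  (forall b, smooth_at (base y) (M b)) /\ smooth_at (base y) N.
Proof.
have n1 := near_base (near_all (fun b => smooth_near (sM b))).
have n2 := near_base (smooth_near sN).
by near=> y; split; near: y.
Unshelve. all: by end_near. Qed.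

Lemma dif2_affine_tx i j : dif (tx j) (dif (tx i) (affine M N)) z =
  affine (fun b => dif j (dif i (M b))) (dif j (dif i N)) z.
Proof.
transitivity (dif (tx j) (affine (fun b => dif i (M b)) (dif i N)) z).
  by apply: dif_near; apply: filterS near_smooth_base => y [? ?]; exact: dif_affine_tx.
by rewrite dif_affine_tx // => *; exact: smooth_dif.
Qed.

Lemma dif2_affine_xdv i c : dif (dv c) (dif (tx i) (affine M N)) z = dif i (M c) (base z).
Proof.
transitivity (dif (dv c) (affine (fun b => dif i (M b)) (dif i N)) z).
  by apply: dif_near; apply: filterS near_smooth_base => y [? ?]; exact: dif_affine_tx.
by rewrite dif_affine_dv // => *; exact: smooth_dif.
Qed.

Lemma dif2_affine_dv b c : dif (dv c) (dif (dv b) (affine M N)) z = 0.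
Proof.
transitivity (dif (dv c) (fun z => M b (base z)) z); last exact: dif_base_dv.
by apply: dif_near; apply: filterS near_smooth_base => y [? ?]; exact: dif_affine_dv.
Qed.

End AffineFunctions2.

Lemma dif2_base (h : 'rV[R]_2 -> R) (z : Z) i j : smooth_at (base z) h ->
  dif (tx j) (dif (tx i) (fun z => h (base z))) z = dif j (dif i h) (base z).
Proof.
move=> sh; rewrite -(dif_base j (smooth_dif i sh)); apply: dif_near.
by apply: filterS (near_base (smooth_near sh)) => y; exact: dif_base.
Qed.

(** The residues of [affmap] in terms of T, X, M and N alone, so that they can be evaluated on a
    whole fibre. *)
Definition ares0 (A : 'rV[R]_2 -> R) (H0 : 'I_m -> 'rV[R]_2 -> 'rV[R]_m -> R)
    (H1 : 'I_m -> 'I_m -> 'rV[R]_2 -> 'rV[R]_m -> R) T X M N (z : Z) l : R :=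
  let w := base z in let w' := base (affmap T X M N z) in
  let u' := dep (affmap T X M N z) in
  affine (fun b => dif it (M l b)) (dif it (N l)) z
  - \sum_b M l b w * H0 b w (dep z)
  - affine (fun b => dif ix (M l b)) (dif ix (N l)) z / dif ix X w
      * (dif it X w - A w * dif ix (dif ix X) w)
  - A w * affine (fun b => dif ix (dif ix (M l b))) (dif ix (dif ix (N l))) z
  + dif it T w * (H0 l w' u' + \sum_d H1 l d w' u'
      * (affine (fun b => dif ix (M d b)) (dif ix (N d)) z / dif ix X w)).

Definition ares1 (A : 'rV[R]_2 -> R)
    (H1 : 'I_m -> 'I_m -> 'rV[R]_2 -> 'rV[R]_m -> R) T X M N (z : Z) l c : R :=
  let w := base z in let w' := base (affmap T X M N z) in
  let u' := dep (affmap T X M N z) in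
  - \sum_b M l b w * H1 b c w (dep z)
  - M l c w / dif ix X w * (dif it X w - A w * dif ix (dif ix X) w)
  - 2 * A w * dif ix (M l c) w
  + dif it T w * \sum_d H1 l d w' u' * (M d c w / dif ix X w).

Definition smooth_data w T X M N : Prop :=
  [/\ smooth_at w T, smooth_at w X, forall l b, smooth_at w (M l b) & forall l, smooth_at w (N l)].

Lemma smooth_data_near w T X M N :
  smooth_data w T X M N -> \forall y \near w, smooth_data y T X M N.
Proof.
move=> [sT sX sM sN].
have n1 := smooth_near sT; have n2 := smooth_near sX.
have n3 := near_all (fun l => near_all (fun b => smooth_near (sM l b))).
have n4 := near_all (fun l => smooth_near (sN l)).
by near=> y; split; near: y.
Unshelve. all: by end_near. Qed.

Lemma affmapTE T X M N : (fun z => affmap T X M N z 0 (tx it)) = fun z => T (base z).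
Proof. by apply/funext => z; rewrite affmapT. Qed.
Lemma affmapXE T X M N : (fun z => affmap T X M N z 0 (tx ix)) = fun z => X (base z).
Proof. by apply/funext => z; rewrite affmapX. Qed.
Lemma affmapDE T X M N l : (fun z => affmap T X M N z 0 (dv l)) = affine (M l) (N l).
Proof. by apply/funext => z; rewrite affmapD. Qed.

Lemma smooth_affmap T X M N z :
  smooth_data (base z) T X M N -> smooth_at z (affmap T X M N).
Proof.
move=> [sT sX sM sN]; apply/smooth_rowP; apply: idxP => [||b].
- by rewrite affmapTE; exact: smooth_over_base.
- by rewrite affmapXE; exact: smooth_over_base.
- by rewrite affmapDE; exact: smooth_affine.
Qed.

Lemma res0_affmap A H0 H1 T X M N z l : smooth_data (base z) T X M N ->
  res0 (affmap T X M N) z A H0 H1 l = ares0 A H0 H1 T X M N z l.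
Proof.
move=> [sT sX sM sN]; rewrite /res0 /ares0 !affmapTE !affmapXE !affmapDE.
rewrite !dif_base // !dif2_base // !dif_affine_tx // dif2_affine_tx //.
congr (_ - _ - _ - _ + _ * (_ + _)); apply: eq_bigr => b _; first by rewrite dif_affine_dv.
by rewrite affmapDE dif_affine_tx.
Qed.

Lemma res1_affmap A H1 T X M N z l c : smooth_data (base z) T X M N ->
  res1 (affmap T X M N) z A H1 l c = ares1 A H1 T X M N z l c.
Proof.
move=> [sT sX sM sN]; rewrite /res1 /ares1 !affmapTE !affmapXE !affmapDE.
rewrite !dif_base // !dif2_base // dif_affine_dv // dif2_affine_xdv //.
congr (- _ - _ - _ + _ * _); apply: eq_bigr => b _; first by rewrite dif_affine_dv.
by rewrite affmapDE dif_affine_dv.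
Qed.

(** The base components do not depend on the fibre, so the Jacobian is block triangular. *)
Lemma det_affmap T X M N z : smooth_data (base z) T X M N ->
  \det ('J (affmap T X M N) z) =
  (dif it T (base z) * dif ix X (base z) - dif it X (base z) * dif ix T (base z))
  * \det (\matrix_(b, l) M l b (base z)).
Proof.
move=> sd; have sf := smooth_affmap sd; case: sd => [sT sX sM sN].
have -> : 'J (affmap T X M N) z = block_mx
    (\matrix_(i, j) dif i (if j == it then T else X) (base z))
    (\matrix_(i, l) dif (tx i) (affine (M l) (N l)) z) 0
    (\matrix_(b, l) M l b (base z)).
  apply/matrixP => k l; rewrite jacobianE //; move: k l; apply: idxP => [||b]; apply: idxP => [||l].
  all: rewrite ?affmapTE ?affmapXE ?affmapDE ?dif_base ?dif_base_dv ?dif_affine_dv //.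
  all: rewrite ?(block_mxEul, block_mxEur, block_mxEdl, block_mxEdr) ?mxE //=.
by rewrite det_ublock det2E !mxE /=; congr (_ * _); ring.
Qed.

End AffineMaps.

(** * Point symmetries of evolution systems are affine along the fibres *)

Section SymmetryIsAffine.
Context {R : realType}.

Lemma smooth_bigsum (I : Type) (r : seq I) (P : pred I) n (F : I -> 'rV[R]_n -> R) p :
  (forall i, smooth_at p (F i)) -> smooth_at p (fun z => \sum_(i <- r | P i) F i z).
Proof.
move=> sF; elim: r => [|i r IHr].
  by under eq_fun do rewrite big_nil; exact: smooth_cst.
under eq_fun do rewrite big_cons; case: (P i) => //; exact: smoothD.
Qed.

Lemma smooth_bigprod (I : Type) (r : seq I) (P : pred I) n (F : I -> 'rV[R]_n -> R) p :
  (forall i, smooth_at p (F i)) -> smooth_at p (fun z => \prod_(i <- r | P i) F i z).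
Proof.
move=> sF; elim: r => [|i r IHr].
  by under eq_fun do rewrite big_nil; exact: smooth_cst.
under eq_fun do rewrite big_cons; case: (P i) => //; exact: smoothM.
Qed.

Lemma smooth_det n k (F : 'I_k -> 'I_k -> 'rV[R]_n -> R) p :
  (forall i j, smooth_at p (F i j)) -> smooth_at p (fun z => \det (\matrix_(i, j) F i j z)).
Proof.
move=> sF; rewrite /determinant; apply: smooth_bigsum => s.
apply: smoothM; first exact: smooth_cst.
by apply: smooth_bigprod => i; under eq_fun do rewrite mxE.
Qed.

Lemma near_neq0 n (h : 'rV[R]_n -> R) p : smooth_at p h -> h p != 0 ->
  \forall z \near p, h z != 0.
Proof.
move=> sh h0; exact: (smooth_continuous sh) (open_nbhs_nbhs (conj (@open_neq _ 0) h0)).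
Qed.

Context {m : nat}.
Notation Z := 'rV[R]_(2 + m).

Lemma smooth_section (h : Z -> R) (p : Z) :
  smooth_at p h -> smooth_at (base p) (fun w => h (row_mx w (dep p))).
Proof.
move=> sh; apply: (@smooth_on_graph _ _ h (fun=> dep p)).
  by apply/smooth_rowP => a; exact: smooth_cst.
by rewrite row_base_dep.
Qed.

(** [genT], [genX], [genM] and [genN] read candidate coefficients off the section with fibre value
    [dep p]. They are defined for every [f]; that they reproduce its germ is shown only under the
    conditions of [affgen_germ]. *)
Definition genT (f : Z -> Z) p w : R := f (row_mx w (dep p)) 0 (tx it).
Definition genX (f : Z -> Z) p w : R := f (row_mx w (dep p)) 0 (tx ix).
Definition genM (f : Z -> Z) p l b w : R := dif (dv b) (fun z => f z 0 (dv l)) (row_mx w (dep p)).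
Definition genN (f : Z -> Z) p l w : R :=
  f (row_mx w (dep p)) 0 (dv l) - \sum_b genM f p l b w * dep p 0 b.
Definition affgen f p : Z -> Z := affmap (genT f p) (genX f p) (genM f p) (genN f p).

Lemma smooth_gen_data (f : Z -> Z) p : smooth_at p f ->
  smooth_data (base p) (genT f p) (genX f p) (genM f p) (genN f p).
Proof.
move=> /smooth_rowP sf; have sM l b : smooth_at (base p) (genM f p l b).
  by apply: (smooth_section (h := dif (dv b) (fun z => f z 0 (dv l)))); exact: smooth_dif.
split=> [||//|l]; rewrite /genT /genX.
- exact: (smooth_section (sf _)).
- exact: (smooth_section (sf _)).
apply: smoothB; first exact: (smooth_section (sf _)).
by apply: smooth_sum => b; apply: smoothM => //; exact: smooth_cst.
Qed.

Lemma affgen_germ (f : Z -> Z) p : smooth_at p f ->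
  (\forall z \near p, forall b, dif (dv b) (fun z => f z 0 (tx it)) z = 0) ->
  (\forall z \near p, forall b, dif (dv b) (fun z => f z 0 (tx ix)) z = 0) ->
  (\forall z \near p, forall l b c, dif (dv c) (dif (dv b) (fun z => f z 0 (dv l))) z = 0) ->
  germ_eq p f (affgen f p).
Proof.
move=> /smooth_rowP sf fT fX fG.
have n1 := fiber_const (sf _) fT; have n2 := fiber_const (sf _) fX.
have n3 : \forall z \near p, forall l, f z 0 (dv l) = affgen f p z 0 (dv l).
  apply: near_all => l; have := @fiber_affine _ _ (fun z => f z 0 (dv l)) p (sf _) => H.
  have fGl : \forall z \near p, forall b c, dif (dv c) (dif (dv b) (fun z => f z 0 (dv l))) z = 0.
    by apply: filterS fG => z; exact.
  by apply: filterS (H fGl) => z ->; rewrite affmapD.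
near=> z; apply/rowP; apply: idxP => [||b].
- by rewrite affmapT; near: z.
- by rewrite affmapX; near: z.
- by move: b; near: z.
Unshelve. all: by end_near. Qed.

Section Germs.
Variables (f g : Z -> Z) (z : Z).
Hypothesis fg : germ_eq z f g.

Lemma germ_dif k l : dif k (fun z => f z 0 l) z = dif k (fun z => g z 0 l) z.
Proof. by apply: dif_near; apply: filterS fg => y ->. Qed.

Lemma germ_dif2 k k' l :
  dif k' (dif k (fun z => f z 0 l)) z = dif k' (dif k (fun z => g z 0 l)) z.
Proof. by apply: dif_near; apply: near_dif; apply: filterS fg => y ->. Qed.

Lemma germ_smooth : smooth_at z f -> smooth_at z g.
Proof.
move=> /smooth_rowP sf; apply/smooth_rowP => a; apply: smooth_eq (sf a).
by apply: filterS fg => y ->.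
Qed.

Lemma germ_jacobian : smooth_at z f -> 'J f z = 'J g z.
Proof.
move=> sf; apply/matrixP => k l.
exact: (etrans (jacobianE k l sf) (etrans (germ_dif k l)
  (esym (jacobianE k l (germ_smooth sf))))).
Qed.

Lemma germ_res0 A H0 H1 l : res0 f z A H0 H1 l = res0 g z A H0 H1 l.
Proof.
rewrite /res0 !germ_dif !germ_dif2 (nbhs_singleton fg).
congr (_ - _ - _ - _ + _ * (_ + _)); apply: eq_bigr => b _; by rewrite germ_dif.
Qed.

Lemma germ_res1 A H1 l c : res1 f z A H1 l c = res1 g z A H1 l c.
Proof.
rewrite /res1 !germ_dif !germ_dif2 (nbhs_singleton fg).
congr (- _ - _ - _ + _ * _); apply: eq_bigr => b _; by rewrite germ_dif.
Qed.

End Germs.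

Variables (Omega : set 'rV[R]_2) (A : 'rV[R]_2 -> R)
  (H0 : 'I_m -> 'rV[R]_2 -> 'rV[R]_m -> R)
  (H1 : 'I_m -> 'I_m -> 'rV[R]_2 -> 'rV[R]_m -> R).
Hypothesis oO : open Omega.
Hypothesis A0 : forall w, Omega w -> A w != 0.

Record affine_symmetry T X M N (z : Z) : Prop := AffineSymmetry {
  afs_Tx : dif ix T (base z) = 0;
  afs_Tt : dif it T (base z) != 0;
  afs_Xx : dif ix X (base z) != 0;
  afs_det : \det (\matrix_(b, l) M l b (base z)) != 0;
  afs_A : A (base z) * dif ix X (base z) ^+ 2
    = A (row2 (T (base z)) (X (base z))) * dif it T (base z);
  afs_res0 : forall l, ares0 A H0 H1 T X M N z l = 0;
  afs_res1 : forall l c, ares1 A H1 T X M N z l c = 0 }.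

Lemma near_Omega_base (p : Z) : Omega (base p) -> \forall z \near p, Omega (base z).
Proof. by move=> Op; apply: near_base; exact: open_nbhs_nbhs (conj oO Op). Qed.

Lemma near_Omega_image (f : Z -> Z) p : smooth_at p f -> Omega (base (f p)) ->
  \forall z \near p, Omega (base (f z)).
Proof.
move=> /smooth_rowP sf Op; apply: (@near_comp _ _ _ (fun z => base (f z)) p Omega).
  by move=> a; under eq_fun do rewrite baseE.
exact: open_nbhs_nbhs (conj oO Op).
Qed.

(** Each determining step is pointwise, but the next one differentiates its conclusion. Every
    conclusion is therefore collected near [p] and, by [near_join], near each nearby [z]: first for
    T, then for X with the relation on [A], then for the residues. Only then can [f] be replaced by
    [affgen f p]. *)
Lemma point_symmetry_affine (f : Z -> Z) p (l0 : 'I_m) :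
  point_symmetry Omega (evol A H0 H1) p f ->
  germ_eq p f (affgen f p) /\ \forall z \near p,
    affine_symmetry (genT f p) (genX f p) (genM f p) (genN f p) z.
Proof.
move=> [Op Ofp sf Jf pf]; have /smooth_rowP sfc := sf.
have n1 := smooth_near_row sf.
have n2 : \forall z \near p, \det ('J f z) != 0.
  have JE z : smooth_at z f -> 'J f z = \matrix_(k, l) dif k (fun z => f z 0 l) z.
    by move=> sfz; apply/matrixP => k l; rewrite [RHS]mxE; exact: jacobianE.
  have := @near_neq0 _ (fun z => \det (\matrix_(k, l) dif k (fun z => f z 0 l) z)) p.
  rewrite -(JE p sf) => /(_ _ Jf) H; apply: filterS2 n1 (H _).
    by move=> z sfz; rewrite (JE z sfz).
  by apply: smooth_det => k l; exact: smooth_dif.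
have n4 := near_Omega_base Op; have n5 := near_Omega_image sf Ofp.
have n6 : \forall z \near p, dif (tx ix) (fun z => f z 0 (tx it)) z = 0 /\
    forall b, dif (dv b) (fun z => f z 0 (tx it)) z = 0.
  near=> z; have [sfz Jz Oz Ofz pz] : [/\ smooth_at z f, \det ('J f z) != 0, Omega (base z),
      Omega (base (f z)) & preserves_at (evol A H0 H1) f z] by split; near: z.
  exact: (time_projectable sfz Jz (A0 Oz) (A0 Ofz) l0 pz).
have n6' : \forall z \near p, forall k, k != tx it -> \forall y \near z,
    dif k (fun z => f z 0 (tx it)) y = 0.
  apply: filterS (near_join n6) => z nz k; rewrite -(splitK k).
  case: (fintype.split k) => j /=; last by move=> _; apply: filterS nz => y [].
  by move: j; apply: ord2P; rewrite ?eqxx // => _; apply: filterS nz => y [].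
have n7 : \forall z \near p, [/\ dif (tx it) (fun z => f z 0 (tx it)) z != 0,
    dif (tx ix) (fun z => f z 0 (tx ix)) z != 0,
    forall b, dif (dv b) (fun z => f z 0 (tx ix)) z = 0
    & A (base z) * dif (tx ix) (fun z => f z 0 (tx ix)) z ^+ 2
      = A (base (f z)) * dif (tx it) (fun z => f z 0 (tx it)) z].
  near=> z; have [sfz Jz Oz Ofz pz] : [/\ smooth_at z f, \det ('J f z) != 0, Omega (base z),
      Omega (base (f z)) & preserves_at (evol A H0 H1) f z] by split; near: z.
  have tz : forall k, k != tx it -> \forall y \near z,
    dif k (fun z => f z 0 (tx it)) y = 0 by near: z.
  exact: (space_projectable sfz Jz (A0 Oz) l0 pz tz).
have n7' := near_join n7.
have n8 : \forall z \near p, [/\ forall l, res0 f z A H0 H1 l = 0,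
    forall l c, res1 f z A H1 l c = 0
    & forall l b c, dif (dv c) (dif (dv b) (fun z => f z 0 (dv l))) z = 0].
  near=> z; have n7z : \forall y \near z, [/\ dif (tx it) (fun z => f z 0 (tx it)) y != 0,
    dif (tx ix) (fun z => f z 0 (tx ix)) y != 0,
    forall b, dif (dv b) (fun z => f z 0 (tx ix)) y = 0
    & A (base y) * dif (tx ix) (fun z => f z 0 (tx ix)) y ^+ 2
      = A (base (f y)) * dif (tx it) (fun z => f z 0 (tx it)) y] by near: z.
  have [_ Xx _ AX] := nbhs_singleton n7z.
  have [sfz Jz Oz pz] : [/\ smooth_at z f, \det ('J f z) != 0, Omega (base z)
      & preserves_at (evol A H0 H1) f z] by split; near: z.
  have tz : forall k, k != tx it -> \forall y \near z,
    dif k (fun z => f z 0 (tx it)) y = 0 by near: z.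
  have xz b : \forall y \near z, dif (dv b) (fun z => f z 0 (tx ix)) y = 0.
    by apply: filterS n7z => y [].
  exact: (evol_residues sfz Jz (A0 Oz) tz xz Xx AX pz).
have germ : germ_eq p f (affgen f p).
  by apply: affgen_germ => //; [apply: filterS n6 => z []|apply: filterS n7 => z []
    |apply: filterS n8 => z []].
split=> //; have n9 := near_join germ.
have n10 := near_base (smooth_data_near (smooth_gen_data sf)).
near=> z; have gz : germ_eq z f (affgen f p) by near: z.
have sd : smooth_data (base z) (genT f p) (genX f p) (genM f p) (genN f p) by near: z.
have [sT sX _ _] := sd.
have Tx : dif ix (genT f p) (base z) = 0.
  have [] : dif (tx ix) (fun z => f z 0 (tx it)) z = 0 /\
    forall b, dif (dv b) (fun z => f z 0 (tx it)) z = 0 by near: z.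
  by rewrite (germ_dif gz) affmapTE dif_base.
have [r0 r1 _] : [/\ forall l, res0 f z A H0 H1 l = 0,
    forall l c, res1 f z A H1 l c = 0
    & forall l b c, dif (dv c) (dif (dv b) (fun z => f z 0 (dv l))) z = 0] by near: z.
have [Tt Xx _ AX] : [/\ dif (tx it) (fun z => f z 0 (tx it)) z != 0,
    dif (tx ix) (fun z => f z 0 (tx ix)) z != 0,
    forall b, dif (dv b) (fun z => f z 0 (tx ix)) z = 0
    & A (base z) * dif (tx ix) (fun z => f z 0 (tx ix)) z ^+ 2
      = A (base (f z)) * dif (tx it) (fun z => f z 0 (tx it)) z] by near: z.
move: Tt Xx AX; rewrite !(germ_dif gz) (nbhs_singleton gz) affmapTE affmapXE.
rewrite !dif_base // base_affmap => Tt Xx AX.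
split=> //.
- have : \det ('J f z) != 0 by near: z.
  rewrite (germ_jacobian gz); last by near: z.
  by rewrite det_affmap // mulf_eq0 negb_or => /andP[].
- by move=> l; rewrite -res0_affmap // -(germ_res0 gz).
- by move=> l c; rewrite -res1_affmap // -(germ_res1 gz).
Unshelve. all: by end_near. Qed.

Lemma affine_point_symmetry (p : Z) T X M N :
  Omega (base p) -> Omega (row2 (T (base p)) (X (base p))) ->
  smooth_data (base p) T X M N -> (\forall z \near p, affine_symmetry T X M N z) ->
  point_symmetry Omega (evol A H0 H1) p (affmap T X M N).
Proof.
move=> Op Op' sd ns; have sf := smooth_affmap sd.
have Jnz z : smooth_data (base z) T X M N -> affine_symmetry T X M N z ->
    \det ('J (affmap T X M N) z) != 0.
  move=> sdz sz; rewrite det_affmap // (afs_Tx sz) mulr0 subr0.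
  by rewrite !mulf_neq0 //; [exact: afs_Tt sz|exact: afs_Xx sz|exact: afs_det sz].
have Ofp : Omega (base (affmap T X M N p)) by rewrite base_affmap.
split=> //; first exact: Jnz sd (nbhs_singleton ns).
have n1 := near_Omega_base Op; have n2 := near_Omega_image sf Ofp.
have n3 := near_base (smooth_data_near sd); have n4 := near_join ns.
have n5 := near_join n3.
near=> z; have sdz : smooth_data (base z) T X M N by near: z.
have nsz : \forall y \near z, affine_symmetry T X M N y by near: z.
have nsd : \forall y \near z, smooth_data (base y) T X M N by near: z.
have sz := nbhs_singleton nsz; have [sT sX sM sN] := sdz.
move=> u v; apply: (@residues_preserve _ _ _ z (smooth_affmap sdz) (Jnz z sdz sz) A H0 H1).
- move=> k; rewrite -(splitK k); rewrite affmapTE; case: (fintype.split k) => j /=; last first.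
    by move=> _; apply: filterS nsd => y [sTy _ _ _]; exact: dif_base_dv.
  move: j; apply: ord2P; rewrite ?eqxx // => _.
  by apply: filterS2 nsd nsz => y [sTy _ _ _] sy; rewrite dif_base // (afs_Tx sy).
- move=> b; rewrite affmapXE.
  by apply: filterS nsd => y [_ sXy _ _]; exact: dif_base_dv.
- by rewrite affmapXE dif_base //; exact: afs_Xx sz.
- by rewrite affmapXE affmapTE !dif_base // base_affmap; exact: afs_A sz.
- by move=> l; rewrite res0_affmap //; exact: afs_res0 sz _.
- by move=> l c; rewrite res1_affmap //; exact: afs_res1 sz _ _.
- by move=> l b c; rewrite affmapDE dif2_affine_dv.
Unshelve. all: by end_near. Qed.

End SymmetryIsAffine.

(** * Polynomial dependence on the fibre coordinates, and extension to whole fibres *)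

Section FiberPolynomials.
Context {R : realType} {m : nat}.
Implicit Types F G : 'rV[R]_m -> R.

(** Degree is measured along lines only. This suffices to propagate vanishing over a fibre and turns
    each closure property into an identity in one variable. *)
Record isaff F : Prop := IsAff { isaffE : forall u d,
  exists a b, forall s : R, F (u + s *: d) = a + b * s }.
Record isquad F : Prop := IsQuad { isquadE : forall u d,
  exists a b c, forall s : R, F (u + s *: d) = a + b * s + c * s ^+ 2 }.

Lemma isaff_cst c : isaff (fun=> c).
Proof. by split=> u d; exists c, 0 => s; rewrite mul0r addr0. Qed.
Lemma isaff_coord b : isaff (fun u => u 0 b).
Proof. by split=> u d; exists (u 0 b), (d 0 b) => s; rewrite !mxE mulrC. Qed.
Lemma isaffD F G : isaff F -> isaff G -> isaff (fun u => F u + G u).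
Proof.
move=> aF aG; split=> u d; have [a [b E]] := isaffE aF u d; have [a' [b' E']] := isaffE aG u d.
by exists (a + a'), (b + b') => s; rewrite E E'; ring.
Qed.
Lemma isaffM c F : isaff F -> isaff (fun u => c * F u).
Proof.
move=> aF; split=> u d; have [a [b E]] := isaffE aF u d.
by exists (c * a), (c * b) => s; rewrite E; ring.
Qed.
Lemma isaffMr c F : isaff F -> isaff (fun u => F u * c).
Proof. by move=> aF; under eq_fun do rewrite mulrC; exact: isaffM. Qed.
Lemma isaffN F : isaff F -> isaff (fun u => - F u).
Proof. by move=> aF; under eq_fun do rewrite -mulN1r; exact: isaffM. Qed.

Lemma isquadM F G : isaff F -> isaff G -> isquad (fun u => F u * G u).
Proof.
move=> aF aG; split=> u d; have [a [b E]] := isaffE aF u d; have [a' [b' E']] := isaffE aG u d.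
by exists (a * a'), (a * b' + b * a'), (b * b') => s; rewrite E E'; ring.
Qed.
Lemma isquad_aff F : isaff F -> isquad F.
Proof.
move=> aF; split=> u d; have [a [b E]] := isaffE aF u d.
by exists a, b, 0 => s; rewrite E; ring.
Qed.
Lemma isquadD F G : isquad F -> isquad G -> isquad (fun u => F u + G u).
Proof.
move=> aF aG; split=> u d; have [a [b [c E]]] := isquadE aF u d; have [a' [b' [c' E']]] := isquadE aG u d.
by exists (a + a'), (b + b'), (c + c') => s; rewrite E E'; ring.
Qed.
Lemma isquadZ c F : isquad F -> isquad (fun u => c * F u).
Proof.
move=> aF; split=> u d; have [a [b [c' E]]] := isquadE aF u d.
by exists (c * a), (c * b), (c * c') => s; rewrite E; ring.
Qed.
Lemma isquadN F : isquad F -> isquad (fun u => - F u).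
Proof. by move=> aF; under eq_fun do rewrite -mulN1r; exact: isquadZ. Qed.
Lemma isquad_sum n (F : 'I_n -> 'rV[R]_m -> R) :
  (forall i, isquad (F i)) -> isquad (fun u => \sum_i F i u).
Proof.
elim: n F => [|n IHn] F qF.
  by under eq_fun do rewrite big_ord0; apply: isquad_aff; exact: isaff_cst.
under eq_fun do rewrite big_ord_recl; apply: isquadD => //; exact: IHn.
Qed.
Lemma isaff_sum n (F : 'I_n -> 'rV[R]_m -> R) :
  (forall i, isaff (F i)) -> isaff (fun u => \sum_i F i u).
Proof.
elim: n F => [|n IHn] F qF.
  by under eq_fun do rewrite big_ord0; exact: isaff_cst.
under eq_fun do rewrite big_ord_recl; apply: isaffD => //; exact: IHn.
Qed.

(** On the line from [u0] to [u] the function is a quadratic polynomial in the parameter; its values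
    at 0, h and -h near [u0] kill the three coefficients, and [u] itself is the value at parameter
    1. *)
Lemma quad_eq0 F (u0 : 'rV[R]_m) : isquad F -> (\forall u \near u0, F u = 0) -> forall u, F u = 0.
Proof.
move=> qF /nbhs_ballP[r /= r0 rP] u; have [a [b [c E]]] := isquadE qF u0 (u - u0).
(* The summand 1 keeps [K] positive when [u = u0], and the factor 2 in [h] puts the points with
   parameter at most [h] strictly inside the ball of radius [r]. *)
pose K := 1 + `|u - u0|; have K0 : 0 < K by rewrite ltr_pwDl.
pose h := r / (2 * K).
have h0 : 0 < h by rewrite divr_gt0 // mulr_gt0.
have F0 s : `|s| <= h -> a + b * s + c * s ^+ 2 = 0.
  move=> sh; rewrite -E; apply: rP; rewrite -ball_normE /= opprD addrA subrr sub0r normrN normrZ.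
  apply: (@le_lt_trans _ _ (h * K)).
    by apply: ler_pM => //; rewrite lerDr.
  by rewrite /h invfM mulrA divfK ?lt0r_neq0 // ltr_pdivrMr // ltr_pMr // ltr1n.
have := F0 0; rewrite normr0 (ltW h0) => /(_ isT) e0.
have := F0 h; rewrite ger0_norm ?lexx ?(ltW h0) // => /(_ isT) e1.
have := F0 (- h); rewrite normrN ger0_norm ?lexx ?(ltW h0) // => /(_ isT) e2.
have hn : h != 0 by rewrite lt0r_neq0.
have a0 : a = 0 by move: e0; rewrite mulr0 expr0n mulr0 !addr0.
have b0 : b = 0 by apply: (mulIf hn); move: e1 e2; rewrite sqrrN mul0r; lra.
have c0 : c = 0.
  apply: (mulIf hn); apply: (mulIf hn); move: e1; rewrite a0 b0; lra.
by have := E 1; rewrite scale1r addrC subrK => ->; rewrite a0 b0 c0; ring.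
Qed.

Lemma near_fibers (p : 'rV[R]_(2 + m)) (P : 'rV[R]_(2 + m) -> Prop) :
  (\forall z \near p, P z) ->
  \forall w \near base p, \forall u \near dep p, P (row_mx w u).
Proof.
move=> /near_join nP; have : \forall w \near base p, \forall z \near row_mx w (dep p), P z.
  apply: (@near_section _ _ (base p) (dep p) (fun y => \forall z \near y, P z)).
  by rewrite row_base_dep.
apply: filterS => w; apply: (@near_comp _ _ _ (fun u => row_mx w u) (dep p) P) => a.
rewrite -(splitK a); case: (fintype.split a) => k /=.
  by under eq_fun do rewrite row_mxEl; exact: smooth_cst.
by under eq_fun do rewrite row_mxEr; exact: smooth_coord.
Qed.

Section AllFibers.
Variables (A : 'rV[R]_2 -> R) (H0 : 'I_m -> 'rV[R]_2 -> 'rV[R]_m -> R)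
  (H1 : 'I_m -> 'I_m -> 'rV[R]_2 -> 'rV[R]_m -> R).
Hypothesis quadH0 : forall l w, isquad (H0 l w).
Hypothesis affH1 : forall l c w, isaff (H1 l c w).
Variables (T X : 'rV[R]_2 -> R) (M : 'I_m -> 'I_m -> 'rV[R]_2 -> R)
  (N : 'I_m -> 'rV[R]_2 -> R).

Lemma isaff_affine M' N' w : isaff (fun u => affine M' N' (row_mx w u)).
Proof.
rewrite /affine; apply: isaffD; last first.
  by under eq_fun do rewrite base_row; exact: isaff_cst.
apply: isaff_sum => b; under eq_fun do rewrite base_row dep_row.
by apply: isaffM; exact: isaff_coord.
Qed.

Lemma dep_affmap_line w u d (s : R) : dep (affmap T X M N (row_mx w (u + s *: d))) =
  dep (affmap T X M N (row_mx w u)) + s *: \row_l \sum_b M l b w * d 0 b.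
Proof.
apply/rowP => l; rewrite depE affmapD mxE depE affmapD !base_row !dep_row.
rewrite [X in _ = _ + X]mxE [X in _ = _ + _ * X]mxE mulr_sumr.
rewrite addrAC -big_split /=; congr (_ + _); apply: eq_bigr => b _.
by rewrite mxE [X in _ * (_ + X)]mxE; ring.
Qed.

Lemma isaff_image F w : isaff F -> isaff (fun u => F (dep (affmap T X M N (row_mx w u)))).
Proof.
move=> aF; split=> u d; have [a [b E]] := isaffE aF (dep (affmap T X M N (row_mx w u))) (\row_l \sum_b M l b w * d 0 b).
by exists a, b => s; rewrite dep_affmap_line.
Qed.
Lemma isquad_image F w : isquad F -> isquad (fun u => F (dep (affmap T X M N (row_mx w u)))).
Proof.
move=> aF; split=> u d; have [a [b [c E]]] := isquadE aF (dep (affmap T X M N (row_mx w u))) (\row_l \sum_b M l b w * d 0 b).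
by exists a, b, c => s; rewrite dep_affmap_line.
Qed.

Lemma isquad_ares0 w l : isquad (fun u => ares0 A H0 H1 T X M N (row_mx w u) l).
Proof.
rewrite /ares0; under eq_fun do rewrite base_affmap base_row dep_row.
apply: isquadD; [apply: isquadD; [apply: isquadD; [apply: isquadD|]|]|].
- by apply: isquad_aff; exact: isaff_affine.
- by apply: isquadN; apply: isquad_sum => b; exact: isquadZ.
- by apply: isquadN; apply: isquad_aff; do 2!apply: isaffMr; exact: isaff_affine.
- by apply: isquadN; apply: isquad_aff; apply: isaffM; exact: isaff_affine.
apply: isquadZ; apply: isquadD; first exact: (isquad_image (F := H0 l _)).
apply: isquad_sum => d; apply: isquadM; first exact: (isaff_image (F := H1 l d _)).
by apply: isaffMr; exact: isaff_affine.
Qed.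

Lemma isaff_ares1 w l c : isaff (fun u => ares1 A H1 T X M N (row_mx w u) l c).
Proof.
rewrite /ares1; under eq_fun do rewrite base_affmap base_row dep_row.
apply: isaffD; [apply: isaffD; [apply: isaffD|]|].
- by apply: isaffN; apply: isaff_sum => b; exact: isaffM.
- exact: isaff_cst.
- exact: isaff_cst.
apply: isaffM; apply: isaff_sum => d; apply: isaffMr; exact: (isaff_image (F := H1 l d _)).
Qed.

(** The germ at [p] gives the conditions for fibre values near [dep p] only; since the residues are
    at most quadratic there, they vanish on the whole fibre. Afterwards nothing remembers the fibre
    coordinate of [p], which permits the comparison with an arbitrary [q] over the same point. *)
Lemma affine_symmetry_fibers p :
  (\forall z \near p, affine_symmetry A H0 H1 T X M N z) ->
  \forall w \near base p, forall u, affine_symmetry A H0 H1 T X M N (row_mx w u).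
Proof.
move=> /near_fibers; apply: filterS => w nu u.
have := nbhs_singleton nu; case; rewrite !base_row => Tx Tt Xx dM AX _ _.
split; rewrite ?base_row //.
  move=> l; move: u; apply: (quad_eq0 (isquad_ares0 w l)).
  by apply: filterS nu => u [].
move=> l c; move: u; apply: (quad_eq0 (isquad_aff (isaff_ares1 w l c))).
by apply: filterS nu => u [].
Qed.

Lemma affine_symmetry_base (p : 'rV[R]_(2 + m)) :
  (\forall w \near base p, forall u, affine_symmetry A H0 H1 T X M N (row_mx w u)) ->
  \forall z \near p, affine_symmetry A H0 H1 T X M N z.
Proof. by move=> /near_base; apply: filterS => z /(_ (dep z)); rewrite row_base_dep. Qed.

End AllFibers.
End FiberPolynomials.

(** * Composition with a map of the (t, x)-plane *)

Section BaseMaps.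
Context {R : realType}.
Variables (T X F : 'rV[R]_2 -> R) (w0 : 'rV[R]_2).
Hypothesis sT : smooth_at w0 T.
Hypothesis sX : smooth_at w0 X.
Hypothesis sF : smooth_at (row2 (T w0) (X w0)) F.

Let srow a : smooth_at w0 (fun w => row2 (T w) (X w) 0 a).
Proof.
by move: a; apply: ord2P; [under eq_fun do rewrite row2_it|under eq_fun do rewrite row2_ix].
Qed.

Lemma near_smooth_image : \forall w \near w0, smooth_at (row2 (T w) (X w)) F.
Proof.
apply: (@near_comp _ _ _ (fun w => row2 (T w) (X w)) w0 (fun y => smooth_at y F)) => //.
exact: smooth_near.
Qed.

Lemma smooth_image : smooth_at w0 (fun w => F (row2 (T w) (X w))).
Proof. exact: (smooth_comp (g := fun w => row2 (T w) (X w))). Qed.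

Lemma dif_image i : dif i (fun w => F (row2 (T w) (X w))) w0 =
  dif it F (row2 (T w0) (X w0)) * dif i T w0 + dif ix F (row2 (T w0) (X w0)) * dif i X w0.
Proof.
rewrite (@dif_comp _ _ _ _ _ F (fun w => row2 (T w) (X w))) // sum2E.
by under eq_fun do rewrite row2_it; under [X in _ + _ * dif _ X _ = _]eq_fun do rewrite row2_ix.
Qed.

End BaseMaps.

(** * The two systems as evolution systems with polynomial coefficients *)

Section TheTwoSystems.
Context {R : realType}.
Variables (A B C : 'rV[R]_2 -> R).

Definition i1 : 'I_3 := @Ordinal 3 0 isT.
Definition i2 : 'I_3 := @Ordinal 3 1 isT.
Definition i3 : 'I_3 := @Ordinal 3 2 isT.

Lemma ord3P (P : 'I_3 -> Prop) : P i1 -> P i2 -> P i3 -> forall i, P i.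
Proof.
move=> P1 P2 P3 i; have [->|->|->] // : [\/ i = i1, i = i2 | i = i3].
case: i => -[|[|[|//]]] Hi; [constructor 1|constructor 2|constructor 3]; exact: val_inj.
Qed.

Lemma sum3E (F : 'I_3 -> R) : \sum_k F k = F i1 + F i2 + F i3.
Proof.
rewrite !big_ord_recl big_ord0 addr0 addrA; congr (F _ + F _ + F _); exact: val_inj.
Qed.

Lemma sum1E (F : 'I_1 -> R) : \sum_k F k = F 0.
Proof. by rewrite big_ord_recl big_ord0 addr0. Qed.

Definition L0 (l : 'I_1) (w : 'rV[R]_2) (u : 'rV[R]_1) : R := - (C w * u 0 0).
Definition L1 (l c : 'I_1) (w : 'rV[R]_2) (u : 'rV[R]_1) : R := - B w.

Lemma eqL_evol : eqL A B C = evol A L0 L1.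
Proof.
apply/funext => l; apply/funext => J; rewrite /eqL /evol sum1E (ord1 l) /L0 /L1.
by set a := jt1 J; set b := jt2 J; ring.
Qed.

Definition D0 (l : 'I_3) (w : 'rV[R]_2) (g : 'rV[R]_3) : R :=
  let K := - (dif ix A w / A w * g 0 i1) - dif it A w / A w in
  [:: K * (g 0 i1 + B w) + dif ix B w * g 0 i1 + dif it B w;
      K * (g 0 i2 - C w) - dif ix C w * g 0 i1 - dif it C w;
      K * g 0 i3 - C w * g 0 i3]`_l.

(** The term 2 g1_x of the common factor of the three equations is counted here. It makes the first
    column depend on the unknowns and turns the coefficient -B of g1_x in the first equation into 2
    g1 + B. *)
Definition D1 (l c : 'I_3) (w : 'rV[R]_2) (g : 'rV[R]_3) : R :=
  (nth [::] [:: [:: 2 * g 0 i1 + B w; 2 * A w; 0];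
                [:: 2 * (g 0 i2 - C w); - B w; 0];
                [:: 2 * g 0 i3; 0; - B w]] l)`_c.

Lemma DE1_evol : DE1 A B C = evol A D0 D1.
Proof.
apply/funext => l; apply/funext => J; rewrite /DE1 /evol sum3E /D0 /D1 -!difE.
rewrite -/i1 -/i2 -/i3; set a := jt1 J; set b := jt2 J; set w := jt_base J; set g := jt0 J.
by move: l; apply: ord3P; rewrite /=; ring.
Qed.

Ltac aff_tac := repeat first
  [ apply: isaff_coord | apply: isaff_cst | apply: isaffN | apply: isaffM | apply: isaffMr
  | apply: isaffD ].

Lemma quad_L0 l w : isquad (L0 l w).
Proof. by rewrite /L0; apply: isquad_aff; aff_tac. Qed.
Lemma aff_L1 l c w : isaff (L1 l c w).
Proof. exact: isaff_cst. Qed.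

Lemma quad_D0 l w : isquad (D0 l w).
Proof.
rewrite /D0; move: l; apply: ord3P => /=;
  repeat first [apply: isquadM; aff_tac | apply: isquad_aff; by aff_tac | apply: isquadD
    | apply: isquadN].
Qed.
Lemma aff_D1 l c w : isaff (D1 l c w).
Proof. by rewrite /D1; move: l c; apply: ord3P; apply: ord3P => /=; aff_tac. Qed.

End TheTwoSystems.

(** * Point symmetries of the two systems *)

Section Classification.
Context {R : realType}.
Variables (A B C : 'rV[R]_2 -> R).
Implicit Types (T X : 'rV[R]_2 -> R).

(** Pull the equation back along (T, X): if u' solves it and v(t, x) = u'(T, X), then v_t = A v_xx +
    [drift] v_x + T_t C' v, where C' is [C] at the image point and the relation T_t A' = A X_x^2 has
    been used. *)
Definition drift T X (w : 'rV[R]_2) : R :=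
  (dif it T w * B (row2 (T w) (X w)) + dif it X w - A w * dif ix (dif ix X) w) / dif ix X w.

(** The last three conditions result from substituting v = U1 u + U0 into the pulled-back equation
    and comparing the coefficients of u_x, of u and of 1 when u_t is eliminated. *)
Record equivalence T X (U1 U0 : 'rV[R]_2 -> R) (w : 'rV[R]_2) : Prop := Equivalence {
  eqv_Tx : dif ix T w = 0;
  eqv_Tt : dif it T w != 0;
  eqv_Xx : dif ix X w != 0;
  eqv_U1 : U1 w != 0;
  eqv_A : A w * dif ix X w ^+ 2 = A (row2 (T w) (X w)) * dif it T w;
  eqv_B : U1 w * B w = 2 * A w * dif ix U1 w + drift T X w * U1 w;
  eqv_C : U1 w * C w = A w * dif ix (dif ix U1) w + drift T X w * dif ix U1 w
    + dif it T w * C (row2 (T w) (X w)) * U1 w - dif it U1 w;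
  eqv_0 : dif it U0 w = A w * dif ix (dif ix U0) w + drift T X w * dif ix U0 w
    + dif it T w * C (row2 (T w) (X w)) * U0 w }.

Lemma dep_affmapE m T X (M : 'I_m -> 'I_m -> 'rV[R]_2 -> R) N z l :
  dep (affmap T X M N z) 0 l = affine (M l) (N l) z.
Proof. by rewrite depE affmapD. Qed.

(** For a linear scalar equation [ares1] does not depend on u and [ares0] is affine in u, so the
    values u = 0 and u = 1 recover all conditions. *)
Lemma L_symmetryP T X (M : 'I_1 -> 'I_1 -> 'rV[R]_2 -> R) N w :
  (forall u, affine_symmetry A (L0 C) (L1 B) T X M N (row_mx w u)) <->
  equivalence T X (M 0 0) (N 0) w.
Proof.
have r0E u : ares0 A (L0 C) (L1 B) T X M N (row_mx w u) 0 =
    dif it (M 0 0) w * u 0 0 + dif it (N 0) w + M 0 0 w * C w * u 0 0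
    - (dif ix (M 0 0) w * u 0 0 + dif ix (N 0) w) / dif ix X w
       * (dif it X w - A w * dif ix (dif ix X) w)
    - A w * (dif ix (dif ix (M 0 0)) w * u 0 0 + dif ix (dif ix (N 0)) w)
    + dif it T w * (- C (row2 (T w) (X w)) * (M 0 0 w * u 0 0 + N 0 w)
       - B (row2 (T w) (X w)) * ((dif ix (M 0 0) w * u 0 0 + dif ix (N 0) w) / dif ix X w)).
  rewrite /ares0 /L0 /L1 !sum1E base_affmap dep_affmapE /affine !sum1E base_row dep_row; ring.
have r1E u : ares1 A (L1 B) T X M N (row_mx w u) 0 0 = M 0 0 w * B w
    - M 0 0 w / dif ix X w * (dif it X w - A w * dif ix (dif ix X) w)
    - 2 * A w * dif ix (M 0 0) w - dif it T w * B (row2 (T w) (X w)) * (M 0 0 w / dif ix X w).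
  rewrite /ares1 /L1 !sum1E base_affmap base_row; ring.
have detE : \det (\matrix_(b, l) M l b w) = M 0 0 w by rewrite det_mx11 mxE.
split=> [S|S].
  have := S 0; case; rewrite base_row detE => Tx Tt Xx U1n AX r0 r1.
  have := S (const_mx 1) => -[_ _ _ _ _ s0 _].
  have := r0 0; have := s0 0; have := r1 0 0; rewrite !r0E r1E !mxE => {s0 r0 r1} e1 e2 e3.
  by split=> //; rewrite /drift; [move: e1|move: e2 e3|move: e3]; lra.
case: S => Tx Tt Xx U1n AX eB eC e0 u.
split; rewrite ?base_row ?detE //.
  move=> l; rewrite (ord1 l) r0E; move: eC e0; rewrite /drift => eC e0.
  have {}eC := congr1 (fun t => t * u 0 0) eC.
  by move: eC e0; rewrite /=; lra.
move=> l c; rewrite (ord1 l) (ord1 c) r1E; move: eB; rewrite /drift; lra.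
Qed.

(** * Differentiation in the presence of the factor T_t, which does not depend on x *)

Section TimeScaling.
Variables (T : 'rV[R]_2 -> R) (w0 : 'rV[R]_2).
Hypothesis sT : smooth_at w0 T.
Hypothesis nT : \forall w \near w0, dif it T w != 0 /\ dif ix T w = 0.

Lemma near_Ttx : \forall w \near w0, dif ix (dif it T) w = 0.
Proof.
apply: filterS2 (near_join nT) (smooth_near sT) => w nTw sTw.
rewrite dif_swap // (@dif_near _ _ _ _ (fun=> 0)) ?dif_cst //.
by apply: filterS nTw => y [].
Qed.

Lemma near_Tt_x (F : 'rV[R]_2 -> R) : smooth_at w0 F ->
  \forall w \near w0, dif ix (fun w => dif it T w * F w) w = dif it T w * dif ix F w.
Proof.
move=> sF; apply: filterS3 (smooth_near sF) (smooth_near (smooth_dif it sT)) near_Ttx.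
by move=> w sFw sTw Ttx; rewrite difM // Ttx mul0r add0r.
Qed.

Lemma near_invTt_x (F : 'rV[R]_2 -> R) : smooth_at w0 F ->
  \forall w \near w0, dif ix (fun w => (dif it T w)^-1 * F w) w = (dif it T w)^-1 * dif ix F w.
Proof.
move=> sF; have n1 := smooth_near sF; have n2 := smooth_near (smooth_dif it sT).
have n3 := near_Ttx; near=> w.
have [Tt _] : dif it T w != 0 /\ dif ix T w = 0 by near: w.
have sTt : smooth_at w (dif it T) by near: w.
have Ttx : dif ix (dif it T) w = 0 by near: w.
rewrite difM; [|exact: smoothV|by near: w].
by rewrite difV // Ttx oppr0 !mul0r add0r.
Unshelve. all: by end_near. Qed.

Lemma near_invTt2_x (F : 'rV[R]_2 -> R) : smooth_at w0 F ->
  \forall w \near w0, dif ix (dif ix (fun w => (dif it T w)^-1 * F w)) w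
    = (dif it T w)^-1 * dif ix (dif ix F) w.
Proof.
move=> sF; have n1 := near_join (near_invTt_x sF); have n2 := near_invTt_x (smooth_dif ix sF).
near=> w; transitivity (dif ix (fun w => (dif it T w)^-1 * dif ix F w) w); last by near: w.
by apply: dif_near; near: w.
Unshelve. all: by end_near. Qed.

Lemma near_invTt_t (F : 'rV[R]_2 -> R) : smooth_at w0 F ->
  \forall w \near w0, dif it (fun w => (dif it T w)^-1 * F w) w
    = (dif it T w)^-1 * (dif it F w - dif it (dif it T) w * (dif it T w)^-1 * F w).
Proof.
move=> sF; have n1 := smooth_near sF; have n2 := smooth_near (smooth_dif it sT).
near=> w; have [Tt _] : dif it T w != 0 /\ dif ix T w = 0 by near: w.
have sTt : smooth_at w (dif it T) by near: w.
rewrite difM; [|exact: smoothV|by near: w].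
by rewrite difV //; field.
Unshelve. all: by end_near. Qed.

(** All entries of the induced map have the form h / T_t. The factor passes through x-derivatives
    because T_tx = 0, while the t-derivative produces a term with T_tt. *)
Lemma near_scaled (F h : 'rV[R]_2 -> R) : smooth_at w0 h ->
  (\forall w \near w0, F w = (dif it T w)^-1 * h w) ->
  \forall w \near w0, [/\ F w = (dif it T w)^-1 * h w,
    dif ix F w = (dif it T w)^-1 * dif ix h w,
    dif ix (dif ix F) w = (dif it T w)^-1 * dif ix (dif ix h) w
    & dif it F w = (dif it T w)^-1 * (dif it h w - dif it (dif it T) w * (dif it T w)^-1 * h w)].
Proof.
move=> sh Fh; have n1 := near_invTt_x sh; have n2 := near_invTt2_x sh; have n3 := near_invTt_t sh.
have m1 := near_dif ix Fh; have m2 := near_dif ix m1; have m3 := near_dif it Fh.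
near=> w; split; first by near: w.
- transitivity (dif ix (fun w => (dif it T w)^-1 * h w) w); by near: w.
- transitivity (dif ix (dif ix (fun w => (dif it T w)^-1 * h w)) w); by near: w.
- transitivity (dif it (fun w => (dif it T w)^-1 * h w) w); by near: w.
Unshelve. all: by end_near. Qed.

End TimeScaling.

(** * Recovering a symmetry of [eqL] from a symmetry of [DE1] *)

Section DataOfSymmetry.
Variables (T X : 'rV[R]_2 -> R) (M : 'I_3 -> 'I_3 -> 'rV[R]_2 -> R)
  (N : 'I_3 -> 'rV[R]_2 -> R).

Notation DE_symmetry := (fun w => forall u,
  affine_symmetry A (D0 A B C) (D1 A B C) T X M N (row_mx w u)).

Section AtPoint.
Variable w : 'rV[R]_2.
Hypothesis S : DE_symmetry w.

Let g0 : 'rV[R]_3 := row3 0 0 0.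
Let Tt := afs_Tt (S g0).
Let Xx := afs_Xx (S g0).

Lemma ares1E l c (u : 'rV[R]_3) : ares1 A (D1 A B C) T X M N (row_mx w u) l c =
  - (M l i1 w * D1 A B C i1 c w u + M l i2 w * D1 A B C i2 c w u + M l i3 w * D1 A B C i3 c w u)
  - M l c w / dif ix X w * (dif it X w - A w * dif ix (dif ix X) w)
  - 2 * A w * dif ix (M l c) w
  + dif it T w * (
     let w' := row2 (T w) (X w) in
     let u' := \row_l (M l i1 w * u 0 i1 + M l i2 w * u 0 i2 + M l i3 w * u 0 i3 + N l w) in
     D1 A B C l i1 w' u' * (M i1 c w / dif ix X w) + D1 A B C l i2 w' u' * (M i2 c w / dif ix X w)
     + D1 A B C l i3 w' u' * (M i3 c w / dif ix X w)).
Proof.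
rewrite /ares1 !sum3E base_affmap base_row dep_row.
suff -> : dep (affmap T X M N (row_mx w u)) = \row_l (M l i1 w * u 0 i1 + M l i2 w * u 0 i2
   + M l i3 w * u 0 i3 + N l w) by [].
by apply/rowP => k; rewrite dep_affmapE /affine sum3E base_row dep_row mxE.
Qed.

Lemma ares0E l (u : 'rV[R]_3) : ares0 A (D0 A B C) (D1 A B C) T X M N (row_mx w u) l =
  let V d := dif ix (M d i1) w * u 0 i1 + dif ix (M d i2) w * u 0 i2 + dif ix (M d i3) w * u 0 i3
     + dif ix (N d) w in
  let w' := row2 (T w) (X w) in
  let u' := \row_l (M l i1 w * u 0 i1 + M l i2 w * u 0 i2 + M l i3 w * u 0 i3 + N l w) in
  dif it (M l i1) w * u 0 i1 + dif it (M l i2) w * u 0 i2 + dif it (M l i3) w * u 0 i3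
  + dif it (N l) w
  - (M l i1 w * D0 A B C i1 w u + M l i2 w * D0 A B C i2 w u + M l i3 w * D0 A B C i3 w u)
  - V l / dif ix X w * (dif it X w - A w * dif ix (dif ix X) w)
  - A w * (dif ix (dif ix (M l i1)) w * u 0 i1 + dif ix (dif ix (M l i2)) w * u 0 i2
      + dif ix (dif ix (M l i3)) w * u 0 i3 + dif ix (dif ix (N l)) w)
  + dif it T w * (D0 A B C l w' u' + (D1 A B C l i1 w' u' * (V i1 / dif ix X w)
     + D1 A B C l i2 w' u' * (V i2 / dif ix X w) + D1 A B C l i3 w' u' * (V i3 / dif ix X w))).
Proof.
rewrite /ares0 /affine !sum3E base_affmap base_row dep_row.
suff -> : dep (affmap T X M N (row_mx w u)) = \row_l (M l i1 w * u 0 i1 + M l i2 w * u 0 i2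
   + M l i3 w * u 0 i3 + N l w) by [].
by apply/rowP => k; rewrite dep_affmapE /affine sum3E base_row dep_row mxE.
Qed.

(** The part of the residue (1, c) linear in the unknowns is 2 (M u)_1 times (T_t M_1c / X_x -
    delta_c1). Invertibility of M provides a [d] with M_1d nonzero, and the difference of the values
    at the unit vector [d] and at 0 isolates the second factor. *)
Lemma DE_M1 c : M i1 c w * dif it T w = (c == i1)%:R * dif ix X w.
Proof.
have [d Md] : exists d, M i1 d w != 0.
  apply/not_existsP => H; have := afs_det (S g0); rewrite base_row (expand_det_col _ i1) big1 ?eqxx //.
  by move=> d _; rewrite mxE; have /negP := H d; rewrite negbK => /eqP ->; rewrite mul0r.
have E1 (u : 'rV[R]_3) := afs_res1 (S u) i1 c.
have key : M i1 d w * (M i1 c w * dif it T w / dif ix X w - (c == i1)%:R) = 0.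
  have := E1 (\row_k (k == d)%:R); have := E1 0.
  rewrite !ares1E; move: Xx; rewrite base_row => Xx'.
  by move: d c {E1 Md}; apply: ord3P; apply: ord3P; rewrite /D1 /= !mxE /=; lra.
move/eqP: key; rewrite mulf_eq0 (negbTE Md) /= subr_eq0 => /eqP <-.
by move: Xx; rewrite base_row => Xx'; field.
Qed.

End AtPoint.

Definition log_x (U : 'rV[R]_2 -> R) w : R := dif ix U w / U w.
Definition log_t (U : 'rV[R]_2 -> R) w : R := dif it U w / U w.

(* For an equivalence (T, X, U1 u + U0) of L these are the coefficients of the
   induced map of the operators d_t + g1 d_x + (g2 u + g3) d_u, pushed forward
   and normalized to have coefficient 1 at d_t. *)
Definition indM T X (U1 U0 : 'rV[R]_2 -> R) (l b : 'I_3) (w : 'rV[R]_2) : R :=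
  (dif it T w)^-1 * (nth [::] [:: [:: dif ix X w; 0; 0]; [:: log_x U1 w; 1; 0];
     [:: dif ix U0 w - log_x U1 w * U0 w; - U0 w; U1 w]] l)`_b.
Definition indN T X (U1 U0 : 'rV[R]_2 -> R) (l : 'I_3) (w : 'rV[R]_2) : R :=
  (dif it T w)^-1 * [:: dif it X w; log_t U1 w; dif it U0 w - log_t U1 w * U0 w]`_l.

Section Near.
Variable w0 : 'rV[R]_2.
Hypothesis sd : smooth_data w0 T X M N.
Hypothesis sA : smooth_at w0 A.
Hypothesis sA' : smooth_at (row2 (T w0) (X w0)) A.
Hypothesis A0 : \forall w \near w0, A w != 0.
Hypothesis S : \forall w \near w0, DE_symmetry w.

Let sT : smooth_at w0 T. Proof. by case: sd. Qed.
Let sX : smooth_at w0 X. Proof. by case: sd. Qed.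
Let sM l b : smooth_at w0 (M l b). Proof. by case: sd. Qed.
Let sN l : smooth_at w0 (N l). Proof. by case: sd. Qed.

Definition pulled_U1 w : R := dif it T w * M i3 i3 w.
Definition pulled_U0 w : R := - (dif it T w * M i3 i2 w).

Lemma near_M1 : \forall w \near w0, [/\ M i1 i1 w = (dif it T w)^-1 * dif ix X w,
  M i1 i2 w = 0 & M i1 i3 w = 0].
Proof.
apply: filterS S => w Sw; have := afs_Tt (Sw 0); rewrite base_row => Tt.
have E c : M i1 c w = (c == i1)%:R * dif ix X w / dif it T w.
  by apply: (mulIf Tt); rewrite (DE_M1 Sw) divfK.
by split; rewrite E /=; [rewrite mulrC mul1r|rewrite !mul0r|rewrite !mul0r].
Qed.

Lemma near_basic : \forall w \near w0, [/\ dif it T w != 0, dif ix X w != 0, dif ix T w = 0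
  & A w * dif ix X w ^+ 2 = A (row2 (T w) (X w)) * dif it T w].
Proof. by apply: filterS S => w /(_ 0)[]; rewrite base_row. Qed.

Let nT : \forall w \near w0, dif it T w != 0 /\ dif ix T w = 0.
Proof. by apply: filterS near_basic => w []. Qed.

(** The first row being known, the residues (1, 3) and (1, 2) at 0 contain M_23 and M_22 multiplied
    by the nonzero value of [A] at the image point, and the residue (3, 3) is the condition on
    [B]. *)
Lemma near_MB : \forall w \near w0, [/\ M i2 i2 w = (dif it T w)^-1, M i2 i3 w = 0
  & M i3 i3 w * B w = 2 * A w * dif ix (M i3 i3) w + drift T X w * M i3 i3 w].
Proof.
have n1 := near_join near_M1; have n2 := near_basic.
near=> w; have n1w : \forall w \near w, [/\ M i1 i1 w = (dif it T w)^-1 * dif ix X w,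
  M i1 i2 w = 0 & M i1 i3 w = 0] by near: w.
have [Tt Xx _ AX] : [/\ dif it T w != 0, dif ix X w != 0, dif ix T w = 0
  & A w * dif ix X w ^+ 2 = A (row2 (T w) (X w)) * dif it T w] by near: w.
have Aw : A w != 0 by near: w.
have Sw : DE_symmetry w by near: w.
have [M11 M12 M13] := nbhs_singleton n1w.
have M12x : dif ix (M i1 i2) w = 0.
  by rewrite (@dif_near _ _ _ _ (fun=> 0)) ?dif_cst //; apply: filterS n1w => y [].
have M13x : dif ix (M i1 i3) w = 0.
  by rewrite (@dif_near _ _ _ _ (fun=> 0)) ?dif_cst //; apply: filterS n1w => y [].
have A' : A (row2 (T w) (X w)) = A w * dif ix X w ^+ 2 / dif it T w by rewrite AX mulfK.
have A'0 : A (row2 (T w) (X w)) != 0 by rewrite A' !mulf_neq0 ?invr_eq0 ?expf_neq0.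
have := afs_res1 (Sw 0) i1 i3; have := afs_res1 (Sw 0) i1 i2; have := afs_res1 (Sw 0) i3 i3.
rewrite !ares1E /D1 /= !mxE /= M12 M13 M12x M13x M11 => e33 e12 e13.
have M23 : M i2 i3 w = 0.
  apply: (mulfI (mulf_neq0 (mulf_neq0 Tt A'0) (invr_neq0 Xx))); move: e13; lra.
split=> //; last by move: e33; rewrite /drift M23; lra.
apply: (mulfI (mulf_neq0 Aw Xx)); have : dif it T w * (A (row2 (T w) (X w)) * (M i2 i2 w / dif ix X w))
   = A w * ((dif it T w)^-1 * dif ix X w) by move: e12; lra.
rewrite A' => H; transitivity (dif it T w * (A w * dif ix X w ^+ 2 / dif it T w * (M i2 i2 w / dif ix X w))).
  by field; rewrite Tt Xx.
by rewrite H; ring.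
Unshelve. all: by end_near. Qed.

Lemma det_lower (w : 'rV[R]_2) : M i1 i2 w = 0 -> M i1 i3 w = 0 -> M i2 i3 w = 0 ->
  \det (\matrix_(b, l) M l b w) = M i1 i1 w * M i2 i2 w * M i3 i3 w.
Proof.
move=> M12 M13 M23; rewrite -det_tr det_trig; last first.
  by apply/is_trig_mxP; apply: ord3P; apply: ord3P => //; rewrite !mxE.
rewrite !big_ord_recl big_ord0 mulr1 mulrA !mxE.
by congr (M _ _ w * M _ _ w * M _ _ w); exact: val_inj.
Qed.

(** The residues (2, 2), (3, 2) and (1, 1) at 0 are solved for M_21, M_31 and N_1. The value of [B]
    at the image point is first expressed through [drift], and [drift] through the condition from
    [near_MB]. *)
Lemma near_MC : \forall w \near w0, [/\ M i2 i1 w = (dif it T w)^-1 * log_x pulled_U1 w,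
  N i1 w = (dif it T w)^-1 * dif it X w,
  M i3 i1 w = (dif it T w)^-1 * (dif ix pulled_U0 w - log_x pulled_U1 w * pulled_U0 w) & pulled_U1 w != 0].
Proof.
have n1 := near_join near_M1; have n1' := near_join near_MB; have n2 := near_basic.
have n3 := near_Tt_x sT nT (sM i3 i3); have n4 := near_Tt_x sT nT (sM i3 i2).
have n5 := near_invTt_x sT nT (smooth_dif ix sX); have n6 := near_invTt_x sT nT (smooth_cst w0 1).
have n7 := smooth_near (smoothM (smooth_dif it sT) (sM i3 i2)).
near=> w; have n1w : \forall w \near w, [/\ M i1 i1 w = (dif it T w)^-1 * dif ix X w,
  M i1 i2 w = 0 & M i1 i3 w = 0] by near: w.
have n1'w : \forall w \near w, [/\ M i2 i2 w = (dif it T w)^-1, M i2 i3 w = 0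
  & M i3 i3 w * B w = 2 * A w * dif ix (M i3 i3) w + drift T X w * M i3 i3 w] by near: w.
have [Tt Xx _ AX] : [/\ dif it T w != 0, dif ix X w != 0, dif ix T w = 0
  & A w * dif ix X w ^+ 2 = A (row2 (T w) (X w)) * dif it T w] by near: w.
have Aw : A w != 0 by near: w.
have Sw : DE_symmetry w by near: w.
have [M11 M12 M13] := nbhs_singleton n1w; have [M22 M23 eB] := nbhs_singleton n1'w.
have M12x : dif ix (M i1 i2) w = 0.
  by rewrite (@dif_near _ _ _ _ (fun=> 0)) ?dif_cst //; apply: filterS n1w => y [].
have M23x : dif ix (M i2 i3) w = 0.
  by rewrite (@dif_near _ _ _ _ (fun=> 0)) ?dif_cst //; apply: filterS n1'w => y [].
have M11x : dif ix (M i1 i1) w = (dif it T w)^-1 * dif ix (dif ix X) w.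
  transitivity (dif ix (fun w => (dif it T w)^-1 * dif ix X w) w); last by near: w.
  by apply: dif_near; apply: filterS n1w => y [].
have M22x : dif ix (M i2 i2) w = 0.
  transitivity (dif ix (fun w => (dif it T w)^-1 * 1) w).
    by apply: dif_near; apply: filterS n1'w => y [-> _ _]; rewrite mulr1.
  transitivity ((dif it T w)^-1 * dif ix (fun=> 1) w); first by near: w.
  by rewrite dif_cst mulr0.
have U1x : dif ix pulled_U1 w = dif it T w * dif ix (M i3 i3) w by near: w.
have U0x : dif ix pulled_U0 w = - (dif it T w * dif ix (M i3 i2) w).
  by rewrite /pulled_U0 difN; [congr (- _); near: w|near: w].
have A' : A (row2 (T w) (X w)) = A w * dif ix X w ^+ 2 / dif it T w by rewrite AX mulfK.
have M33 : M i3 i3 w != 0.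
  have := afs_det (Sw 0); rewrite base_row det_lower // mulf_eq0 negb_or => /andP[].
  by [].
have := afs_res1 (Sw 0) i1 i1; have := afs_res1 (Sw 0) i2 i2; have := afs_res1 (Sw 0) i3 i2.
rewrite !ares1E /D1 /= !mxE /= M12 M13 M23 M11 M22 M11x M22x => e32 e22 e11.
have B' : B (row2 (T w) (X w)) = (drift T X w * dif ix X w - dif it X w
    + A w * dif ix (dif ix X) w) / dif it T w.
  by rewrite /drift; field; rewrite Tt Xx.
have dE : drift T X w = B w - 2 * A w * dif ix (M i3 i3) w / M i3 i3 w.
  by apply: (mulIf M33); rewrite mulrBl divfK // -[in RHS](mulrC (M i3 i3 w)) eB; ring.
have two : 2 != 0 :> R by rewrite pnatr_eq0.
have M21 : M i2 i1 w = (dif it T w)^-1 * log_x pulled_U1 w.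
  apply: (mulfI (mulf_neq0 two Aw)); rewrite /log_x U1x /pulled_U1.
  (* After multiplication by 2 A the difference of the two sides is minus the residue [e22], so the
     zero on the right is replaced by that residue and a rational identity remains. *)
  by apply/eqP; rewrite -subr_eq0 -oppr_eq0 -[X in _ == X]e22; apply/eqP; rewrite B' dE; field; rewrite Tt Xx M33.
split=> //.
- apply: (mulfI (mulf_neq0 two (invr_neq0 Tt))); apply: (mulIf Tt).
  apply/eqP; rewrite -subr_eq0 -[X in _ == X]e11; apply/eqP.
  by rewrite B' dE A' M21 /log_x U1x /pulled_U1; field; rewrite Tt Xx M33.
- apply: (mulfI (mulf_neq0 two Aw)); rewrite /log_x U1x U0x /pulled_U1 /pulled_U0.
  by apply/eqP; rewrite -subr_eq0 -oppr_eq0 -[X in _ == X]e32; apply/eqP; rewrite B' dE; field; rewrite Tt Xx M33.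
- by rewrite /pulled_U1 mulf_neq0.
Unshelve. all: by end_near. Qed.

(** The free term of the third equation yields the conditions on [C] and on U0. Once they are known,
    the residues (2, 1) and (3, 1) at 0 are solved for N_2 and N_3. *)
Lemma near_MD : \forall w \near w0, [/\ N i2 w = (dif it T w)^-1 * log_t pulled_U1 w,
  N i3 w = (dif it T w)^-1 * (dif it pulled_U0 w - log_t pulled_U1 w * pulled_U0 w)
  & equivalence T X pulled_U1 pulled_U0 w].
Proof.
have sU1 : smooth_at w0 pulled_U1 by apply: smoothM => //; exact: smooth_dif.
have sU0 : smooth_at w0 pulled_U0 by apply: smoothN; apply: smoothM => //; exact: smooth_dif.
have n1 := near_join near_M1; have n1' := near_join near_MB; have n2 := near_join near_basic.
have n0 := near_join near_MC; have nt := near_Ttx.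
have n3 := smooth_near (smooth_dif it sT).
have U1n : pulled_U1 w0 != 0 by have [] := nbhs_singleton near_MC.
have slam : smooth_at w0 (log_x pulled_U1).
  by apply: smoothM; [exact: smooth_dif|exact: smoothV].
have n4 := near_invTt_x sT nT slam.
have n5 := near_invTt_x sT nT (smoothB (smooth_dif ix sU0) (smoothM slam sU0)).
have n6 := near_invTt_x sT nT (smooth_dif it sX).
have n7 := near_Tt_x sT nT (sM i3 i3).
have s1 := smooth_near sU1; have s2 := smooth_near sU0; have s3 := smooth_near slam.
have n8 := near_invTt2_x sT nT sU1; have n9 := near_invTt2_x sT nT sU0.
have n10 := near_invTt_t sT nT sU1; have n11 := near_invTt_t sT nT sU0.
have n12 := near_smooth_image sT sX sA'; have s4 := smooth_near sA.
have s5 := smooth_near sX; have s6 := smooth_near sT.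
near=> w; have [[Tt Xx Tx AX] n2w] : [/\ dif it T w != 0, dif ix X w != 0, dif ix T w = 0
    & A w * dif ix X w ^+ 2 = A (row2 (T w) (X w)) * dif it T w] /\
  \forall w \near w, [/\ dif it T w != 0, dif ix X w != 0, dif ix T w = 0
  & A w * dif ix X w ^+ 2 = A (row2 (T w) (X w)) * dif it T w].
  have H : \forall w \near w, [/\ dif it T w != 0, dif ix X w != 0, dif ix T w = 0
    & A w * dif ix X w ^+ 2 = A (row2 (T w) (X w)) * dif it T w] by near: w.
  by split=> //; exact: nbhs_singleton H.
have n1w : \forall w \near w, [/\ M i1 i1 w = (dif it T w)^-1 * dif ix X w,
  M i1 i2 w = 0 & M i1 i3 w = 0] by near: w.
have n1'w : \forall w \near w, [/\ M i2 i2 w = (dif it T w)^-1, M i2 i3 w = 0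
  & M i3 i3 w * B w = 2 * A w * dif ix (M i3 i3) w + drift T X w * M i3 i3 w] by near: w.
have n0w : \forall w \near w, [/\ M i2 i1 w = (dif it T w)^-1 * log_x pulled_U1 w,
  N i1 w = (dif it T w)^-1 * dif it X w,
  M i3 i1 w = (dif it T w)^-1 * (dif ix pulled_U0 w - log_x pulled_U1 w * pulled_U0 w) & pulled_U1 w != 0] by near: w.
have Aw : A w != 0 by near: w.
have Sw : DE_symmetry w by near: w.
have [M11 M12 M13] := nbhs_singleton n1w; have [M22 M23 eB] := nbhs_singleton n1'w.
have [M21 N1 M31 U1w] := nbhs_singleton n0w.
have [sTw sXw sAw sA'w] : [/\ smooth_at w T, smooth_at w X, smooth_at w A
  & smooth_at (row2 (T w) (X w)) A] by split; near: w.
have [sTtw sU1w sU0w slw] : [/\ smooth_at w (dif it T), smooth_at w pulled_U1, smooth_at w pulled_U0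
  & smooth_at w (log_x pulled_U1)] by split; near: w.
have M21x : dif ix (M i2 i1) w = (dif it T w)^-1 * dif ix (log_x pulled_U1) w.
  transitivity (dif ix (fun w => (dif it T w)^-1 * log_x pulled_U1 w) w); last by near: w.
  by apply: dif_near; apply: filterS n0w => y [].
have M31x : dif ix (M i3 i1) w = (dif it T w)^-1 * dif ix (fun w => dif ix pulled_U0 w - log_x pulled_U1 w * pulled_U0 w) w.
  transitivity (dif ix (fun w => (dif it T w)^-1 * (dif ix pulled_U0 w - log_x pulled_U1 w * pulled_U0 w)) w).
    by apply: dif_near; apply: filterS n0w => y [].
  by near: w.
have N1x : dif ix (N i1) w = (dif it T w)^-1 * dif ix (dif it X) w.
  transitivity (dif ix (fun w => (dif it T w)^-1 * dif it X w) w); last by near: w.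
  by apply: dif_near; apply: filterS n0w => y [].
have lx : dif ix (log_x pulled_U1) w = dif ix (dif ix pulled_U1) w / pulled_U1 w - (dif ix pulled_U1 w / pulled_U1 w) ^+ 2.
  rewrite /log_x difM; [|exact: smooth_dif|exact: smoothV].
  by rewrite difV //; field.
have px : dif ix (fun w => dif ix pulled_U0 w - log_x pulled_U1 w * pulled_U0 w) w
   = dif ix (dif ix pulled_U0) w - dif ix (log_x pulled_U1) w * pulled_U0 w - log_x pulled_U1 w * dif ix pulled_U0 w.
  rewrite difB; [|exact: smooth_dif|exact: smoothM].
  by rewrite difM // opprD addrA.
have M33e : \forall w \near w, M i3 i3 w = (dif it T w)^-1 * pulled_U1 w.
  by apply: filterS n2w => y [Ty _ _ _]; rewrite /pulled_U1 mulKf.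
have M32e : \forall w \near w, M i3 i2 w = - ((dif it T w)^-1 * pulled_U0 w).
  by apply: filterS n2w => y [Ty _ _ _]; rewrite /pulled_U0 mulrN opprK mulKf.
have sk : smooth_at w (fun w => (dif it T w)^-1) by exact: smoothV.
have M33 := nbhs_singleton M33e; have M32 := nbhs_singleton M32e.
have M33x : dif ix (M i3 i3) w = (dif it T w)^-1 * dif ix pulled_U1 w.
  by rewrite (dif_near _ M33e); near: w; exact: (near_invTt_x sT nT).
have M33xx : dif ix (dif ix (M i3 i3)) w = (dif it T w)^-1 * dif ix (dif ix pulled_U1) w.
  by rewrite (dif_near _ (near_dif ix M33e)); near: w.
have M33t : dif it (M i3 i3) w = (dif it T w)^-1 * (dif it pulled_U1 w - dif it (dif it T) w * (dif it T w)^-1 * pulled_U1 w).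
  by rewrite (dif_near _ M33e); near: w.
have skU0 : smooth_at w (fun w => (dif it T w)^-1 * pulled_U0 w) by exact: smoothM.
have M32x : dif ix (M i3 i2) w = - ((dif it T w)^-1 * dif ix pulled_U0 w).
  by rewrite (dif_near _ M32e) difN //; congr (- _); near: w; exact: (near_invTt_x sT nT).
have M32xx : dif ix (dif ix (M i3 i2)) w = - ((dif it T w)^-1 * dif ix (dif ix pulled_U0) w).
  transitivity (- dif ix (dif ix (fun w => (dif it T w)^-1 * pulled_U0 w)) w); last first.
    by congr (- _); near: w.
  rewrite (dif_near _ (near_dif ix M32e)) -difN; last exact: smooth_dif.
  by apply: dif_near; apply: filterS (smooth_near skU0) => y; exact: difN.
have M32t : dif it (M i3 i2) w = - ((dif it T w)^-1 * (dif it pulled_U0 w - dif it (dif it T) w * (dif it T w)^-1 * pulled_U0 w)).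
  by rewrite (dif_near _ M32e) difN //; congr (- _); near: w.
have A' : A (row2 (T w) (X w)) = A w * dif ix X w ^+ 2 / dif it T w by rewrite AX mulfK.
(* [DE1] contains A_t / A, so the value of A_t at the image point is needed; it comes from
   differentiating the relation A X_x^2 = A' T_t in t. *)
have A't : dif it A (row2 (T w) (X w)) * dif it T w =
   (dif it A w * dif ix X w ^+ 2 + 2 * A w * dif ix X w * dif ix (dif it X) w
    - A (row2 (T w) (X w)) * dif it (dif it T) w) / dif it T w
   - dif ix A (row2 (T w) (X w)) * dif it X w.
  have : dif it (fun w => A w * (dif ix X w * dif ix X w)) w
      = dif it (fun w => A (row2 (T w) (X w)) * dif it T w) w.
    by apply: dif_near; apply: filterS n2w => y [_ _ _ <-]; rewrite expr2.
  have sXx : smooth_at w (dif ix X) by exact: smooth_dif.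
  have sAi : smooth_at w (fun w => A (row2 (T w) (X w))) by exact: smooth_image.
  rewrite !difM //; last exact: smoothM.
  rewrite dif_image // (dif_swap it ix sXw) => E.
  apply: (mulIf Tt); rewrite mulrBl divfK //; move: E; lra.
have M13x : dif ix (M i1 i3) w = 0.
  by rewrite (@dif_near _ _ _ _ (fun=> 0)) ?dif_cst //; apply: filterS n1w => y [].
have M12x : dif ix (M i1 i2) w = 0.
  by rewrite (@dif_near _ _ _ _ (fun=> 0)) ?dif_cst //; apply: filterS n1w => y [].
have dE : drift T X w = B w - 2 * A w * dif ix pulled_U1 w / pulled_U1 w.
  apply: (mulIf U1w); apply: (mulfI (invr_neq0 Tt)); rewrite mulrBl divfK //.
  by move: eB; rewrite M33 M33x; lra.
have B' : B (row2 (T w) (X w)) = (drift T X w * dif ix X w - dif it X w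
    + A w * dif ix (dif ix X) w) / dif it T w.
  by rewrite /drift; field; rewrite Tt Xx.
(* With g1 = 0 the third residue is affine in g2 and g3. The difference with [r0] thus isolates the
   coefficient of g3, which is the condition on [C], or that of g2, which is the equation for U0. *)
have r0 := afs_res0 (Sw (row3 0 0 0)) i3; have r3 := afs_res0 (Sw (row3 0 0 1)) i3.
have r2 := afs_res0 (Sw (row3 0 1 0)) i3.
have := afs_res1 (Sw 0) i2 i1; have := afs_res1 (Sw 0) i3 i1; move: r0 r2 r3.
rewrite !ares1E !ares0E /D1 /D0 /= !mxE /=.
rewrite M12 M13 M23 M12x M13x.
rewrite M11 M22 M21 M31 M33 M32 N1.
rewrite M21x M31x N1x M33x M33xx M33t M32x M32xx M32t px lx.
move=> r0 r2 r3 e31 e21.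
have {}A't : dif it A (row2 (T w) (X w)) =
   ((dif it A w * dif ix X w ^+ 2 + 2 * A w * dif ix X w * dif ix (dif it X) w
    - A (row2 (T w) (X w)) * dif it (dif it T) w) / dif it T w
   - dif ix A (row2 (T w) (X w)) * dif it X w) / dif it T w.
  by rewrite -A't mulfK.
have nz := (Tt, Xx, U1w, Aw).
have eC : pulled_U1 w * C w = A w * dif ix (dif ix pulled_U1) w + drift T X w * dif ix pulled_U1 w
    + dif it T w * C (row2 (T w) (X w)) * pulled_U1 w - dif it pulled_U1 w.
  have E := etrans (congr2 (fun a b => a - b) r3 r0) (subrr 0).
  apply: (mulfI (invr_neq0 Tt)); apply/eqP; rewrite -subr_eq0 -[X in _ == X]E; apply/eqP.
  by rewrite A't B' A' dE /log_x; field; rewrite !nz.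
have e0 : dif it pulled_U0 w = A w * dif ix (dif ix pulled_U0) w + drift T X w * dif ix pulled_U0 w
    + dif it T w * C (row2 (T w) (X w)) * pulled_U0 w.
  have E := etrans (congr2 (fun a b => a - b) r2 r0) (subrr 0).
  apply: (mulfI (invr_neq0 Tt)); apply/eqP; rewrite -subr_eq0 -oppr_eq0 -[X in _ == X]E; apply/eqP.
  by rewrite A't B' A' dE /log_x; field; rewrite !nz.
have C' : C (row2 (T w) (X w)) = (pulled_U1 w * C w - A w * dif ix (dif ix pulled_U1) w
   - drift T X w * dif ix pulled_U1 w + dif it pulled_U1 w) / (dif it T w * pulled_U1 w).
  by rewrite eC; field; rewrite !nz.
have two : 2 != 0 :> R by rewrite pnatr_eq0.
split.
- apply: (mulfI two); apply/eqP; rewrite -subr_eq0 -[X in _ == X]e21; apply/eqP.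
  by rewrite C' B' dE ?A' /log_t /log_x; field; rewrite !nz.
- apply: (mulfI two); apply/eqP; rewrite -subr_eq0 -[X in _ == X]e31; apply/eqP.
  by rewrite e0 C' B' dE ?A' /log_t /log_x; field; rewrite !nz.
split=> //; rewrite dE; field; by rewrite !nz.
Unshelve. all: by end_near. Qed.

End Near.
End DataOfSymmetry.
End Classification.

(** * From a symmetry of [eqL] to a symmetry of [DE1] *)

Section InducedSymmetry.
Context {R : realType}.
Variables (A B C T X U1 U0 : 'rV[R]_2 -> R) (w0 : 'rV[R]_2).
Hypotheses (sA : smooth_at w0 A) (sB : smooth_at w0 B) (sC : smooth_at w0 C).
Let w0' := row2 (T w0) (X w0).
Hypotheses (sA' : smooth_at w0' A) (sB' : smooth_at w0' B) (sC' : smooth_at w0' C).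
Hypotheses (sT : smooth_at w0 T) (sX : smooth_at w0 X).
Hypotheses (sU1 : smooth_at w0 U1) (sU0 : smooth_at w0 U0).
Hypothesis A0 : \forall w \near w0, A w != 0.
Hypothesis E : \forall w \near w0, equivalence A B C T X U1 U0 w.

Let nT : \forall w \near w0, dif it T w != 0 /\ dif ix T w = 0.
Proof. by apply: filterS E => w []. Qed.

Notation lam := (log_x U1).
Notation mu := (log_t U1).
(** [phi] and [psi] are U1 times the x- and the t-derivative of U0 / U1; divided by T_t they are the
    entries M_31 and N_3 of the induced map. *)
Definition phi w := dif ix U0 w - lam w * U0 w.
Definition psi w := dif it U0 w - mu w * U0 w.

Let slam : smooth_at w0 lam.
Proof.
apply: smoothM; first exact: smooth_dif.
by apply: smoothV => //; have [] := nbhs_singleton E.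
Qed.
Let smu : smooth_at w0 mu.
Proof.
apply: smoothM; first exact: smooth_dif.
by apply: smoothV => //; have [] := nbhs_singleton E.
Qed.
Let sphi : smooth_at w0 phi.
Proof. by apply: smoothB; [exact: smooth_dif|exact: smoothM]. Qed.
Let spsi : smooth_at w0 psi.
Proof. by apply: smoothB; [exact: smooth_dif|exact: smoothM]. Qed.

(** Both sides are the mixed second derivative of log |U1|. *)
Lemma near_log_t : \forall w \near w0, dif it lam w = dif ix mu w.
Proof.
have n1 := smooth_near sU1; near=> w.
have sU : smooth_at w U1 by near: w.
have U1n : U1 w != 0 by near: w; apply: filterS E => w [].
rewrite /log_x /log_t !difM ?difV //; try exact: smooth_dif; try exact: smoothV.
by rewrite (dif_swap ix it sU); field.
Unshelve. all: by end_near. Qed.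

(** The compatibility of the two first derivatives of U0 / U1, with the factor U1 differentiated
    along. *)
Lemma near_phi_t : \forall w \near w0, dif it phi w = dif ix psi w - lam w * psi w + mu w * phi w.
Proof.
have n1 := smooth_near sU0; have n2 := smooth_near slam; have n3 := smooth_near smu.
have n4 := near_log_t; near=> w.
have sU : smooth_at w U0 by near: w.
have sl : smooth_at w lam by near: w.
have sm : smooth_at w mu by near: w.
rewrite /phi /psi !difB; try exact: smooth_dif; try exact: smoothM.
rewrite (difM _ sl sU) (difM _ sm sU) (dif_swap ix it sU); have -> : dif it lam w = dif ix mu w by near: w.
ring.
Unshelve. all: by end_near. Qed.

Lemma near_U1 : \forall w \near w0, [/\ dif ix U1 w = lam w * U1 w, dif it U1 w = mu w * U1 w
  & dif ix (dif ix U1) w = (dif ix lam w + lam w ^+ 2) * U1 w].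
Proof.
have n1 := smooth_near sU1; have n2 := smooth_near slam.
have ex : \forall w \near w0, dif ix U1 w = lam w * U1 w.
  by apply: filterS E => w [_ _ _ U1n _ _ _ _]; rewrite /log_x divfK.
have n3 := near_join ex; near=> w.
have sU : smooth_at w U1 by near: w.
have sl : smooth_at w lam by near: w.
have U1n : U1 w != 0 by near: w; apply: filterS E => w [].
have exw : \forall w \near w, dif ix U1 w = lam w * U1 w by near: w.
rewrite (dif_near _ exw) difM // (nbhs_singleton exw); split=> //; last by ring.
by rewrite /log_t divfK.
Unshelve. all: by end_near. Qed.

Lemma near_U0 : \forall w \near w0, [/\ dif ix U0 w = phi w + lam w * U0 w,
  dif it U0 w = psi w + mu w * U0 w
  & dif ix (dif ix U0) w = dif ix phi w + dif ix lam w * U0 w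
      + lam w * (phi w + lam w * U0 w)].
Proof.
have n1 := smooth_near sU0; have n2 := smooth_near slam; have n4 := smooth_near sphi.
near=> w; have sU : smooth_at w U0 by near: w.
have sl : smooth_at w lam by near: w.
have sp : smooth_at w phi by near: w.
have exw : \forall y \near w, dif ix U0 y = phi y + lam y * U0 y.
  by near=> y; rewrite /phi subrK.
rewrite (dif_near _ exw) difD; [|exact: sp|exact: smoothM].
rewrite difM // (nbhs_singleton exw); split=> //; last by ring.
by rewrite /psi subrK.
Unshelve. all: by end_near. Qed.

(** T_t times the values of [A], [B], [C] at the image point, written at the source point by solving
    [equivalence]. U1 then occurs only through its logarithmic derivatives. *)
Definition h_A w := A w * (dif ix X w * dif ix X w).
Definition h_B w := dif ix X w * (B w - 2 * A w * lam w) - dif it X w + A w * dif ix (dif ix X) w.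
Definition h_C w := C w + mu w - A w * dif ix lam w + A w * (lam w * lam w) - B w * lam w.

Lemma near_coef : \forall w \near w0, [/\
  A (row2 (T w) (X w)) = (dif it T w)^-1 * h_A w,
  B (row2 (T w) (X w)) = (dif it T w)^-1 * h_B w,
  C (row2 (T w) (X w)) = (dif it T w)^-1 * h_C w
  & psi w = A w * (dif ix phi w - lam w * phi w) + B w * phi w + C w * U0 w].
Proof.
have n1 := near_U1; have n2 := near_U0; near=> w.
have [Tx Tt Xx U1n eA eB eC e0] : equivalence A B C T X U1 U0 w by near: w.
have [U1x U1t U1xx] : [/\ dif ix U1 w = lam w * U1 w, dif it U1 w = mu w * U1 w
  & dif ix (dif ix U1) w = (dif ix lam w + lam w ^+ 2) * U1 w] by near: w.
have [U0x U0t U0xx] : [/\ dif ix U0 w = phi w + lam w * U0 w,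
  dif it U0 w = psi w + mu w * U0 w
  & dif ix (dif ix U0) w = dif ix phi w + dif ix lam w * U0 w
      + lam w * (phi w + lam w * U0 w)] by near: w.
have dE : drift A B T X w = B w - 2 * A w * lam w.
  by apply: (mulIf U1n); move: eB; rewrite U1x; lra.
have eC' : dif it T w * C (row2 (T w) (X w)) = h_C w.
  by rewrite /h_C; apply: (mulIf U1n); move: eC; rewrite U1x U1t U1xx dE; lra.
split.
- by rewrite /h_A -expr2 eA mulrC mulfK.
- rewrite /h_B -dE /drift; field; by rewrite Tt Xx.
- by rewrite -eC' mulKf.
- by move: e0; rewrite U0t U0xx U0x dE eC' /h_C; lra.
Unshelve. all: by end_near. Qed.

(** The relation is differentiated along the base map. Because T_x = 0, the x-derivative sees only
    F_x at the image point, whereas the t-derivative mixes F_t and F_x. *)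
Lemma near_image_dif (F h : 'rV[R]_2 -> R) : smooth_at w0' F -> smooth_at w0 h ->
  (\forall w \near w0, F (row2 (T w) (X w)) = (dif it T w)^-1 * h w) ->
  \forall w \near w0, dif ix F (row2 (T w) (X w)) * dif ix X w = (dif it T w)^-1 * dif ix h w /\
    dif it F (row2 (T w) (X w)) * dif it T w + dif ix F (row2 (T w) (X w)) * dif it X w
    = (dif it T w)^-1 * (dif it h w - dif it (dif it T) w * (dif it T w)^-1 * h w).
Proof.
move=> sF sh Fh; have n1 := near_scaled sT nT sh Fh.
have n2 := near_smooth_image sT sX sF; have n3 := smooth_near sT; have n4 := smooth_near sX.
near=> w; have sFw : smooth_at (row2 (T w) (X w)) F by near: w.
have sTw : smooth_at w T by near: w.
have sXw : smooth_at w X by near: w.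
have [_ Tx] : dif it T w != 0 /\ dif ix T w = 0 by near: w.
have [_ <- _ <-] : [/\ F (row2 (T w) (X w)) = (dif it T w)^-1 * h w,
    dif ix (fun w => F (row2 (T w) (X w))) w = (dif it T w)^-1 * dif ix h w,
    dif ix (dif ix (fun w => F (row2 (T w) (X w)))) w = (dif it T w)^-1 * dif ix (dif ix h) w
    & dif it (fun w => F (row2 (T w) (X w))) w
      = (dif it T w)^-1 * (dif it h w - dif it (dif it T) w * (dif it T w)^-1 * h w)] by near: w.
by rewrite !dif_image // Tx mulr0 add0r.
Unshelve. all: by end_near. Qed.

Definition d_A i w := dif i A w * dif ix X w ^+ 2 + 2 * A w * dif ix X w * dif i (dif ix X) w.
Definition d_B i w := dif i (dif ix X) w * (B w - 2 * A w * lam w)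
  + dif ix X w * (dif i B w - 2 * (dif i A w * lam w + A w * dif i lam w))
  - dif i (dif it X) w + dif i A w * dif ix (dif ix X) w + A w * dif i (dif ix (dif ix X)) w.
Definition d_C i w := dif i C w + dif i mu w - dif i A w * dif ix lam w
  - A w * dif i (dif ix lam) w + dif i A w * lam w ^+ 2 + 2 * A w * lam w * dif i lam w
  - dif i B w * lam w - B w * dif i lam w.
Definition d_psi i w := dif i A w * (dif ix phi w - lam w * phi w)
  + A w * (dif i (dif ix phi) w - dif i lam w * phi w - lam w * dif i phi w)
  + dif i B w * phi w + B w * dif i phi w + dif i C w * U0 w + C w * dif i U0 w.

(** The conditions on the data and their first derivatives, solved for all quantities in the
    residues that are not independent: image values of the coefficients and of their derivatives,
    derivatives of [psi], and mixed derivatives. After substitution the residues must cancel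
    identically. *)
Record prolonged_equivalence w : Prop := ProlongedEquivalence {
  pe_A : A (row2 (T w) (X w)) = (dif it T w)^-1 * h_A w;
  pe_Ax : dif ix A (row2 (T w) (X w)) * dif ix X w = (dif it T w)^-1 * d_A ix w;
  pe_At : dif it A (row2 (T w) (X w)) * dif it T w + dif ix A (row2 (T w) (X w)) * dif it X w
    = (dif it T w)^-1 * (d_A it w
        - dif it (dif it T) w * (dif it T w)^-1 * h_A w);
  pe_B : B (row2 (T w) (X w)) = (dif it T w)^-1 * h_B w;
  pe_Bx : dif ix B (row2 (T w) (X w)) * dif ix X w = (dif it T w)^-1 * d_B ix w;
  pe_Bt : dif it B (row2 (T w) (X w)) * dif it T w + dif ix B (row2 (T w) (X w)) * dif it X w
    = (dif it T w)^-1 * (d_B it w - dif it (dif it T) w * (dif it T w)^-1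
       * h_B w);
  pe_C : C (row2 (T w) (X w)) = (dif it T w)^-1 * h_C w;
  pe_Cx : dif ix C (row2 (T w) (X w)) * dif ix X w = (dif it T w)^-1 * d_C ix w;
  pe_Ct : dif it C (row2 (T w) (X w)) * dif it T w + dif ix C (row2 (T w) (X w)) * dif it X w
    = (dif it T w)^-1 * (d_C it w - dif it (dif it T) w * (dif it T w)^-1
       * h_C w);
  pe_psi : psi w = A w * (dif ix phi w - lam w * phi w) + B w * phi w + C w * U0 w;
  pe_psix : dif ix psi w = d_psi ix w;
  pe_psit : dif it psi w = d_psi it w;
  pe_Xtx : dif it (dif ix X) w = dif ix (dif it X) w;
  pe_Xtxx : dif it (dif ix (dif ix X)) w = dif ix (dif ix (dif it X)) w;
  pe_lt : dif it lam w = dif ix mu w;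
  pe_ltx : dif it (dif ix lam) w = dif ix (dif ix mu) w;
  pe_phit : dif it phi w = dif ix psi w - lam w * psi w + mu w * phi w;
  pe_phitx : dif it (dif ix phi) w = dif ix (dif ix psi) w - dif ix lam w * psi w
    - lam w * dif ix psi w + dif ix mu w * phi w + mu w * dif ix phi w }.

Ltac sm := repeat first [assumption | apply: smooth_cst | apply: smooth_dif | apply: smoothB
  | apply: smoothD | apply: smoothM].

Lemma near_prolonged : \forall w \near w0, prolonged_equivalence w.
Proof.
have sAh : smooth_at w0 h_A by sm.
have sBh : smooth_at w0 h_B by sm.
have sCh : smooth_at w0 h_C by sm.
have [cA cB cC cP] : [/\ \forall w \near w0, A (row2 (T w) (X w)) = (dif it T w)^-1 * h_A w,
   \forall w \near w0, B (row2 (T w) (X w)) = (dif it T w)^-1 * h_B w,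
   \forall w \near w0, C (row2 (T w) (X w)) = (dif it T w)^-1 * h_C w &
   \forall w \near w0, psi w = A w * (dif ix phi w - lam w * phi w) + B w * phi w + C w * U0 w].
  by split; apply: filterS near_coef => w [].
have dA := near_image_dif sA' sAh cA; have dB := near_image_dif sB' sBh cB.
have dC := near_image_dif sC' sCh cC; have cPj := near_join cP.
have nXtx : \forall w \near w0, dif it (dif ix X) w = dif ix (dif it X) w.
  by apply: filterS (smooth_near sX) => w; exact: dif_swap.
have nXtxx : \forall w \near w0, dif it (dif ix (dif ix X)) w = dif ix (dif ix (dif it X)) w.
  apply: filterS2 (near_dif ix nXtx) (smooth_near (smooth_dif ix sX)) => w <- sw.
  exact: dif_swap.
have nlt := near_log_t; have nphit := near_phi_t.
have nltx : \forall w \near w0, dif it (dif ix lam) w = dif ix (dif ix mu) w.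
  apply: filterS2 (near_dif ix nlt) (smooth_near slam) => w <- sw.
  exact: dif_swap.
have s1 := smooth_near sA; have s2 := smooth_near sB; have s3 := smooth_near sC.
have s4 := smooth_near slam; have s5 := smooth_near smu; have s6 := smooth_near sphi.
have s7 := smooth_near spsi; have s8 := smooth_near sX; have s9 := smooth_near sU0.
have nphitx : \forall w \near w0, dif it (dif ix phi) w = dif ix (dif ix psi) w - dif ix lam w * psi w
    - lam w * dif ix psi w + dif ix mu w * phi w + mu w * dif ix phi w.
  have H := near_dif ix nphit; near=> w; rewrite dif_swap; last by near: w.
  transitivity (dif ix (fun w => dif ix psi w - lam w * psi w + mu w * phi w) w); first by near: w.
  have sw1 : smooth_at w lam by near: w.
  have sw2 : smooth_at w mu by near: w.
  have sw3 : smooth_at w phi by near: w.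
  have sw4 : smooth_at w psi by near: w.
  have spx : smooth_at w (dif ix psi) by sm.
  have q1 := smoothM sw1 sw4; have q2 := smoothM sw2 sw3.
  rewrite (difD _ (smoothB spx q1) q2) (difB _ spx q1) (difM _ sw1 sw4) (difM _ sw2 sw3).
  by ring.
near=> w.
have sw1 : smooth_at w lam by near: w.
have sw2 : smooth_at w mu by near: w.
have sw3 : smooth_at w phi by near: w.
have sw4 : smooth_at w psi by near: w.
have sw5 : smooth_at w A by near: w.
have sw6 : smooth_at w B by near: w.
have sw7 : smooth_at w C by near: w.
have sw8 : smooth_at w X by near: w.
have sw9 : smooth_at w U0 by near: w.
have hAE i : dif i h_A w = d_A i w.
  have sx : smooth_at w (dif ix X) by sm.
  by rewrite /h_A /d_A !difM //; sm; ring.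
have c2 i : dif i (fun w => 2 * A w * lam w) w = 2 * (dif i A w * lam w + A w * dif i lam w).
  have sc : smooth_at w (fun=> 2 : R) by sm.
  by rewrite (difM _ (smoothM sc sw5) sw1) (difM _ sc sw5) dif_cst; ring.
have hBE i : dif i h_B w = d_B i w.
  have sx : smooth_at w (dif ix X) by sm.
  have st : smooth_at w (dif it X) by sm.
  have sxx : smooth_at w (dif ix (dif ix X)) by sm.
  have s2l : smooth_at w (fun w => 2 * A w * lam w) by sm.
  have sb2 : smooth_at w (fun w => B w - 2 * A w * lam w) by sm.
  rewrite /h_B /d_B (difD _ (smoothB (smoothM sx sb2) st) (smoothM sw5 sxx)).
  rewrite (difB _ (smoothM sx sb2) st) (difM _ sx sb2) (difB _ sw6 s2l) c2 (difM _ sw5 sxx).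
  by ring.
have hCE i : dif i h_C w = d_C i w.
  have slx : smooth_at w (dif ix lam) by sm.
  have q1 := smoothD sw7 sw2; have q2 := smoothB q1 (smoothM sw5 slx).
  have q3 := smoothD q2 (smoothM sw5 (smoothM sw1 sw1)).
  rewrite /h_C /d_C (difB _ q3 (smoothM sw6 sw1)) (difD _ q2 (smoothM sw5 (smoothM sw1 sw1))).
  rewrite (difB _ q1 (smoothM sw5 slx)) (difD _ sw7 sw2) (difM _ sw5 slx).
  by rewrite (difM _ sw5 (smoothM sw1 sw1)) (difM _ sw1 sw1) (difM _ sw6 sw1); ring.
have psE i : dif i psi w = d_psi i w.
  have cPw : \forall w \near w, psi w = A w * (dif ix phi w - lam w * phi w) + B w * phi w + C w * U0 w.
    by near: w.
  have spx : smooth_at w (dif ix phi) by sm.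
  have q0 := smoothB spx (smoothM sw1 sw3); have q1 := smoothM sw5 q0.
  have q2 := smoothD q1 (smoothM sw6 sw3).
  rewrite (dif_near i cPw) /d_psi (difD _ q2 (smoothM sw7 sw9)) (difD _ q1 (smoothM sw6 sw3)).
  rewrite (difM _ sw5 q0) (difB _ spx (smoothM sw1 sw3)) (difM _ sw1 sw3) (difM _ sw6 sw3).
  by rewrite (difM _ sw7 sw9); ring.
split; rewrite -?hAE -?hBE -?hCE -?psE //.
all: try by near: w.
- by near: w; apply: filterS dA => w [].
- by near: w; apply: filterS dA => w [].
- by near: w; apply: filterS dB => w [].
- by near: w; apply: filterS dB => w [].
- by near: w; apply: filterS dC => w [].
- by near: w; apply: filterS dC => w [].
Unshelve. all: by end_near. Qed.

Lemma dif_cstE i (c : R) : dif i (fun _ : 'rV[R]_2 => c) = fun=> 0.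
Proof. by apply/funext => w; rewrite dif_cst. Qed.

Notation iM := (indM T X U1 U0).
Notation iN := (indN T X U1 U0).
Notation scaled w F h hx hxx ht := [/\ F w = (dif it T w)^-1 * h,
    dif ix F w = (dif it T w)^-1 * hx,
    dif ix (dif ix F) w = (dif it T w)^-1 * hxx
    & dif it F w = (dif it T w)^-1 * (ht - dif it (dif it T) w * (dif it T w)^-1 * h)].

Record induced_jets w : Prop := InducedJets {
  ij11 : scaled w (iM i1 i1) (dif ix X w) (dif ix (dif ix X) w) (dif ix (dif ix (dif ix X)) w) (dif it (dif ix X) w);
  ij12 : scaled w (iM i1 i2) 0 0 0 0;
  ij13 : scaled w (iM i1 i3) 0 0 0 0;
  ij21 : scaled w (iM i2 i1) (lam w) (dif ix lam w) (dif ix (dif ix lam) w) (dif it lam w);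
  ij22 : scaled w (iM i2 i2) 1 0 0 0;
  ij23 : scaled w (iM i2 i3) 0 0 0 0;
  ij31 : scaled w (iM i3 i1) (phi w) (dif ix phi w) (dif ix (dif ix phi) w) (dif it phi w);
  ij32 : scaled w (iM i3 i2) (- U0 w) (- dif ix U0 w) (- dif ix (dif ix U0) w) (- dif it U0 w);
  ij33 : scaled w (iM i3 i3) (U1 w) (dif ix U1 w) (dif ix (dif ix U1) w) (dif it U1 w);
  ij1 : scaled w (iN i1) (dif it X w) (dif ix (dif it X) w) (dif ix (dif ix (dif it X)) w) (dif it (dif it X) w);
  ij2 : scaled w (iN i2) (mu w) (dif ix mu w) (dif ix (dif ix mu) w) (dif it mu w);
  ij3 : scaled w (iN i3) (psi w) (dif ix psi w) (dif ix (dif ix psi) w) (dif it psi w) }.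

Lemma near_induced_jets : \forall w \near w0, induced_jets w.
Proof.
have tr F h : F = (fun w => (dif it T w)^-1 * h w) ->
  \forall w \near w0, F w = (dif it T w)^-1 * h w by move=> ->; near=> w.
have cst c F : F = (fun w => (dif it T w)^-1 * c) ->
   \forall w \near w0, scaled w F c 0 0 0.
  move=> FE; have := near_scaled sT nT (smooth_cst w0 c) (tr F (fun=> c) FE).
  by apply: filterS => w; rewrite !dif_cstE.
have neg : \forall w \near w0, scaled w (iM i3 i2) (- U0 w) (- dif ix U0 w) (- dif ix (dif ix U0) w) (- dif it U0 w).
  have H := near_scaled sT nT (smoothN sU0) (tr (iM i3 i2) (fun w => - U0 w) erefl).
  have m1 i : \forall w \near w0, dif i (fun w => - U0 w) w = - dif i U0 w.
    by apply: filterS (smooth_near sU0) => w; exact: difN.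
  have m2 : \forall w \near w0, dif ix (dif ix (fun w => - U0 w)) w = - dif ix (dif ix U0) w.
    apply: filterS2 (near_dif ix (m1 ix)) (smooth_near (smooth_dif ix sU0)) => w -> sw.
    exact: difN.
  have m1x := m1 ix; have m1t := m1 it.
  by near=> w; rewrite -(near m1x w) // -(near m1t w) // -(near m2 w) //; near: w.
have n11 := near_scaled sT nT (smooth_dif ix sX) (tr (iM i1 i1) (dif ix X) erefl).
have n21 := near_scaled sT nT slam (tr (iM i2 i1) lam erefl).
have n31 := near_scaled sT nT sphi (tr (iM i3 i1) phi erefl).
have n33 := near_scaled sT nT sU1 (tr (iM i3 i3) U1 erefl).
have m1 := near_scaled sT nT (smooth_dif it sX) (tr (iN i1) (dif it X) erefl).
have m2 := near_scaled sT nT smu (tr (iN i2) mu erefl).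
have m3 := near_scaled sT nT spsi (tr (iN i3) psi erefl).
have n12 := cst 0 (iM i1 i2) erefl; have n13 := cst 0 (iM i1 i3) erefl.
have n23 := cst 0 (iM i2 i3) erefl; have n22 := cst 1 (iM i2 i2) erefl.
by near=> w; split; near: w.
Unshelve. all: by end_near. Qed.

(** Once the entries of the map and their derivatives are replaced by means of [induced_jets] and
    [prolonged_equivalence], each residue is a rational identity whose denominators are products of
    A, T_t, X_x and U1. Invertibility holds because the matrix is lower triangular. *)
Lemma induced_symmetry : \forall w \near w0, forall u,
  affine_symmetry A (D0 A B C) (D1 A B C) T X iM iN (row_mx w u).
Proof.
have nj := near_induced_jets; have np := near_prolonged; have nu := near_U1; have nv := near_U0.
near=> w => u.
have [Tx Tt Xx U1n eA _ _ _] : equivalence A B C T X U1 U0 w by near: w.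
have An : A w != 0 by near: w.
have [U1x U1t U1xx] : [/\ dif ix U1 w = lam w * U1 w, dif it U1 w = mu w * U1 w
  & dif ix (dif ix U1) w = (dif ix lam w + lam w ^+ 2) * U1 w] by near: w.
have [U0x U0t U0xx] : [/\ dif ix U0 w = phi w + lam w * U0 w,
  dif it U0 w = psi w + mu w * U0 w
  & dif ix (dif ix U0) w = dif ix phi w + dif ix lam w * U0 w
      + lam w * (phi w + lam w * U0 w)] by near: w.
have [[M11 M11x M11xx M11t] [M12 M12x M12xx M12t] [M13 M13x M13xx M13t]
  [M21 M21x M21xx M21t] [M22 M22x M22xx M22t] [M23 M23x M23xx M23t]
  [M31 M31x M31xx M31t] [M32 M32x M32xx M32t] [M33 M33x M33xx M33t]
  [N1 N1x N1xx N1t] [N2 N2x N2xx N2t] [N3 N3x N3xx N3t]] : induced_jets w by near: w.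
have [A' A'x A't B' B'x B't C' C'x C't ps psx pst Xtx Xtxx lt ltx pt ptx] : prolonged_equivalence w by near: w.
(* The x-relations are divided by X_x; the t-relations, which still contain X_t times the
   x-derivative, are solved afterwards by dividing by T_t. *)
have {}A'x := canRL (mulfK Xx) A'x; have {}A't := canRL (mulfK Tt) (canRL (addrK _) A't).
have {}B'x := canRL (mulfK Xx) B'x; have {}B't := canRL (mulfK Tt) (canRL (addrK _) B't).
have {}C'x := canRL (mulfK Xx) C'x; have {}C't := canRL (mulfK Tt) (canRL (addrK _) C't).
have nz := (Tt, Xx, U1n, An).
split; rewrite ?base_row //.
- rewrite det_lower ?M12 ?M13 ?M23 ?mulr0 // M11 M22 M33.
  by rewrite !mulf_neq0 ?invr_eq0 ?oner_neq0 //.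
- move=> l; rewrite ares0E /D0 /D1.
  move: (u 0 i1) (u 0 i2) (u 0 i3) => g1 g2 g3.
  move: l; apply: ord3P; rewrite /= !mxE /=.
  all: rewrite ?M11 ?M12 ?M13 ?M21 ?M22 ?M23 ?M31 ?M32 ?M33 ?N1 ?N2 ?N3.
  all: rewrite ?M11x ?M12x ?M13x ?M21x ?M22x ?M23x ?M31x ?M32x ?M33x ?N1x ?N2x ?N3x.
  all: rewrite ?M11xx ?M12xx ?M13xx ?M21xx ?M22xx ?M23xx ?M31xx ?M32xx ?M33xx ?N1xx ?N2xx ?N3xx.
  all: rewrite ?M11t ?M12t ?M13t ?M21t ?M22t ?M23t ?M31t ?M32t ?M33t ?N1t ?N2t ?N3t.
  all: rewrite ?A't ?A'x ?A' ?B't ?B'x ?B' ?C't ?C'x ?C' ?pst ?psx ?ps.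
  all: rewrite /d_A /d_B /d_C /d_psi /h_A /h_B /h_C ?ptx ?pt ?ltx ?lt ?Xtx ?Xtxx ?psx ?ps /d_psi.
  all: rewrite ?U1x ?U1t ?U1xx ?U0xx ?U0x ?U0t ?ps.
  1-3: by field; rewrite !nz.
move=> l c; rewrite ares1E /D1.
move: (u 0 i1) (u 0 i2) (u 0 i3) => g1 g2 g3.
move: l c; apply: ord3P; apply: ord3P; rewrite /= !mxE /=.
all: rewrite ?M11 ?M12 ?M13 ?M21 ?M22 ?M23 ?M31 ?M32 ?M33 ?N1 ?N2 ?N3.
all: rewrite ?M11x ?M12x ?M13x ?M21x ?M22x ?M23x ?M31x ?M32x ?M33x ?A' ?B' ?C' /h_A /h_B /h_C.
all: rewrite ?U1x ?U0x ?ps.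
all: by field; rewrite !nz.
Unshelve. all: by end_near. Qed.

End InducedSymmetry.

(** * The pseudogroup isomorphism *)

Section AffineGerms.
Context {R : realType} {m : nat}.
Notation Z := 'rV[R]_(2 + m).

(** The slopes are fibre derivatives and the shifts are what then remains. The comparison is made
    along the section with fibre value [dep p], where equality of germs is available at every nearby
    base point. *)
Lemma affmap_inj T X M N T' X' M' N' (p : Z) :
  smooth_data (base p) T X M N -> smooth_data (base p) T' X' M' N' ->
  germ_eq p (affmap T X M N) (affmap T' X' M' N') ->
  \forall w \near base p, [/\ T w = T' w, X w = X' w, forall l b, M l b w = M' l b w
    & forall l, N l w = N' l w].
Proof.
move=> sd sd' g.
have nd : \forall z \near p, [/\ smooth_data (base z) T X M N, smooth_data (base z) T' X' M' N'
    & germ_eq z (affmap T X M N) (affmap T' X' M' N')].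
  have n1 := near_base (smooth_data_near sd); have n2 := near_base (smooth_data_near sd').
  have n3 := near_join g; by near=> z; split; near: z.
have := @near_section _ _ (base p) (dep p) _; rewrite row_base_dep => /(_ _ nd).
apply: filterS => w [[_ _ sM sN] [_ _ sM' sN'] gw]; rewrite base_row in sM sN sM' sN'.
have Mw l b : M l b w = M' l b w.
  have := germ_dif gw (dv b) (dv l); rewrite !affmapDE !dif_affine_dv ?base_row //.
split=> //.
- by have := congr1 (fun r : Z => r 0 (tx it)) (nbhs_singleton gw); rewrite !affmapT base_row.
- by have := congr1 (fun r : Z => r 0 (tx ix)) (nbhs_singleton gw); rewrite !affmapX base_row.
move=> l; have := congr1 (fun r : Z => r 0 (dv l)) (nbhs_singleton gw); rewrite !affmapD base_row.
by under eq_bigr do rewrite Mw; move/addrI.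
Unshelve. all: by end_near. Qed.

Lemma affmap_germ T X M N T' X' M' N' (p : Z) :
  (\forall w \near base p, [/\ T w = T' w, X w = X' w, forall l b, M l b w = M' l b w
    & forall l, N l w = N' l w]) ->
  germ_eq p (affmap T X M N) (affmap T' X' M' N').
Proof.
move=> /near_base; apply: filterS => z [eT eX eM eN]; rewrite /affmap eT eX.
congr row_mx; apply/rowP => l; rewrite !mxE eN; congr (_ + _).
by apply: eq_bigr => b _; rewrite eM.
Qed.

Lemma germ_gen (f g : Z -> Z) p : germ_eq p f g ->
  \forall w \near base p, [/\ genT f p w = genT g p w, genX f p w = genX g p w,
    forall l b, genM f p l b w = genM g p l b w & forall l, genN f p l w = genN g p l w].
Proof.
move=> /near_join fg; have := @near_section _ _ (base p) (dep p) _.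
rewrite row_base_dep => /(_ _ fg); apply: filterS => w gw.
have Mw l b : genM f p l b w = genM g p l b w by exact: germ_dif gw _ _.
have fgw := nbhs_singleton gw.
split=> //; rewrite /genT /genX /genN ?fgw //.
by move=> l; under eq_bigr do rewrite Mw.
Qed.

Lemma gen_affmap T X M N (p : Z) : smooth_data (base p) T X M N ->
  let f : Z -> Z := affmap T X M N in \forall w \near base p,
  [/\ genT f p w = T w, genX f p w = X w, forall l b, genM f p l b w = M l b w
    & forall l, genN f p l w = N l w].
Proof.
move=> /smooth_data_near; apply: filterS => w [sT sX sM sN].
have Mw l b : genM (affmap T X M N) p l b w = M l b w.
  by rewrite /genM affmapDE dif_affine_dv ?base_row.
split=> //; first by rewrite /genT affmapT base_row.
  by rewrite /genX affmapX base_row.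
move=> l; rewrite /genN affmapD base_row dep_row; under [X in _ - X]eq_bigr do rewrite Mw.
by rewrite addrC addKr.
Qed.

End AffineGerms.

Section GroupIsomorphism.
Context {R : realType}.
Implicit Types (T X : 'rV[R]_2 -> R).

Definition Lmap T X (U1 U0 : 'rV[R]_2 -> R) : 'rV[R]_(2 + 1) -> 'rV[R]_(2 + 1) :=
  affmap T X (fun _ _ => U1) (fun _ => U0).
Definition indmap T X (U1 U0 : 'rV[R]_2 -> R) : 'rV[R]_(2 + 3) -> 'rV[R]_(2 + 3) :=
  affmap T X (indM T X U1 U0) (indN T X U1 U0).

Definition genU1 (f : 'rV[R]_(2 + 1) -> 'rV[R]_(2 + 1)) p := genM f p 0 0.
Definition genU0 (f : 'rV[R]_(2 + 1) -> 'rV[R]_(2 + 1)) p := genN f p 0.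

Definition smooth4 w T X (U1 U0 : 'rV[R]_2 -> R) :=
  [/\ smooth_at w T, smooth_at w X, smooth_at w U1 & smooth_at w U0].
Definition eq4 T X (U1 U0 : 'rV[R]_2 -> R) T' X' (U1' U0' : 'rV[R]_2 -> R) (w : 'rV[R]_2) :=
  [/\ T w = T' w, X w = X' w, U1 w = U1' w & U0 w = U0' w].

Lemma smooth4_data w T X U1 U0 : smooth4 w T X U1 U0 ->
  smooth_data w T X (fun _ _ => U1) (fun _ : 'I_1 => U0).
Proof. by case. Qed.

Lemma smooth_gen4 f (p : 'rV[R]_(2 + 1)) : smooth_at p f ->
  smooth4 (base p) (genT f p) (genX f p) (genU1 f p) (genU0 f p).
Proof. by move=> /smooth_gen_data[sT sX sM sN]; split; [| |exact: sM|exact: sN]. Qed.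

Lemma affgenL f (p : 'rV[R]_(2 + 1)) :
  affgen f p = Lmap (genT f p) (genX f p) (genU1 f p) (genU0 f p).
Proof.
apply/funext => z; rewrite /affgen /Lmap /affmap; congr row_mx; apply/rowP => l.
by rewrite !mxE (ord1 l); congr (_ + _); apply: eq_bigr => b _; rewrite (ord1 b).
Qed.

Lemma germ_gen4 f g (p : 'rV[R]_(2 + 1)) : germ_eq p f g -> \forall w \near base p,
  eq4 (genT f p) (genX f p) (genU1 f p) (genU0 f p) (genT g p) (genX g p) (genU1 g p) (genU0 g p) w.
Proof. by move=> /germ_gen; apply: filterS => w [? ? eM eN]; split; rewrite ?/genU1 ?/genU0 ?eM ?eN. Qed.

Lemma gen_Lmap T X U1 U0 p : smooth4 (base p) T X U1 U0 -> let f := Lmap T X U1 U0 in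
  \forall w \near base p, eq4 (genT f p) (genX f p) (genU1 f p) (genU0 f p) T X U1 U0 w.
Proof.
move=> /smooth4_data/gen_affmap; apply: filterS => w [? ? eM eN].
by split; rewrite ?/genU1 ?/genU0 ?eM ?eN.
Qed.

Lemma Lmap_germ T X U1 U0 T' X' U1' U0' (p : 'rV[R]_(2 + 1)) :
  (\forall w \near base p, eq4 T X U1 U0 T' X' U1' U0' w) ->
  germ_eq p (Lmap T X U1 U0) (Lmap T' X' U1' U0').
Proof. by move=> H; apply: affmap_germ; apply: filterS H => w []. Qed.

Lemma indmap_germ T X U1 U0 T' X' U1' U0' (q : 'rV[R]_(2 + 3)) :
  (\forall w \near base q, eq4 T X U1 U0 T' X' U1' U0' w) ->
  germ_eq q (indmap T X U1 U0) (indmap T' X' U1' U0').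
Proof.
move=> H; apply: affmap_germ; apply: filterS (near_join H) => w nw.
have [eT eX e1 e0] := nbhs_singleton nw.
have dT i : dif i T w = dif i T' w by apply: dif_near; apply: filterS nw => y [].
have dX i : dif i X w = dif i X' w by apply: dif_near; apply: filterS nw => y [].
have d1 i : dif i U1 w = dif i U1' w by apply: dif_near; apply: filterS nw => y [].
have d0 i : dif i U0 w = dif i U0' w by apply: dif_near; apply: filterS nw => y [].
by split=> // [l b|l]; rewrite /indM /indN /log_x /log_t !dT !dX !d1 !d0 ?e1 ?e0.
Qed.

Lemma smooth_indM T X U1 U0 w : smooth4 w T X U1 U0 -> dif it T w != 0 -> U1 w != 0 ->
  smooth_data w T X (indM T X U1 U0) (indN T X U1 U0).
Proof.
move=> [sT sX s1 s0] Tt U1n; have sk : smooth_at w (fun w => (dif it T w)^-1).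
  by apply: smoothV => //; exact: smooth_dif.
have sl : smooth_at w (log_x U1) by apply: smoothM; [exact: smooth_dif|exact: smoothV].
have sm : smooth_at w (log_t U1) by apply: smoothM; [exact: smooth_dif|exact: smoothV].
split=> // [l b|l]; apply: smoothM => //.
  by move: l b; apply: ord3P; apply: ord3P => /=; repeat first [assumption
    | exact: smooth_cst | apply: smooth_dif | apply: smoothN | apply: smoothB | apply: smoothM].
by move: l; apply: ord3P => /=; repeat first [assumption
    | exact: smooth_cst | apply: smooth_dif | apply: smoothB | apply: smoothM].
Qed.

(** Equality of T gives equality of T_t, and the entries (3, 3) and (3, 2), namely U1 / T_t and - U0
    / T_t, then give back U1 and U0. *)
Lemma indmap_inj T X U1 U0 T' X' U1' U0' (q : 'rV[R]_(2 + 3)) :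
  smooth4 (base q) T X U1 U0 -> smooth4 (base q) T' X' U1' U0' ->
  dif it T (base q) != 0 -> U1 (base q) != 0 ->
  dif it T' (base q) != 0 -> U1' (base q) != 0 ->
  germ_eq q (indmap T X U1 U0) (indmap T' X' U1' U0') ->
  \forall w \near base q, eq4 T X U1 U0 T' X' U1' U0' w.
Proof.
move=> s s' Tt U1n Tt' U1n' g.
have H := affmap_inj (smooth_indM s Tt U1n) (smooth_indM s' Tt' U1n') g.
have nTt : \forall w \near base q, dif it T w != 0.
  by apply: near_neq0 => //; case: s => sT _ _ _; exact: smooth_dif.
have Hj := near_join H; near=> w.
have nw : \forall w \near w, [/\ T w = T' w, X w = X' w, forall l b, indM T X U1 U0 l b w = indM T' X' U1' U0' l b w
    & forall l, indN T X U1 U0 l w = indN T' X' U1' U0' l w] by near: w.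
have [eT eX eM _] := nbhs_singleton nw.
have dT : dif it T w = dif it T' w by apply: dif_near; apply: filterS nw => y [].
have Tw : dif it T w != 0 by near: w.
split=> //.
  by have := eM i3 i3; rewrite /indM /= -dT => /(mulfI (invr_neq0 Tw)).
by have := eM i3 i2; rewrite /indM /= -dT => /(mulfI (invr_neq0 Tw))/oppr_inj.
Unshelve. all: by end_near. Qed.

End GroupIsomorphism.

Section Composition.
Context {R : realType} {m : nat}.

Lemma affmap_comp T' X' M' N' T X M N (z : 'rV[R]_(2 + m)) :
  affmap T' X' M' N' (affmap T X M N z) =
  affmap (fun w => T' (row2 (T w) (X w))) (fun w => X' (row2 (T w) (X w)))
    (fun l c w => \sum_b M' l b (row2 (T w) (X w)) * M b c w)
    (fun l w => \sum_b M' l b (row2 (T w) (X w)) * N b w + N' l (row2 (T w) (X w))) z.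
Proof.
apply/rowP; apply: idxP => [||l]; rewrite ?affmapT ?affmapX ?affmapD base_affmap //.
rewrite addrA; congr (_ + _); under eq_bigr do rewrite dep_affmapE /affine mulrDr.
rewrite big_split /=; congr (_ + _); under [RHS]eq_bigr do rewrite mulr_suml.
rewrite exchange_big /=; apply: eq_bigr => b _; rewrite mulr_sumr.
by apply: eq_bigr => c _; rewrite mulrA.
Qed.

Lemma germ_trans (p : 'rV[R]_(2 + m)) f g h : germ_eq p f g -> germ_eq p g h -> germ_eq p f h.
Proof. by apply: filterS2 => z ->. Qed.

Lemma germ_sym (p : 'rV[R]_(2 + m)) f g : germ_eq p f g -> germ_eq p g f.
Proof. by apply: filterS => z ->. Qed.

End Composition.

Section PseudogroupIsomorphism.
Context {R : realType}.
Variables (Omega : set 'rV[R]_2) (A B C : 'rV[R]_2 -> R).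
Hypothesis oO : open Omega.
Hypotheses (sA : forall w, Omega w -> smooth_at w A) (sB : forall w, Omega w -> smooth_at w B)
  (sC : forall w, Omega w -> smooth_at w C).
Hypothesis A0 : forall w, Omega w -> A w != 0.
Implicit Types (T X : 'rV[R]_2 -> R).

Definition admissible w T X U1 U0 := [/\ Omega w, Omega (row2 (T w) (X w)),
  smooth4 w T X U1 U0 & \forall w \near w, equivalence A B C T X U1 U0 w].

Lemma near_A0 w : Omega w -> \forall w \near w, A w != 0.
Proof. by move=> Ow; apply: filterS (open_nbhs_nbhs (conj oO Ow)); exact: A0. Qed.

Lemma gen_row2 m (f : 'rV[R]_(2 + m) -> 'rV[R]_(2 + m)) p :
  row2 (genT f p (base p)) (genX f p (base p)) = base (f p).
Proof.
rewrite /genT /genX row_base_dep; apply/rowP; apply: ord2P; rewrite ?row2_it ?row2_ix baseE //.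
Qed.

Lemma L_symmetry_data p f : point_symmetry Omega (eqL A B C) p f ->
  admissible (base p) (genT f p) (genX f p) (genU1 f p) (genU0 f p) /\
  germ_eq p f (Lmap (genT f p) (genX f p) (genU1 f p) (genU0 f p)).
Proof.
rewrite eqL_evol => Sf; have [fg S] := point_symmetry_affine oO A0 0 Sf.
case: Sf => Op Ofp sf _ _; rewrite affgenL in fg; split=> //; split=> //.
- by rewrite gen_row2.
- exact: smooth_gen4.
have := affine_symmetry_fibers (quad_L0 C) (aff_L1 B) S.
by apply: filterS => w /L_symmetryP.
Qed.

Lemma L_symmetry_Lmap p T X U1 U0 : admissible (base p) T X U1 U0 ->
  point_symmetry Omega (eqL A B C) p (Lmap T X U1 U0).
Proof.
case=> Op Op' s4 E; rewrite eqL_evol; apply: affine_point_symmetry => //.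
  exact: smooth4_data.
apply: affine_symmetry_base; apply: filterS E => w Ew.
by apply/L_symmetryP.
Qed.

Lemma DE1_symmetry_indmap q T X U1 U0 : admissible (base q) T X U1 U0 ->
  point_symmetry Omega (DE1 A B C) q (indmap T X U1 U0).
Proof.
case=> Oq Oq' s4 E; have [sT sX s1 s0] := s4; have [_ Tt _ U1n _ _ _ _] := nbhs_singleton E.
rewrite DE1_evol; apply: affine_point_symmetry => //; first exact: smooth_indM.
apply: affine_symmetry_base; apply: induced_symmetry => //; try exact: near_A0.
- exact: sA. - exact: sB. - exact: sC. - exact: sA. - exact: sB. - exact: sC.
Qed.

(** The formulas for the entries of M and N found near the base point identify them with [indM] and
    [indN] of the pulled-back data. *)
Lemma DE1_symmetry_data q h : point_symmetry Omega (DE1 A B C) q h ->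
  exists T X U1 U0, admissible (base q) T X U1 U0 /\ germ_eq q h (indmap T X U1 U0).
Proof.
rewrite DE1_evol => Sh; have [hg S] := point_symmetry_affine oO A0 i1 Sh.
case: Sh => Oq Ohq sh _ _; have sd := smooth_gen_data sh; have [sT sX sM sN] := sd.
have {}S := affine_symmetry_fibers (quad_D0 A B C) (aff_D1 A B C) S.
have sA' : smooth_at (row2 (genT h q (base q)) (genX h q (base q))) A.
  by apply: sA; rewrite gen_row2.
have nA := near_A0 Oq; have n1 := near_M1 S.
have n2 := near_MB nA S; have n3 := near_MC sd nA S.
have n4 := near_MD sd (sA Oq) sA' nA S; have nb := near_basic S.
exists (genT h q), (genX h q), (pulled_U1 (genT h q) (genM h q)), (pulled_U0 (genT h q) (genM h q)); split.
  split=> //; first by rewrite gen_row2.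
    split=> //; first by apply: smoothM => //; exact: smooth_dif.
    by apply: smoothN; apply: smoothM => //; exact: smooth_dif.
  by apply: filterS n4 => w [].
apply: germ_trans hg (affmap_germ _).
apply: filterS (filterI n1 (filterI n2 (filterI nb (filterI n3 n4)))).
move=> w [[M11 M12 M13] [[M22 M23 _] [[Tt _ _ _] [[M21 N1 M31 _] [N2 N3 _]]]]].
split=> //.
  apply: ord3P; apply: ord3P; rewrite /indM /= ?mulr0 ?mulr1 //.
    by rewrite /pulled_U0 opprK mulKf.
  by rewrite /pulled_U1 mulKf.
by apply: ord3P.
Qed.

Section Compose.
Variables (T' X' V1 V0 T X U1 U0 : 'rV[R]_2 -> R) (w0 : 'rV[R]_2).
Hypothesis s : smooth4 w0 T X U1 U0.
Hypothesis s' : smooth4 (row2 (T w0) (X w0)) T' X' V1 V0.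
Notation im w := (row2 (T w) (X w)).
Notation T'' := (fun w => T' (im w)).
Notation X'' := (fun w => X' (im w)).
Notation V1'' := (fun w => V1 (im w) * U1 w).
Notation V0'' := (fun w => V1 (im w) * U0 w + V0 (im w)).

Lemma smooth4_comp : smooth4 w0 T'' X'' V1'' V0''.
Proof.
case: s s' => sT sX s1 s0 [sT' sX' s1' s0'].
split; [exact: smooth_image|exact: smooth_image|apply: smoothM => //; exact: smooth_image|].
by apply: smoothD; [apply: smoothM => //|]; exact: smooth_image.
Qed.

Lemma Lmap_comp z : Lmap T' X' V1 V0 (Lmap T X U1 U0 z) = Lmap T'' X'' V1'' V0'' z.
Proof.
rewrite /Lmap affmap_comp /affmap; congr row_mx; apply/rowP => l; rewrite !mxE !sum1E.
by [].
Qed.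

Hypothesis E : \forall w \near w0, equivalence A B C T X U1 U0 w.
Hypothesis E' : \forall w \near im w0, equivalence A B C T' X' V1 V0 w.

(** The chain rule, with T_x = 0 on both sides, makes T_t and X_x multiplicative; the logarithmic
    derivatives of the product of V1 at the image with U1 add up. The twelve entries then agree as
    rational expressions. *)
Lemma indmap_comp (q : 'rV[R]_(2 + 3)) : base q = w0 ->
  germ_eq q (indmap T' X' V1 V0 \o indmap T X U1 U0) (indmap T'' X'' V1'' V0'').
Proof.
move=> qw; have [sT sX s1 s0] := s; have [sT' sX' s1' s0'] := s'.
have -> : indmap T' X' V1 V0 \o indmap T X U1 U0 = fun z => affmap T'' X''
    (fun l c w => \sum_b indM T' X' V1 V0 l b (im w) * indM T X U1 U0 b c w)
    (fun l w => \sum_b indM T' X' V1 V0 l b (im w) * indN T X U1 U0 b w + indN T' X' V1 V0 l (im w)) z.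
  by apply/funext => z; exact: affmap_comp.
apply: affmap_germ; rewrite qw.
have n1 : \forall w \near w0, equivalence A B C T' X' V1 V0 (im w).
  apply: (@near_comp _ _ _ (fun w => im w) w0 (equivalence A B C T' X' V1 V0)) => //.
  by apply: ord2P; [under eq_fun do rewrite row2_it|under eq_fun do rewrite row2_ix].
have n2 := near_smooth_image sT sX sT'; have n3 := near_smooth_image sT sX sX'.
have n4 := near_smooth_image sT sX s1'; have n5 := near_smooth_image sT sX s0'.
have m1 := smooth_near sT; have m2 := smooth_near sX; have m3 := smooth_near s1.
have m4 := smooth_near s0.
near=> w.
have [Tx Tt Xx Un _ _ _ _] : equivalence A B C T X U1 U0 w by near: w.
have [Tx' Tt' Xx' Un' _ _ _ _] : equivalence A B C T' X' V1 V0 (im w) by near: w.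
have aT : smooth_at w T by near: w.
have aX : smooth_at w X by near: w.
have a1 : smooth_at w U1 by near: w.
have a0 : smooth_at w U0 by near: w.
have aT' : smooth_at (im w) T' by near: w.
have aX' : smooth_at (im w) X' by near: w.
have a1' : smooth_at (im w) V1 by near: w.
have a0' : smooth_at (im w) V0 by near: w.
have b1 : smooth_at w (fun w => V1 (im w)) by exact: smooth_image.
have b0 : smooth_at w (fun w => V0 (im w)) by exact: smooth_image.
have dTt := dif_image aT aX aT' it; have dXt := dif_image aT aX aX' it.
have dXx := dif_image aT aX aX' ix.
have d1t := dif_image aT aX a1' it; have d1x := dif_image aT aX a1' ix.
have d0t := dif_image aT aX a0' it; have d0x := dif_image aT aX a0' ix.
have e1 i : dif i V1'' w = dif i (fun w => V1 (im w)) w * U1 w + V1 (im w) * dif i U1 w.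
  exact: difM.
have e0 i : dif i V0'' w = dif i (fun w => V1 (im w)) w * U0 w + V1 (im w) * dif i U0 w
    + dif i (fun w => V0 (im w)) w.
  by rewrite (difD i (smoothM b1 a0) b0) (difM i b1 a0).
have nz := (Tt, Xx, Un, Tt', Xx', Un').
split=> // [l b|l]; rewrite sum3E /indM /indN /log_x /log_t !e1 !e0.
  move: l b; apply: ord3P; apply: ord3P;
    rewrite /= ?dTt ?dXx ?d1t ?d1x ?d0t ?d0x ?Tx ?Tx' ?(mul0r, addr0, mulr0, add0r) //;
    by field; rewrite ?nz.
move: l; apply: ord3P;
  rewrite /= ?dTt ?dXt ?d1t ?d1x ?d0t ?d0x ?Tx ?Tx' ?(mul0r, addr0, mulr0, add0r);
  by field; rewrite ?nz.
Unshelve. all: by end_near. Qed.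

End Compose.
End PseudogroupIsomorphism.

Section GroupIsomorphism.
Context {R : realType}.
Variables (Omega : set 'rV[R]_2) (A B C : 'rV[R]_2 -> R).
Hypothesis oO : open Omega.
Hypotheses (sA : forall w, Omega w -> smooth_at w A) (sB : forall w, Omega w -> smooth_at w B)
  (sC : forall w, Omega w -> smooth_at w C).
Hypothesis A0 : forall w, Omega w -> A w != 0.
Notation psymL := (point_symmetry Omega (eqL A B C)).

(** The germ at [p] is reduced to four functions of (t, x), and these act on the fibre over any [q]
    with the same base point. *)
Definition induced (p : 'rV[R]_(2 + 1)) (q : 'rV[R]_(2 + 3)) f :=
  indmap (genT f p) (genX f p) (genU1 f p) (genU0 f p).

Lemma smooth4_near w T X (U1 U0 : 'rV[R]_2 -> R) : smooth4 w T X U1 U0 ->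
  \forall w \near w, smooth4 w T X U1 U0.
Proof.
case=> /smooth_near sT /smooth_near sX /smooth_near s1 /smooth_near s0.
by near=> y; split; near: y.
Unshelve. all: by end_near. Qed.

(** Any representative [Lmap] of the germ of [f] gives the same induced germ, because the data read
    off on the section agree with its coefficients near the base point. Composition, locality and
    surjectivity all rest on this independence. *)
Lemma induced_germ p q f T X U1 U0 : base p = base q -> smooth4 (base p) T X U1 U0 ->
  germ_eq p f (Lmap T X U1 U0) -> germ_eq q (induced p q f) (indmap T X U1 U0).
Proof.
move=> pq s4 /germ_gen4 fg; apply: indmap_germ; rewrite -pq.
apply: filterS2 fg (gen_Lmap s4) => w [e1 e2 e3 e4] [h1 h2 h3 h4].
by split; rewrite ?e1 ?e2 ?e3 ?e4.
Qed.

Lemma induced_base p q f : base p = base q -> base (induced p q f q) = base (f p).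
Proof. by move=> pq; rewrite /induced /indmap base_affmap -pq gen_row2. Qed.

Lemma induced_comp p q f f' : base p = base q -> psymL p f -> psymL (f p) f' ->
  germ_eq q (induced p q (f' \o f)) (induced (f p) (induced p q f q) f' \o induced p q f).
Proof.
move=> pq Sf Sf'; have [[Op _ s4 E] fg] := L_symmetry_data oO A0 Sf.
have [[_ _ s4' E'] fg'] := L_symmetry_data oO A0 Sf'; rewrite -gen_row2 in s4' E'.
apply: germ_trans (germ_sym (indmap_comp s4 s4' E E' (esym pq))).
apply: induced_germ => //; first exact: smooth4_comp.
have cf : \forall z \near p, f' (f z) =
    Lmap (genT f' (f p)) (genX f' (f p)) (genU1 f' (f p)) (genU0 f' (f p)) (f z).
  apply: (@near_comp _ _ _ f p (fun y => f' y = _ y)) => //.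
  by case: Sf => _ _ /smooth_rowP.
by apply: filterS2 cf fg => z /= -> ->; rewrite Lmap_comp.
Qed.

(** At a nearby [p'] the data are read off on a different section, but the representative found at
    [p] still represents the germ of [f] at [p'], so [induced_germ] applies. *)
Lemma induced_local p q f : base p = base q -> psymL p f ->
  \forall p' \near p & q' \near q, base p' = base q' ->
    germ_eq q' (induced p' q' f) (induced p q f).
Proof.
move=> pq Sf; have [[Op _ s4 E] fg] := L_symmetry_data oO A0 Sf.
have n1 := near_base (smooth4_near s4).
(* The product filter asks for a box: the conditions concern the first factor, and the second is the
   whole space. *)
exists ([set p' | smooth4 (base p') (genT f p) (genX f p) (genU1 f p) (genU0 f p) /\
   germ_eq p' f (Lmap (genT f p) (genX f p) (genU1 f p) (genU0 f p))], setT) => /=.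
  split; last exact: filterT.
  by apply: filterS2 n1 (near_join fg) => p'.
by case=> p' q' /= [[s4' g] _] pq'; exact: induced_germ.
Qed.

Lemma groups_isomorphic : point_symmetry_groups_isomorphic Omega (eqL A B C) (DE1 A B C).
Proof.
exists induced; split.
- move=> p q f pq Sf; have [ad _] := L_symmetry_data oO A0 Sf.
  by apply: DE1_symmetry_indmap => //; rewrite -pq.
- by move=> p q f pq _; exact: induced_base.
- move=> p q f f' pq Sf Sf'; have [[_ _ s4 E] fg] := L_symmetry_data oO A0 Sf.
  have [[_ _ s4' E'] fg'] := L_symmetry_data oO A0 Sf'; split=> [ff'|].
    by apply: indmap_germ; rewrite -pq; exact: germ_gen4.
  have [_ Tt _ U1n _ _ _ _] := nbhs_singleton E; have [_ Tt' _ U1n' _ _ _ _] := nbhs_singleton E'.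
  rewrite pq in s4 s4' Tt U1n Tt' U1n'.
  move=> /(indmap_inj s4 s4' Tt U1n Tt' U1n') e4; apply: germ_trans fg _.
  by apply: germ_trans (germ_sym fg'); apply: Lmap_germ; rewrite pq.
- move=> p q h pq /(DE1_symmetry_data oO sA A0)[T [X [U1 [U0 [ad hg]]]]].
  rewrite -pq in ad; exists (Lmap T X U1 U0); first exact: L_symmetry_Lmap.
  apply: germ_trans (germ_sym hg); have [_ _ s4 _] := ad; apply: induced_germ => //.
  by near=> z.
- by move=> p q f f' pq; exact: induced_comp.
- by move=> p q f pq; exact: induced_local.
Unshelve. all: by end_near. Qed.

End GroupIsomorphism.

(** * Lie symmetries of evolution systems *)

Section InfinitesimalInvariance.
Context {R : realType} {m : nat}.
Notation Z := 'rV[R]_(2 + m).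

Definition lie (Q : Z -> Z) (h : Z -> R) (z : Z) : R := \sum_k Q z 0 k * dif k h z.

(** The classical prolongation coefficients as functions of the point [z] and of jet coordinates, in
    place of a function [u]. In [zeta2] the total derivative of the first-order coefficient is
    already expanded. *)
Definition zeta1 (Q : Z -> Z) z a i l : R := td (fun z => Q z 0 (dv l)) z a i
  - \sum_k td (fun z => Q z 0 (tx k)) z a i * a k l.
Definition zeta2 (Q : Z -> Z) z a s i j l : R :=
  let D2 k := td2 (fun z => Q z 0 k) z a i j
    + \sum_b dif (dv b) (fun z => Q z 0 k) z * s i j b in
  D2 (dv l) - \sum_k (D2 (tx k) * a k l + td (fun z => Q z 0 (tx k)) z a i * s k j l)
  - \sum_k td (fun z => Q z 0 (tx k)) z a j * s i k l.

Section Prolongation.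
Variables (Q : Z -> Z) (u : 'rV[R]_2 -> 'rV[R]_m) (w : 'rV[R]_2).
Hypothesis su : smooth_at w u.
Hypothesis sQ : smooth_at (row_mx w (u w)) Q.
Let q k w : R := Q (row_mx w (u w)) 0 k.
Let v l w : R := u w 0 l.

Let sQc k : smooth_at (row_mx w (u w)) (fun z => Q z 0 k).
Proof. by move/smooth_rowP: sQ. Qed.
Let sq k : smooth_at w (q k). Proof. exact: (smooth_on_graph su (sQc k)). Qed.
Let sv l : smooth_at w (v l). Proof. by move: l; apply/smooth_rowP. Qed.

Lemma xi_onE k : xi_on Q u k = q (tx k).
Proof. by apply/funext => y; rewrite /xi_on baseE. Qed.
Lemma eta_onE l : (fun y => eta_on Q u y 0 l) = q (dv l).
Proof. by apply/funext => y; rewrite /eta_on depE. Qed.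

Lemma prol1_near i l : \forall y \near w, prol1 Q u i y 0 l
  = dif i (q (dv l)) y - \sum_k dif i (q (tx k)) y * dif k (v l) y.
Proof.
have se : smooth_at w (eta_on Q u) by apply/smooth_rowP => k; rewrite eta_onE.
apply: filterS2 (smooth_near_row se) (smooth_near_row su) => y sey suy.
rewrite /prol1 mxE [X in _ + X]mxE pd_coord // eta_onE summxE; congr (_ - _).
by apply: eq_bigr => k _; rewrite mxE pd_coord // xi_onE !difE.
Qed.

Lemma prol1E i l : prol1 Q u i w 0 l =
  zeta1 Q (row_mx w (u w)) (fun i l => dif i (v l) w) i l.
Proof.
rewrite (nbhs_singleton (prol1_near i l)) (dif_graph i su (sQc _)); congr (_ - _).
by apply: eq_bigr => k _; rewrite (dif_graph i su (sQc _)).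
Qed.

Lemma prol2E i j l : prol2 Q u i j w 0 l = zeta2 Q (row_mx w (u w))
  (fun i l => dif i (v l) w) (fun i j l => dif j (dif i (v l)) w) i j l.
Proof.
have sk k : smooth_at w (fun y => dif i (q (tx k)) y * dif k (v l) y).
  by apply: smoothM; exact: smooth_dif.
have sp k : smooth_at w (fun y => prol1 Q u i y 0 k).
  apply: (@smooth_eq _ _ _ (fun y => dif i (q (dv k)) y - \sum_b dif i (q (tx b)) y * dif b (v k) y)).
    by apply: filterS (prol1_near i k) => y ->.
  apply: smoothB; first exact: smooth_dif.
  by apply: smooth_sum => b; apply: smoothM; exact: smooth_dif.
have sP : smooth_at w (prol1 Q u i) by exact/smooth_rowP.
rewrite /prol2 mxE [X in _ + X]mxE summxE (pd_coord j l sP) (dif_near _ (prol1_near i l)).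
rewrite difB; [|exact: smooth_dif|exact: smooth_sum].
rewrite dif_sum // (dif2_graph i j su (sQc _)) /zeta2; congr (_ - _ - _).
- by rewrite /td2 big_split /= addrA.
- apply: eq_bigr => k _; rewrite difM; [|exact: smooth_dif|exact: smooth_dif].
  rewrite (dif2_graph i j su (sQc _)) (dif_graph i su (sQc _)); congr (_ * _ + _).
  by rewrite /td2 big_split /= addrA.
apply: eq_bigr => k _.
by rewrite mxE (pd2_coord i k l su) xi_onE -difE (dif_graph j su (sQc _)).
Qed.

End Prolongation.

Section Linearization.
Variables (A : 'rV[R]_2 -> R)
  (H0 : 'I_m -> 'rV[R]_2 -> 'rV[R]_m -> R)
  (H1 : 'I_m -> 'I_m -> 'rV[R]_2 -> 'rV[R]_m -> R).
Notation fA := (fun z : Z => A (base z)).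
Notation f0 l := (fun z : Z => H0 l (base z) (dep z)).
Notation f1 l c := (fun z : Z => H1 l c (base z) (dep z)).

(** The differential of the evolution system in the direction of the prolonged field, in jet
    coordinates. *)
Definition lin_evol Q z a s l : R :=
  zeta1 Q z a it l - A (base z) * zeta2 Q z a s ix ix l - lie Q fA z * s ix ix l
  + lie Q (f0 l) z
  + \sum_c (lie Q (f1 l c) z * a ix c + f1 l c z * zeta1 Q z a ix c).

Variables (Q : Z -> Z) (z : Z).
Hypothesis sQ : smooth_at z Q.
Hypotheses (dA : differentiable fA z) (d0 : forall l, differentiable (f0 l) z)
  (d1 : forall l c, differentiable (f1 l c) z).

Lemma derive_line (h : Z -> R) : differentiable h z ->
  is_derive (0 : R) 1 (fun s : R => h (z + s *: Q z)) (lie Q h z).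
Proof.
move=> dh; rewrite /lie -derive_dif //.
have := @is_derive_line _ _ h z (Q z) 0; rewrite scale0r addr0; exact.
Qed.

Lemma derive_aff (a b : R) : is_derive (0 : R) 1 (fun s : R => a + s * b) b.
Proof.
have D := is_deriveD (is_derive_cst a (0 : R) (1 : R)) (is_deriveZ b (is_derive_id (0 : R) (1 : R))).
have -> : (fun s : R => a + s * b) = cst a + b \*: (id : R -> R).
  by apply/funext => s; rewrite /= mulrC.
by move: D; rewrite add0r [b *: 1]mulr1.
Qed.

Lemma evol_line (J V : jet R m) s y a b2 (c : 'I_2 -> 'I_m -> R) d2 l :
  jt_base J + s *: jt_base V = base y -> jt0 J + s *: jt0 V = dep y ->
  (forall i k, jt1 J i 0 k = a i k) -> jt2 J ix ix 0 l = b2 ->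
  (forall i k, jt1 V i 0 k = c i k) -> jt2 V ix ix 0 l = d2 ->
  evol A H0 H1 l (jet_line J V s) =
  (a it l + s * c it l) - fA y * (b2 + s * d2) + f0 l y
  + \sum_k f1 l k y * (a ix k + s * c ix k).
Proof.
have E (x x' : 'rV[R]_m) k : (x + s *: x') 0 k = x 0 k + s * x' 0 k by rewrite !mxE.
case: J V => w0 u0 p q [w1 u1 p1 q1] /= bE eE Ha Hb Hc Hd.
rewrite /evol /= !E bE eE Ha Hb Hc Hd; congr (_ + _).
by apply: eq_bigr => k _; rewrite E Ha Hc.
Qed.

(** Along the jet line each factor is either a function of z + s Q(z) or affine in [s], so the
    product rule at s = 0 gives [lin_evol]. *)
Lemma derive_evol u l : smooth_at (base z) u -> u (base z) = dep z ->
  derive1 (fun s : R => evol A H0 H1 l (jet_line (j2 u (base z))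
    (prolongation Q u (base z)) s)) 0
  = lin_evol Q z (fun i l => dif i (fun w => u w 0 l) (base z))
      (fun i j l => dif j (dif i (fun w => u w 0 l)) (base z)) l.
Proof.
move=> su uz; set w := base z in su uz *; have zE : row_mx w (u w) = z by rewrite uz row_base_dep.
have sQ' : smooth_at (row_mx w (u w)) Q by rewrite zE.
pose a i l : R := dif i (fun w => u w 0 l) w.
pose s2 i j l : R := dif j (dif i (fun w => u w 0 l)) w.
rewrite -[RHS]/(lin_evol Q z a s2 l).
have bE (s : R) : w + s *: \row_k xi_on Q u k w = base (z + s *: Q z).
  by apply/rowP => k; rewrite !(mxE, baseE) xi_onE zE.
have eE (s : R) : u w + s *: eta_on Q u w = dep (z + s *: Q z).
  by rewrite uz /eta_on zE; apply/rowP => k; rewrite !(mxE, depE).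
have -> : (fun s : R => evol A H0 H1 l (jet_line (j2 u w) (prolongation Q u w) s)) =
  (fun s => (a it l + s * zeta1 Q z a it l)
     - fA (z + s *: Q z) * (s2 ix ix l + s * zeta2 Q z a s2 ix ix l)
     + f0 l (z + s *: Q z)
     + \sum_c f1 l c (z + s *: Q z) * (a ix c + s * zeta1 Q z a ix c)).
  apply/funext => s; apply: (evol_line (y := z + s *: Q z)).
  - exact: bE.
  - exact: eE.
  - by move=> i k; exact: pd_coord.
  - exact: pd2_coord.
  - by move=> i k; have := prol1E su sQ' i k; rewrite zE.
  - by have := prol2E su sQ' ix ix l; rewrite zE.
have D1 := derive_aff (a it l) (zeta1 Q z a it l).
have D2 := derive_aff (s2 ix ix l) (zeta2 Q z a s2 ix ix l).
have D3 c := is_deriveM (derive_line (d1 l c)) (derive_aff (a ix c) (zeta1 Q z a ix c)).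
have D := is_deriveD (is_deriveD (is_deriveB D1 (is_deriveM (derive_line dA) D2))
  (derive_line (d0 l))) (is_derive_sum D3).
rewrite derive1E; apply: etrans (etrans (congr1 (fun F => derive F (0 : R) (1 : R)) _)
  (@derive_val _ _ _ _ _ _ _ D)) _.
  by apply/funext => s; rewrite /= fct_sumE.
rewrite /lin_evol !scale0r !addr0; congr (_ + _).
  by rewrite mul0r addr0 /GRing.scale /=; ring.
by apply: eq_bigr => c _; rewrite mul0r addr0 /GRing.scale /=; ring.
Qed.

End Linearization.
End InfinitesimalInvariance.

(** * Determining equations for Lie symmetries of evolution systems *)

Section InfinitesimalEquations.
Context {R : realType} {m : nat}.
Notation Z := 'rV[R]_(2 + m).
Variables (A : 'rV[R]_2 -> R)
  (H0 : 'I_m -> 'rV[R]_2 -> 'rV[R]_m -> R)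
  (H1 : 'I_m -> 'I_m -> 'rV[R]_2 -> 'rV[R]_m -> R).
Notation fA := (fun z : Z => A (base z)).
Notation f0 l := (fun z : Z => H0 l (base z) (dep z)).
Notation f1 l c := (fun z : Z => H1 l c (base z) (dep z)).

Definition smooth_evol (z : Z) : Prop := [/\ smooth_at z fA,
  forall l, smooth_at z (f0 l) & forall l c, smooth_at z (f1 l c)].

Variables (Q : Z -> Z) (z : Z).
Hypothesis sQ : smooth_at z Q.
Hypothesis sE : smooth_evol z.

(** As in the finite case, [qrow] realizes every symmetric jet, so the quantifier over functions
    disappears. *)
Lemma inf_invariantP : inf_invariant_at (evol A H0 H1) Q z <->
  forall a s, s it ix =1 s ix it -> (forall l, evol_jet A H0 H1 z a s l = 0) ->
  forall l, lin_evol A H0 H1 Q z a s l = 0.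
Proof.
have dA : differentiable fA z by case: sE => /smooth_diff.
have d0 l : differentiable (f0 l) z by case: sE => _ /(_ l)/smooth_diff.
have d1 l c : differentiable (f1 l c) z by case: sE => _ _ /(_ l c)/smooth_diff.
split=> [inv a s sC E l|H u su uz Eu l].
  pose u := qrow (base z) (dep z) a s.
  have uz : u (base z) = dep z by exact: qrow0.
  have zE : row_mx (base z) (u (base z)) = z by rewrite uz row_base_dep.
  have aE i k : dif i (fun w => u w 0 k) (base z) = a i k by rewrite dif_qrow.
  have sE' i j k : dif j (dif i (fun w => u w 0 k)) (base z) = s i j k by rewrite dif2_qrow.
  have su : smooth_at (base z) u by exact: smooth_qrow.
  have := inv u su uz ((satisfies_evol A H0 H1 su zE aE sE').2 E) l.
  rewrite (derive_evol sQ dA d0 d1 l su uz).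
  have -> : (fun i l => dif i (fun w => u w 0 l) (base z)) = a by do 2!apply/funext => ?.
  suff -> : (fun i j l => dif j (dif i (fun w => u w 0 l)) (base z)) = s by [].
  by do 3!apply/funext => ?.
rewrite (derive_evol sQ dA d0 d1 l su uz); apply: H.
  by move=> k; rewrite dif_swap //; move: k; apply/smooth_rowP.
have zE : row_mx (base z) (u (base z)) = z by rewrite uz row_base_dep.
exact: (satisfies_evol A H0 H1 su zE (fun _ _ => erefl) (fun _ _ _ => erefl)).1 Eu.
Qed.

Notation "'d_[ k ] l" := (dif k (fun z : Z => Q z 0 l) z)
  (at level 10, k at level 200, l at level 9).
Notation "'d2_[ k , k' ] l" := (dif k' (dif k (fun z : Z => Q z 0 l)) z)
  (at level 10, k at level 200, k' at level 200, l at level 9).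
Notation T := (@tx m it).
Notation X := (@tx m ix).

Section Invariant.
Hypothesis Az : A (base z) != 0.
Hypothesis inv : inf_invariant_at (evol A H0 H1) Q z.
Variable l0 : 'I_m.

Let h p b := - H0 b (base z) (dep z) - \sum_c H1 b c (base z) (dep z) * p c.
Let linE a s := inf_invariantP.1 inv a s.

(* Vary u_tx, which occurs only with the factor D_x tau. *)
Lemma lie_time : 'd_[X] T = 0 /\ forall b, 'd_[dv b] T = 0.
Proof.
have D p : 'd_[X] T + \sum_b 'd_[dv b] T * p b = 0.
  pose s (e : R) := jet2 (fun=> 0) (fun b : 'I_m => e * (b == l0)%:R) (fun=> 0 : R).
  have E0 e b : evol_jet A H0 H1 z (jet1 (h p) p) (s e) b = 0.
    by rewrite /evol_jet /s /jet1 /jet2 /= /h; ring.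
  have := linE (a := jet1 (h p) p) (s := s 1) (fun=> erefl) (E0 1) l0.
  have := linE (a := jet1 (h p) p) (s := s 0) (fun=> erefl) (E0 0) l0.
  rewrite /lin_evol /zeta2 !sum2E /s /jet2 /= eqxx td_jet1x mulr1n => e0 e1.
  by apply: (mulfI Az); move: e0 e1; lra.
have X0 : 'd_[X] T = 0 by have := D (fun=> 0); under eq_bigr do rewrite mulr0; rewrite big1 ?addr0.
by split=> // b; have := D (fun b' => (b' == b)%:R); rewrite X0 add0r sum_delta.
Qed.

Hypothesis Tflat : forall k, k != T -> \forall z' \near z, dif k (fun z => Q z 0 T) z' = 0.

(* Vary u_xx together with u_t. *)
Lemma lie_space : (forall b, 'd_[dv b] X = 0) /\
  2 * A (base z) * 'd_[X] X = A (base z) * 'd_[T] T + lie Q fA z.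
Proof.
have D p : 2 * A (base z) * ('d_[X] X + \sum_b 'd_[dv b] X * p b)
    = A (base z) * 'd_[T] T + lie Q fA z.
  pose a e := jet1 (fun b => h p b + A (base z) * e * (b == l0)%:R) p.
  pose s (e : R) := jet2 (fun=> 0) (fun=> 0) (fun b : 'I_m => e * (b == l0)%:R).
  have E0 e b : evol_jet A H0 H1 z (a e) (s e) b = 0.
    by rewrite /evol_jet /a /s /jet1 /jet2 /= /h; ring.
  have aX e e' k : td (fun z => Q z 0 k) z (a e) ix = td (fun z => Q z 0 k) z (a e') ix by [].
  have a2 e k : td2 (fun z => Q z 0 k) z (a e) ix ix = td2 (fun z => Q z 0 k) z (a 0) ix ix by [].
  have at_ e k : td (fun z => Q z 0 k) z (a e) it
     = td (fun z => Q z 0 k) z (jet1 (h p) p) it + A (base z) * e * 'd_[dv l0] k.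
    by rewrite /a !td_jet1t sum_deltaD addrA.
  have S1 : \sum_c (lie Q (f1 l0 c) z * a 1 ix c + f1 l0 c z * zeta1 Q z (a 1) ix c)
      = \sum_c (lie Q (f1 l0 c) z * a 0 ix c + f1 l0 c z * zeta1 Q z (a 0) ix c).
    by apply: eq_bigr => c _; rewrite /zeta1 !sum2E !(td_Tx Tflat) !mul0r.
  have T0 : 'd_[dv l0] T = 0 by apply: (dif_T Tflat); rewrite /dv eq_rlshift.
  have al e : a e it l0 = h p l0 + A (base z) * e by rewrite /a /jet1 /= eqxx mulr1.
  have ax e : a e ix l0 = p l0 by [].
  have := linE (a := a 1) (s := s 1) (fun=> erefl) (E0 1) l0.
  have := linE (a := a 0) (s := s 0) (fun=> erefl) (E0 0) l0.
  rewrite /lin_evol S1 [zeta1 Q z (a 0) it l0]/zeta1 [zeta1 Q z (a 1) it l0]/zeta1.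
  rewrite /zeta2 !sum2E !at_ !(td_Tt Tflat) !(td_Tx Tflat) !(td2_Txx Tflat) !(a2 1).
  rewrite T0 !al !ax (aX 1 0) td_jet1x /s /jet2 /= eqxx mulr1n !sum_deltaM => e0 e1.
  move: e0 e1; lra.
have X0 : 2 * A (base z) * 'd_[X] X = A (base z) * 'd_[T] T + lie Q fA z.
  by have := D (fun=> 0); under eq_bigr do rewrite mulr0; rewrite big1 ?addr0.
split=> // b; have two : 2 != 0 :> R by rewrite pnatr_eq0.
(* The right side of [D] does not depend on u_x, so the slope in each fibre direction has to
   vanish. *)
have := D (fun b' => (b' == b)%:R); rewrite sum_delta mulrDr X0.
by move=> E; apply: (mulfI (mulf_neq0 two Az)); move: E; lra.
Qed.

End Invariant.

(** [lres0] and [lres1] are the coefficients of degree 0 and 1 in u_x of the linearized equation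
    after u_t has been eliminated by the equation itself. They are the infinitesimal counterparts of
    [res0] and [res1]. *)
Definition lres0 l : R :=
  'd_[T] (dv l) - \sum_b 'd_[dv b] (dv l) * f0 b z + 'd_[T] T * f0 l z
  - A (base z) * 'd2_[X, X] (dv l) + lie Q (f0 l) z + \sum_d f1 l d z * 'd_[X] (dv d).

Definition lres1 l c : R :=
  - \sum_b 'd_[dv b] (dv l) * f1 b c z + 'd_[T] T * f1 l c z
  - 2 * A (base z) * 'd2_[X, dv c] (dv l) + lie Q (f1 l c) z
  + \sum_d f1 l d z * 'd_[dv c] (dv d) - f1 l c z * 'd_[X] X
  - (c == l)%:R * ('d_[T] X - A (base z) * 'd2_[X, X] X).

Section Flat.
Hypothesis Tflat : forall k, k != T -> \forall z' \near z, dif k (fun z => Q z 0 T) z' = 0.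
Hypothesis Xflat : forall b, \forall z' \near z, dif (dv b) (fun z => Q z 0 X) z' = 0.

(** The original equation eliminates u_t. All remaining u_xx terms combine into a multiple of the
    component [l], and its factor is the condition relating X_x, T_t and the derivative of [A] along
    the field. *)
Lemma lin_evol_flat a s l : (forall l, evol_jet A H0 H1 z a s l = 0) ->
  lin_evol A H0 H1 Q z a s l =
  (2 * A (base z) * 'd_[X] X - A (base z) * 'd_[T] T - lie Q fA z) * s ix ix l
  + lres0 l + \sum_c lres1 l c * a ix c
  - A (base z) * \sum_b (\sum_c 'd2_[dv b, dv c] (dv l) * a ix c) * a ix b.
Proof.
move=> E; have sl : smooth_at z (fun z => Q z 0 (dv l)) by move: (dv l); apply/smooth_rowP.
have at_ k : a it k = A (base z) * s ix ix k - f0 k z - \sum_c f1 k c z * a ix c.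
  by have := E k; rewrite /evol_jet; lra.
have S1 : \sum_b 'd_[dv b] (dv l) * a it b = A (base z) * \sum_b 'd_[dv b] (dv l) * s ix ix b
   - \sum_b 'd_[dv b] (dv l) * f0 b z - \sum_c (\sum_b 'd_[dv b] (dv l) * f1 b c z) * a ix c.
  under eq_bigr do rewrite at_ !mulrDr !mulrN.
  rewrite !big_split /= !sumrN; congr (_ - _ - _).
    by rewrite mulr_sumr; apply: eq_bigr => b _; ring.
  under [LHS]eq_bigr do rewrite mulr_sumr; rewrite exchange_big /=; apply: eq_bigr => b _.
  by rewrite mulr_suml; apply: eq_bigr => d _; ring.
have z1t : zeta1 Q z a it l = 'd_[T] (dv l) + \sum_b 'd_[dv b] (dv l) * a it b
   - ('d_[T] T * a it l + 'd_[T] X * a ix l).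
  by rewrite /zeta1 sum2E (td_Tt Tflat) (td_X Xflat).
have z1x c : zeta1 Q z a ix c = 'd_[X] (dv c) + \sum_b 'd_[dv b] (dv c) * a ix b
   - 'd_[X] X * a ix c.
  by rewrite /zeta1 sum2E (td_Tx Tflat) (td_X Xflat) mul0r add0r.
have z2 : zeta2 Q z a s ix ix l = 'd2_[X, X] (dv l)
   + 2 * \sum_b 'd2_[X, dv b] (dv l) * a ix b
   + \sum_b (\sum_c 'd2_[dv b, dv c] (dv l) * a ix c) * a ix b
   + \sum_b 'd_[dv b] (dv l) * s ix ix b - 'd2_[X, X] X * a ix l - 2 * 'd_[X] X * s ix ix l.
  rewrite /zeta2 !sum2E (td_Tx Tflat) (td2_Txx Tflat) (td_X Xflat) (td2_Xxx sQ Xflat) {1}/td2.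
  under [X in _ + _ + X + _ - _ - _ = _]eq_bigr do rewrite mulrDl (dif_swap _ _ sl).
  by rewrite big_split /=; ring.
have S3 : \sum_c (lie Q (f1 l c) z * a ix c + f1 l c z * zeta1 Q z a ix c)
  = \sum_c lie Q (f1 l c) z * a ix c + \sum_d f1 l d z * 'd_[X] (dv d)
   + \sum_c (\sum_d f1 l d z * 'd_[dv c] (dv d)) * a ix c
   - 'd_[X] X * \sum_c f1 l c z * a ix c.
  rewrite big_split /= -!addrA; congr (_ + _).
  under eq_bigr do rewrite z1x !mulrDr mulrN.
  rewrite !big_split /= sumrN -addrA; congr (_ + (_ - _)); last first.
    by rewrite mulr_sumr; apply: eq_bigr => b _; ring.
  under [LHS]eq_bigr do rewrite mulr_sumr; rewrite exchange_big /=; apply: eq_bigr => b _.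
  by rewrite mulr_suml; apply: eq_bigr => d _; ring.
have S2 : \sum_c lres1 l c * a ix c =
  - \sum_c (\sum_b 'd_[dv b] (dv l) * f1 b c z) * a ix c
  + 'd_[T] T * \sum_c f1 l c z * a ix c
  - 2 * A (base z) * \sum_b 'd2_[X, dv b] (dv l) * a ix b
  + \sum_c lie Q (f1 l c) z * a ix c
  + \sum_c (\sum_d f1 l d z * 'd_[dv c] (dv d)) * a ix c
  - 'd_[X] X * \sum_c f1 l c z * a ix c
  - a ix l * ('d_[T] X - A (base z) * 'd2_[X, X] X).
  have -> : a ix l * ('d_[T] X - A (base z) * 'd2_[X, X] X)
     = \sum_c (c == l)%:R * ('d_[T] X - A (base z) * 'd2_[X, X] X) * a ix c.
    rewrite -[RHS](@eq_bigr _ _ _ _ _ _ (fun c => a ix c * (('d_[T] X - A (base z) * 'd2_[X, X] X) * (c == l)%:R))).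
      by rewrite sum_deltaM; ring.
    by move=> c _; ring.
  rewrite /lres1; under eq_bigr do rewrite !mulrDl !mulNr.
  rewrite !big_split /= !sumrN; congr (- _ + _ - _ + _ + _ - _ - _).
  - by rewrite mulr_sumr; apply: eq_bigr => b _; ring.
  - by rewrite mulr_sumr; apply: eq_bigr => b _; ring.
  - by rewrite mulr_sumr; apply: eq_bigr => b _; ring.
rewrite /lin_evol S3 S2 z1t z2 S1 at_ /lres0; ring.
Qed.

Hypothesis Az : A (base z) != 0.
Hypothesis AX : 2 * A (base z) * 'd_[X] X = A (base z) * 'd_[T] T + lie Q fA z.

Lemma lie_residues : inf_invariant_at (evol A H0 H1) Q z <->
  [/\ forall l, lres0 l = 0, forall l c, lres1 l c = 0
    & forall l b c, 'd2_[dv b, dv c] (dv l) = 0].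
Proof.
have AX0 : 2 * A (base z) * 'd_[X] X - A (base z) * 'd_[T] T - lie Q fA z = 0.
  by move: AX; lra.
split=> [inv|[r0 r1 r2]].
  have H l : [/\ lres0 l = 0, forall c, lres1 l c = 0
     & forall b c, 'd2_[dv b, dv c] (dv l) = 0].
    apply: (quadratic_eq0 Az).
      by move=> b c; apply: dif_swap; move: (dv l); apply/smooth_rowP.
    move=> p; pose a := jet1 (fun b => - f0 b z - \sum_c f1 b c z * p c) p.
    pose s : 'I_2 -> 'I_2 -> 'I_m -> R := jet2 (fun=> 0) (fun=> 0) (fun=> 0).
    have E0 b : evol_jet A H0 H1 z a s b = 0 by rewrite /evol_jet /a /s /jet1 /jet2 /=; ring.
    have := inf_invariantP.1 inv a s (fun=> erefl) E0 l.
    by rewrite lin_evol_flat // AX0 mul0r add0r => /eqP; rewrite subr_eq0 => /eqP.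
  by split=> l; have [] := H l.
apply/inf_invariantP => a s _ E l; rewrite lin_evol_flat // AX0 mul0r add0r r0 add0r.
rewrite big1 => [|c _]; last by rewrite r1 mul0r.
by rewrite big1 ?mulr0 ?subr0 // => b _; rewrite big1 ?mul0r // => c _; rewrite r2 mul0r.
Qed.

End Flat.
End InfinitesimalEquations.

(** * Derivation rules along a vector field *)

Section LieDerivative.
Context {R : realType} {m : nat}.
Notation Z := 'rV[R]_(2 + m).
Variables (Q : Z -> Z) (z : Z).
Implicit Types (f g : Z -> R) (F : 'rV[R]_2 -> R).

Definition dirdif F (v w : 'rV[R]_2) : R := v 0 it * dif it F w + v 0 ix * dif ix F w.

Lemma lie_cst c : lie Q (fun=> c) z = 0.
Proof. by rewrite /lie big1 // => k _; rewrite dif_cst mulr0. Qed.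

Lemma lieD f g : smooth_at z f -> smooth_at z g ->
  lie Q (fun z => f z + g z) z = lie Q f z + lie Q g z.
Proof.
by move=> sf sg; rewrite /lie -big_split /=; apply: eq_bigr => k _; rewrite difD // mulrDr.
Qed.

Lemma lieN f : smooth_at z f -> lie Q (fun z => - f z) z = - lie Q f z.
Proof.
by move=> sf; rewrite /lie -sumrN; apply: eq_bigr => k _; rewrite difN // mulrN.
Qed.

Lemma lieM f g : smooth_at z f -> smooth_at z g ->
  lie Q (fun z => f z * g z) z = lie Q f z * g z + f z * lie Q g z.
Proof.
move=> sf sg; rewrite /lie mulr_suml mulr_sumr -big_split /=.
by apply: eq_bigr => k _; rewrite difM //; ring.
Qed.

Lemma lie_base F : smooth_at (base z) F ->
  lie Q (fun z => F (base z)) z = dirdif F (base (Q z)) (base z).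
Proof.
move=> sF; rewrite /lie sum_split big1 => [|b _]; last by rewrite dif_base_dv // mulr0.
by rewrite !dif_base // addr0 /dirdif !baseE.
Qed.

Lemma lie_dep b : lie Q (fun z => dep z 0 b) z = dep (Q z) 0 b.
Proof.
rewrite /lie sum_split !dif_dep_tx !mulr0 !add0r.
under eq_bigr do rewrite dif_dep_dv eq_sym.
by rewrite sum_delta depE.
Qed.

End LieDerivative.

(** * Lie symmetries of evolution systems are affine along the fibres *)

Section LieSymmetryIsAffine.
Context {R : realType} {m : nat}.
Notation Z := 'rV[R]_(2 + m).
Variables (Omega : set 'rV[R]_2) (A : 'rV[R]_2 -> R)
  (H0 : 'I_m -> 'rV[R]_2 -> 'rV[R]_m -> R)
  (H1 : 'I_m -> 'I_m -> 'rV[R]_2 -> 'rV[R]_m -> R)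
  (dH0 : 'I_m -> 'rV[R]_2 -> 'rV[R]_m -> 'rV[R]_2 -> 'rV[R]_m -> R)
  (dH1 : 'I_m -> 'I_m -> 'rV[R]_2 -> 'rV[R]_m -> 'rV[R]_2 -> 'rV[R]_m -> R).
Hypothesis oO : open Omega.
Hypothesis A0 : forall w, Omega w -> A w != 0.
Hypothesis sA : forall w, Omega w -> smooth_at w A.
Hypothesis sE : forall z : Z, Omega (base z) -> smooth_evol A H0 H1 z.
Hypothesis lieH0 : forall (Q : Z -> Z) z l, Omega (base z) ->
  lie Q (fun z => H0 l (base z) (dep z)) z = dH0 l (base z) (dep z) (base (Q z)) (dep (Q z)).
Hypothesis lieH1 : forall (Q : Z -> Z) z l c, Omega (base z) ->
  lie Q (fun z => H1 l c (base z) (dep z)) z = dH1 l c (base z) (dep z) (base (Q z)) (dep (Q z)).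
Implicit Types (T X : 'rV[R]_2 -> R) (M : 'I_m -> 'I_m -> 'rV[R]_2 -> R)
  (N : 'I_m -> 'rV[R]_2 -> R).

(** [dH0] and [dH1] stand for the differentials of the coefficients as functions of a point and a
    direction. This form displays their degree in the fibre coordinate when the direction is itself
    affine in it. *)
Definition alres0 T X M N (z : Z) l : R :=
  let w := base z in let u := dep z in
  affine (fun b => dif it (M l b)) (dif it (N l)) z - \sum_b M l b w * H0 b w u
  + dif it T w * H0 l w u
  - A w * affine (fun b => dif ix (dif ix (M l b))) (dif ix (dif ix (N l))) z
  + dH0 l w u (row2 (T w) (X w)) (dep (affmap T X M N z))
  + \sum_d H1 l d w u * affine (fun b => dif ix (M d b)) (dif ix (N d)) z.

Definition alres1 T X M N (z : Z) l c : R :=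
  let w := base z in let u := dep z in
  - \sum_b M l b w * H1 b c w u + dif it T w * H1 l c w u - 2 * A w * dif ix (M l c) w
  + dH1 l c w u (row2 (T w) (X w)) (dep (affmap T X M N z))
  + \sum_d H1 l d w u * M d c w - H1 l c w u * dif ix X w
  - (c == l)%:R * (dif it X w - A w * dif ix (dif ix X) w).

Record affine_lie T X M N (z : Z) : Prop := AffineLie {
  afl_Tx : dif ix T (base z) = 0;
  afl_A : 2 * A (base z) * dif ix X (base z)
    = A (base z) * dif it T (base z) + dirdif A (row2 (T (base z)) (X (base z))) (base z);
  afl_res0 : forall l, alres0 T X M N z l = 0;
  afl_res1 : forall l c, alres1 T X M N z l c = 0 }.

Lemma lres0_affmap T X M N z l : Omega (base z) -> smooth_data (base z) T X M N ->
  lres0 A H0 H1 (affmap T X M N) z l = alres0 T X M N z l.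
Proof.
move=> Oz [sT sX sM sN]; rewrite /lres0 /alres0 lieH0 // base_affmap !affmapTE !affmapDE.
rewrite !dif_base // !dif_affine_tx // dif2_affine_tx //.
congr (_ - _ + _ - _ + _ + _); apply: eq_bigr => b _; first by rewrite dif_affine_dv.
by rewrite affmapDE dif_affine_tx.
Qed.

Lemma lres1_affmap T X M N z l c : Omega (base z) -> smooth_data (base z) T X M N ->
  lres1 A H1 (affmap T X M N) z l c = alres1 T X M N z l c.
Proof.
move=> Oz [sT sX sM sN]; rewrite /lres1 /alres1 lieH1 // base_affmap !affmapTE !affmapXE !affmapDE.
rewrite !dif_base // !dif2_base // dif2_affine_xdv //.
congr (- _ + _ - _ + _ + _ - _ - _); apply: eq_bigr => b _; first by rewrite dif_affine_dv.
by rewrite affmapDE dif_affine_dv.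
Qed.

Section Germs.
Variables (f g : Z -> Z) (z : Z).
Hypothesis fg : germ_eq z f g.

Lemma germ_lie h : lie f h z = lie g h z.
Proof. by rewrite /lie (nbhs_singleton fg). Qed.

Lemma germ_lres0 l : lres0 A H0 H1 f z l = lres0 A H0 H1 g z l.
Proof.
rewrite /lres0 !(germ_dif fg) !(germ_dif2 fg) germ_lie.
by congr (_ - _ + _ - _ + _ + _); apply: eq_bigr => b _; rewrite (germ_dif fg).
Qed.

Lemma germ_lres1 l c : lres1 A H1 f z l c = lres1 A H1 g z l c.
Proof.
rewrite /lres1 !(germ_dif fg) !(germ_dif2 fg) germ_lie.
by congr (- _ + _ - _ + _ + _ - _ - _); apply: eq_bigr => b _; rewrite (germ_dif fg).
Qed.

End Germs.

(** The same bootstrapping as for point symmetries: a pointwise conclusion is spread over a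
    neighbourhood before the next step differentiates it. *)
Lemma lie_symmetry_affine (Q : Z -> Z) p (l0 : 'I_m) :
  lie_symmetry Omega (evol A H0 H1) p Q ->
  germ_eq p Q (affgen Q p) /\ \forall z \near p,
    affine_lie (genT Q p) (genX Q p) (genM Q p) (genN Q p) z.
Proof.
move=> [Op sQ pf].
have n1 := smooth_near_row sQ; have n4 := near_Omega_base oO Op.
have n6 : \forall z \near p, dif (tx ix) (fun z => Q z 0 (tx it)) z = 0 /\
    forall b, dif (dv b) (fun z => Q z 0 (tx it)) z = 0.
  near=> z; have [sQz Oz pz] : [/\ smooth_at z Q, Omega (base z)
      & inf_invariant_at (evol A H0 H1) Q z] by split; near: z.
  exact: (lie_time sQz (sE Oz) (A0 Oz) pz l0).
have n6' : \forall z \near p, forall k, k != tx it -> \forall y \near z,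
    dif k (fun z => Q z 0 (tx it)) y = 0.
  apply: filterS (near_join n6) => z nz k; rewrite -(splitK k).
  case: (fintype.split k) => j /=; last by move=> _; apply: filterS nz => y [].
  by move: j; apply: ord2P; rewrite ?eqxx // => _; apply: filterS nz => y [].
have n7 : \forall z \near p, (forall b, dif (dv b) (fun z => Q z 0 (tx ix)) z = 0) /\
    2 * A (base z) * dif (tx ix) (fun z => Q z 0 (tx ix)) z
      = A (base z) * dif (tx it) (fun z => Q z 0 (tx it)) z + lie Q (fun z => A (base z)) z.
  near=> z; have [sQz Oz pz] : [/\ smooth_at z Q, Omega (base z)
      & inf_invariant_at (evol A H0 H1) Q z] by split; near: z.
  have tz : forall k, k != tx it -> \forall y \near z,
    dif k (fun z => Q z 0 (tx it)) y = 0 by near: z.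
  exact: (lie_space sQz (sE Oz) (A0 Oz) pz l0 tz).
have n7' := near_join n7.
have n8 : \forall z \near p, [/\ forall l, lres0 A H0 H1 Q z l = 0,
    forall l c, lres1 A H1 Q z l c = 0
    & forall l b c, dif (dv c) (dif (dv b) (fun z => Q z 0 (dv l))) z = 0].
  near=> z; have n7z : \forall y \near z, (forall b, dif (dv b) (fun z => Q z 0 (tx ix)) y = 0) /\
    2 * A (base y) * dif (tx ix) (fun z => Q z 0 (tx ix)) y
      = A (base y) * dif (tx it) (fun z => Q z 0 (tx it)) y + lie Q (fun z => A (base z)) y
    by near: z.
  have [sQz Oz pz] : [/\ smooth_at z Q, Omega (base z)
      & inf_invariant_at (evol A H0 H1) Q z] by split; near: z.
  have tz : forall k, k != tx it -> \forall y \near z,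
    dif k (fun z => Q z 0 (tx it)) y = 0 by near: z.
  have xz b : \forall y \near z, dif (dv b) (fun z => Q z 0 (tx ix)) y = 0.
    by apply: filterS n7z => y [].
  exact: (lie_residues sQz (sE Oz) tz xz (A0 Oz) (nbhs_singleton n7z).2).1 pz.
have germ : germ_eq p Q (affgen Q p).
  by apply: affgen_germ => //; [apply: filterS n6 => z []|apply: filterS n7 => z []
    |apply: filterS n8 => z []].
split=> //; have n9 := near_join germ.
have n10 := near_base (smooth_data_near (smooth_gen_data sQ)).
near=> z; have gz : germ_eq z Q (affgen Q p) by near: z.
have sd : smooth_data (base z) (genT Q p) (genX Q p) (genM Q p) (genN Q p) by near: z.
have [sT sX _ _] := sd; have Oz : Omega (base z) by near: z.
have [r0 r1 _] : [/\ forall l, lres0 A H0 H1 Q z l = 0,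
    forall l c, lres1 A H1 Q z l c = 0
    & forall l b c, dif (dv c) (dif (dv b) (fun z => Q z 0 (dv l))) z = 0] by near: z.
have [Tx _] : dif (tx ix) (fun z => Q z 0 (tx it)) z = 0 /\
    forall b, dif (dv b) (fun z => Q z 0 (tx it)) z = 0 by near: z.
have [_ AX] : (forall b, dif (dv b) (fun z => Q z 0 (tx ix)) z = 0) /\
    2 * A (base z) * dif (tx ix) (fun z => Q z 0 (tx ix)) z
      = A (base z) * dif (tx it) (fun z => Q z 0 (tx it)) z + lie Q (fun z => A (base z)) z
  by near: z.
move: Tx AX; rewrite !(germ_dif gz) (germ_lie gz) affmapTE affmapXE !dif_base //.
rewrite lie_base ?base_affmap; last exact: sA.
move=> Tx AX; split=> //.
- by move=> l; rewrite -lres0_affmap // -(germ_lres0 gz).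
- by move=> l c; rewrite -lres1_affmap // -(germ_lres1 gz).
Unshelve. all: by end_near. Qed.

Lemma affine_lie_symmetry (p : Z) T X M N : Omega (base p) ->
  smooth_data (base p) T X M N -> (\forall z \near p, affine_lie T X M N z) ->
  lie_symmetry Omega (evol A H0 H1) p (affmap T X M N).
Proof.
move=> Op sd ns; have sf := smooth_affmap sd.
split=> //; have n1 := near_Omega_base oO Op.
have n3 := near_base (smooth_data_near sd); have n4 := near_join ns.
have n5 := near_join n3.
near=> z; have sdz : smooth_data (base z) T X M N by near: z.
have nsz : \forall y \near z, affine_lie T X M N y by near: z.
have nsd : \forall y \near z, smooth_data (base y) T X M N by near: z.
have Oz : Omega (base z) by near: z.
have [Tx AX r0 r1] := nbhs_singleton nsz; have [sT sX sM sN] := sdz.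
apply: (lie_residues (smooth_affmap sdz) (sE Oz) _ _ (A0 Oz) _).2.
- move=> k; rewrite -(splitK k); rewrite affmapTE; case: (fintype.split k) => j /=; last first.
    by move=> _; apply: filterS nsd => y [sTy _ _ _]; exact: dif_base_dv.
  move: j; apply: ord2P; rewrite ?eqxx // => _.
  by apply: filterS2 nsd nsz => y [sTy _ _ _] [Txy _ _ _]; rewrite dif_base.
- move=> b; rewrite affmapXE.
  by apply: filterS nsd => y [_ sXy _ _]; exact: dif_base_dv.
- by rewrite affmapXE affmapTE !dif_base // lie_base ?base_affmap //; exact: sA.
split=> [l|l c|l b c].
- by rewrite lres0_affmap.
- by rewrite lres1_affmap.
- by rewrite affmapDE dif2_affine_dv.
Unshelve. all: by end_near. Qed.

Section AllFibers.
Hypothesis quadH0 : forall l w, isquad (H0 l w).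
Hypothesis affH1 : forall l c w, isaff (H1 l c w).
Hypothesis quad_dH0 : forall l w v (e : 'rV[R]_m -> 'rV[R]_m),
  (forall k, isaff (fun u => e u 0 k)) -> isquad (fun u => dH0 l w u v (e u)).
Hypothesis aff_dH1 : forall l c w v (e : 'rV[R]_m -> 'rV[R]_m),
  (forall k, isaff (fun u => e u 0 k)) -> isaff (fun u => dH1 l c w u v (e u)).
Variables (T X : 'rV[R]_2 -> R) (M : 'I_m -> 'I_m -> 'rV[R]_2 -> R)
  (N : 'I_m -> 'rV[R]_2 -> R).

Let aff_dep w k : isaff (fun u => dep (affmap T X M N (row_mx w u)) 0 k).
Proof. by under eq_fun do rewrite dep_affmapE; exact: isaff_affine. Qed.

Lemma isquad_alres0 w l : isquad (fun u => alres0 T X M N (row_mx w u) l).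
Proof.
rewrite /alres0; under eq_fun do rewrite base_row dep_row.
apply: isquadD; [apply: isquadD; [apply: isquadD; [apply: isquadD; [apply: isquadD|]|]|]|].
- by apply: isquad_aff; exact: isaff_affine.
- by apply: isquadN; apply: isquad_sum => b; exact: isquadZ.
- exact: isquadZ.
- by apply: isquadN; apply: isquad_aff; apply: isaffM; exact: isaff_affine.
- exact: (quad_dH0 l w (row2 (T w) (X w)) (aff_dep w)).
by apply: isquad_sum => d; apply: isquadM => //; exact: isaff_affine.
Qed.

Lemma isaff_alres1 w l c : isaff (fun u => alres1 T X M N (row_mx w u) l c).
Proof.
rewrite /alres1; under eq_fun do rewrite base_row dep_row.
apply: isaffD; [apply: isaffD; [apply: isaffD; [apply: isaffD; [apply: isaffD;
  [apply: isaffD|]|]|]|]|].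
- by apply: isaffN; apply: isaff_sum => b; exact: isaffM.
- exact: isaffM.
- exact: isaff_cst.
- exact: (aff_dH1 l c w (row2 (T w) (X w)) (aff_dep w)).
- by apply: isaff_sum => d; exact: isaffMr.
- by apply: isaffN; exact: isaffMr.
- exact: isaff_cst.
Qed.

(** The linearized residues are again at most quadratic in the fibre coordinate, so [quad_eq0]
    extends their vanishing to the whole fibre. *)
Lemma affine_lie_fibers (p : Z) : (\forall z \near p, affine_lie T X M N z) ->
  \forall w \near base p, forall u, affine_lie T X M N (row_mx w u).
Proof.
move=> /near_fibers; apply: filterS => w nu u.
have := nbhs_singleton nu; case; rewrite !base_row => Tx AX _ _.
split; rewrite ?base_row //.
  move=> l; move: u; apply: (quad_eq0 (isquad_alres0 w l)).
  by apply: filterS nu => u [].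
move=> l c; move: u; apply: (quad_eq0 (isquad_aff (isaff_alres1 w l c))).
by apply: filterS nu => u [].
Qed.

Lemma affine_lie_base (p : Z) :
  (\forall w \near base p, forall u, affine_lie T X M N (row_mx w u)) ->
  \forall z \near p, affine_lie T X M N z.
Proof. by move=> /near_base; apply: filterS => z /(_ (dep z)); rewrite row_base_dep. Qed.

End AllFibers.
End LieSymmetryIsAffine.

(** * Lie symmetries of the two systems *)

Section LieOfTheTwoSystems.
Context {R : realType}.
Variables (Omega : set 'rV[R]_2) (A B C : 'rV[R]_2 -> R).
Hypothesis oO : open Omega.
Hypotheses (sA : forall w, Omega w -> smooth_at w A) (sB : forall w, Omega w -> smooth_at w B)
  (sC : forall w, Omega w -> smooth_at w C).
Hypothesis A0 : forall w, Omega w -> A w != 0.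
Implicit Types (T X : 'rV[R]_2 -> R).

Definition dL0 (l : 'I_1) (w : 'rV[R]_2) (u : 'rV[R]_1) (v : 'rV[R]_2) (e : 'rV[R]_1) : R :=
  - (dirdif C v w * u 0 0 + C w * e 0 0).
Definition dL1 (l c : 'I_1) (w : 'rV[R]_2) (u : 'rV[R]_1) (v : 'rV[R]_2) (e : 'rV[R]_1) : R :=
  - dirdif B v w.

Definition dD0 (l : 'I_3) (w : 'rV[R]_2) (g : 'rV[R]_3) (v : 'rV[R]_2) (e : 'rV[R]_3) : R :=
  let K := - (log_x A w * g 0 i1) - log_t A w in
  let dK := - (dirdif (log_x A) v w * g 0 i1 + log_x A w * e 0 i1) - dirdif (log_t A) v w in
  [:: dK * (g 0 i1 + B w) + K * (e 0 i1 + dirdif B v w)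
        + (dirdif (dif ix B) v w * g 0 i1 + dif ix B w * e 0 i1) + dirdif (dif it B) v w;
      dK * (g 0 i2 - C w) + K * (e 0 i2 - dirdif C v w)
        - (dirdif (dif ix C) v w * g 0 i1 + dif ix C w * e 0 i1) - dirdif (dif it C) v w;
      dK * g 0 i3 + K * e 0 i3 - (dirdif C v w * g 0 i3 + C w * e 0 i3)]`_l.

Definition dD1 (l c : 'I_3) (w : 'rV[R]_2) (g : 'rV[R]_3) (v : 'rV[R]_2) (e : 'rV[R]_3) : R :=
  (nth [::] [:: [:: 2 * e 0 i1 + dirdif B v w; 2 * dirdif A v w; 0];
                [:: 2 * (e 0 i2 - dirdif C v w); - dirdif B v w; 0];
                [:: 2 * e 0 i3; 0; - dirdif B v w]] l)`_c.

Ltac smz := repeat first [assumption | apply: smooth_over_base; by [] | apply: smooth_dep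
  | apply: smooth_cst | apply: smoothB | apply: smoothD | apply: smoothM | apply: smoothN].

Section AtPoint.
Variables (m : nat) (z : 'rV[R]_(2 + m)).
Hypothesis Oz : Omega (base z).
Let sAz := sA Oz. Let sBz := sB Oz. Let sCz := sC Oz.
Lemma smooth_coefs : [/\ smooth_at z (fun z => A (base z)), smooth_at z (fun z => B (base z)),
  smooth_at z (fun z => C (base z))
  & [/\ smooth_at z (fun z => dif ix B (base z)), smooth_at z (fun z => dif it B (base z)),
  smooth_at z (fun z => dif ix C (base z)) & smooth_at z (fun z => dif it C (base z))]].
Proof. by split; [..|split]; apply: smooth_over_base => //; exact: smooth_dif. Qed.

Lemma smooth_logs : smooth_at (base z) (log_x A) /\ smooth_at (base z) (log_t A).
Proof.
have iA : smooth_at (base z) (fun w => (A w)^-1) by apply: smoothV => //; exact: A0.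
by split; apply: smoothM => //; exact: smooth_dif.
Qed.
End AtPoint.

Lemma smooth_evol_L z : Omega (base z) -> smooth_evol A (L0 C) (L1 B) z.
Proof.
move=> Oz; have [zA zB zC _] := smooth_coefs Oz.
by split=> // [l|l c]; rewrite /L0 /L1; smz.
Qed.

Lemma lie_L0 Q z l : Omega (base z) ->
  lie Q (fun z => L0 C l (base z) (dep z)) z = dL0 l (base z) (dep z) (base (Q z)) (dep (Q z)).
Proof.
move=> Oz; have [_ _ zC _] := smooth_coefs Oz.
rewrite /L0 /dL0 lieN; last by smz.
rewrite lieM //; last by smz.
by rewrite lie_base ?lie_dep //; exact: sC.
Qed.

Lemma lie_L1 Q z l c : Omega (base z) ->
  lie Q (fun z => L1 B l c (base z) (dep z)) z = dL1 l c (base z) (dep z) (base (Q z)) (dep (Q z)).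
Proof.
move=> Oz; have [_ zB _ _] := smooth_coefs Oz.
by rewrite /L1 /dL1 lieN // lie_base //; exact: sB.
Qed.

Lemma smooth_evol_D z : Omega (base z) -> smooth_evol A (D0 A B C) (D1 A B C) z.
Proof.
move=> Oz; have [zA zB zC [zBx zBt zCx zCt]] := smooth_coefs Oz.
have [/smooth_over_base zl /smooth_over_base zm] := smooth_logs Oz.
split=> // [l|l c].
  by rewrite /D0; move: l; apply: ord3P => /=; smz.
by rewrite /D1; move: l c; apply: ord3P; apply: ord3P => /=; smz.
Qed.

Lemma lie_D0 Q z l : Omega (base z) -> lie Q (fun z => D0 A B C l (base z) (dep z)) z
  = dD0 l (base z) (dep z) (base (Q z)) (dep (Q z)).
Proof.
move=> Oz; have [zA zB zC [zBx zBt zCx zCt]] := smooth_coefs Oz.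
have [sl sm] := smooth_logs Oz; have zl := smooth_over_base sl; have zm := smooth_over_base sm.
have sBz := sB Oz; have sCz := sC Oz.
pose K (z : 'rV[R]_(2 + 3)) := - (log_x A (base z) * dep z 0 i1) - log_t A (base z).
have sK : smooth_at z K by rewrite /K; smz.
have lK : lie Q K z = - (dirdif (log_x A) (base (Q z)) (base z) * dep z 0 i1
    + log_x A (base z) * dep (Q z) 0 i1) - dirdif (log_t A) (base (Q z)) (base z).
  have s1 : smooth_at z (fun z => log_x A (base z) * dep z 0 i1) by smz.
  have s2 : smooth_at z (fun z => - (log_x A (base z) * dep z 0 i1)) by smz.
  have s3 : smooth_at z (fun z => - log_t A (base z)) by smz.
  by rewrite /K (lieD _ s2 s3) !lieN // lieM // ?lie_base // ?lie_dep; smz.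
have sBx := smooth_dif ix sBz; have sBt := smooth_dif it sBz.
have sCx := smooth_dif ix sCz; have sCt := smooth_dif it sCz.
rewrite /dD0; move: l; apply: ord3P => /=.
- transitivity (lie Q (fun z => K z * (dep z 0 i1 + B (base z)) + dif ix B (base z) * dep z 0 i1
    + dif it B (base z)) z); first by [].
  by rewrite !(lieD, lieM, lie_dep, lie_base, lK) //; smz.
- transitivity (lie Q (fun z => K z * (dep z 0 i2 + - C (base z)) + - (dif ix C (base z) * dep z 0 i1)
    + - dif it C (base z)) z); first by [].
  by rewrite !(lieD, lieM, lieN, lie_dep, lie_base, lK) //; smz.
transitivity (lie Q (fun z => K z * dep z 0 i3 + - (C (base z) * dep z 0 i3)) z); first by [].
by rewrite !(lieD, lieM, lieN, lie_dep, lie_base, lK) //; smz.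
Qed.

Lemma lie_D1 Q z l c : Omega (base z) -> lie Q (fun z => D1 A B C l c (base z) (dep z)) z
  = dD1 l c (base z) (dep z) (base (Q z)) (dep (Q z)).
Proof.
move=> Oz; have [zA zB zC _] := smooth_coefs Oz.
have sAz := sA Oz; have sBz := sB Oz; have sCz := sC Oz.
rewrite /D1 /dD1; move: l c; apply: ord3P; apply: ord3P => /=;
  rewrite ?(lieD, lieN, lieM, lie_dep, lie_base, lie_cst) //; smz; rewrite ?mul0r ?add0r //.
Qed.

Ltac aff_tac := repeat first
  [ assumption | apply: isaff_coord | apply: isaff_cst | apply: isaffN | apply: isaffM
  | apply: isaffMr | apply: isaffD ].

Lemma quad_dL0 l w v (e : 'rV[R]_1 -> 'rV[R]_1) :
  (forall k, isaff (fun u => e u 0 k)) -> isquad (fun u => dL0 l w u v (e u)).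
Proof. by move=> /(_ 0) ae; apply: isquad_aff; rewrite /dL0; aff_tac. Qed.
Lemma aff_dL1 l c w v (e : 'rV[R]_1 -> 'rV[R]_1) :
  (forall k, isaff (fun u => e u 0 k)) -> isaff (fun u => dL1 l c w u v (e u)).
Proof. by move=> _; exact: isaff_cst. Qed.

Lemma quad_dD0 l w v (e : 'rV[R]_3 -> 'rV[R]_3) :
  (forall k, isaff (fun u => e u 0 k)) -> isquad (fun u => dD0 l w u v (e u)).
Proof.
move=> ae; have a1 := ae i1; have a2 := ae i2; have a3 := ae i3.
rewrite /dD0; move: l; apply: ord3P => /=;
  repeat first [apply: isquadM; by aff_tac | apply: isquad_aff; by aff_tac | apply: isquadD
    | apply: isquadN].
Qed.
Lemma aff_dD1 l c w v (e : 'rV[R]_3 -> 'rV[R]_3) :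
  (forall k, isaff (fun u => e u 0 k)) -> isaff (fun u => dD1 l c w u v (e u)).
Proof.
move=> ae; have a1 := ae i1; have a2 := ae i2; have a3 := ae i3.
by rewrite /dD1; move: l c; apply: ord3P; apply: ord3P => /=; aff_tac.
Qed.

(** The linearization of [equivalence] at T = t, X = x, U1 = 1, U0 = 0, solved for the derivatives
    of [B] and [C] along the base field. *)
Record inf_equivalence T X (z1 z0 : 'rV[R]_2 -> R) (w : 'rV[R]_2) : Prop := InfEquivalence {
  ieq_Tx : dif ix T w = 0;
  ieq_A : 2 * A w * dif ix X w = A w * dif it T w + dirdif A (row2 (T w) (X w)) w;
  ieq_B : dirdif B (row2 (T w) (X w)) w = - (dif it T w * B w) - dif it X w
    - 2 * A w * dif ix z1 w + A w * dif ix (dif ix X) w + B w * dif ix X w;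
  ieq_C : dirdif C (row2 (T w) (X w)) w = dif it z1 w - dif it T w * C w
    - A w * dif ix (dif ix z1) w - B w * dif ix z1 w;
  ieq_0 : dif it z0 w = A w * dif ix (dif ix z0) w + B w * dif ix z0 w + C w * z0 w }.

(** The degree 0 residue is affine in u and the degree 1 residue is constant in it, so u = 0 and u =
    1 suffice. *)
Lemma L_lieP T X (M : 'I_1 -> 'I_1 -> 'rV[R]_2 -> R) N w :
  (forall u, affine_lie A (L0 C) (L1 B) dL0 dL1 T X M N (row_mx w u)) <->
  inf_equivalence T X (M 0 0) (N 0) w.
Proof.
have r0E u : alres0 A (L0 C) (L1 B) dL0 T X M N (row_mx w u) 0 =
  (dif it (M 0 0) w - dif it T w * C w - A w * dif ix (dif ix (M 0 0)) w
    - dirdif C (row2 (T w) (X w)) w - B w * dif ix (M 0 0) w) * u 0 0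
  + (dif it (N 0) w - A w * dif ix (dif ix (N 0)) w - C w * N 0 w - B w * dif ix (N 0) w).
  rewrite /alres0 /L0 /L1 /dL0 !sum1E dep_affmapE /affine !sum1E base_row dep_row; ring.
have r1E u : alres1 A (L1 B) dL1 T X M N (row_mx w u) 0 0 =
  - (dif it T w * B w) - dif it X w - 2 * A w * dif ix (M 0 0) w
  + A w * dif ix (dif ix X) w - dirdif B (row2 (T w) (X w)) w + B w * dif ix X w.
  rewrite /alres1 /L1 /dL1 !sum1E base_row eqxx mulr1n; ring.
split=> [S|[Tx eA eB eC e0] u].
  have := S 0; case; rewrite base_row => Tx AX r0 r1.
  have := S (const_mx 1) => -[_ _ s0 _].
  have := r0 0; have := s0 0; have := r1 0 0; rewrite !r0E r1E !mxE => {s0 r0 r1} e1 e2 e3.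
  by split=> //; [move: e1|move: e2 e3|move: e3]; lra.
split; rewrite ?base_row // => l; rewrite (ord1 l).
  by rewrite r0E eC e0; ring.
by move=> c; rewrite (ord1 c) r1E eB; ring.
Qed.

End LieOfTheTwoSystems.

(** * Recovering a Lie symmetry of [eqL] from one of [DE1] *)

Section InducedLieSymmetry.
Context {R : realType}.
Variables (A B C T X : 'rV[R]_2 -> R).
Notation v w := (row2 (T w) (X w)).

(** The linearization of [indM] at the identity. The overall factor 1 / T_t contributes the term -
    T_t on the diagonal. *)
Definition indlieM T X (z1 z0 : 'rV[R]_2 -> R) (l b : 'I_3) (w : 'rV[R]_2) : R :=
  (nth [::] [:: [:: dif ix X w - dif it T w; 0; 0]; [:: dif ix z1 w; - dif it T w; 0];
     [:: dif ix z0 w; - z0 w; z1 w - dif it T w]] l)`_b.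
Definition indlieN X (z1 z0 : 'rV[R]_2 -> R) (l : 'I_3) (w : 'rV[R]_2) : R :=
  [:: dif it X w; dif it z1 w; dif it z0 w]`_l.

Section TimeDependence.
Variable w0 : 'rV[R]_2.
Hypotheses (sT : smooth_at w0 T) (sX : smooth_at w0 X).
Hypothesis nT : \forall w \near w0, dif ix T w = 0.

Lemma near_Ttx0 : \forall w \near w0, dif ix (dif it T) w = 0.
Proof.
apply: filterS2 (near_join nT) (smooth_near sT) => w nTw sTw.
by rewrite dif_swap // (@dif_near _ _ _ _ (fun=> 0)) ?dif_cst.
Qed.

(** The last two terms are the commutator of the partial derivative with the base field. *)
Lemma near_dirdif_dif (F : 'rV[R]_2 -> R) i : smooth_at w0 F -> \forall w \near w0,
  dif i (fun w => dirdif F (v w) w) w = dirdif (dif i F) (v w) w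
    + dif i T w * dif it F w + dif i X w * dif ix F w.
Proof.
move=> sF; have n1 := smooth_near sT; have n2 := smooth_near sX; have n3 := smooth_near sF.
near=> w; have sTw : smooth_at w T by near: w.
have sXw : smooth_at w X by near: w.
have sFw : smooth_at w F by near: w.
have s1 := smooth_dif it sFw; have s2 := smooth_dif ix sFw.
rewrite /dirdif; under eq_fun do rewrite row2_it row2_ix.
rewrite (difD _ (smoothM sTw s1) (smoothM sXw s2)) (difM _ sTw s1) (difM _ sXw s2).
by rewrite row2_it row2_ix (dif_swap it i sFw) (dif_swap ix i sFw); ring.
Unshelve. all: by end_near. Qed.

(** Division of the condition on [A] by [A] gives T (log A)_t + X (log A)_x = 2 X_x - T_t, in
    logarithmic derivatives. Differentiating it in x and in t, with T_x = T_tx = 0 and equal mixed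
    derivatives, yields the two formulas. *)
Lemma near_dirdif_log (sA : smooth_at w0 A) : (\forall w \near w0, A w != 0) ->
  (\forall w \near w0, 2 * A w * dif ix X w = A w * dif it T w + dirdif A (v w) w) ->
  \forall w \near w0, dirdif (log_x A) (v w) w = 2 * dif ix (dif ix X) w - dif ix X w * log_x A w
    /\ dirdif (log_t A) (v w) w = 2 * dif it (dif ix X) w - dif it (dif it T) w
      - dif it T w * log_t A w - dif it X w * log_x A w.
Proof.
move=> nA eA; have n1 := smooth_near sT; have n2 := smooth_near sX; have n3 := smooth_near sA.
have eL : \forall w \near w0, T w * log_t A w + X w * log_x A w = 2 * dif ix X w - dif it T w.
  apply: filterS2 nA eA => w An e; apply: (mulfI An).
  have -> : A w * (T w * log_t A w + X w * log_x A w) = dirdif A (v w) w.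
    by rewrite /dirdif /log_t /log_x row2_it row2_ix; field.
  by move: e; lra.
have eLj := near_join eL; have ntx := near_Ttx0; near=> w.
have sTw : smooth_at w T by near: w.
have sXw : smooth_at w X by near: w.
have sAw : smooth_at w A by near: w.
have An : A w != 0 by near: w.
have Tx : dif ix T w = 0 by near: w.
have Ttx : dif ix (dif it T) w = 0 by near: w.
have iA : smooth_at w (fun w => (A w)^-1) by exact: smoothV.
have sl : smooth_at w (log_x A) by apply: smoothM => //; exact: smooth_dif.
have sm : smooth_at w (log_t A) by apply: smoothM => //; exact: smooth_dif.
have lm : dif it (log_x A) w = dif ix (log_t A) w.
  rewrite /log_x /log_t !difM ?difV //; try exact: smooth_dif.
  by rewrite (dif_swap ix it sAw); field.
have e : \forall y \near w, T y * log_t A y + X y * log_x A y = 2 * dif ix X y - dif it T y.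
  by near: w.
have sXx := smooth_dif ix sXw; have sTt := smooth_dif it sTw; have s2 := smooth_cst w 2.
have E i := dif_near i e; have := E it; have := E ix.
rewrite !(difD _ (smoothM sTw sm) (smoothM sXw sl)) !(difM _ sTw sm) !(difM _ sXw sl).
rewrite !(difB _ (smoothM s2 sXx) sTt) !(difM _ s2 sXx) !dif_cst Tx Ttx.
by rewrite /dirdif row2_it row2_ix -lm; split; lra.
Unshelve. all: by end_near. Qed.

End TimeDependence.

Section DataOfSymmetry.
Variables (M : 'I_3 -> 'I_3 -> 'rV[R]_2 -> R) (N : 'I_3 -> 'rV[R]_2 -> R).
Variable w0 : 'rV[R]_2.
Hypothesis sd : smooth_data w0 T X M N.
Hypothesis sA : smooth_at w0 A.
Hypothesis A0 : \forall w \near w0, A w != 0.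
Hypothesis S : \forall w \near w0, forall u,
  affine_lie A (D0 A B C) (D1 A B C) (dD0 A B C) (dD1 A B C) T X M N (row_mx w u).

Let sT : smooth_at w0 T. Proof. by case: sd. Qed.
Let sX : smooth_at w0 X. Proof. by case: sd. Qed.
Let sM l b : smooth_at w0 (M l b). Proof. by case: sd. Qed.
Let sN l : smooth_at w0 (N l). Proof. by case: sd. Qed.

(** In the third component of the induced field the coefficient of g3 is zeta1 - tau_t and that of
    g2 is - zeta0; the two definitions invert this. *)
Definition pulled_zeta1 w : R := M i3 i3 w + dif it T w.
Definition pulled_zeta0 w : R := - M i3 i2 w.

Lemma near_lie_basic : \forall w \near w0, dif ix T w = 0 /\
  2 * A w * dif ix X w = A w * dif it T w + dirdif A (v w) w.
Proof. by apply: filterS S => w /(_ 0)[]; rewrite base_row. Qed.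

Let nT : \forall w \near w0, dif ix T w = 0.
Proof. by apply: filterS near_lie_basic => w []. Qed.

Ltac ev H := move: H; rewrite /alres0 /alres1 /D0 /D1 /dD0 /dD1 !sum3E ?dep_affmapE
  /affine ?sum3E base_row ?dep_row /= ?dep_affmapE /affine ?sum3E ?base_row ?dep_row ?mxE /=.

(** The difference of the residues (1, c) at g1 = 1 and at g1 = 0 isolates their coefficient of g1,
    which determines the first row. *)
Lemma near_lie_M1 : \forall w \near w0, [/\ M i1 i1 w = dif ix X w - dif it T w,
  M i1 i2 w = 0 & M i1 i3 w = 0].
Proof.
apply: filterS2 S A0 => w Sw An; pose E u l c := afl_res1 (Sw u) l c.
have two : 2 != 0 :> R by rewrite pnatr_eq0.
have M12 : M i1 i2 w = 0.
  apply: (mulfI two); have := E (row3 1 0 0) i1 i2; have := E 0 i1 i2.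
  by move=> e0 e1; ev e0; ev e1; lra.
have M13 : M i1 i3 w = 0.
  apply: (mulfI two); have := E (row3 1 0 0) i1 i3; have := E 0 i1 i3.
  by move=> e0 e1; ev e0; ev e1; lra.
split=> //; have := E (row3 1 0 0) i1 i1; have := E 0 i1 i1.
by move=> e0 e1; ev e0; ev e1; rewrite M12; lra.
Qed.

(** With the first row known, the residues (1, 2), (1, 3) and (3, 2) at 0 are linear equations for
    M_22, M_23 and M_31 with the nonzero coefficient 2 A. *)
Lemma near_lie_M2 : \forall w \near w0, [/\ M i2 i2 w = - dif it T w, M i2 i3 w = 0
  & M i3 i1 w = dif ix pulled_zeta0 w].
Proof.
have n1 := near_join near_lie_M1; have n2 := near_lie_basic; have n3 := near_Ttx0 sT nT.
have n4 := smooth_near (sM i3 i2).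
near=> w; have n1w : \forall w \near w, [/\ M i1 i1 w = dif ix X w - dif it T w,
  M i1 i2 w = 0 & M i1 i3 w = 0] by near: w.
have [Tx eA] : dif ix T w = 0 /\
  2 * A w * dif ix X w = A w * dif it T w + dirdif A (v w) w by near: w.
have An : A w != 0 by near: w.
have s32 : smooth_at w (M i3 i2) by near: w.
have Sw : forall u, affine_lie A (D0 A B C) (D1 A B C) (dD0 A B C) (dD1 A B C) T X M N (row_mx w u)
  by near: w.
have [M11 M12 M13] := nbhs_singleton n1w; pose E u l c := afl_res1 (Sw u) l c.
have M12x : dif ix (M i1 i2) w = 0.
  by rewrite (@dif_near _ _ _ _ (fun=> 0)) ?dif_cst //; apply: filterS n1w => y [].
have M13x : dif ix (M i1 i3) w = 0.
  by rewrite (@dif_near _ _ _ _ (fun=> 0)) ?dif_cst //; apply: filterS n1w => y [].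
have two : 2 != 0 :> R by rewrite pnatr_eq0.
have e12 := E 0 i1 i2; have e13 := E 0 i1 i3; have e32 := E 0 i3 i2.
ev e12; ev e13; ev e32; rewrite M11 M12 M13 M12x M13x => e32 e13 e12.
have M23 : M i2 i3 w = 0 by apply: (mulfI (mulf_neq0 two An)); move: e13; lra.
split=> //.
  by apply: (mulfI (mulf_neq0 two An)); move: e12 eA; lra.
rewrite /pulled_zeta0 difN //; apply: (mulfI (mulf_neq0 two An)); move: e32; lra.
Unshelve. all: by end_near. Qed.

Lemma near_lie_M3 : \forall w \near w0, [/\ M i2 i1 w = dif ix pulled_zeta1 w, N i1 w = dif it X w
  & dirdif B (v w) w = - (dif it T w * B w) - dif it X w
    - 2 * A w * dif ix pulled_zeta1 w + A w * dif ix (dif ix X) w + B w * dif ix X w].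
Proof.
have n1 := near_join near_lie_M1; have n2 := near_lie_basic; have n3 := near_Ttx0 sT nT.
have n1' := near_join near_lie_M2.
have n4 := smooth_near (sM i3 i3); have n5 := smooth_near (smooth_dif it sT).
have n6 := smooth_near (smooth_dif ix sX).
near=> w; have n1w : \forall w \near w, [/\ M i1 i1 w = dif ix X w - dif it T w,
  M i1 i2 w = 0 & M i1 i3 w = 0] by near: w.
have n1'w : \forall w \near w, [/\ M i2 i2 w = - dif it T w, M i2 i3 w = 0
  & M i3 i1 w = dif ix pulled_zeta0 w] by near: w.
have [Tx eA] : dif ix T w = 0 /\
  2 * A w * dif ix X w = A w * dif it T w + dirdif A (v w) w by near: w.
have Ttx : dif ix (dif it T) w = 0 by near: w.
have An : A w != 0 by near: w.
have s33 : smooth_at w (M i3 i3) by near: w.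
have sTt : smooth_at w (dif it T) by near: w.
have sXx : smooth_at w (dif ix X) by near: w.
have Sw : forall u, affine_lie A (D0 A B C) (D1 A B C) (dD0 A B C) (dD1 A B C) T X M N (row_mx w u)
  by near: w.
have [M11 M12 M13] := nbhs_singleton n1w; pose E u l c := afl_res1 (Sw u) l c.
have [M22 M23 M31] := nbhs_singleton n1'w.
have M11x : dif ix (M i1 i1) w = dif ix (dif ix X) w.
  rewrite (@dif_near _ _ _ _ (fun y => dif ix X y - dif it T y)) ?difB ?Ttx ?subr0 //.
  by apply: filterS n1w => y [].
have M22x : dif ix (M i2 i2) w = 0.
  rewrite (@dif_near _ _ _ _ (fun y => - dif it T y)) ?difN ?Ttx ?oppr0 //.
  by apply: filterS n1'w => y [].
have two : 2 != 0 :> R by rewrite pnatr_eq0.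
have e11 := E 0 i1 i1; have e22 := E 0 i2 i2; have e33 := E 0 i3 i3.
have z1x : dif ix pulled_zeta1 w = dif ix (M i3 i3) w by rewrite /pulled_zeta1 difD // Ttx addr0.
ev e11; ev e22; ev e33; rewrite M11 M12 M13 M22 M23 M11x M22x -z1x => e33 e22 e11.
have M21 : M i2 i1 w = dif ix pulled_zeta1 w.
  by apply: (mulfI (mulf_neq0 two An)); move: e22 e33; lra.
split=> //; last by move: e33; lra.
by apply: (mulfI two); move: e11 e22; lra.
Unshelve. all: by end_near. Qed.

(** For g1 = 0 the third free term is affine in g2 and g3; unit differences give the condition on
    [C] and the equation for the shift. Together with the residues (2, 1) and (3, 1) they fix N_2
    and N_3. *)
Lemma near_lie_M4 : \forall w \near w0, [/\ N i2 w = dif it pulled_zeta1 w, N i3 w = dif it pulled_zeta0 w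
  & inf_equivalence A B C T X pulled_zeta1 pulled_zeta0 w].
Proof.
have n1 := near_join near_lie_M1; have n2 := near_join near_lie_M2; have n3 := near_join near_lie_M3.
have n4 := near_lie_basic; have n5 := near_Ttx0 sT nT.
have eA : \forall w \near w0, 2 * A w * dif ix X w = A w * dif it T w + dirdif A (v w) w.
  by apply: filterS n4 => w [].
have n6 := near_dirdif_log sT sX nT sA A0 eA.
have n7 := smooth_near sX; have n8 := smooth_near (smooth_dif it sT); have n9 := smooth_near (sM i3 i3).
have n10 := smooth_near (sM i3 i2); have n11 := near_join n5.
near=> w.
have n1w : \forall w \near w, [/\ M i1 i1 w = dif ix X w - dif it T w,
  M i1 i2 w = 0 & M i1 i3 w = 0] by near: w.
have [M11 M12 M13] := nbhs_singleton n1w.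
have M12x : dif ix (M i1 i2) w = 0.
  by rewrite (@dif_near _ _ _ _ (fun=> 0)) ?dif_cst //; apply: filterS n1w => y [].
have M13x : dif ix (M i1 i3) w = 0.
  by rewrite (@dif_near _ _ _ _ (fun=> 0)) ?dif_cst //; apply: filterS n1w => y [].
have n2w : \forall w \near w, [/\ M i2 i2 w = - dif it T w, M i2 i3 w = 0
  & M i3 i1 w = dif ix pulled_zeta0 w] by near: w.
have n3w : \forall w \near w, [/\ M i2 i1 w = dif ix pulled_zeta1 w, N i1 w = dif it X w
  & dirdif B (v w) w = - (dif it T w * B w) - dif it X w
    - 2 * A w * dif ix pulled_zeta1 w + A w * dif ix (dif ix X) w + B w * dif ix X w] by near: w.
have [Tx eAw] : dif ix T w = 0 /\
  2 * A w * dif ix X w = A w * dif it T w + dirdif A (v w) w by near: w.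
have [_ mv] : dirdif (log_x A) (v w) w = 2 * dif ix (dif ix X) w - dif ix X w * log_x A w
    /\ dirdif (log_t A) (v w) w = 2 * dif it (dif ix X) w - dif it (dif it T) w
      - dif it T w * log_t A w - dif it X w * log_x A w by near: w.
have Ttxw : \forall w \near w, dif ix (dif it T) w = 0 by near: w.
have Ttx := nbhs_singleton Ttxw.
have Ttxx : dif ix (dif ix (dif it T)) w = 0 by rewrite (dif_near _ Ttxw) dif_cst.
have An : A w != 0 by near: w.
have sXw : smooth_at w X by near: w.
have s33 : smooth_at w (M i3 i3) by near: w.
have s32 : smooth_at w (M i3 i2) by near: w.
have sTt : smooth_at w (dif it T) by near: w.
have Sw : forall u, affine_lie A (D0 A B C) (D1 A B C) (dD0 A B C) (dD1 A B C) T X M N (row_mx w u)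
  by near: w.
have [M22 M23 M31] := nbhs_singleton n2w; have [M21 N1 eB] := nbhs_singleton n3w.
have two : 2 != 0 :> R by rewrite pnatr_eq0.
have z1w : \forall y \near w, dif ix pulled_zeta1 y = dif ix (M i3 i3) y + dif ix (dif it T) y.
  by apply: filterS2 (smooth_near s33) (smooth_near sTt) => y ? ?; exact: difD.
have z1x := nbhs_singleton z1w.
have z1xx : dif ix (dif ix pulled_zeta1) w = dif ix (dif ix (M i3 i3)) w.
  by rewrite (dif_near _ z1w) difD ?Ttxx ?addr0 //; exact: smooth_dif.
have z1t : dif it pulled_zeta1 w = dif it (M i3 i3) w + dif it (dif it T) w by exact: difD.
have z0w : \forall y \near w, dif ix pulled_zeta0 y = - dif ix (M i3 i2) y.
  by apply: filterS (smooth_near s32) => y ?; exact: difN.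
have z0x := nbhs_singleton z0w.
have z0xx : dif ix (dif ix pulled_zeta0) w = - dif ix (dif ix (M i3 i2)) w.
  by rewrite (dif_near _ z0w) difN //; exact: smooth_dif.
have z0t : dif it pulled_zeta0 w = - dif it (M i3 i2) w by exact: difN.
have M21x : dif ix (M i2 i1) w = dif ix (dif ix pulled_zeta1) w.
  by apply: dif_near; apply: filterS n3w => y [].
have M31x : dif ix (M i3 i1) w = dif ix (dif ix pulled_zeta0) w.
  by apply: dif_near; apply: filterS n2w => y [].
have N1x : dif ix (N i1) w = dif it (dif ix X) w.
  by rewrite (dif_swap ix it sXw); apply: dif_near; apply: filterS n3w => y [].
have e21 := afl_res1 (Sw 0) i2 i1; have e31 := afl_res1 (Sw 0) i3 i1.
have r0 := afl_res0 (Sw (row3 0 0 0)) i3; have r3 := afl_res0 (Sw (row3 0 0 1)) i3.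
have r2 := afl_res0 (Sw (row3 0 1 0)) i3.
ev e21; ev e31; ev r0; ev r2; ev r3.
rewrite -/(log_x A w) -/(log_t A w).
rewrite M11 M12 M13 M12x M13x M21 M22 M23 M31 M21x M31x N1 N1x mv z1xx z0xx z0x z1x Ttx.
move=> r3 r2 r0 e31 e21; split.
- by apply: (mulfI two); rewrite z1t; move: e21 r3 r0; lra.
- by apply: (mulfI two); rewrite z0t; move: e31 r2 r0; lra.
split=> //.
- by rewrite z1x z1xx z1t Ttx; move: r3 r0; lra.
- by rewrite z0x z0xx z0t /pulled_zeta0; move: r2 r0; lra.
Unshelve. all: by end_near. Qed.

End DataOfSymmetry.
End InducedLieSymmetry.

(** * From a Lie symmetry of [eqL] to a Lie symmetry of [DE1] *)

Section InducedLie.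
Context {R : realType}.
Variables (A B C T X z1 z0 : 'rV[R]_2 -> R) (w0 : 'rV[R]_2).
Notation v w := (row2 (T w) (X w)).
Hypotheses (sA : smooth_at w0 A) (sB : smooth_at w0 B) (sC : smooth_at w0 C).
Hypotheses (sT : smooth_at w0 T) (sX : smooth_at w0 X).
Hypotheses (s1 : smooth_at w0 z1) (s0 : smooth_at w0 z0).
Hypothesis A0 : \forall w \near w0, A w != 0.
Hypothesis E : \forall w \near w0, inf_equivalence A B C T X z1 z0 w.

Let nT : \forall w \near w0, dif ix T w = 0.
Proof. by apply: filterS E => w []. Qed.

(** The first derivatives of the infinitesimal conditions, solved for the derivatives along the base
    field of those coefficients that occur in the linearization of [DE1]. *)
Record prolonged_inf_equivalence w : Prop := ProlongedInfEquivalence {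
  pie_lx : dirdif (log_x A) (v w) w = 2 * dif ix (dif ix X) w - dif ix X w * log_x A w;
  pie_lt : dirdif (log_t A) (v w) w = 2 * dif it (dif ix X) w - dif it (dif it T) w
      - dif it T w * log_t A w - dif it X w * log_x A w;
  pie_Bx : dirdif (dif ix B) (v w) w = - (dif it T w * dif ix B w) - dif ix (dif it X) w
    - 2 * (dif ix A w * dif ix z1 w + A w * dif ix (dif ix z1) w)
    + (dif ix A w * dif ix (dif ix X) w + A w * dif ix (dif ix (dif ix X)) w)
    + B w * dif ix (dif ix X) w;
  pie_Bt : dirdif (dif it B) (v w) w = - (dif it (dif it T) w * B w + dif it T w * dif it B w)
    - dif it (dif it X) w
    - 2 * (dif it A w * dif ix z1 w + A w * dif it (dif ix z1) w)
    + (dif it A w * dif ix (dif ix X) w + A w * dif it (dif ix (dif ix X)) w)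
    + (dif it B w * dif ix X w + B w * dif it (dif ix X) w)
    - dif it T w * dif it B w - dif it X w * dif ix B w;
  pie_Cx : dirdif (dif ix C) (v w) w = dif ix (dif it z1) w - dif it T w * dif ix C w
    - (dif ix A w * dif ix (dif ix z1) w + A w * dif ix (dif ix (dif ix z1)) w)
    - (dif ix B w * dif ix z1 w + B w * dif ix (dif ix z1) w) - dif ix X w * dif ix C w;
  pie_Ct : dirdif (dif it C) (v w) w = dif it (dif it z1) w
    - (dif it (dif it T) w * C w + dif it T w * dif it C w)
    - (dif it A w * dif ix (dif ix z1) w + A w * dif it (dif ix (dif ix z1)) w)
    - (dif it B w * dif ix z1 w + B w * dif it (dif ix z1) w)
    - dif it T w * dif it C w - dif it X w * dif ix C w;
  pie_0t : dif it (dif it z0) w = dif it A w * dif ix (dif ix z0) w + A w * dif it (dif ix (dif ix z0)) w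
    + (dif it B w * dif ix z0 w + B w * dif it (dif ix z0) w)
    + (dif it C w * z0 w + C w * dif it z0 w);
  pie_0x : dif ix (dif it z0) w = dif ix A w * dif ix (dif ix z0) w + A w * dif ix (dif ix (dif ix z0)) w
    + (dif ix B w * dif ix z0 w + B w * dif ix (dif ix z0) w)
    + (dif ix C w * z0 w + C w * dif ix z0 w) }.

Lemma near_swap (F : 'rV[R]_2 -> R) : smooth_at w0 F -> \forall w \near w0,
  dif it (dif ix F) w = dif ix (dif it F) w /\
  dif it (dif ix (dif ix F)) w = dif ix (dif ix (dif it F)) w.
Proof.
move=> sF; have n1 : \forall w \near w0, dif it (dif ix F) w = dif ix (dif it F) w.
  by apply: filterS (smooth_near sF) => w; exact: dif_swap.
apply: filterS3 n1 (near_dif ix n1) (smooth_near (smooth_dif ix sF)) => w e <- sw.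
by split=> //; exact: dif_swap.
Qed.

Ltac sm := repeat first [assumption | apply: smooth_cst | apply: smooth_dif | apply: smoothN
  | apply: smoothB | apply: smoothD | apply: smoothM].

Lemma near_prolonged_inf : \forall w \near w0, prolonged_inf_equivalence w.
Proof.
have eA : \forall w \near w0, 2 * A w * dif ix X w = A w * dif it T w + dirdif A (v w) w.
  by apply: filterS E => w [].
have n1 := near_dirdif_log sT sX nT sA A0 eA; have n2 := near_Ttx0 sT nT.
have n3 := near_dirdif_dif sT sX ix sB; have n4 := near_dirdif_dif sT sX it sB.
have n5 := near_dirdif_dif sT sX ix sC; have n6 := near_dirdif_dif sT sX it sC.
have Ej := near_join E; have m1 := smooth_near sA; have m2 := smooth_near sB.
have m3 := smooth_near sC; have m4 := smooth_near sT; have m5 := smooth_near sX.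
have m6 := smooth_near s1; have m7 := smooth_near s0.
near=> w.
have [lx lt] : dirdif (log_x A) (v w) w = 2 * dif ix (dif ix X) w - dif ix X w * log_x A w
    /\ dirdif (log_t A) (v w) w = 2 * dif it (dif ix X) w - dif it (dif it T) w
      - dif it T w * log_t A w - dif it X w * log_x A w by near: w.
have Ttx : dif ix (dif it T) w = 0 by near: w.
have Ew : \forall w \near w, inf_equivalence A B C T X z1 z0 w by near: w.
have [Tx _ _ _ _] := nbhs_singleton Ew.
have [sAw sBw sCw] : [/\ smooth_at w A, smooth_at w B & smooth_at w C] by split; near: w.
have [sTw sXw s1w s0w] : [/\ smooth_at w T, smooth_at w X, smooth_at w z1 & smooth_at w z0]
  by split; near: w.
have dB i : dif i (fun w => dirdif B (v w) w) w =
   dif i (fun w => - (dif it T w * B w) - dif it X w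
    - 2 * A w * dif ix z1 w + A w * dif ix (dif ix X) w + B w * dif ix X w) w.
  by apply: dif_near; apply: filterS Ew => y [].
have dC i : dif i (fun w => dirdif C (v w) w) w = dif i (fun w => dif it z1 w - dif it T w * C w
    - A w * dif ix (dif ix z1) w - B w * dif ix z1 w) w.
  by apply: dif_near; apply: filterS Ew => y [].
have d0 i : dif i (dif it z0) w = dif i (fun w => A w * dif ix (dif ix z0) w
    + B w * dif ix z0 w + C w * z0 w) w.
  by apply: dif_near; apply: filterS Ew => y [].
have sTt := smooth_dif it sTw; have sXx := smooth_dif ix sXw; have sXt := smooth_dif it sXw.
have sXxx := smooth_dif ix sXx; have s1x := smooth_dif ix s1w; have s1xx := smooth_dif ix s1x.
have s1t := smooth_dif it s1w; have s0x := smooth_dif ix s0w; have s0xx := smooth_dif ix s0x.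
have sc := smooth_cst w (2 : R).
have := dB ix; have := dB it; have := dC ix; have := dC it; have := d0 it; have := d0 ix.
rewrite !(difD _ (smoothD (smoothM sAw s0xx) (smoothM sBw s0x)) (smoothM sCw s0w)).
rewrite !(difD _ (smoothM sAw s0xx) (smoothM sBw s0x)) !(difM _ sAw s0xx) !(difM _ sBw s0x) !(difM _ sCw s0w).
have q1 := smoothB s1t (smoothM sTt sCw); have q2 := smoothB q1 (smoothM sAw s1xx).
rewrite !(difB _ q2 (smoothM sBw s1x)) !(difB _ q1 (smoothM sAw s1xx)) !(difB _ s1t (smoothM sTt sCw)).
rewrite !(difM _ sTt sCw) !(difM _ sAw s1xx) !(difM _ sBw s1x).
have r1 := smoothN (smoothM sTt sBw); have r2 := smoothB r1 sXt.
have r3 := smoothM (smoothM sc sAw) s1x; have r4 := smoothB r2 r3.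
have r5 := smoothM sAw sXxx; have r6 := smoothD r4 r5.
rewrite !(difD _ r6 (smoothM sBw sXx)) !(difD _ r4 r5) !(difB _ r2 r3) !(difB _ r1 sXt).
rewrite !(difN _ (smoothM sTt sBw)) !(difM _ sTt sBw) !(difM _ (smoothM sc sAw) s1x) !(difM _ sc sAw).
rewrite !(difM _ sAw sXxx) !(difM _ sBw sXx) !dif_cst.
have -> : dif ix (fun w => dirdif B (v w) w) w = dirdif (dif ix B) (v w) w
    + dif ix T w * dif it B w + dif ix X w * dif ix B w by near: w.
have -> : dif it (fun w => dirdif B (v w) w) w = dirdif (dif it B) (v w) w
    + dif it T w * dif it B w + dif it X w * dif ix B w by near: w.
have -> : dif ix (fun w => dirdif C (v w) w) w = dirdif (dif ix C) (v w) w
    + dif ix T w * dif it C w + dif ix X w * dif ix C w by near: w.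
have -> : dif it (fun w => dirdif C (v w) w) w = dirdif (dif it C) (v w) w
    + dif it T w * dif it C w + dif it X w * dif ix C w by near: w.
rewrite Tx Ttx => e0x e0 eCt eCx eBt eBx; split=> //.
- move: eBx; lra.
- move: eBt; lra.
- move: eCx; lra.
- move: eCt; lra.
Unshelve. all: by end_near. Qed.

Notation iM := (indlieM T X z1 z0).
Notation iN := (indlieN X z1 z0).
Notation jet_of w F h hx hxx ht := [/\ F w = h, dif ix F w = hx, dif ix (dif ix F) w = hxx
    & dif it F w = ht].

Record inf_induced_jets w : Prop := InfInducedJets {
  iij11 : jet_of w (iM i1 i1) (dif ix X w - dif it T w) (dif ix (dif ix X) w)
    (dif ix (dif ix (dif ix X)) w) (dif it (dif ix X) w - dif it (dif it T) w);
  iij22 : jet_of w (iM i2 i2) (- dif it T w) 0 0 (- dif it (dif it T) w);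
  iij32 : jet_of w (iM i3 i2) (- z0 w) (- dif ix z0 w) (- dif ix (dif ix z0) w) (- dif it z0 w);
  iij33 : jet_of w (iM i3 i3) (z1 w - dif it T w) (dif ix z1 w) (dif ix (dif ix z1) w)
    (dif it z1 w - dif it (dif it T) w) }.

Lemma near_inf_induced_jets : \forall w \near w0, inf_induced_jets w.
Proof.
have n2 := near_join (near_Ttx0 sT nT); have m4 := smooth_near sT; have m5 := smooth_near sX.
have m6 := smooth_near s1; have m7 := smooth_near s0.
near=> w; have Ttxw : \forall w \near w, dif ix (dif it T) w = 0 by near: w.
have Ttx := nbhs_singleton Ttxw.
have Ttxx : dif ix (dif ix (dif it T)) w = 0 by rewrite (dif_near _ Ttxw) dif_cst.
have [sTw sXw s1w s0w] : [/\ smooth_at w T, smooth_at w X, smooth_at w z1 & smooth_at w z0]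
  by split; near: w.
have sTt := smooth_dif it sTw; have sXx := smooth_dif ix sXw.
have sub F : smooth_at w F -> forall H, H = (fun w => F w - dif it T w) ->
    jet_of w H (F w - dif it T w) (dif ix F w) (dif ix (dif ix F) w) (dif it F w - dif it (dif it T) w).
  move=> sF H ->; have e : \forall y \near w, dif ix (fun w => F w - dif it T w) y = dif ix F y.
    apply: filterS3 (smooth_near sF) (smooth_near sTt) Ttxw => y sFy sTy Ty.
    by rewrite difB // Ty subr0.
  by split=> //; [exact: nbhs_singleton e|exact: dif_near e|exact: difB].
have neg F : smooth_at w F -> forall H, H = (fun w => - F w) ->
    jet_of w H (- F w) (- dif ix F w) (- dif ix (dif ix F) w) (- dif it F w).
  move=> sF H ->; have e : \forall y \near w, dif ix (fun w => - F w) y = - dif ix F y.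
    by apply: filterS (smooth_near sF) => y; exact: difN.
  split=> //; [exact: nbhs_singleton e| |exact: difN].
  by rewrite (dif_near _ e) difN //; exact: smooth_dif.
split.
- exact: (sub (dif ix X)).
- by have := neg (dif it T) sTt (iM i2 i2) erefl; rewrite Ttx Ttxx oppr0.
- exact: (neg z0).
- exact: (sub z1).
Unshelve. all: by end_near. Qed.

(** Substitution of the conditions and their first derivatives reduces every linearized residue to a
    polynomial identity in the remaining derivatives and in g1, g2, g3. *)
Lemma induced_lie : \forall w \near w0, forall u,
  affine_lie A (D0 A B C) (D1 A B C) (dD0 A B C) (dD1 A B C) T X iM iN (row_mx w u).
Proof.
have nj := near_inf_induced_jets; have np := near_prolonged_inf.
have swX := near_swap sX; have sw1 := near_swap s1; have sw0 := near_swap s0.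
near=> w => u.
have [Tx eA eB eC e0] : inf_equivalence A B C T X z1 z0 w by near: w.
have [Xtx Xtxx] : dif it (dif ix X) w = dif ix (dif it X) w /\
  dif it (dif ix (dif ix X)) w = dif ix (dif ix (dif it X)) w by near: w.
have [z1tx z1txx] : dif it (dif ix z1) w = dif ix (dif it z1) w /\
  dif it (dif ix (dif ix z1)) w = dif ix (dif ix (dif it z1)) w by near: w.
have [z0tx z0txx] : dif it (dif ix z0) w = dif ix (dif it z0) w /\
  dif it (dif ix (dif ix z0)) w = dif ix (dif ix (dif it z0)) w by near: w.
have An : A w != 0 by near: w.
have [[M11 M11x M11xx M11t] [M22 M22x M22xx M22t] [M32 M32x M32xx M32t]
  [M33 M33x M33xx M33t]] : inf_induced_jets w by near: w.
have [lx lt Bx Bt Cx Ct z0tt z0x] : prolonged_inf_equivalence w by near: w.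
have M12 : iM i1 i2 = fun=> 0 by [].
have M13 : iM i1 i3 = fun=> 0 by [].
have M23 : iM i2 i3 = fun=> 0 by [].
have M21 : iM i2 i1 = dif ix z1 by [].
have M31 : iM i3 i1 = dif ix z0 by [].
have N1 : iN i1 = dif it X by [].
have N2 : iN i2 = dif it z1 by [].
have N3 : iN i3 = dif it z0 by [].
(* Writing A_x and A_t through the logarithmic derivatives removes every quotient, so [ring] is
   enough. *)
have Ax : dif ix A w = log_x A w * A w by rewrite /log_x divfK.
have At : dif it A w = log_t A w * A w by rewrite /log_t divfK.
have dA : dirdif A (v w) w = 2 * A w * dif ix X w - A w * dif it T w by rewrite eA; ring.
split; rewrite ?base_row //.
- move=> l; rewrite /alres0 !sum3E /affine !sum3E base_row dep_row.
  rewrite /dD0 /D0 /D1 -/(log_x A w) -/(log_t A w).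
  move: l; apply: ord3P; rewrite /= ?dep_affmapE /affine ?sum3E ?base_row ?dep_row.
  all: move: (u 0 i1) (u 0 i2) (u 0 i3) => g1 g2 g3.
  all: rewrite ?M12 ?M13 ?M23 ?M21 ?M31 ?N1 ?N2 ?N3 ?dif_cstE ?dif_cst.
  all: rewrite ?M11x ?M11xx ?M11t ?M22x ?M22xx ?M22t ?M32x ?M32xx ?M32t ?M33x ?M33xx ?M33t.
  all: rewrite ?M11 ?M22 ?M32 ?M33 ?lx ?lt ?Bx ?Bt ?Cx ?Ct ?eB ?eC ?z0tt.
  all: rewrite ?Xtxx ?Xtx ?z1txx ?z1tx ?z0txx ?z0tx ?Ax ?At.
  all: rewrite ?z0x ?e0 ?Ax.
  1-3: ring.
move=> l c; rewrite /alres1 !sum3E base_row dep_row /D1 /dD1.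
move: l c; apply: ord3P; apply: ord3P; rewrite /= ?dep_affmapE /affine ?sum3E ?base_row ?dep_row /=.
all: rewrite ?M12 ?M13 ?M23 ?M21 ?M31 ?N1 ?N2 ?N3 ?dif_cstE ?dif_cst.
all: rewrite ?M11x ?M22x ?M32x ?M33x ?M11 ?M22 ?M32 ?M33 ?eB ?eC ?dA ?e0.
all: rewrite ?mulr1n; ring.
Unshelve. all: by end_near. Qed.

End InducedLie.

(** * The Lie algebra isomorphism *)

Section VectorFields.
Context {R : realType} {m : nat}.
Notation Z := 'rV[R]_(2 + m).

Lemma lie_bracketE (Q P : Z -> Z) z k : smooth_at z Q -> smooth_at z P ->
  lie_bracket Q P z 0 k = lie Q (fun z => P z 0 k) z - lie P (fun z => Q z 0 k) z.
Proof.
have D (f : Z -> Z) u : smooth_at z f -> 'D_u f z 0 k = \sum_j u 0 j * dif j (fun z => f z 0 k) z.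
  move=> /smooth_rowP sf; rewrite -derive_dif; last exact: smooth_diff.
  rewrite derive_mx ?mxE //; apply/diff_derivable/differentiable_row => a.
  exact: smooth_diff.
by move=> sQ sP; rewrite /lie_bracket mxE [X in _ + X]mxE !D.
Qed.

Lemma germ_bracket (Q P Q' P' : Z -> Z) p : smooth_at p Q -> smooth_at p P ->
  germ_eq p Q Q' -> germ_eq p P P' -> germ_eq p (lie_bracket Q P) (lie_bracket Q' P').
Proof.
move=> /smooth_near_row sQ /smooth_near_row sP /near_join gQ /near_join gP; near=> z.
have sQz : smooth_at z Q by near: z.
have sPz : smooth_at z P by near: z.
have gQz : germ_eq z Q Q' by near: z.
have gPz : germ_eq z P P' by near: z.
apply/rowP => k; rewrite !lie_bracketE //; [|exact: germ_smooth gQz _|exact: germ_smooth gPz _].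
rewrite (germ_lie gQz) (germ_lie gPz) /lie; congr (_ - _); apply: eq_bigr => j _.
  by rewrite (germ_dif gPz).
by rewrite (germ_dif gQz).
Unshelve. all: by end_near. Qed.

Implicit Types (T X : 'rV[R]_2 -> R) (M : 'I_m -> 'I_m -> 'rV[R]_2 -> R)
  (N : 'I_m -> 'rV[R]_2 -> R).

Lemma affmap_linear a T X M N T' X' M' N' (z : Z) :
  affmap (fun w => a * T w + T' w) (fun w => a * X w + X' w)
    (fun l b w => a * M l b w + M' l b w) (fun l w => a * N l w + N' l w) z
  = a *: affmap T X M N z + affmap T' X' M' N' z.
Proof.
apply/rowP; apply: idxP => [||l]; rewrite [RHS]mxE [X in _ = X + _]mxE.
- by rewrite !affmapT.
- by rewrite !affmapX.
rewrite !affmapD mulrDr mulr_sumr addrACA -big_split /=; congr (_ + _).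
by apply: eq_bigr => b _; ring.
Qed.

(** The coefficients are differentiated along the base parts of the two fields. The fibre parts
    contribute a matrix commutator in the order M' M - M M', because the bracket differentiates the
    second field along the first. *)
Lemma affmap_bracket T X M N T' X' M' N' (p : Z) :
  smooth_data (base p) T X M N -> smooth_data (base p) T' X' M' N' ->
  let v w := row2 (T w) (X w) in let v' w := row2 (T' w) (X' w) in
  germ_eq p (lie_bracket (affmap T X M N) (affmap T' X' M' N'))
    (affmap (fun w => dirdif T' (v w) w - dirdif T (v' w) w)
       (fun w => dirdif X' (v w) w - dirdif X (v' w) w)
       (fun l b w => dirdif (M' l b) (v w) w - dirdif (M l b) (v' w) w
          + \sum_c (M' l c w * M c b w - M l c w * M' c b w))
       (fun l w => dirdif (N' l) (v w) w - dirdif (N l) (v' w) w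
          + \sum_c (M' l c w * N c w - M l c w * N' c w))).
Proof.
move=> sd sd' v v'; have n1 := near_base (smooth_data_near sd).
have n2 := near_base (smooth_data_near sd'); near=> z.
have sdz : smooth_data (base z) T X M N by near: z.
have sdz' : smooth_data (base z) T' X' M' N' by near: z.
have [sT sX sM sN] := sdz; have [sT' sX' sM' sN'] := sdz'.
have lA (Q : Z -> Z) (F : 'I_m -> 'rV[R]_2 -> R) (G : 'rV[R]_2 -> R) : (forall b, smooth_at (base z) (F b)) ->
    smooth_at (base z) G -> lie Q (affine F G) z =
    \sum_b dirdif (F b) (base (Q z)) (base z) * dep z 0 b + dirdif G (base (Q z)) (base z)
    + \sum_b F b (base z) * dep (Q z) 0 b.
  move=> s1 s2; rewrite /lie sum_split !dif_affine_tx // -!baseE.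
  congr (_ + _); last by apply: eq_bigr => b _; rewrite dif_affine_dv // -depE mulrC.
  rewrite /affine /dirdif !mulrDr !mulr_sumr addrACA -big_split /=; congr (_ + _).
  by apply: eq_bigr => b _; ring.
apply/rowP; apply: idxP => [||l].
- rewrite lie_bracketE ?affmapTE ?affmapT; [|exact: smooth_affmap|exact: smooth_affmap].
  by rewrite !lie_base // !base_affmap.
- rewrite lie_bracketE ?affmapXE ?affmapX; [|exact: smooth_affmap|exact: smooth_affmap].
  by rewrite !lie_base // !base_affmap.
rewrite lie_bracketE ?affmapDE ?affmapD; [|exact: smooth_affmap|exact: smooth_affmap].
rewrite !lA // !base_affmap -/(v _) -/(v' _); set w := base z.
have E (M1 : 'I_m -> 'I_m -> 'rV[R]_2 -> R) T2 X2 M2 N2 : \sum_b M1 l b w * dep (affmap T2 X2 M2 N2 z) 0 b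
   = \sum_b (\sum_c M1 l c w * M2 c b w) * dep z 0 b + \sum_c M1 l c w * N2 c w.
  under eq_bigr do rewrite dep_affmapE /affine mulrDr mulr_sumr.
  rewrite big_split /= exchange_big /=; congr (_ + _); apply: eq_bigr => b _.
  by rewrite mulr_suml; apply: eq_bigr => c _; rewrite mulrA.
rewrite !E.
under [X in _ = X + _]eq_bigr do rewrite sumrB mulrDl !mulrBl.
by rewrite big_split /= !sumrB; ring.
Unshelve. all: by end_near. Qed.

End VectorFields.

Section LieAlgebraIsomorphism.
Context {R : realType}.
Variables (Omega : set 'rV[R]_2) (A B C : 'rV[R]_2 -> R).
Hypothesis oO : open Omega.
Hypotheses (sA : forall w, Omega w -> smooth_at w A) (sB : forall w, Omega w -> smooth_at w B)
  (sC : forall w, Omega w -> smooth_at w C).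
Hypothesis A0 : forall w, Omega w -> A w != 0.
Implicit Types (T X : 'rV[R]_2 -> R).
Notation lieL := (lie_symmetry Omega (eqL A B C)).
Notation lieD := (lie_symmetry Omega (DE1 A B C)).

Definition inf_admissible w T X z1 z0 := [/\ Omega w, smooth4 w T X z1 z0
  & \forall w \near w, inf_equivalence A B C T X z1 z0 w].

Definition indfield T X (z1 z0 : 'rV[R]_2 -> R) : 'rV[R]_(2 + 3) -> 'rV[R]_(2 + 3) :=
  affmap T X (indlieM T X z1 z0) (indlieN X z1 z0).

Lemma smooth_indfield w T X z1 z0 : smooth4 w T X z1 z0 ->
  smooth_data w T X (indlieM T X z1 z0) (indlieN X z1 z0).
Proof.
move=> [sT sX s1 s0]; split=> // [l b|l].
  by move: l b; apply: ord3P; apply: ord3P => /=; repeat first [assumption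
    | exact: smooth_cst | apply: smooth_dif | apply: smoothB | apply: smoothN].
by move: l; apply: ord3P => /=; exact: smooth_dif.
Qed.

Lemma L_lie_data p Q : lieL p Q ->
  inf_admissible (base p) (genT Q p) (genX Q p) (genU1 Q p) (genU0 Q p) /\
  germ_eq p Q (Lmap (genT Q p) (genX Q p) (genU1 Q p) (genU0 Q p)).
Proof.
rewrite eqL_evol => SQ.
have [Qg S] := lie_symmetry_affine oO A0 sA (smooth_evol_L sA sB sC) (lie_L0 sA sB sC)
  (lie_L1 sA sB sC) 0 SQ.
case: SQ => Op sQ _; rewrite affgenL in Qg; split=> //; split=> //.
  exact: smooth_gen4.
have := affine_lie_fibers (quad_L0 C) (aff_L1 B) (quad_dL0 C) (aff_dL1 B) S.
by apply: filterS => w /L_lieP.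
Qed.

Lemma L_lie_Lmap p T X z1 z0 : inf_admissible (base p) T X z1 z0 -> lieL p (Lmap T X z1 z0).
Proof.
case=> Op s4 E; rewrite eqL_evol.
apply: (affine_lie_symmetry oO A0 sA (smooth_evol_L sA sB sC) (lie_L0 sA sB sC)
  (lie_L1 sA sB sC)) => //; first exact: smooth4_data.
by apply: affine_lie_base; apply: filterS E => w Ew; apply/L_lieP.
Qed.

Lemma DE1_lie_indfield q T X z1 z0 : inf_admissible (base q) T X z1 z0 ->
  lieD q (indfield T X z1 z0).
Proof.
case=> Oq s4 E; have [sT sX s1 s0] := s4; rewrite DE1_evol.
apply: (affine_lie_symmetry oO A0 sA (smooth_evol_D sA sB sC A0) (lie_D0 sA sB sC A0)
  (lie_D1 sA sB sC)) => //; first exact: smooth_indfield.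
apply: affine_lie_base; apply: induced_lie => //; try exact: (near_A0 oO A0 Oq).
- exact: sA. - exact: sB. - exact: sC.
Qed.

Lemma DE1_lie_data q P : lieD q P ->
  exists T X z1 z0, inf_admissible (base q) T X z1 z0 /\ germ_eq q P (indfield T X z1 z0).
Proof.
rewrite DE1_evol => SP.
have [Pg S] := lie_symmetry_affine oO A0 sA (smooth_evol_D sA sB sC A0) (lie_D0 sA sB sC A0)
  (lie_D1 sA sB sC) i1 SP.
case: SP => Oq sP _; have sd := smooth_gen_data sP; have [sT sX sM sN] := sd.
have {}S := affine_lie_fibers (quad_D0 A B C) (aff_D1 A B C) (quad_dD0 A B C)
  (aff_dD1 A B C) S.
have nA := near_A0 oO A0 Oq; have n1 := near_lie_M1 nA S; have n2 := near_lie_M2 sd nA S.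
have n3 := near_lie_M3 sd nA S; have n4 := near_lie_M4 sd (sA Oq) nA S.
exists (genT P q), (genX P q), (pulled_zeta1 (genT P q) (genM P q)), (pulled_zeta0 (genM P q)); split.
  split=> //; first by split=> //; [apply: smoothD => //; exact: smooth_dif|exact: smoothN].
  by apply: filterS n4 => w [].
apply: germ_trans Pg (affmap_germ _).
apply: filterS (filterI n1 (filterI n2 (filterI n3 n4))).
move=> w [[M11 M12 M13] [[M22 M23 M31] [[M21 N1 _] [N2 N3 _]]]].
split=> //; last by apply: ord3P.
apply: ord3P; apply: ord3P; rewrite /indlieM //=.
  by rewrite /pulled_zeta0 opprK.
by rewrite /pulled_zeta1 addrK.
Qed.

Lemma indfield_germ T X z1 z0 T' X' z1' z0' (q : 'rV[R]_(2 + 3)) :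
  (\forall w \near base q, eq4 T X z1 z0 T' X' z1' z0' w) ->
  germ_eq q (indfield T X z1 z0) (indfield T' X' z1' z0').
Proof.
move=> H; apply: affmap_germ; apply: filterS (near_join H) => w nw.
have [eT eX e1 e0] := nbhs_singleton nw.
have dT i : dif i T w = dif i T' w by apply: dif_near; apply: filterS nw => y [].
have dX i : dif i X w = dif i X' w by apply: dif_near; apply: filterS nw => y [].
have d1 i : dif i z1 w = dif i z1' w by apply: dif_near; apply: filterS nw => y [].
have d0 i : dif i z0 w = dif i z0' w by apply: dif_near; apply: filterS nw => y [].
by split=> // [l b|l]; rewrite /indlieM /indlieN ?dT ?dX ?d1 ?d0 ?e1 ?e0.
Qed.

Lemma indfield_inj T X z1 z0 T' X' z1' z0' (q : 'rV[R]_(2 + 3)) :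
  smooth4 (base q) T X z1 z0 -> smooth4 (base q) T' X' z1' z0' ->
  germ_eq q (indfield T X z1 z0) (indfield T' X' z1' z0') ->
  \forall w \near base q, eq4 T X z1 z0 T' X' z1' z0' w.
Proof.
move=> s s' g; have H := near_join (affmap_inj (smooth_indfield s) (smooth_indfield s') g).
apply: filterS H => w nw; have [eT eX eM _] := nbhs_singleton nw.
have dT : dif it T w = dif it T' w by apply: dif_near; apply: filterS nw => y [].
split=> //; first by have := eM i3 i3; rewrite /indlieM /= dT => /addIr.
by have := eM i3 i2; rewrite /indlieM /= => /oppr_inj.
Qed.

Definition induced_field (p : 'rV[R]_(2 + 1)) Q :=
  indfield (genT Q p) (genX Q p) (genU1 Q p) (genU0 Q p).

Lemma induced_field_germ p q Q T X z1 z0 : base p = base q -> smooth4 (base p) T X z1 z0 ->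
  germ_eq p Q (Lmap T X z1 z0) -> germ_eq q (induced_field p Q) (indfield T X z1 z0).
Proof.
move=> pq s4 /germ_gen4 fg; apply: indfield_germ; rewrite -pq.
apply: filterS2 fg (gen_Lmap s4) => w [e1 e2 e3 e4] [h1 h2 h3 h4].
by split; rewrite ?e1 ?e2 ?e3 ?e4.
Qed.

Lemma induced_field_linear p q a Q P : base p = base q -> lieL p Q -> lieL p P ->
  germ_eq q (induced_field p (fun z => a *: Q z + P z))
    (fun z => a *: induced_field p Q z + induced_field p P z).
Proof.
move=> pq /L_lie_data[[_ s4 _] gQ] /L_lie_data[[_ s4' _] gP].
rewrite /induced_field; move: (genT Q p) (genX Q p) (genU1 Q p) (genU0 Q p)
  (genT P p) (genX P p) (genU1 P p) (genU0 P p) s4 s4' gQ gP => T X z1 z0 T' X' z1' z0' s4 s4' gQ gP.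
have lin F F' : smooth_at (base p) F -> smooth_at (base p) F' ->
    smooth_at (base p) (fun w => a * F w + F' w).
  by move=> sF sF'; apply: smoothD => //; apply: smoothM => //; exact: smooth_cst.
have [sT sX s1 s0] := s4; have [sT' sX' s1' s0'] := s4'.
have := @induced_field_germ p q (fun z => a *: Q z + P z) (fun w => a * T w + T' w)
  (fun w => a * X w + X' w) (fun w => a * z1 w + z1' w) (fun w => a * z0 w + z0' w) pq.
move=> /(_ _ _)/germ_trans; apply.
- by split; exact: lin.
- by apply: filterS2 gQ gP => z -> ->; rewrite -affmap_linear.
have -> : (fun z => a *: indfield T X z1 z0 z + indfield T' X' z1' z0' z) =
  affmap (fun w => a * T w + T' w) (fun w => a * X w + X' w)
    (fun l b w => a * indlieM T X z1 z0 l b w + indlieM T' X' z1' z0' l b w)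
    (fun l w => a * indlieN X z1 z0 l w + indlieN X' z1' z0' l w).
  by apply/funext => z; rewrite affmap_linear.
apply: affmap_germ; rewrite -pq.
have dl F F' i : smooth_at (base p) F -> smooth_at (base p) F' -> \forall w \near base p,
    dif i (fun w => a * F w + F' w) w = a * dif i F w + dif i F' w.
  move=> sF sF'; apply: filterS2 (smooth_near sF) (smooth_near sF') => w sFw sFw'.
  have sc := smooth_cst w a.
  by rewrite (difD i (smoothM sc sFw) sFw') (difM i sc sFw) dif_cst mul0r add0r.
have n1 := dl _ _ it sT sT'; have n2 := dl _ _ ix sX sX'; have n3 := dl _ _ it sX sX'.
have n4 := dl _ _ ix s1 s1'; have n5 := dl _ _ it s1 s1'; have n6 := dl _ _ ix s0 s0'.
have n7 := dl _ _ it s0 s0'.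
apply: filterS (filterI n1 (filterI n2 (filterI n3 (filterI n4 (filterI n5 (filterI n6 n7)))))).
move=> w [e1 [e2 [e3 [e4 [e5 [e6 e7]]]]]]; split=> // [l b|l]; rewrite /indlieM /indlieN.
  by move: l b; apply: ord3P; apply: ord3P; rewrite /= ?e1 ?e2 ?e4 ?e6; ring.
by move: l; apply: ord3P; rewrite /= ?e3 ?e5 ?e7.
Qed.

End LieAlgebraIsomorphism.

Section BracketAndOperators.
Context {R : realType}.
Variables (Omega : set 'rV[R]_2) (A B C : 'rV[R]_2 -> R).
Hypothesis oO : open Omega.
Hypotheses (sA : forall w, Omega w -> smooth_at w A) (sB : forall w, Omega w -> smooth_at w B)
  (sC : forall w, Omega w -> smooth_at w C).
Hypothesis A0 : forall w, Omega w -> A w != 0.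
Implicit Types (T X : 'rV[R]_2 -> R).
Notation lieL := (lie_symmetry Omega (eqL A B C)).
Notation lieD := (lie_symmetry Omega (DE1 A B C)).

Section Bracket.
Variables (T X z1 z0 T' X' z1' z0' : 'rV[R]_2 -> R) (w0 : 'rV[R]_2).
Hypotheses (s : smooth4 w0 T X z1 z0) (s' : smooth4 w0 T' X' z1' z0').
Notation v w := (row2 (T w) (X w)).
Notation v' w := (row2 (T' w) (X' w)).
Notation T'' := (fun w => dirdif T' (v w) w - dirdif T (v' w) w).
Notation X'' := (fun w => dirdif X' (v w) w - dirdif X (v' w) w).
Notation z1'' := (fun w => dirdif z1' (v w) w - dirdif z1 (v' w) w).
Notation z0'' := (fun w => dirdif z0' (v w) w - dirdif z0 (v' w) w
  + (z1' w * z0 w - z1 w * z0' w)).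

Lemma smooth_dirdif F F1 F2 : smooth_at w0 F -> smooth_at w0 F1 -> smooth_at w0 F2 ->
  smooth_at w0 (fun w => dirdif F (row2 (F1 w) (F2 w)) w).
Proof.
move=> sF sF1 sF2; rewrite /dirdif; under eq_fun do rewrite row2_it row2_ix.
by apply: smoothD; apply: smoothM => //; exact: smooth_dif.
Qed.

Lemma smooth4_bracket : smooth4 w0 T'' X'' z1'' z0''.
Proof.
case: s s' => sT sX s1 s0 [sT' sX' s1' s0'].
split; [| | |apply: smoothD; last by apply: smoothB; exact: smoothM];
  by apply: smoothB; exact: smooth_dirdif.
Qed.

Lemma Lmap_bracket (p : 'rV[R]_(2 + 1)) : base p = w0 ->
  germ_eq p (lie_bracket (Lmap T X z1 z0) (Lmap T' X' z1' z0')) (Lmap T'' X'' z1'' z0'').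
Proof.
move=> pw; have [sd sd'] : smooth_data (base p) T X (fun _ _ => z1) (fun _ : 'I_1 => z0) /\
    smooth_data (base p) T' X' (fun _ _ => z1') (fun _ : 'I_1 => z0').
  by rewrite pw; split; exact: smooth4_data.
apply: germ_trans (affmap_bracket sd sd') (affmap_germ _); near=> w.
split=> // [_ _|_]; first by rewrite sum1E mulrC subrr addr0.
by rewrite sum1E.
Unshelve. all: by end_near. Qed.

Hypotheses (nT : \forall w \near w0, dif ix T w = 0) (nT' : \forall w \near w0, dif ix T' w = 0).

(** Derivatives of the bracket data are expanded by the commutator formula [near_dirdif_dif]. Since
    T_x = T'_x = 0, the terms that would couple x-derivatives with t-derivatives vanish, and the
    entries match those of the matrix bracket. *)
Lemma indfield_bracket (q : 'rV[R]_(2 + 3)) : base q = w0 ->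
  germ_eq q (indfield T'' X'' z1'' z0'')
    (lie_bracket (indfield T X z1 z0) (indfield T' X' z1' z0')).
Proof.
move=> qw; have [sd sd'] : smooth_data (base q) T X (indlieM T X z1 z0) (indlieN X z1 z0) /\
    smooth_data (base q) T' X' (indlieM T' X' z1' z0') (indlieN X' z1' z0').
  by rewrite qw; split; exact: smooth_indfield.
apply: germ_sym; apply: germ_trans (affmap_bracket sd sd') (affmap_germ _); rewrite qw.
have [sT sX s1 s0] := s; have [sT' sX' s1' s0'] := s'.
have m1 := smooth_near sT; have m2 := smooth_near sX; have m3 := smooth_near s1.
have m4 := smooth_near s0; have m1' := smooth_near sT'; have m2' := smooth_near sX'.
have m3' := smooth_near s1'; have m4' := smooth_near s0'.
have nb F F' i : smooth_at w0 F -> smooth_at w0 F' -> \forall w \near w0,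
    dif i (fun w => dirdif F' (v w) w - dirdif F (v' w) w) w =
    dirdif (dif i F') (v w) w + dif i T w * dif it F' w + dif i X w * dif ix F' w
    - (dirdif (dif i F) (v' w) w + dif i T' w * dif it F w + dif i X' w * dif ix F w).
  move=> sF sF'; have e1 := near_dirdif_dif sT sX i sF'; have e2 := near_dirdif_dif sT' sX' i sF.
  have e3 := smooth_near (smooth_dirdif sF' sT sX); have e4 := smooth_near (smooth_dirdif sF sT' sX').
  apply: filterS (filterI e1 (filterI e2 (filterI e3 e4))) => w [h1 [h2 [h3 h4]]].
  by rewrite (difB i h3 h4) h1 h2.
have nd F G i : smooth_at w0 F -> smooth_at w0 G -> \forall w \near w0,
    dif i (fun w => F w + G w) w = dif i F w + dif i G w.
  by move=> sF sG; apply: filterS2 (smooth_near sF) (smooth_near sG) => w; exact: difD.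
have sz0 : smooth_at w0 (fun w => dirdif z0' (v w) w - dirdif z0 (v' w) w).
  by apply: smoothB; exact: smooth_dirdif.
have szz : smooth_at w0 (fun w => z1' w * z0 w - z1 w * z0' w).
  by apply: smoothB; exact: smoothM.
have bT := nb _ _ it sT sT'; have bXx := nb _ _ ix sX sX'; have bXt := nb _ _ it sX sX'.
have b1x := nb _ _ ix s1 s1'; have b1t := nb _ _ it s1 s1'.
have b0x := nb _ _ ix s0 s0'; have b0t := nb _ _ it s0 s0'.
have d0x := nd _ _ ix sz0 szz; have d0t := nd _ _ it sz0 szz.
near=> w.
have Tx : dif ix T w = 0 by near: w.
have Tx' : dif ix T' w = 0 by near: w.
have [sTw sXw s1w s0w] : [/\ smooth_at w T, smooth_at w X, smooth_at w z1 & smooth_at w z0]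
  by split; near: w.
have [sTw' sXw' s1w' s0w'] : [/\ smooth_at w T', smooth_at w X', smooth_at w z1' & smooth_at w z0']
  by split; near: w.
have zz i : dif i (fun w => z1' w * z0 w - z1 w * z0' w) w =
    dif i z1' w * z0 w + z1' w * dif i z0 w - (dif i z1 w * z0' w + z1 w * dif i z0' w).
  by rewrite (difB i (smoothM s1w' s0w) (smoothM s1w s0w')) (difM i s1w' s0w) (difM i s1w s0w').
have dc y : dirdif (fun=> 0 : R) y w = 0 by rewrite /dirdif !dif_cst !mulr0 addr0.
have dB F G y : smooth_at w F -> smooth_at w G ->
    dirdif (fun w => F w - G w) y w = dirdif F y w - dirdif G y w.
  by move=> sF sG; rewrite /dirdif (difB _ sF sG) (difB _ sF sG); ring.
have dN F y : smooth_at w F -> dirdif (fun w => - F w) y w = - dirdif F y w.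
  by move=> sF; rewrite /dirdif !(difN _ sF); ring.
have eT : dif it T'' w = dirdif (dif it T') (v w) w + dif it T w * dif it T' w + dif it X w * dif ix T' w
    - (dirdif (dif it T) (v' w) w + dif it T' w * dif it T w + dif it X' w * dif ix T w) by near: w.
have eXx : dif ix X'' w = dirdif (dif ix X') (v w) w + dif ix T w * dif it X' w + dif ix X w * dif ix X' w
    - (dirdif (dif ix X) (v' w) w + dif ix T' w * dif it X w + dif ix X' w * dif ix X w) by near: w.
have eXt : dif it X'' w = dirdif (dif it X') (v w) w + dif it T w * dif it X' w + dif it X w * dif ix X' w
    - (dirdif (dif it X) (v' w) w + dif it T' w * dif it X w + dif it X' w * dif ix X w) by near: w.
have e1x : dif ix z1'' w = dirdif (dif ix z1') (v w) w + dif ix T w * dif it z1' w + dif ix X w * dif ix z1' w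
    - (dirdif (dif ix z1) (v' w) w + dif ix T' w * dif it z1 w + dif ix X' w * dif ix z1 w) by near: w.
have e1t : dif it z1'' w = dirdif (dif it z1') (v w) w + dif it T w * dif it z1' w + dif it X w * dif ix z1' w
    - (dirdif (dif it z1) (v' w) w + dif it T' w * dif it z1 w + dif it X' w * dif ix z1 w) by near: w.
have e0x : dif ix z0'' w = dirdif (dif ix z0') (v w) w + dif ix T w * dif it z0' w + dif ix X w * dif ix z0' w
    - (dirdif (dif ix z0) (v' w) w + dif ix T' w * dif it z0 w + dif ix X' w * dif ix z0 w)
    + dif ix (fun w => z1' w * z0 w - z1 w * z0' w) w.
  by rewrite (near d0x w) ?(near b0x w).
have e0t : dif it z0'' w = dirdif (dif it z0') (v w) w + dif it T w * dif it z0' w + dif it X w * dif ix z0' w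
    - (dirdif (dif it z0) (v' w) w + dif it T' w * dif it z0 w + dif it X' w * dif ix z0 w)
    + dif it (fun w => z1' w * z0 w - z1 w * z0' w) w.
  by rewrite (near d0t w) ?(near b0t w).
split=> // [l b|l]; rewrite /indlieM /indlieN sum3E.
  move: l b; apply: ord3P; apply: ord3P; rewrite /= ?dc ?dN ?dB; try exact: smooth_dif; try by [];
    rewrite ?eT ?eXx ?e1x ?e0x ?zz ?Tx ?Tx'; ring.
move: l; apply: ord3P; rewrite /= ?eXt ?e1t ?e0t ?zz; ring.
Unshelve. all: by end_near. Qed.

End Bracket.

Lemma induced_field_bracket p q Q P : base p = base q -> lieL p Q -> lieL p P ->
  germ_eq q (induced_field p (lie_bracket Q P))
    (lie_bracket (induced_field p Q) (induced_field p P)).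
Proof.
move=> pq SQ SP; have sQ : smooth_at p Q by case: SQ.
have sP : smooth_at p P by case: SP.
have [[_ s4 E] gQ] := L_lie_data oO sA sB sC A0 SQ.
have [[_ s4' E'] gP] := L_lie_data oO sA sB sC A0 SP.
have nT : \forall w \near base p, dif ix (genT Q p) w = 0 by apply: filterS E => w [].
have nT' : \forall w \near base p, dif ix (genT P p) w = 0 by apply: filterS E' => w [].
have H := indfield_bracket s4 s4' nT nT' (esym pq).
apply: germ_trans H; apply: induced_field_germ => //; first exact: smooth4_bracket.
exact: germ_trans (germ_bracket sQ sP gQ gP) (Lmap_bracket s4 s4' erefl).
Qed.

Lemma lie_algebras_isomorphic p q : base p = base q ->
  lie_algebra_iso p (lieL p) q (lieD q) (induced_field p).
Proof.
move=> pq; split.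
- move=> Q SQ; have [ad _] := L_lie_data oO sA sB sC A0 SQ.
  by apply: DE1_lie_indfield => //; rewrite -pq.
- move=> Q P SQ SP; have [[_ s4 _] gQ] := L_lie_data oO sA sB sC A0 SQ.
  have [[_ s4' _] gP] := L_lie_data oO sA sB sC A0 SP; split=> [QP|].
    by apply: indfield_germ; rewrite -pq; exact: germ_gen4.
  rewrite pq in s4 s4' => /(indfield_inj s4 s4') e4; apply: germ_trans gQ _.
  by apply: germ_trans (germ_sym gP); apply: Lmap_germ; rewrite pq.
- move=> P /(DE1_lie_data oO sA sB sC A0)[T [X [z1 [z0 [ad Pg]]]]].
  rewrite -pq in ad; exists (Lmap T X z1 z0); first exact: L_lie_Lmap.
  apply: germ_trans (germ_sym Pg); have [_ s4 _] := ad; apply: induced_field_germ => //.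
  by near=> z.
- by move=> a Q P; exact: (induced_field_linear oO sA sB sC A0).
- by move=> Q P; exact: induced_field_bracket.
Unshelve. all: by end_near. Qed.

End BracketAndOperators.

(** * The operators [opQ] and [opQ1] in terms of the coefficient data *)

Section Operators.
Context {R : realType}.

(** Smoothness of the coefficients is recovered from that of the field: T and X are components
    restricted to a section, z1 is a fibre derivative, and z0 is the remainder. *)
Lemma smooth4_Lmap T X z1 z0 (p : 'rV[R]_(2 + 1)) :
  smooth_at p (Lmap T X z1 z0) -> smooth4 (base p) T X z1 z0.
Proof.
move=> /smooth_rowP sf.
have sc k := smooth_section (sf k).
have sT : smooth_at (base p) T.
  by apply: smooth_eq (sc (tx it)); near=> w; rewrite affmapT base_row.
have sX : smooth_at (base p) X.
  by apply: smooth_eq (sc (tx ix)); near=> w; rewrite affmapX base_row.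
have D z : dif (dv 0) (fun z => Lmap T X z1 z0 z 0 (dv 0)) z = z1 (base z).
  (* The field is affine in u, so the difference quotient in the fibre direction is constantly z1
     for nonzero increments; this computes the derivative before anything is known about z1. *)
  rewrite difE /pd; apply/cvg_lim => //; apply: cvg_near_cst; near=> h.
  have h0 : h != 0 by near: h; exact: nbhs_dnbhs_neq.
  have bE : base (h *: delta_mx 0 (dv 0) + z) = base z.
    by apply/rowP => i; rewrite !baseE !mxE eqxx eq_lrshift mulr0 add0r.
  have dE : dep (h *: delta_mx 0 (dv 0) + z) 0 0 = h + dep z 0 0.
    by rewrite !depE !mxE !eqxx mulr1.
  by rewrite /= !affmapD !sum1E bE dE /GRing.scale /=; field.
have s1 : smooth_at (base p) z1.
  have := smooth_section (smooth_dif (dv 0) (sf (dv 0))).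
  by apply: smooth_eq; near=> w; rewrite D base_row.
split=> //; have := smoothB (sc (dv 0)) (smoothM s1 (smooth_cst _ (dep p 0 0))).
by apply: smooth_eq; near=> w; rewrite affmapD sum1E base_row dep_row addrC addKr.
Unshelve. all: by end_near. Qed.

Lemma opQ_Lmap (tau : R -> R) xi z1 z0 : opQ tau xi z1 z0 = Lmap (fun w => tau (w 0 it)) xi z1 z0.
Proof.
apply/funext => z; rewrite /opQ /Lmap /affmap; congr row_mx; apply/rowP => l.
by rewrite [LHS]mxE [RHS]mxE sum1E.
Qed.

(** Both sides are the limit of literally the same difference quotient. *)
Lemma dif_time (tau : R -> R) (w : 'rV[R]_2) :
  dif it (fun w => tau (w 0 it)) w = derive1 tau (w 0 it).
Proof.
rewrite difE /pd /derive /derive1; apply: (congr1 (fun F : R -> R => lim (F @ 0^'))).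
apply/funext => h.
by rewrite /= !mxE !eqxx mulr1.
Qed.

Lemma opQ1_indfield (tau : R -> R) xi z1 z0 :
  opQ1 tau xi z1 z0 = indfield (fun w => tau (w 0 it)) xi z1 z0.
Proof.
apply/funext => z; rewrite /opQ1 /indfield /affmap; congr row_mx; apply/rowP => l.
rewrite [LHS]mxE [RHS]mxE sum3E /indlieM /indlieN dif_time -!difE -/i1 -/i2 -/i3.
by move: l; apply: ord3P; rewrite /=; ring.
Qed.

Lemma inf_equivalence_eq4 A B C T X z1 z0 T' X' z1' z0' (w : 'rV[R]_2) :
  (\forall y \near w, eq4 T X z1 z0 T' X' z1' z0' y) ->
  inf_equivalence A B C T X z1 z0 w -> inf_equivalence A B C T' X' z1' z0' w.
Proof.
move=> nw [Tx eA eB eC e0]; have [eT eX e1 e0'] := nbhs_singleton nw.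
have nT : \forall y \near w, T y = T' y by apply: filterS nw => y [].
have nX : \forall y \near w, X y = X' y by apply: filterS nw => y [].
have n1 : \forall y \near w, z1 y = z1' y by apply: filterS nw => y [].
have n0 : \forall y \near w, z0 y = z0' y by apply: filterS nw => y [].
split.
- by rewrite -(dif_near _ nT).
- by rewrite -(dif_near _ nT) -(dif_near _ nX) -eT -eX.
- by rewrite -(dif_near _ nT) -!(dif_near _ nX) -(dif_near _ (near_dif ix nX)) -(dif_near _ n1) -eT -eX.
- by rewrite -(dif_near _ nT) -!(dif_near _ n1) -(dif_near _ (near_dif ix n1)) -eT -eX.
- by rewrite -!(dif_near _ n0) -(dif_near _ (near_dif ix n0)) -e0'.
Qed.

End Operators.

Theorem corollary9 (R : realType) (Omega : set 'rV[R]_2)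
    (A B C : 'rV[R]_2 -> R)
    (open_Omega : open Omega)
    (analytic_A : analytic_on Omega A)
    (analytic_B : analytic_on Omega B)
    (analytic_C : analytic_on Omega C)
    (A_neq0 : forall w, Omega w -> A w != 0) :
  point_symmetry_groups_isomorphic Omega (eqL A B C) (DE1 A B C) /\
  forall (p : 'rV[R]_(2 + 1)) (q : 'rV[R]_(2 + 3)),
    Omega (base p) -> base p = base q ->
    exists J : ('rV[R]_(2 + 1) -> 'rV[R]_(2 + 1)) ->
               ('rV[R]_(2 + 3) -> 'rV[R]_(2 + 3)),
      lie_algebra_iso p (lie_symmetry Omega (eqL A B C) p)
                      q (lie_symmetry Omega (DE1 A B C) q) J /\
      forall (tau : R -> R) (xi zeta1 zeta0 : 'rV[R]_2 -> R),
        lie_symmetry Omega (eqL A B C) p (opQ tau xi zeta1 zeta0) ->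
        lie_symmetry Omega (DE1 A B C) q (opQ1 tau xi zeta1 zeta0) /\
        germ_eq q (J (opQ tau xi zeta1 zeta0)) (opQ1 tau xi zeta1 zeta0).
Proof.
have sm F : analytic_on Omega F -> forall w, Omega w -> smooth_at w F.
  by move=> aF w /aF[].
have sA := sm _ analytic_A; have sB := sm _ analytic_B; have sC := sm _ analytic_C.
split; first exact: groups_isomorphic.
move=> p q Op pq; exists (induced_field p); split; first exact: lie_algebras_isomorphic.
move=> tau xi z1 z0; rewrite opQ_Lmap opQ1_indfield => SQ.
have s4 : smooth4 (base p) (fun w => tau (w 0 it)) xi z1 z0.
  by apply: smooth4_Lmap; case: SQ.
split; last by apply: induced_field_germ => //; near=> z.
have [[_ _ E] _] := L_lie_data open_Omega sA sB sC A_neq0 SQ.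
apply: DE1_lie_indfield => //; rewrite -pq; split=> //.
(* The conditions are known for the data read off from [Lmap]. These coincide near the base point
   with tau, xi, z1 and z0, and the equality has to hold as germs because the conditions involve
   derivatives. *)
by apply: filterS2 (near_join (gen_Lmap s4)) E => w; exact: inf_equivalence_eq4.
Unshelve. all: by end_near. Qed.
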